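(* Let $a,b>0$ be constants with $a+b<\tfrac12$. There exists $\varepsilon_0>0$ such that for every fixed $0<\varepsilon<\varepsilon_0$ the following holds. Consider data $m,n,\boldsymbol{s},\boldsymbol{t},H$ with $m,n\to\infty$, where $H$ satisfies $x_j=x$ for all $j$ and $y_k=y$ for all $k$, such that uniformly $s_j-s$, $t_k-t$, $x$, $y$ are $O(n^{1/2+\varepsilon})$; $X=O(n^{1+2\varepsilon})$; $n=o(m^{1+\varepsilon})$, $m=o(n^{1+\varepsilon})$; and $\frac{(1-2\lambda)^2}{8A}\bigl(1+\frac{5m}{6n}+\frac{5n}{6m}\bigr)\le a\log n$. Let $G$ be uniformly random in $\mathcal{B}(\boldsymbol{s},\boldsymbol{t})$. Then (i) the expected number of graphs $H'\in\mathcal{I}(H)$ with $E(H')\subseteq E(G)$ is \[\lambda^X|\mathcal{I}(H)|\exp\Bigl(-\frac{(1-\lambda)(xy-x-y)}{2\lambda}-\frac{yR+xC}{2\lambda^2mn}+O(n^{-b})\Bigr);\] (ii) the expected number of graphs $H'\in\mathcal{I}(H)$ that are edge-disjoint from $G$ is \[(1-\lambda)^X|\mathcal{I}(H)|\exp\Bigl(-\frac{\lambda(xy-x-y)}{2(1-\lambda)}-\frac{yR+xC}{2(1-\lambda)^2mn}+O(n^{-b})\Bigr).\]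
   Context: $\mathcal{B}(\boldsymbol{s},\boldsymbol{t})$ is the set of simple bipartite graphs on $\{u_1,\dots,u_m\}\cup\{v_1,\dots,v_n\}$ (edges only between $u$'s and $v$'s) with $\deg u_j=s_j$, $\deg v_k=t_k$, where $\boldsymbol{s},\boldsymbol{t}$ are vectors of positive integers with equal sums. $H$ is a fixed bipartite graph on the same vertex set in which $u_j$ has degree $x_j$ and $v_k$ has degree $y_k$; $X$ is its number of edges. A colour-preserving isomorphism between bipartite graphs on this vertex set is an isomorphism mapping $\{u_1,\dots,u_m\}$ to itself and $\{v_1,\dots,v_n\}$ to itself; $\mathcal{I}(H)$ is the set of all bipartite graphs on this vertex set that are colour-preservingly isomorphic to $H$ (so $|\mathcal{I}(H)|=m!\,n!/\operatorname{aut}(H)$, $\operatorname{aut}(H)$ being the number of colour-preserving automorphisms). $s=m^{-1}\sum_js_j$, $t=n^{-1}\sum_kt_k$, $\lambda=s/n=t/m$, $A=\tfrac12\lambda(1-\lambda)$, $R=\sum_j(s_j-s)^2$, $C=\sum_k(t_k-t)^2$. Asymptotic notation refers to $m,n\to\infty$. *)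

(* Defs.v *)
From HB Require Import structures.
From mathcomp Require Import all_boot all_order all_algebra all_fingroup.
From mathcomp Require Import reals sequences exp.
Set Implicit Arguments. Unset Strict Implicit. Unset Printing Implicit Defensive.
Import Order.TTheory GRing.Theory Num.Theory.

(* A simple bipartite graph on {u_1..u_m} ∪ {v_1..v_n} is its edge set,
   a subset of 'I_m * 'I_n (pair (j,k) = edge u_j v_k). *)
Section Bip.
Variables m n : nat.
Definition bgraph := {set 'I_m * 'I_n}.

Definition deg_u (E : bgraph) (j : 'I_m) : nat := #|[set k : 'I_n | (j, k) \in E]|.
Definition deg_v (E : bgraph) (k : 'I_n) : nat := #|[set j : 'I_m | (j, k) \in E]|.

Definition Bst (s : 'I_m -> nat) (t : 'I_n -> nat) : {set bgraph} :=
  [set E : bgraph | [forall j, deg_u E j == s j] && [forall k, deg_v E k == t k]].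

Definition relabel (sg : {perm 'I_m}) (tau : {perm 'I_n}) (E : bgraph) : bgraph :=
  [set (sg p.1, tau p.2) | p in E].

Definition isoClass (H : bgraph) : {set bgraph} :=
  [set E : bgraph | [exists sg : {perm 'I_m}, exists tau : {perm 'I_n},
                        E == relabel sg tau H]].

Local Open Scope ring_scope.
Variable R : realType.

Definition exp_contained s t (H : bgraph) : R :=
  (\sum_(G in Bst s t) (#|[set H' in isoClass H | H' \subset G]|)%:R)
    / (#|Bst s t|)%:R.

Definition exp_disjoint s t (H : bgraph) : R :=
  (\sum_(G in Bst s t) (#|[set H' in isoClass H | H' :&: G == set0]|)%:R)
    / (#|Bst s t|)%:R.

Definition smean (s : 'I_m -> nat) : R := (\sum_(j < m) (s j)%:R) / m%:R.
Definition tmean (t : 'I_n -> nat) : R := (\sum_(k < n) (t k)%:R) / n%:R.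
Definition lam (s : 'I_m -> nat) : R := smean s / n%:R.
Definition Acoef (s : 'I_m -> nat) : R := lam s * (1 - lam s) / 2.
Definition Rdev (s : 'I_m -> nat) : R := \sum_(j < m) ((s j)%:R - smean s) ^+ 2.
Definition Cdev (t : 'I_n -> nat) : R := \sum_(k < n) ((t k)%:R - tmean t) ^+ 2.
End Bip.

(* Main.v *)
(* Fix H and weight every G in B(s,t) by q^(number of edges of H missing from G), 0 < q <= 1.
   The logarithmic derivative in q of the total weight is the expected number of edges of H
   missing from G, so integrating it over [q0, 1] with a tiny q0, where Markov's inequality
   applies, yields the probability that G contains H.

   The expected overlap is computed from switchings {ab, ce} <-> {ae, cb}.  Write W for the
   adjacency matrix minus its rank-two mean.  Balance of weights, tested against a matrix
   function F(W), gives a "loop equation" in which the linear term LL W dominates the cubic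
   term V = W W^T W; bootstrapping with F = V, al al^T W, W (W^T W)^2 bounds the moments of V.
   Testing with a function supported on the edges of H, corrected to second order in the degree
   deviations, then gives the overlap up to n^(-1/2+o(1)).

   The answer depends on H only through Z = sum over H of al_a be_b, which has mean zero over
   the isomorphism class; its exponential moment is 1 + o(n^(-1/2)) by Stein's method of
   exchangeable pairs with column transpositions.  Part (ii) is part (i) for the complement of G. *)
Require Import Defs.
From HB Require Import structures.
From mathcomp Require Import all_boot all_order all_algebra all_fingroup.
From mathcomp Require Import reals sequences exp.
From mathcomp Require Import ring lra zify.
From mathcomp Require all_classical topology normedtype derive realfun.
Import Order.TTheory GRing.Theory Num.Theory.
Set Implicit Arguments. Unset Strict Implicit. Unset Printing Implicit Defensive.
Local Open Scope ring_scope.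

(** * Norms and sums *)
Section SumTools.
Variable R : realFieldType.

(** All sizes are recorded as [K ^+ i * v ^+ j] with [K ^+ 100 <= v]: only the power of [v] matters,
    and powers of [K] are spent freely as long as they stay below 100. The test functions of the
    bootstrap are chosen so that <F, W> and <F, V> are both squared norms. The left side of the loop
    equation then has two nonnegative terms and bounds both at once. The obstacle is precision. The
    overlap has order [v ^+ 2] and is wanted up to [1 / v]; after multiplication by [LL], of order
    [v ^+ 4], every error has to be of order [v ^+ 3]. For G supported on [h], Cauchy-Schwarz gives
    only order [v ^+ 5] for <G, V>. The two missing powers come from a further loop equation, with F
    = W G^T W off [h], which shows that V acts on such G like the multiple
    [dens * (1 - dens) * (m + n)] of W. Integrating an error [1 / v] against dq/q over an interval
    starting at [v ^- 4] costs only a logarithm. With [v] about the square root of n, the final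
    error is n^(-1/2 + O(eps)), whence the restriction b < 1/2. *)

Lemma sqrD_le (a b : R) : (a + b) ^+ 2 <= 2 * (a ^+ 2 + b ^+ 2).
Proof. have := sqr_ge0 (a - b); lra. Qed.
Lemma ler_norm_sqr (a b : R) : 0 <= b -> a ^+ 2 <= b ^+ 2 -> `|a| <= b.
Proof. by move=> b0 h; rewrite -(ler_sqr (normr_ge0 a) b0) real_normK ?num_real. Qed.

Lemma sqr_le_norm (a b : R) : `|a| <= b -> a ^+ 2 <= b ^+ 2.
Proof.
move=> h; have b0 : 0 <= b by apply: le_trans h.
by rewrite -(real_normK (num_real a)) ler_sqr.
Qed.

Lemma normrM_le (a b c d : R) : `|a| <= c -> `|b| <= d -> `|a * b| <= c * d.
Proof. by move=> h1 h2; rewrite normrM; apply: ler_pM. Qed.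

Lemma normrD_le (a b c d : R) : `|a| <= c -> `|b| <= d -> `|a + b| <= c + d.
Proof. by move=> h1 h2; apply: le_trans (ler_normD _ _) _; apply: lerD. Qed.

Lemma normrB_le (a b c d : R) : `|a| <= c -> `|b| <= d -> `|a - b| <= c + d.
Proof. by move=> h1 h2; apply: le_trans (ler_normB _ _) _; apply: lerD. Qed.

Lemma cauchy_sum (I : finType) (u v : I -> R) :
  (\sum_i u i * v i) ^+ 2 <= (\sum_i u i ^+ 2) * (\sum_i v i ^+ 2).
Proof.
set A := \sum_i u i ^+ 2; set B := \sum_i v i ^+ 2; set C := \sum_i u i * v i.
have A0 : 0 <= A by apply: sumr_ge0 => i _; apply: sqr_ge0.
have B0 : 0 <= B by apply: sumr_ge0 => i _; apply: sqr_ge0.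
(* The extra factor [A] avoids a division: the product is a plain sum of squares, and the case
   [A = 0] is treated apart. *)
have key : 0 <= A * (A * B - C ^+ 2).
  have -> : A * (A * B - C ^+ 2) = \sum_i (A * v i - C * u i) ^+ 2.
    under eq_bigr => i _.
      rewrite (_ : (A * v i - C * u i) ^+ 2 =
        A ^+ 2 * (v i ^+ 2) + (- (2 * A * C) * (u i * v i) + C ^+ 2 * u i ^+ 2)); last by ring.
      over.
    by rewrite !big_split /= -!mulr_sumr -/A -/B -/C; ring.
  by apply: sumr_ge0 => i _; apply: sqr_ge0.
have [A1|A1] := eqVneq A 0; last first.
  by rewrite -subr_ge0; rewrite pmulr_rge0 ?lt_def ?A1 ?A0 in key.
suff -> : C = 0 by rewrite expr0n mulr_ge0.
apply: big1 => i _; suff -> : u i = 0 by rewrite mul0r.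
have /eqP := A1; rewrite psumr_eq0; last by move=> j _; apply: sqr_ge0.
by move/allP/(_ i); rewrite mem_index_enum /= sqrf_eq0 => /(_ isT)/eqP.
Qed.

Lemma sqr_sum_le (I : finType) (u : I -> R) :
  (\sum_i u i) ^+ 2 <= #|I|%:R * \sum_i u i ^+ 2.
Proof.
have := cauchy_sum (fun=> 1) u.
under eq_bigr do rewrite mul1r.
under [X in _ <= X * _ -> _]eq_bigr do rewrite expr1n.
by rewrite sumr_const.
Qed.

Lemma ler_norm_sumD (I : finType) (u v : I -> R) :
  (forall i, `|u i| <= v i) -> `|\sum_i u i| <= \sum_i v i.
Proof. by move=> h; apply: le_trans (ler_norm_sum _ _ _) _; apply: ler_sum. Qed.

Lemma ler_sum_const (I : finType) (u : I -> R) c : (forall i, u i <= c) -> \sum_i u i <= #|I|%:R * c.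
Proof.
move=> h; apply: (@le_trans _ _ (\sum_(i : I) c)); first exact: ler_sum.
by rewrite sumr_const mulr_natl.
Qed.

Lemma sum_constM (I : finType) (c : R) : \sum_(i : I) c = #|I|%:R * c.
Proof. by rewrite sumr_const mulr_natl. Qed.

End SumTools.

Section Frobenius.
Variable R : realFieldType.

Definition dot m n (A B : 'M[R]_(m, n)) : R := \sum_i \sum_j A i j * B i j.
Definition nF m n (A : 'M[R]_(m, n)) : R := dot A A.

Lemma dotE m n (A B : 'M[R]_(m, n)) : dot A B = \tr (A *m B^T).
Proof. by apply: eq_bigr => i _; rewrite mxE; apply: eq_bigr => j _; rewrite mxE. Qed.

Lemma dot_pair m n (A B : 'M[R]_(m, n)) : dot A B = \sum_(p : 'I_m * 'I_n) A p.1 p.2 * B p.1 p.2.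
Proof. by rewrite /dot (pair_bigA _ (fun i j => A i j * B i j)). Qed.

Lemma nFE m n (A : 'M[R]_(m, n)) : nF A = \sum_i \sum_j A i j ^+ 2.
Proof. by []. Qed.

Lemma dotC m n (A B : 'M[R]_(m, n)) : dot A B = dot B A.
Proof. by apply: eq_bigr => i _; apply: eq_bigr => j _; rewrite mulrC. Qed.

Lemma dot_mull m n p (A : 'M[R]_(m, n)) (B : 'M_(n, p)) C : dot (A *m B) C = dot A (C *m B^T).
Proof. by rewrite !dotE trmx_mul trmxK mulmxA. Qed.

Lemma dot_mulr m n p (A : 'M[R]_(m, n)) (B : 'M_(n, p)) C : dot (A *m B) C = dot B (A^T *m C).
Proof. by rewrite !dotE trmx_mul trmxK -mulmxA mxtrace_mulC -mulmxA. Qed.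

Lemma dot_tr m n (A B : 'M[R]_(m, n)) : dot A^T B^T = dot A B.
Proof. by rewrite /dot exchange_big /=; apply: eq_bigr => i _; apply: eq_bigr => j _; rewrite !mxE. Qed.

Lemma nF_tr m n (A : 'M[R]_(m, n)) : nF A^T = nF A.
Proof. exact: dot_tr. Qed.

Lemma nF_ge0 m n (A : 'M[R]_(m, n)) : 0 <= nF A.
Proof. by apply: sumr_ge0 => i _; apply: sumr_ge0 => j _; apply: sqr_ge0. Qed.

Lemma cs_dot m n (A B : 'M[R]_(m, n)) : dot A B ^+ 2 <= nF A * nF B.
Proof.
rewrite /nF !dot_pair; apply: le_trans (cauchy_sum _ _) _.
by under eq_bigr do rewrite expr2; under [X in _ * X <= _]eq_bigr do rewrite expr2.
Qed.

Lemma dotDl m n (A B C : 'M[R]_(m, n)) : dot (A + B) C = dot A C + dot B C.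
Proof.
rewrite -big_split; apply: eq_bigr => i _; rewrite -big_split; apply: eq_bigr => j _.
by rewrite mxE mulrDl.
Qed.

Lemma dotDr m n (A B C : 'M[R]_(m, n)) : dot A (B + C) = dot A B + dot A C.
Proof. by rewrite dotC dotDl !(dotC A). Qed.

Lemma nF_col m n (A : 'M[R]_(m, n)) : nF A = \sum_j \sum_i A i j ^+ 2.
Proof. by rewrite nFE exchange_big. Qed.

Lemma nF_mul m n p (A : 'M[R]_(m, n)) (B : 'M_(n, p)) : nF (A *m B) <= nF A * nF B.
Proof.
rewrite (nFE (A *m B)) (nFE A) (nF_col B) mulr_suml.
apply: ler_sum => i _; rewrite mulr_sumr; apply: ler_sum => j _.
by rewrite mxE; apply: cauchy_sum.
Qed.

Lemma nF_cv m (v : 'cV[R]_m) : nF v = \sum_i v i 0 ^+ 2.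
Proof. by rewrite nFE; apply: eq_bigr => i _; rewrite big_ord1. Qed.

Lemma sum_norm_cv m (v : 'cV[R]_m) : (\sum_i `|v i 0|) ^+ 2 <= m%:R * nF v.
Proof.
apply: le_trans (sqr_sum_le _) _; rewrite card_ord nF_cv ler_wpM2l //.
by apply: ler_sum => i _; rewrite real_normK ?num_real.
Qed.

Definition mbnd m n (A : 'M[R]_(m, n)) c := forall i j, `|A i j| <= c.

Lemma mbnd_mul m n p (A : 'M[R]_(m, n)) (B : 'M_(n, p)) c d :
  mbnd A c -> mbnd B d -> mbnd (A *m B) (n%:R * (c * d)).
Proof.
move=> hA hB i j; rewrite mxE; apply: le_trans (ler_norm_sum _ _ _) _.
have := @ler_sum_const _ _ (fun k => `|A i k * B k j|) (c * d).
by rewrite card_ord; apply => k; rewrite normrM; apply: ler_pM.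
Qed.

Lemma mbnd_tr m n (A : 'M[R]_(m, n)) c : mbnd A c -> mbnd A^T c.
Proof. by move=> h i j; rewrite mxE. Qed.

Lemma mbnd_le m n (A : 'M[R]_(m, n)) c d : mbnd A c -> c <= d -> mbnd A d.
Proof. by move=> h cd i j; apply: le_trans (h i j) cd. Qed.

Lemma mbndD m n (A B : 'M[R]_(m, n)) c d : mbnd A c -> mbnd B d -> mbnd (A + B) (c + d).
Proof. by move=> hA hB i j; rewrite mxE; apply: normrD_le. Qed.

(** Schur's test: domination by a nonnegative matrix with row sums at most [x] and column sums at
    most [y] bounds the squared operator norm by [x * y]. Hence multiplying by a matrix supported on
    [h] costs only powers of [K]. *)
Lemma nF_dom m n p (H : 'M[R]_(m, n)) (h : 'M[R]_(m, n)) (A : 'M_(n, p)) x y :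
  0 <= x -> (forall i j, `|H i j| <= h i j) -> (forall i, \sum_j h i j <= x) -> (forall j, \sum_i h i j <= y) ->
  nF (H *m A) <= x * y * nF A.
Proof.
move=> x0 hH hx hy.
have h0 i j : 0 <= h i j by apply: le_trans (hH i j).
have row i k : (\sum_j H i j * A j k) ^+ 2 <= x * \sum_j h i j * A j k ^+ 2.
  have c1 : `|\sum_j H i j * A j k| <= \sum_j h i j * `|A j k|.
    by apply: ler_norm_sumD => j; rewrite normrM ler_wpM2r.
  apply: le_trans (sqr_le_norm c1) _.
  have sq : (\sum_j h i j * `|A j k|) ^+ 2 <= (\sum_j h i j) * \sum_j h i j * A j k ^+ 2.
    set S := \sum_j h i j; set T := \sum_j _ * `|_|; set U := \sum_j _ * _ ^+ 2.
    have S0 : 0 <= S by apply: sumr_ge0.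
    have U0 : 0 <= U by apply: sumr_ge0 => j _; rewrite mulr_ge0 ?sqr_ge0.
    have key : 0 <= S * (S * U - T ^+ 2).
      have -> : S * (S * U - T ^+ 2) = \sum_j h i j * (S * `|A j k| - T) ^+ 2.
        under eq_bigr => j _.
          rewrite (_ : h i j * (S * `|A j k| - T) ^+ 2 =
             S ^+ 2 * (h i j * A j k ^+ 2) + (- (2 * S * T) * (h i j * `|A j k|) + T ^+ 2 * h i j)); last first.
            by rewrite -(real_normK (num_real (A j k))); ring.
          over.
        by rewrite !big_split /= -!mulr_sumr -/S -/T -/U; ring.
      by apply: sumr_ge0 => j _; rewrite mulr_ge0 ?sqr_ge0.
    have [S1|S1] := eqVneq S 0; last first.
      by rewrite -subr_ge0; rewrite pmulr_rge0 ?lt_def ?S1 ?S0 in key.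
    suff -> : T = 0 by rewrite expr0n mulr_ge0.
    apply: big1 => j _; suff -> : h i j = 0 by rewrite mul0r.
    have /eqP := S1; rewrite psumr_eq0 // => /allP/(_ j).
    by rewrite mem_index_enum => /(_ isT)/eqP.
  apply: le_trans sq _; rewrite ler_wpM2r ?hx //.
  by apply: sumr_ge0 => j _; rewrite mulr_ge0 ?sqr_ge0.
rewrite nFE.
apply: (@le_trans _ _ (\sum_i \sum_k x * \sum_j h i j * A j k ^+ 2)).
  by apply: ler_sum => i _; apply: ler_sum => k _; rewrite mxE; apply: row.
under eq_bigr do rewrite -mulr_sumr.
rewrite -mulr_sumr -mulrA ler_wpM2l //.
under eq_bigr do rewrite exchange_big /=.
rewrite exchange_big /= nFE mulr_sumr; apply: ler_sum => j _.
under eq_bigr do rewrite -mulr_sumr.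
rewrite -mulr_suml ler_wpM2r ?hy //.
by apply: sumr_ge0 => k _; apply: sqr_ge0.
Qed.

End Frobenius.

(** * Weighted ensembles of degree-constrained matrices *)
Section EnsembleDef.
Variable R : realFieldType.
(* [Ex] is the expectation under the weight q^(number of edges of h missing from G); its
   argument ranges over W = G - (dens + al_a + be_b), where [al], [be] are the rescaled
   degree deviations, so that W has zero row and column sums.  [nu] is about the square root
   of the dimensions and [KK] absorbs all subpolynomial factors. *)
Record ensemble (m n : nat) := Ensemble {
  dens : R; al : 'cV[R]_m; be : 'cV[R]_n; hm : 'M[R]_(m, n);
  xd : R; yd : R; qd : R; Ex : ('M[R]_(m, n) -> R) -> R;
  KK : R; nu : R }.

Definition pairv k (a c : 'I_k) : 'cV[R]_k := \col_i ((i == a)%:R - (i == c)%:R).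
Definition Dl m n (a c : 'I_m) (b e : 'I_n) : 'M[R]_(m, n) := pairv a c *m (pairv b e)^T.

Section Defs.
Variables (m n : nat) (d : ensemble m n).
Implicit Type W : 'M[R]_(m, n).

Definition gm W a b : R := dens d + al d a 0 + be d b 0 + W a b.
Definition good W : Prop :=
  [/\ forall a b, gm W a b = 0 \/ gm W a b = 1,
      forall a, \sum_b W a b = 0 & forall b, \sum_a W a b = 0].
(** The factor that a pair contributes to the weight of a graph from which it is missing. *)
Definition kap a b : R := 1 - (1 - qd d) * hm d a b.
(* indicators of the two ends {ab, ce} and {ae, cb} of a switching *)
Definition chip W a b c e : R := gm W a b * gm W c e * (1 - gm W a e) * (1 - gm W c b).
Definition chim W a b c e : R := (1 - gm W a b) * (1 - gm W c e) * gm W a e * gm W c b.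

Definition ga W : 'cV[R]_n := W^T *m al d.
Definition gb W : 'cV[R]_m := W *m be d.
Definition om W : R := \sum_a al d a 0 * gb W a 0.
Definition Mv W : 'M[R]_n := W^T *m W.
Definition Mu W : 'M[R]_m := W *m W^T.
Definition VV W : 'M[R]_(m, n) := W *m Mv W.
Definition ma W : 'cV[R]_m := W *m ga W.
Definition mb W : 'cV[R]_n := W^T *m gb W.
Definition na : R := nF (al d).
Definition nb : R := nF (be d).
Definition mr : R := m%:R.
Definition nr : R := n%:R.
Definition LL : R := dens d * (1 - dens d) * mr * nr.
Definition XX : R := mr * xd d.

(** The number of three-edge paths from [a] to [b] minus its leading part, see [triple_sum_eq]. *)
Definition epsT W a b : R :=
  nr * (dens d + al d a 0) * (na + ga W b 0) + mr * (dens d + be d b 0) * (nb + gb W a 0)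
  + om W + ma W a 0 + mb W b 0 + VV W a b.
(** For a fixed pair ab, [Fm] counts the [(c, e)] that complete ab, when absent, to a [chim]
    pattern; [Fp] counts those that complete it, when present, to a [chip] pattern. *)
Definition Fm W a b : R := \sum_c \sum_e (1 - gm W c e) * gm W a e * gm W c b.
Definition Fp W a b : R := \sum_c \sum_e gm W c e * (1 - gm W a e) * (1 - gm W c b).
(** What the difference of the two switching counts contains besides [LL * W] and the cubic term. It
    sees W only through one entry and through the linear and quadratic statistics [ga], [gb], [om],
    [ma], [mb]. *)
Definition II W a b : R :=
  mr * nr * al d a 0 * be d b 0 * (W a b + (2 * dens d - 1 + al d a 0 + be d b 0))
  - nr * (be d b 0 + W a b) * (na + ga W b 0) - mr * (al d a 0 + W a b) * (nb + gb W a 0)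
  + om W + ma W a 0 + mb W b 0.
Definition YY W : 'M[R]_(m, n) := \matrix_(a, b) (VV W a b + II W a b).

(* [okEsw] is the only property of the random graph that is used: balance of weights under a switching. *)
Record ok : Prop := Ok {
  okK : 100 <= KK d; oknu : KK d ^+ 100 <= nu d;
  okm : mr <= nu d ^+ 2; okn : nr <= nu d ^+ 2; okmn : nu d ^+ 4 <= KK d * (mr * nr);
  okdens : 1 <= KK d * dens d; okdens1 : 1 <= KK d * (1 - dens d);
  okal : forall a, `|al d a 0| * nu d <= KK d; okbe : forall b, `|be d b 0| * nu d <= KK d;
  oksal : \sum_a al d a 0 = 0; oksbe : \sum_b be d b 0 = 0;
  okh : forall a b, hm d a b = 0 \/ hm d a b = 1;
  okx : forall a, \sum_b hm d a b = xd d; oky : forall b, \sum_a hm d a b = yd d;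
  okx0 : 0 <= xd d; oky0 : 0 <= yd d;
  okxK : xd d <= KK d; okyK : yd d <= KK d;
  okq0 : 0 < qd d; okq1 : qd d <= 1;
  okElin : forall c f g, Ex d (fun W => c * f W + g W) = c * Ex d f + Ex d g;
  okEle : forall f g, (forall W, good W -> f W <= g W) -> Ex d f <= Ex d g;
  okE1 : Ex d (fun=> 1) = 1;
  okEsw : forall psi a b c e,
    Ex d (fun W => psi W * (chip W a b c e * (kap a b * kap c e)))
    = Ex d (fun W => psi (W + Dl a c b e) * (chim W a b c e * (kap a e * kap c b))) }.

End Defs.
End EnsembleDef.

(** * Linearity of the expectation and bookkeeping of sizes *)

Section Basic.
Variables (R : realFieldType) (m n : nat) (d : ensemble R m n) (H : ok d).
Implicit Types (W : 'M[R]_(m, n)) (f g : 'M[R]_(m, n) -> R).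
Local Notation E := (Ex d).
Local Notation K := (KK d).
Local Notation v := (nu d).

Lemma eqE f g : (forall W, good d W -> f W = g W) -> E f = E g.
Proof. by move=> h; apply/le_anti/andP; split; apply: (okEle H) => W gW; rewrite h. Qed.

Lemma E0 : E (fun=> 0) = 0.
Proof.
have := okElin H (- 1) (fun=> 0) (fun=> 0).
rewrite (@eqE (fun W => -1 * 0 + 0) (fun=> 0)) //; last by move=> W _; ring.
lra.
Qed.

Lemma EZ c f : E (fun W => c * f W) = c * E f.
Proof.
have := okElin H c f (fun=> 0); rewrite E0 addr0 => <-.
by apply: eqE => W _; rewrite addr0.
Qed.

Lemma ED f g : E (fun W => f W + g W) = E f + E g.
Proof.
have := okElin H 1 f g; rewrite mul1r => <-.
by apply: eqE => W _; rewrite mul1r.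
Qed.

Lemma EN f : E (fun W => - f W) = - E f.
Proof. by rewrite -mulN1r -EZ; apply: eqE => W _; rewrite mulN1r. Qed.

Lemma EB f g : E (fun W => f W - g W) = E f - E g.
Proof. by rewrite ED EN. Qed.

Lemma Ec c : E (fun=> c) = c.
Proof. by rewrite -[RHS]mulr1 -(okE1 H) -EZ; apply: eqE => W _; rewrite mulr1. Qed.

Lemma Esum (I : Type) (r : seq I) (P : pred I) (F : I -> 'M[R]_(m, n) -> R) :
  E (fun W => \sum_(i <- r | P i) F i W) = \sum_(i <- r | P i) E (F i).
Proof.
elim: r => [|i r IH].
  by rewrite big_nil -[RHS]E0; apply: eqE => W _; rewrite big_nil.
rewrite big_cons; case: ifP => Pi; rewrite -?IH -?ED; apply: eqE => W _; rewrite big_cons Pi //.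
Qed.

Lemma Ele f g : (forall W, good d W -> f W <= g W) -> E f <= E g.
Proof. exact: (okEle H). Qed.

Lemma Ege0 f : (forall W, good d W -> 0 <= f W) -> 0 <= E f.
Proof. by move=> h; rewrite -E0; apply: Ele. Qed.

Lemma Ele_c f c : (forall W, good d W -> f W <= c) -> E f <= c.
Proof. by move=> h; rewrite -[leRHS]Ec; apply: Ele. Qed.

Lemma Eabs f : `|E f| <= E (fun W => `|f W|).
Proof.
rewrite ler_norml -EN; apply/andP; split; apply: Ele => W _.
- by rewrite lerNl -normrN ler_norm.
- exact: ler_norm.
Qed.

Lemma Eabs_le f g : (forall W, good d W -> `|f W| <= g W) -> `|E f| <= E g.
Proof. by move=> h; apply: le_trans (Eabs f) _; apply: Ele. Qed.

(** Cauchy-Schwarz without square roots: the weighted arithmetic-geometric mean inequality with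
    ratio [B / A], optimal for the given bounds. *)
Lemma Ecs f g A B : 0 < A -> 0 < B -> E (fun W => f W ^+ 2) <= A ^+ 2 ->
  E (fun W => g W ^+ 2) <= B ^+ 2 -> E (fun W => `|f W * g W|) <= A * B.
Proof.
move=> A0 B0 hA hB.
apply: (@le_trans _ _ (E (fun W => B / A / 2 * f W ^+ 2 + A / B / 2 * g W ^+ 2))).
  apply: Ele => W _; rewrite normrM.
  have := sqr_ge0 (B * `|f W| - A * `|g W|); rewrite -(real_normK (num_real (f W))) -(real_normK (num_real (g W))).
  move: `|f W| `|g W| => u w h.
  rewrite -subr_ge0 (_ : _ - _ = (B * u - A * w) ^+ 2 / (2 * A * B)); last by field; rewrite !gt_eqF.
  by rewrite divr_ge0 // ?mulr_ge0 // ltW.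
rewrite ED !EZ (_ : A * B = B / A / 2 * A ^+ 2 + A / B / 2 * B ^+ 2); last by field; rewrite !gt_eqF.
by apply: lerD; apply: ler_wpM2l => //; rewrite !divr_ge0 // ltW.
Qed.

Lemma Ecs1 f A : 0 < A -> E (fun W => f W ^+ 2) <= A ^+ 2 -> E (fun W => `|f W|) <= A.
Proof.
move=> A0 hA; rewrite -[leRHS]mulr1.
apply: le_trans (Ecs A0 ltr01 hA (_ : E (fun=> 1 ^+ 2) <= 1 ^+ 2)); last by rewrite expr1n Ec.
by apply: Ele => W _; rewrite mulr1.
Qed.

Lemma K_ge1 : 1 <= K. Proof. have := okK H; lra. Qed.
Lemma K_gt0 : 0 < K. Proof. have := okK H; lra. Qed.
Lemma K_ge0 : 0 <= K. Proof. have := okK H; lra. Qed.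
Lemma v_geK : K <= v.
Proof. by apply: le_trans (oknu H); rewrite -{1}[K]expr1 ler_weXn2l // K_ge1. Qed.
Lemma v_ge1 : 1 <= v. Proof. exact: le_trans K_ge1 v_geK. Qed.
Lemma v_gt0 : 0 < v. Proof. exact: lt_le_trans K_gt0 v_geK. Qed.
Lemma v_ge0 : 0 <= v. Proof. exact: ltW v_gt0. Qed.
Lemma Kv_ge0 i j : 0 <= K ^+ i * v ^+ j. Proof. by rewrite mulr_ge0 // exprn_ge0 // ?K_ge0 ?v_ge0. Qed.
Lemma Kv_gt0 i j : 0 < K ^+ i * v ^+ j. Proof. by rewrite mulr_gt0 // exprn_gt0 // ?K_gt0 ?v_gt0. Qed.

(** Since [100 <= K], a numerical constant up to 100 is paid for by one more power of [K]. *)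
Lemma Kv_le c i j p q : c <= 100 -> (i < j)%N -> (p <= q)%N -> c * (K ^+ i * v ^+ p) <= K ^+ j * v ^+ q.
Proof.
move=> hc ij pq.
apply: (@le_trans _ _ (K * (K ^+ i * v ^+ p))).
  by apply: ler_wpM2r; rewrite ?Kv_ge0 //; apply: le_trans hc (okK H).
rewrite mulrA -exprS; apply: ler_pM; rewrite ?exprn_ge0 ?K_ge0 ?v_ge0 //.
  by rewrite ler_weXn2l // K_ge1.
by rewrite ler_weXn2l // v_ge1.
Qed.

Lemma Kv_le1 i j p q : (i <= j)%N -> (p <= q)%N -> K ^+ i * v ^+ p <= K ^+ j * v ^+ q.
Proof.
move=> ij pq; apply: ler_pM; rewrite ?exprn_ge0 ?K_ge0 ?v_ge0 //.
  by rewrite ler_weXn2l // K_ge1.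
by rewrite ler_weXn2l // v_ge1.
Qed.

(** One power of [v] outweighs a hundred powers of [K]; this is how error terms of smaller order in
    [v] are discarded. *)
Lemma K_le_v i p : (i <= 100)%N -> K ^+ i * v ^+ p <= v ^+ p.+1.
Proof.
move=> i100; rewrite exprS ler_wpM2r ?exprn_ge0 ?v_ge0 //.
by apply: le_trans (oknu H); rewrite ler_weXn2l // K_ge1.
Qed.

Local Notation M := (mr R m).
Local Notation N := (nr R n).

Lemma M_ge0 : 0 <= M. Proof. exact: ler0n. Qed.
Lemma N_ge0 : 0 <= N. Proof. exact: ler0n. Qed.

Lemma MN_gt0 : 0 < M * N.
Proof.
have h := okmn H; have h2 : 0 < v ^+ 4 by rewrite exprn_gt0 // v_gt0.
by have := lt_le_trans h2 h; rewrite pmulr_rgt0 // K_gt0.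
Qed.
Lemma M_gt0 : 0 < M.
Proof. by have := MN_gt0; rewrite lt_def mulf_eq0 negb_or => /andP[/andP[h _] _]; rewrite lt_def h M_ge0. Qed.
Lemma N_gt0 : 0 < N.
Proof. by have := MN_gt0; rewrite lt_def mulf_eq0 negb_or => /andP[/andP[_ h] _]; rewrite lt_def h N_ge0. Qed.

Lemma dens_gt0 : 0 < dens d.
Proof. by have := okK H; have := okdens H; nra. Qed.
Lemma dens_lt1 : dens d < 1.
Proof. by have := okK H; have := okdens1 H; nra. Qed.

Lemma al_le a : `|al d a 0| <= K / v.
Proof. by rewrite ler_pdivlMr ?v_gt0 // (okal H). Qed.
Lemma be_le b : `|be d b 0| <= K / v.
Proof. by rewrite ler_pdivlMr ?v_gt0 // (okbe H). Qed.

Lemma Kv_small i : (i < 100)%N -> K ^+ i / v <= K^-1.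
Proof.
move=> hi; rewrite ler_pdivrMr ?v_gt0 // -(ler_pM2l K_gt0) mulrA divff ?gt_eqF ?K_gt0 // mul1r -exprS.
by apply: le_trans (oknu H); rewrite ler_weXn2l // K_ge1.
Qed.

Lemma al_le1 a : `|al d a 0| <= 2^-1.
Proof.
apply: le_trans (al_le a) _; have := @Kv_small 1 isT; rewrite expr1 => h; apply: le_trans h _.
by rewrite lef_pV2 ?posrE ?K_gt0 //; have := okK H; lra.
Qed.
Lemma be_le1 b : `|be d b 0| <= 2^-1.
Proof.
apply: le_trans (be_le b) _; have := @Kv_small 1 isT; rewrite expr1 => h; apply: le_trans h _.
by rewrite lef_pV2 ?posrE ?K_gt0 //; have := okK H; lra.
Qed.

Lemma mean_in01 a b : 0 <= dens d + al d a 0 + be d b 0 <= 1.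
Proof.
have s : K / v <= K^-1 / 2.
  apply: le_trans (_ : K ^+ 2 / v / K <= _).
    by rewrite (_ : K ^+ 2 / v / K = K / v) //; field; rewrite !gt_eqF ?K_gt0 ?v_gt0.
  rewrite mulrC ler_pM2l ?invr_gt0 ?K_gt0 //; apply: le_trans (@Kv_small 2 isT) _.
  by rewrite lef_pV2 ?posrE ?K_gt0 //; have := okK H; lra.
have h1 := le_trans (al_le a) s; have h2 := le_trans (be_le b) s.
have l1 : K^-1 <= dens d by rewrite -(ler_pM2l K_gt0) divff ?gt_eqF ?K_gt0 ?(okdens H).
have l2 : K^-1 <= 1 - dens d by rewrite -(ler_pM2l K_gt0) divff ?gt_eqF ?K_gt0 ?(okdens1 H).
by move: h1 h2; rewrite !ler_norml => /andP[? ?] /andP[? ?]; lra.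
Qed.

Lemma Wle1 W : good d W -> mbnd W 1.
Proof.
case=> h _ _ a b; have /andP[p0 p1] := mean_in01 a b.
by rewrite ler_norml; case: (h a b); rewrite /gm => ?; lra.
Qed.

Lemma gm01 W a b : good d W -> 0 <= gm d W a b <= 1.
Proof. by case=> h _ _; case: (h a b) => ->; rewrite ?lexx ?ler01. Qed.

Lemma h01 a b : 0 <= hm d a b <= 1.
Proof. by case: (okh H a b) => ->; rewrite ?lexx ?ler01. Qed.
Lemma h_ge0 a b : 0 <= hm d a b. Proof. by case/andP: (h01 a b). Qed.
Lemma h_le1 a b : hm d a b <= 1. Proof. by case/andP: (h01 a b). Qed.

Lemma kap01 a b : 0 <= kap d a b <= 1.
Proof. by rewrite /kap; have := okq0 H; have := okq1 H; case: (okh H a b) => ->; lra. Qed.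

Lemma mul01 (x y : R) : 0 <= x <= 1 -> 0 <= y <= 1 -> 0 <= x * y <= 1.
Proof. by move=> /andP[? ?] /andP[? ?]; rewrite mulr_ge0 //= mulr_ile1. Qed.

Lemma opp01 (x : R) : 0 <= x <= 1 -> 0 <= 1 - x <= 1.
Proof. by move=> /andP[? ?]; lra. Qed.

Lemma chip01 W a b c e : good d W -> 0 <= chip d W a b c e <= 1.
Proof. by move=> g; rewrite /chip; do !apply: mul01; rewrite ?opp01 ?gm01. Qed.
Lemma chim01 W a b c e : good d W -> 0 <= chim d W a b c e <= 1.
Proof. by move=> g; rewrite /chim; do !apply: mul01; rewrite ?opp01 ?gm01. Qed.

Lemma sumh : \sum_a \sum_b hm d a b = XX d.
Proof. by under eq_bigr do rewrite (okx H); rewrite sum_constM card_ord. Qed.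

Lemma XXn : XX d = N * yd d.
Proof. by rewrite -sumh exchange_big /=; under eq_bigr do rewrite (oky H); rewrite sum_constM card_ord. Qed.

Lemma XX_ge0 : 0 <= XX d. Proof. by rewrite mulr_ge0 ?M_ge0 ?(okx0 H). Qed.
Lemma XX_le : XX d <= K * v ^+ 2.
Proof. by rewrite mulrC ler_pM ?M_ge0 ?(okx0 H) ?(okxK H) ?(okm H). Qed.

Lemma na_ge0 : 0 <= na d. Proof. exact: nF_ge0. Qed.
Lemma nb_ge0 : 0 <= nb d. Proof. exact: nF_ge0. Qed.
Lemma na_le : na d <= K ^+ 2.
Proof.
rewrite /na nF_cv; apply: le_trans (ler_sum_const (c := (K / v) ^+ 2) _) _.
  by move=> a; apply: sqr_le_norm; apply: al_le.
rewrite card_ord expr_div_n mulrA ler_pdivrMr ?exprn_gt0 ?v_gt0 // mulrC.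
by rewrite ler_wpM2l ?exprn_ge0 ?K_ge0 // (okm H).
Qed.
Lemma nb_le : nb d <= K ^+ 2.
Proof.
rewrite /nb nF_cv; apply: le_trans (ler_sum_const (c := (K / v) ^+ 2) _) _.
  by move=> a; apply: sqr_le_norm; apply: be_le.
rewrite card_ord expr_div_n mulrA ler_pdivrMr ?exprn_gt0 ?v_gt0 // mulrC.
by rewrite ler_wpM2l ?exprn_ge0 ?K_ge0 // (okn H).
Qed.

Lemma LL_ge : v ^+ 4 <= K ^+ 3 * LL d.
Proof.
apply: le_trans (okmn H) _.
have -> : K ^+ 3 * LL d = (K * dens d) * (K * (1 - dens d)) * (K * (M * N)) by rewrite /LL; ring.
rewrite ler_peMl ?mulr_ge0 ?K_ge0 ?M_ge0 ?N_ge0 // -[leLHS]mulr1.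
by rewrite ler_pM ?(okdens H) ?(okdens1 H).
Qed.

Lemma LL_gt0 : 0 < LL d.
Proof.
have h := LL_ge; have h2 : 0 < v ^+ 4 by rewrite exprn_gt0 // v_gt0.
by have := lt_le_trans h2 h; rewrite pmulr_rgt0 // exprn_gt0 // K_gt0.
Qed.

(** Dividing the loop equation by [LL] gains [v ^+ 4] at the price of [K ^+ 3]. *)
Lemma LL_div X i p : 0 <= X -> LL d * X <= K ^+ i * v ^+ (p + 4) -> X <= K ^+ (i + 3) * v ^+ p.
Proof.
move=> X0 h; have v4 : 0 < v ^+ 4 by rewrite exprn_gt0 // v_gt0.
rewrite -(ler_pM2l v4); apply: le_trans (ler_wpM2r X0 LL_ge) _.
rewrite -mulrA; apply: le_trans (ler_wpM2l _ h) _; first by rewrite exprn_ge0 // K_ge0.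
by rewrite !exprD le_eqVlt; apply/orP; left; apply/eqP; ring.
Qed.
End Basic.

(** * The symmetry exchanging rows and columns *)

Section Transpose.
Variable R : realFieldType.
Definition trd m n (d : ensemble R m n) : ensemble R n m :=
  Ensemble (dens d) (be d) (al d) (hm d)^T (yd d) (xd d) (qd d)
    (fun f => Ex d (fun W => f W^T)) (KK d) (nu d).

Lemma trdK_E m n (d : ensemble R m n) f : Ex (trd d) f = Ex d (fun W => f W^T).
Proof. by []. Qed.

Lemma gm_tr m n (d : ensemble R m n) W a b : gm (trd d) W^T b a = gm d W a b.
Proof. by rewrite /gm /= mxE; ring. Qed.

Lemma good_tr m n (d : ensemble R m n) W : good d W -> good (trd d) W^T.
Proof.
case=> h1 h2 h3; split=> [b a|b|a].
- by rewrite gm_tr.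
- by under eq_bigr do rewrite mxE; rewrite h3.
- by under eq_bigr do rewrite mxE; rewrite h2.
Qed.

Lemma Dl_tr m n (a c : 'I_m) (b e : 'I_n) : (Dl R a c b e)^T = Dl R b e a c.
Proof. by rewrite /Dl trmx_mul trmxK. Qed.

Lemma chip_tr m n (d : ensemble R m n) W a b c e : chip (trd d) W^T b a e c = chip d W a b c e.
Proof. by rewrite /chip !gm_tr; ring. Qed.

Lemma chim_tr m n (d : ensemble R m n) W a b c e : chim (trd d) W^T b a e c = chim d W a b c e.
Proof. by rewrite /chim !gm_tr; ring. Qed.

Lemma kap_tr m n (d : ensemble R m n) a b : kap (trd d) b a = kap d a b.
Proof. by rewrite /kap /= mxE. Qed.

Lemma ok_tr m n (d : ensemble R m n) : ok d -> ok (trd d).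
Proof.
case=> hK hnu hm hn hmn hl hl1 ha hb hsa hsb hh hx hy x0 y0 xK yK q0 q1 El Ele E1 Esw.
split=> //=.
- by rewrite (mulrC (mr _ _)).
- by move=> b a; rewrite mxE.
- by move=> b; under eq_bigr do rewrite mxE.
- by move=> a; under eq_bigr do rewrite mxE.
- by move=> f g h; apply: Ele => W gW; apply: h; apply: good_tr.
- move=> psi b a e c.
  have H : ok d by [].
  rewrite (eqE H (_ : forall W, good d W -> _ = psi W^T * (chip d W a b c e * (kap d a b * kap d c e)))); last first.
    by move=> W _; rewrite chip_tr !kap_tr.
  rewrite (Esw (fun W => psi W^T)); apply: (eqE H) => W _.
  by rewrite linearD /= Dl_tr chim_tr !kap_tr (mulrC (kap d a e)).
Qed.

End Transpose.

(** * Switchings *)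
Section Switch.
Variables (R : realFieldType) (m n : nat) (d : ensemble R m n) (H : ok d).
Implicit Types (W : 'M[R]_(m, n)).
Local Notation E := (Ex d).
Local Notation M := (mr R m).
Local Notation N := (nr R n).
Local Notation g := (gm d).

Lemma DlE (a c : 'I_m) (b e : 'I_n) i j :
  Dl R a c b e i j = ((i == a)%:R - (i == c)%:R) * ((j == b)%:R - (j == e)%:R).
Proof. by rewrite !mxE big_ord1 !mxE. Qed.

Lemma pairv_sum0 k (a c : 'I_k) : \sum_i (pairv R a c) i 0 = 0.
Proof.
under eq_bigr do rewrite mxE; rewrite sumrB.
have s (x : 'I_k) : \sum_(i < k) (i == x)%:R = 1 :> R.
  by rewrite (bigD1 x) //= eqxx big1 ?addr0 // => i /negPf ->.
by rewrite !s subrr.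
Qed.

Lemma pairv_dot k (a c : 'I_k) (u : 'I_k -> R) :
  \sum_i (pairv R a c) i 0 * u i = u a - u c.
Proof.
under eq_bigr do rewrite mxE mulrBl; rewrite sumrB.
have s (x : 'I_k) : \sum_(i < k) (i == x)%:R * u i = u x.
  by rewrite (bigD1 x) //= eqxx mul1r big1 ?addr0 // => i /negPf ->; rewrite mul0r.
by rewrite !s.
Qed.

Lemma chim_val W a b c e : good d W -> chim d W a b c e != 0 ->
  [/\ g W a b = 0, g W c e = 0, g W a e = 1 & g W c b = 1].
Proof.
case=> h _ _; rewrite /chim !mulf_eq0 !negb_or !subr_eq0.
move=> /andP[/andP[/andP[n1 n2] n3] n4].
split.
- by case: (h a b) => // e1; rewrite e1 eqxx in n1.
- by case: (h c e) => // e1; rewrite e1 eqxx in n2.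
- by case: (h a e) => // e1; rewrite e1 eqxx in n3.
- by case: (h c b) => // e1; rewrite e1 eqxx in n4.
Qed.

Lemma chim_neq W a b c e : good d W -> chim d W a b c e != 0 -> (a != c) && (b != e).
Proof.
move=> gW /(chim_val gW)[h1 h2 h3 h4]; apply/andP; split; apply/eqP => eq; subst.
  by move: h1; rewrite h4 => /eqP; rewrite oner_eq0.
by move: h1; rewrite h3 => /eqP; rewrite oner_eq0.
Qed.

(** On a [chim] pattern the shift by [Dl] fills the two empty corners and empties the two full ones,
    so entries stay 0 or 1 and line sums are kept. *)
Lemma good_shift W a b c e : good d W -> chim d W a b c e != 0 -> good d (W + Dl R a c b e).
Proof.
move=> gW nz; have /andP[ac be0] := chim_neq gW nz.
have [h1 h2 h3 h4] := chim_val gW nz; case: gW => k1 k2 k3; split.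
- move=> i j; have -> : g (W + Dl R a c b e) i j = g W i j + Dl R a c b e i j by rewrite /gm mxE; ring.
  rewrite DlE.
  have [->|ia] := eqVneq i a; have [->|jb] := eqVneq j b; rewrite ?(negPf ac) ?(negPf be0) ?eqxx ?mulr1n ?mulr0n.
  + by right; rewrite h1; ring.
  + have [->|je] := eqVneq j e; first by left; rewrite h3 ?eqxx ?mulr1n ?mulr0n; ring.
    by rewrite subrr mulr0 addr0.
  + have [->|ic] := eqVneq i c; first by left; rewrite h4 ?eqxx ?mulr1n ?mulr0n; ring.
    by rewrite subrr mul0r addr0.
  + have [->|ic] := eqVneq i c; last by rewrite subrr mul0r addr0.
    have [->|je] := eqVneq j e; last by rewrite subrr mulr0 addr0.
    by right; rewrite h2 ?eqxx ?mulr1n ?mulr0n; ring.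
- move=> i; under eq_bigr do rewrite mxE; rewrite big_split /= k2 add0r.
  under eq_bigr do rewrite mxE big_ord1.
  by rewrite -mulr_sumr; under eq_bigr do rewrite mxE; rewrite pairv_sum0 mulr0.
- move=> j; under eq_bigr do rewrite mxE; rewrite big_split /= k3 add0r.
  under eq_bigr do rewrite mxE big_ord1.
  by rewrite -mulr_suml pairv_sum0 mul0r.
Qed.

(** A discrete integration by parts: [okEsw] turns each [chip] term at W into a [chim] term at the
    switched matrix, so that only the increment of F survives. *)
Lemma Eswitch (F : 'M[R]_(m, n) -> 'I_m -> 'I_n -> R) :
  E (fun W => \sum_a \sum_b \sum_c \sum_e F W a b *
     (chip d W a b c e * (kap d a b * kap d c e) - chim d W a b c e * (kap d a e * kap d c b)))
  = E (fun W => \sum_a \sum_b \sum_c \sum_e (F (W + Dl R a c b e) a b - F W a b) *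
     (chim d W a b c e * (kap d a e * kap d c b))).
Proof.
do 4 (rewrite !(Esum H); apply: eq_bigr => ? _).
under (eqE H) do rewrite mulrBr.
under [RHS](eqE H) do rewrite mulrBl.
rewrite !(EB H); congr (_ - _); exact: (okEsw H).
Qed.

Definition wk W a b c e := chim d W a b c e * (kap d a e * kap d c b).

Lemma wk01 W a b c e : good d W -> 0 <= wk W a b c e <= 1.
Proof. by move=> gW; apply: mul01; [exact: chim01|apply: mul01; exact: kap01]. Qed.

Lemma sum4_norm (u w : 'I_m -> 'I_n -> 'I_m -> 'I_n -> R) :
  (forall a b c e, `|u a b c e| <= w a b c e) ->
  `|\sum_a \sum_b \sum_c \sum_e u a b c e| <= \sum_a \sum_b \sum_c \sum_e w a b c e.
Proof. by move=> h; do 4 (apply: ler_norm_sumD => ?). Qed.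

(** Increments matter only where [wk] does not vanish; there both matrices are good and the corners
    are distinct. *)
Lemma switch_diff_le (F : 'M[R]_(m, n) -> 'I_m -> 'I_n -> R)
    (B : 'M[R]_(m, n) -> 'I_m -> 'I_n -> 'I_m -> 'I_n -> R) :
  (forall W a b c e, good d W -> 0 <= B W a b c e) ->
  (forall W a b c e, good d W -> good d (W + Dl R a c b e) -> a != c -> b != e ->
     `|F (W + Dl R a c b e) a b - F W a b| <= B W a b c e) ->
  `|E (fun W => \sum_a \sum_b \sum_c \sum_e (F (W + Dl R a c b e) a b - F W a b) * wk W a b c e)|
  <= E (fun W => \sum_a \sum_b \sum_c \sum_e B W a b c e).
Proof.
move=> B0 hB; apply: (Eabs_le H) => W gW; apply: sum4_norm => a b c e.
have [z|nz] := eqVneq (chim d W a b c e) 0.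
  by rewrite /wk z mul0r mulr0 normr0 B0.
have /andP[w0 w1] := wk01 a b c e gW.
have /andP[ac be0] := chim_neq gW nz.
rewrite normrM (ger0_norm w0); apply: le_trans (_ : B W a b c e * 1 <= _); last by rewrite mulr1.
by apply: ler_pM => //; apply: hB => //; apply: good_shift.
Qed.

Lemma sum_g_row W a : good d W -> \sum_e g W a e = N * (dens d + al d a 0).
Proof.
case=> _ h _; rewrite /gm !big_split /= h addr0 (oksbe H) addr0 !sum_constM card_ord -/(nr R n).
by ring.
Qed.
Lemma sum_g_col W b : good d W -> \sum_c g W c b = M * (dens d + be d b 0).
Proof.
case=> _ _ h; rewrite /gm !big_split /= h addr0 (oksal H) addr0 !sum_constM card_ord -/(mr R m).
by ring.
Qed.

Lemma sum_g_be W a : good d W -> \sum_e g W a e * be d e 0 = nb d + gb d W a 0.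
Proof.
move=> gW; under eq_bigr do rewrite /gm !mulrDl.
rewrite !big_split /= -!mulr_sumr (oksbe H) !mulr0 !add0r /nb nF_cv.
by congr (_ + _); rewrite mxE.
Qed.

Lemma sum_g_al W b : good d W -> \sum_c g W c b * al d c 0 = na d + ga d W b 0.
Proof.
move=> gW; under eq_bigr do rewrite /gm !mulrDl.
rewrite !big_split /= -!mulr_sumr (oksal H) !mulr0 add0r addr0 /na nF_cv.
by congr (_ + _); rewrite mxE; apply: eq_bigr => c _; rewrite mxE.
Qed.

End Switch.

(** * Counting switchings through a pair, and the loop equation *)

Section Counts.
Variables (R : realFieldType) (m n : nat) (d : ensemble R m n) (H : ok d).
Implicit Types (W : 'M[R]_(m, n)).
Local Notation E := (Ex d).
Local Notation M := (mr R m).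
Local Notation N := (nr R n).
Local Notation g := (gm d).

Lemma sum_gb W : good d W -> \sum_a gb d W a 0 = 0.
Proof.
case=> _ _ h; under eq_bigr do rewrite mxE; rewrite exchange_big big1 //= => e _.
by rewrite -mulr_suml h mul0r.
Qed.
Lemma sum_ga W : good d W -> \sum_b ga d W b 0 = 0.
Proof.
case=> _ h _; under eq_bigr do rewrite mxE; rewrite exchange_big big1 //= => a _.
by under eq_bigr do rewrite mxE; rewrite -mulr_suml h mul0r.
Qed.
Lemma sum_Mu W a : good d W -> \sum_c Mu W c a = 0.
Proof.
case=> _ _ h; under eq_bigr do rewrite mxE; rewrite exchange_big big1 //= => e _.
by under eq_bigr do rewrite mxE; rewrite -mulr_suml h mul0r.
Qed.
Lemma sum_mb W : good d W -> \sum_b mb d W b 0 = 0.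
Proof.
case=> _ h _; under eq_bigr do rewrite mxE; rewrite exchange_big big1 //= => a _.
by under eq_bigr do rewrite mxE; rewrite -mulr_suml h mul0r.
Qed.
Lemma sum_ma W : good d W -> \sum_b ma d W b 0 = 0.
Proof.
case=> _ _ h; under eq_bigr do rewrite mxE; rewrite exchange_big big1 //= => a _.
by rewrite -mulr_suml h mul0r.
Qed.

Lemma MuC W a c : Mu W a c = Mu W c a.
Proof. by rewrite /Mu !mxE; apply: eq_bigr => e _; rewrite !mxE mulrC. Qed.

Lemma VVE W a b : VV W a b = \sum_c Mu W a c * W c b.
Proof. by rewrite /VV /Mv mulmxA -/(Mu W) mxE. Qed.

Lemma maE W a : ma d W a 0 = \sum_c Mu W a c * al d c 0.
Proof. by rewrite /ma /ga mulmxA -/(Mu W) mxE. Qed.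

(** The factors are expanded one at a time around their means; the mixed linear terms drop out
    because [W], [al] and [be] all have zero sums. *)
Lemma triple_sum_eq W a b : good d W ->
  \sum_c \sum_e g W c e * g W a e * g W c b =
  dens d * (N * (dens d + al d a 0)) * (M * (dens d + be d b 0)) + epsT d W a b.
Proof.
move=> gW; rewrite /epsT.
set s := N * _; set t := M * _.
have inner c : \sum_e g W c e * g W a e * g W c b =
    dens d * s * g W c b + s * (g W c b * al d c 0) + (nb d + gb d W a 0) * g W c b
    + g W c b * gb d W c 0 + g W c b * Mu W a c.
  rewrite -mulr_suml.
  have -> : \sum_e g W c e * g W a e =
     (dens d + al d c 0) * (\sum_e g W a e) + (\sum_e g W a e * be d e 0) + \sum_e W c e * g W a e.
    rewrite mulr_sumr -!big_split /=; apply: eq_bigr => e _.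
    by rewrite {1}/gm; ring.
  rewrite (sum_g_row H) // (sum_g_be H) // -/s.
  have -> : \sum_e W c e * g W a e = gb d W c 0 + Mu W a c.
    under eq_bigr do rewrite /gm !mulrDr.
    case: gW => _ h _; rewrite !big_split /= -!mulr_suml h !mul0r !add0r /gb /Mu !mxE.
    by congr (_ + _); apply: eq_bigr => e _; rewrite mxE mulrC.
  by ring.
under eq_bigr do rewrite inner.
rewrite !big_split /= -!mulr_sumr (sum_g_col H) // (sum_g_al H) // -/t.
have -> : \sum_c g W c b * gb d W c 0 = om d W + mb d W b 0.
  rewrite (eq_bigr (fun c => (dens d + be d b 0) * gb d W c 0 + (al d c 0 * gb d W c 0 + W c b * gb d W c 0)));
    last by move=> c _; rewrite /gm; ring.
  rewrite !big_split /= -mulr_sumr sum_gb // mulr0 add0r; congr (_ + _).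
  by rewrite [RHS]mxE; apply: eq_bigr => c _; rewrite [in RHS]mxE.
have -> : \sum_c g W c b * Mu W a c = ma d W a 0 + VV W a b.
  rewrite (eq_bigr (fun c => (dens d + be d b 0) * Mu W c a + (Mu W a c * al d c 0 + Mu W a c * W c b)));
    last by move=> c _; rewrite (MuC W c a) /gm; ring.
  by rewrite !big_split /= -mulr_sumr sum_Mu // mulr0 add0r maE VVE.
rewrite /s /t; ring.
Qed.

Lemma sum_gg W a b : good d W ->
  \sum_c \sum_e g W a e * g W c b = (N * (dens d + al d a 0)) * (M * (dens d + be d b 0)).
Proof.
move=> gW; under eq_bigr do rewrite -mulr_suml (sum_g_row H) //.
by rewrite -mulr_sumr (sum_g_col H).
Qed.

Lemma Fm_eq W a b : good d W ->
  Fm d W a b = M * N * (1 - dens d) * (dens d + al d a 0) * (dens d + be d b 0) - epsT d W a b.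
Proof.
move=> gW; rewrite /Fm.
rewrite (eq_bigr (fun c => \sum_e g W a e * g W c b - \sum_e g W c e * g W a e * g W c b)).
  by rewrite sumrB sum_gg // triple_sum_eq //; ring.
by move=> c _; rewrite -sumrB; apply: eq_bigr => e _; ring.
Qed.

Lemma Fp_eq W a b : good d W ->
  Fp d W a b = M * N * ((1 - dens d) * (dens d - (dens d + al d a 0) * (dens d + be d b 0))
                       + al d a 0 * be d b 0) + epsT d W a b
     - M * (nb d + gb d W a 0) - N * (na d + ga d W b 0).
Proof.
move=> gW; rewrite /Fp.
have -> : \sum_c \sum_e g W c e * (1 - g W a e) * (1 - g W c b) =
  \sum_c (\sum_e g W c e) - \sum_e (\sum_c g W c e) * g W a e - \sum_c (\sum_e g W c e) * g W c b
  + \sum_c \sum_e g W c e * g W a e * g W c b.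
  have -> : \sum_e (\sum_c g W c e) * g W a e = \sum_c \sum_e g W c e * g W a e.
    by rewrite exchange_big /=; apply: eq_bigr => e _; rewrite mulr_suml.
  have -> : \sum_c (\sum_e g W c e) * g W c b = \sum_c \sum_e g W c e * g W c b.
    by apply: eq_bigr => c _; rewrite mulr_suml.
  rewrite -!sumrB -!big_split /=; apply: eq_bigr => c _.
  by rewrite -!sumrB -!big_split /=; apply: eq_bigr => e _; ring.
under eq_bigr do rewrite (sum_g_row H) //.
have -> : \sum_e (\sum_c g W c e) * g W a e = M * (dens d * (N * (dens d + al d a 0)) + (nb d + gb d W a 0)).
  under eq_bigr do rewrite (sum_g_col H) //.
  rewrite (eq_bigr (fun e => M * (dens d * g W a e + g W a e * be d e 0))); last by move=> e _; ring.
  by rewrite -mulr_sumr big_split /= -mulr_sumr (sum_g_row H) // (sum_g_be H).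
have -> : \sum_c (\sum_e g W c e) * g W c b = N * (dens d * (M * (dens d + be d b 0)) + (na d + ga d W b 0)).
  under eq_bigr do rewrite (sum_g_row H) //.
  rewrite (eq_bigr (fun e => N * (dens d * g W e b + g W e b * al d e 0))); last by move=> e _; ring.
  by rewrite -mulr_sumr big_split /= -mulr_sumr (sum_g_col H) // (sum_g_al H).
rewrite -mulr_sumr big_split /= (oksal H) addr0 sum_constM card_ord -/(mr R m) triple_sum_eq //; ring.
Qed.

Lemma sum_chip W a b : \sum_c \sum_e chip d W a b c e = g W a b * Fp d W a b.
Proof.
rewrite /Fp mulr_sumr; apply: eq_bigr => c _; rewrite mulr_sumr; apply: eq_bigr => e _.
by rewrite /chip; ring.
Qed.
Lemma sum_chim W a b : \sum_c \sum_e chim d W a b c e = (1 - g W a b) * Fm d W a b.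
Proof.
rewrite /Fm mulr_sumr; apply: eq_bigr => c _; rewrite mulr_sumr; apply: eq_bigr => e _.
by rewrite /chim; ring.
Qed.

(** In g [Fp] - (1 - g) [Fm] the two copies of [epsT] carry the weights g and 1 - g, so the cubic
    term enters with coefficient exactly one. *)
Lemma switch_balance W a b : good d W ->
  \sum_c \sum_e (chip d W a b c e - chim d W a b c e) = LL d * W a b + YY d W a b.
Proof.
move=> gW; under eq_bigr do rewrite sumrB; rewrite sumrB sum_chip sum_chim Fp_eq // Fm_eq //.
rewrite /YY [X in _ = _ + X]mxE /II /epsT /gm /LL.
by ring.
Qed.

(* Replacing a weight [kap * kap] by 1 only costs switchings that use an edge of [h]. *)
Lemma kap2_le (a : 'I_m) b (c : 'I_m) e : 0 <= 1 - kap d a b * kap d c e <= hm d a b + hm d c e.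
Proof.
have /andP[? ?] := mul01 (kap01 H a b) (kap01 H c e).
rewrite /kap; have := okq0 H; have := okq1 H.
by case: (okh H a b) => ->; case: (okh H c e) => ->; nra.
Qed.

Lemma sum_h4 a b : \sum_c \sum_e (hm d a b + hm d c e + hm d a e + hm d c b) = M * N * hm d a b + 3 * XX d.
Proof.
under eq_bigr do rewrite !big_split /= !(okx H) !sum_constM card_ord -/(nr R n).
rewrite !big_split /= !sum_constM card_ord -/(mr R m) -mulr_sumr (oky H) -(XXn H) /XX; ring.
Qed.

(* The switching identity tested against an arbitrary matrix function F; every moment bound below
   comes from a suitable choice of F. *)
Lemma loop_estimate (F : 'M[R]_(m, n) -> 'M[R]_(m, n)) :
  `|LL d * E (fun W => dot (F W) W) + E (fun W => dot (F W) (YY d W))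
    - E (fun W => \sum_a \sum_b \sum_c \sum_e (F (W + Dl R a c b e) a b - F W a b) * wk d W a b c e)|
  <= M * N * E (fun W => \sum_a \sum_b hm d a b * `|F W a b|) + 3 * XX d * E (fun W => \sum_a \sum_b `|F W a b|).
Proof.
rewrite -(Eswitch H (fun W => F W)) -!(EZ H) -!(ED H) -(EB H).
apply: (Eabs_le H) => W gW.
have -> : LL d * dot (F W) W + dot (F W) (YY d W) =
   \sum_a \sum_b \sum_c \sum_e F W a b * (chip d W a b c e - chim d W a b c e).
  rewrite /dot mulr_sumr -big_split /=; apply: eq_bigr => a _.
  rewrite mulr_sumr -big_split /=; apply: eq_bigr => b _.
  under [RHS]eq_bigr do rewrite -mulr_sumr.
  by rewrite -mulr_sumr switch_balance //; ring.
rewrite mulr_sumr [X in _ <= _ + X]mulr_sumr -!big_split -sumrB /=; apply: ler_norm_sumD => a.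
rewrite [X in _ <= X + _]mulr_sumr [X in _ <= _ + X]mulr_sumr -!big_split -sumrB /=; apply: ler_norm_sumD => b.
rewrite (_ : M * N * (hm d a b * `|F W a b|) + 3 * XX d * `|F W a b| = (M * N * hm d a b + 3 * XX d) * `|F W a b|); last by ring.
rewrite -sum_h4 mulr_suml -sumrB; apply: ler_norm_sumD => c.
rewrite mulr_suml -sumrB; apply: ler_norm_sumD => e.
rewrite -mulrBr normrM mulrC ler_wpM2r //.
have /andP[p0 p1] := chip01 a b c e gW; have /andP[m0 m1] := chim01 a b c e gW.
have /andP[k0 k1] := kap2_le a b c e; have /andP[l0 l1] := kap2_le a e c b.
rewrite (_ : _ - _ = chip d W a b c e * (1 - kap d a b * kap d c e)
   - chim d W a b c e * (1 - kap d a e * kap d c b)); last by ring.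
apply: le_trans (ler_normB _ _) _; rewrite (ger0_norm (mulr_ge0 p0 k0)) (ger0_norm (mulr_ge0 m0 l0)).
apply: (@le_trans _ _ (1 * (hm d a b + hm d c e) + 1 * (hm d a e + hm d c b))).
  by apply: lerD; apply: ler_pM.
by rewrite !mul1r addrA.
Qed.

End Counts.

(** * Entrywise bounds for switching increments of matrix products *)

Section MatBounds.
Variable R : realFieldType.
Lemma pairv_mulr m n (A : 'M[R]_(m, n)) (a c : 'I_n) i :
  (A *m pairv R a c) i 0 = A i a - A i c.
Proof.
rewrite mxE -(pairv_dot a c (fun k => A i k)).
by apply: eq_bigr => k _; rewrite mulrC.
Qed.

Lemma pairv_mull m n (A : 'M[R]_(m, n)) (a c : 'I_m) j :
  ((pairv R a c)^T *m A) 0 j = A a j - A c j.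
Proof.
rewrite mxE -(pairv_dot a c (fun k => A k j)).
by apply: eq_bigr => k _; rewrite mxE.
Qed.

Lemma pairv_le (k : nat) (a c : 'I_k) i : `|pairv R a c i 0| <= 1.
Proof. by rewrite mxE; case: eqP; case: eqP => _ _; rewrite ?subrr ?subr0 ?sub0r ?normrN ?normr0 ?normr1. Qed.

Lemma pairv_a (k : nat) (a c : 'I_k) : a != c -> pairv R a c a 0 = 1.
Proof. by move=> /negPf ac; rewrite mxE eqxx ac subr0. Qed.

Lemma diff_le (x y c : R) : `|x| <= c -> `|y| <= c -> `|x - y| <= 2 * c.
Proof. by move=> h1 h2; apply: le_trans (normrB_le h1 h2) _; rewrite mulr_natl mulr2n. Qed.

Lemma Dl_mullE m n p (a c : 'I_m) (b e : 'I_n) (A : 'M[R]_(n, p)) i j :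
  (Dl R a c b e *m A) i j = pairv R a c i 0 * (A b j - A e j).
Proof. by rewrite -mulmxA mxE big_ord1 pairv_mull. Qed.

Lemma Dl_mulrE m n p (a c : 'I_n) (b e : 'I_p) (A : 'M[R]_(m, n)) i j :
  (A *m Dl R a c b e) i j = (A i a - A i c) * pairv R b e j 0.
Proof. by rewrite mulmxA mxE big_ord1 pairv_mulr mxE. Qed.

Lemma Dl_mull m n p (a c : 'I_m) (b e : 'I_n) (A : 'M[R]_(n, p)) k :
  mbnd A k -> mbnd (Dl R a c b e *m A) (2 * k).
Proof.
move=> hA i j; rewrite Dl_mullE -[leRHS]mul1r; apply: normrM_le; first exact: pairv_le.
exact: diff_le.
Qed.

Lemma Dl_mulr m n p (a c : 'I_n) (b e : 'I_p) (A : 'M[R]_(m, n)) k :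
  mbnd A k -> mbnd (A *m Dl R a c b e) (2 * k).
Proof.
move=> hA i j; rewrite Dl_mulrE -[leRHS]mulr1; apply: normrM_le; last exact: pairv_le.
exact: diff_le.
Qed.

Lemma Dl_mid m n p q (a c : 'I_n) (b e : 'I_p) (A : 'M[R]_(m, n)) (B : 'M[R]_(p, q)) k l :
  mbnd A k -> mbnd B l -> mbnd (A *m Dl R a c b e *m B) (4 * (k * l)).
Proof.
move=> hA hB i j.
have -> : A *m Dl R a c b e *m B = (A *m pairv R a c) *m ((pairv R b e)^T *m B) by rewrite /Dl !mulmxA.
rewrite mxE big_ord1 pairv_mulr pairv_mull.
rewrite (_ : 4 * (k * l) = (2 * k) * (2 * l)); last by ring.
by apply: normrM_le; apply: diff_le.
Qed.

Lemma nF_Mu m n (W : 'M[R]_(m, n)) : nF (Mu W) = nF (Mv W).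
Proof.
have -> : nF (Mu W) = dot W (W *m W^T *m W) by rewrite /nF {1}/Mu dot_mull trmxK.
by rewrite /nF {1}/Mv dot_mulr trmxK /Mv mulmxA.
Qed.

Lemma Mv_tr m n (W : 'M[R]_(m, n)) : (Mv W)^T = Mv W.
Proof. by rewrite /Mv trmx_mul trmxK. Qed.
Lemma Mu_tr m n (W : 'M[R]_(m, n)) : (Mu W)^T = Mu W.
Proof. by rewrite /Mu trmx_mul trmxK. Qed.

Lemma VV_Mu m n (W : 'M[R]_(m, n)) : VV W = Mu W *m W.
Proof. by rewrite /VV /Mv mulmxA. Qed.

Lemma nF_Mu2 m n (W : 'M[R]_(m, n)) : nF (Mu W *m Mu W) = nF (Mv W *m Mv W).
Proof.
have -> : Mu W *m Mu W = VV W *m W^T by rewrite VV_Mu -mulmxA.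
have -> : Mv W *m Mv W = W^T *m VV W by rewrite /VV mulmxA.
have -> : nF (VV W *m W^T) = dot (VV W) (VV W *m W^T *m W) by rewrite /nF dot_mull trmxK.
have -> : nF (W^T *m VV W) = dot (VV W) (W *m (W^T *m VV W)) by rewrite /nF dot_mulr trmxK.
by rewrite /VV /Mv !mulmxA.
Qed.

Lemma dot_VV_W m n (W : 'M[R]_(m, n)) : dot (VV W) W = nF (Mv W).
Proof. by rewrite /VV dot_mulr. Qed.

Lemma amgm (x y s : R) : 0 < s -> `|x * y| <= s / 2 * x ^+ 2 + y ^+ 2 / (2 * s).
Proof.
move=> s0; rewrite normrM -(real_normK (num_real x)) -(real_normK (num_real y)).
rewrite -subr_ge0 (_ : _ - _ = (s * `|x| - `|y|) ^+ 2 / (2 * s)); last by field; rewrite !gt_eqF.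
by rewrite divr_ge0 ?sqr_ge0 // mulr_ge0 // ltW.
Qed.

Lemma dot_amgm m n (A B : 'M[R]_(m, n)) s : 0 < s -> `|dot A B| <= s / 2 * nF A + nF B / (2 * s).
Proof.
move=> s0; rewrite !nFE mulr_sumr mulr_suml -big_split /=; apply: ler_norm_sumD => i.
rewrite mulr_sumr mulr_suml -big_split /=; apply: ler_norm_sumD => j.
exact: amgm.
Qed.
End MatBounds.

(** * Moment bounds *)
Section Moments.
Variables (R : realFieldType) (m n : nat) (d : ensemble R m n) (H : ok d).
Implicit Types (W : 'M[R]_(m, n)).
Local Notation E := (Ex d).
Local Notation K := (KK d).
Local Notation v := (nu d).
Local Notation M := (mr R m).
Local Notation N := (nr R n).

(** The form of [loop_estimate] for test functions whose increments are only bounded, with no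
    leading part extracted from them. *)
Lemma loop_bound (F : 'M[R]_(m, n) -> 'M[R]_(m, n)) (B : 'M[R]_(m, n) -> 'I_m -> 'I_n -> 'I_m -> 'I_n -> R) :
  (forall W a b c e, good d W -> 0 <= B W a b c e) ->
  (forall W a b c e, good d W -> good d (W + Dl R a c b e) -> a != c -> b != e ->
     `|F (W + Dl R a c b e) a b - F W a b| <= B W a b c e) ->
  `|LL d * E (fun W => dot (F W) W) + E (fun W => dot (F W) (YY d W))|
  <= E (fun W => \sum_a \sum_b \sum_c \sum_e B W a b c e)
   + (M * N * E (fun W => \sum_a \sum_b hm d a b * `|F W a b|) + 3 * XX d * E (fun W => \sum_a \sum_b `|F W a b|)).
Proof.
move=> B0 hB; have h1 := loop_estimate H F; have h2 := switch_diff_le H (F := fun W => F W) B0 hB.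
apply: le_trans (lerD h2 h1).
rewrite -[X in `|X| <= _](subrK (E (fun W => \sum_a \sum_b \sum_c \sum_e (F (W + Dl R a c b e) a b - F W a b) * wk d W a b c e))).
by rewrite addrC; apply: ler_normD.
Qed.

Lemma sum4_const c : \sum_(a < m) \sum_(b < n) \sum_(a' < m) \sum_(b' < n) c = (M * N) ^+ 2 * c :> R.
Proof. by rewrite !sum_constM !card_ord /mr /nr; ring. Qed.

Lemma MN_le : M * N <= v ^+ 4.
Proof. by rewrite (_ : v ^+ 4 = v ^+ 2 * v ^+ 2); [rewrite ler_pM ?M_ge0 ?N_ge0 ?(okm H) ?(okn H)|ring]. Qed.
Lemma MN_ge0 : 0 <= M * N. Proof. by rewrite mulr_ge0 ?M_ge0 ?N_ge0. Qed.

Lemma MN2_le : (M * N) ^+ 2 <= v ^+ 8.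
Proof. by rewrite (_ : v ^+ 8 = (v ^+ 4) ^+ 2); [rewrite ler_sqr ?nnegrE ?MN_ge0 ?exprn_ge0 ?(v_ge0 H) ?MN_le|ring]. Qed.

Lemma nF_bnd (A : 'M[R]_(m, n)) c : mbnd A c -> nF A <= M * N * c ^+ 2.
Proof.
move=> h; rewrite nFE; apply: le_trans (_ : \sum_(i < m) \sum_(j < n) c ^+ 2 <= _).
  by apply: ler_sum => i _; apply: ler_sum => j _; apply: sqr_le_norm.
by rewrite !sum_constM !card_ord mulrA.
Qed.

Lemma nFW_le W : good d W -> nF W <= v ^+ 4.
Proof.
move=> /(Wle1 H)/nF_bnd; rewrite expr1n mulr1 => h; apply: le_trans h MN_le.
Qed.

Lemma nF_ga_det W : good d W -> nF (ga d W) <= K ^+ 2 * v ^+ 4.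
Proof.
move=> gW; apply: le_trans (nF_mul _ _) _; rewrite nF_tr mulrC.
by apply: ler_pM; rewrite ?nF_ge0 ?nFW_le //; apply: na_le.
Qed.
Lemma nF_gb_det W : good d W -> nF (gb d W) <= K ^+ 2 * v ^+ 4.
Proof.
move=> gW; apply: le_trans (nF_mul _ _) _; rewrite mulrC.
by apply: ler_pM; rewrite ?nF_ge0 ?nFW_le //; apply: nb_le.
Qed.
Lemma nF_Mv_det W : good d W -> nF (Mv W) <= v ^+ 8.
Proof.
move=> gW; apply: le_trans (nF_mul _ _) _; rewrite nF_tr (_ : v ^+ 8 = v ^+ 4 * v ^+ 4); last by ring.
by apply: ler_pM; rewrite ?nF_ge0 ?nFW_le.
Qed.
Lemma nF_ma W : nF (ma d W) <= K ^+ 2 * nF (Mv W).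
Proof.
rewrite /ma /ga mulmxA -/(Mu W) mulrC; apply: le_trans (nF_mul _ _) _.
by rewrite nF_Mu ler_wpM2l ?nF_ge0 //; apply: na_le.
Qed.
Lemma nF_mb W : nF (mb d W) <= K ^+ 2 * nF (Mv W).
Proof.
rewrite /mb /gb mulmxA -/(Mv W) mulrC; apply: le_trans (nF_mul _ _) _.
by rewrite ler_wpM2l ?nF_ge0 //; apply: nb_le.
Qed.
Lemma om_sqr W : om d W ^+ 2 <= K ^+ 2 * nF (gb d W).
Proof.
have -> : om d W = dot (al d) (gb d W) by apply: eq_bigr => a _; rewrite big_ord1.
by apply: le_trans (cs_dot _ _) _; rewrite ler_wpM2r ?nF_ge0 //; apply: na_le.
Qed.

Lemma sqr_sum6_le (x1 x2 x3 x4 x5 x6 : R) :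
  (x1 + x2 + x3 + x4 + x5 + x6) ^+ 2 <= 8 * (x1 ^+ 2 + x2 ^+ 2 + x3 ^+ 2 + x4 ^+ 2 + x5 ^+ 2 + x6 ^+ 2).
Proof.
have h1 := sqrD_le (x1 + x2 + x3 + x4 + x5) x6; have h2 := sqrD_le (x1 + x2 + x3 + x4) x5.
have a := sqr_ge0 (x1 - x2); have b := sqr_ge0 (x1 - x3); have c := sqr_ge0 (x1 - x4).
have d1 := sqr_ge0 (x1 - x5); have e := sqr_ge0 (x1 - x6); have f := sqr_ge0 (x2 - x3).
have a1 := sqr_ge0 (x2 - x4); have b1 := sqr_ge0 (x2 - x5); have c1 := sqr_ge0 (x2 - x6).
have a2 := sqr_ge0 (x3 - x4); have b2 := sqr_ge0 (x3 - x5); have c2 := sqr_ge0 (x3 - x6).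
have a3 := sqr_ge0 (x4 - x5); have b3 := sqr_ge0 (x4 - x6); have c3 := sqr_ge0 (x5 - x6).
have s1 := sqr_ge0 x1; have s2 := sqr_ge0 x2; have s3 := sqr_ge0 x3; have s4 := sqr_ge0 x4; have s5 := sqr_ge0 x5; have s6 := sqr_ge0 x6.
lra.
Qed.

Definition IIm W : 'M[R]_(m, n) := \matrix_(a, b) II d W a b.

Lemma YYE W : YY d W = VV W + IIm W.
Proof. by apply/matrixP => a b; rewrite !mxE; congr (_ + _); rewrite mxE. Qed.

Lemma dens01 : 0 < dens d < 1.
Proof. by rewrite (dens_gt0 H) (dens_lt1 H). Qed.

Lemma II_le W a b : good d W ->
  II d W a b ^+ 2 <= 8 * ((7 * K ^+ 2 * v ^+ 2) ^+ 2 + (2 * v ^+ 2 * ga d W b 0) ^+ 2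
    + (2 * v ^+ 2 * gb d W a 0) ^+ 2 + om d W ^+ 2 + ma d W a 0 ^+ 2 + mb d W b 0 ^+ 2).
Proof.
move=> gW; have w1 := Wle1 H gW a b; have ha := al_le1 H a; have hb := be_le1 H b.
have /andP[l0 l1] := dens01.
have ka : `|al d a 0| <= K / v := al_le H a. have kb : `|be d b 0| <= K / v := be_le H b.
have v0 := v_gt0 H; have K0 := K_ge0 H.
set A := M * N * al d a 0 * be d b 0 * (W a b + (2 * dens d - 1 + al d a 0 + be d b 0))
  - N * (be d b 0 + W a b) * na d - M * (al d a 0 + W a b) * nb d.
set B := - (N * (be d b 0 + W a b)) * ga d W b 0; set C := - (M * (al d a 0 + W a b)) * gb d W a 0.
have -> : II d W a b = A + B + C + om d W + ma d W a 0 + mb d W b 0 by rewrite /II /A /B /C; ring.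
apply: le_trans (sqr_sum6_le _ _ _ _ _ _) _; apply: ler_wpM2l => //.
have nb2 : `|be d b 0 + W a b| <= 2 by apply: le_trans (normrD_le hb w1) _; lra.
have na2 : `|al d a 0 + W a b| <= 2 by apply: le_trans (normrD_le ha w1) _; lra.
have hN : `|N| <= v ^+ 2 by rewrite ger0_norm ?N_ge0 ?(okn H).
have hM : `|M| <= v ^+ 2 by rewrite ger0_norm ?M_ge0 ?(okm H).
have hna : `|na d| <= K ^+ 2 by rewrite ger0_norm ?na_ge0 //; apply: na_le.
have hnb : `|nb d| <= K ^+ 2 by rewrite ger0_norm ?nb_ge0 //; apply: nb_le.
have hA : `|A| <= 7 * K ^+ 2 * v ^+ 2.
  have t1 : `|M * N * al d a 0 * be d b 0 * (W a b + (2 * dens d - 1 + al d a 0 + be d b 0))|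
     <= v ^+ 2 * v ^+ 2 * (K / v) * (K / v) * 3.
    apply: normrM_le; first by do 3 (apply: normrM_le => //).
    apply: le_trans (normrD_le w1 (_ : _ <= 2)) _; last by lra.
    move: ha hb; rewrite !ler_norml => /andP[? ?] /andP[? ?]; lra.
  have t2 : `|N * (be d b 0 + W a b) * na d| <= v ^+ 2 * 2 * K ^+ 2 by do 2 (apply: normrM_le => //).
  have t3 : `|M * (al d a 0 + W a b) * nb d| <= v ^+ 2 * 2 * K ^+ 2 by do 2 (apply: normrM_le => //).
  apply: le_trans (normrB_le (normrB_le t1 t2) t3) _.
  by rewrite le_eqVlt; apply/orP; left; apply/eqP; field; rewrite gt_eqF.
have sq (k x z : R) : `|k| <= z -> (k * x) ^+ 2 <= (z * x) ^+ 2.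
  by move=> h; rewrite !exprMn ler_wpM2r ?sqr_ge0 //; apply: sqr_le_norm.
have hB : B ^+ 2 <= (2 * v ^+ 2 * ga d W b 0) ^+ 2.
  by apply: sq; rewrite normrN (mulrC N); apply: normrM_le.
have hC : C ^+ 2 <= (2 * v ^+ 2 * gb d W a 0) ^+ 2.
  by apply: sq; rewrite normrN (mulrC M); apply: normrM_le.
have := sqr_le_norm hA; lra.
Qed.

(** Each deviation is at most [K / v], so the term with [al], [be] and the factor m n has order
    [v ^+ 2], like the terms with [na] and [nb]; summed over all pairs this gives the leading
    [v ^+ 8]. *)
Lemma II_nF W : good d W ->
  nF (IIm W) <= K ^+ 6 * (v ^+ 8 + v ^+ 6 * (nF (ga d W) + nF (gb d W)) + v ^+ 2 * nF (Mv W)).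
Proof.
move=> gW; rewrite nFE.
apply: (@le_trans _ _ (\sum_a \sum_b 8 * ((7 * K ^+ 2 * v ^+ 2) ^+ 2 + (2 * v ^+ 2 * ga d W b 0) ^+ 2
    + (2 * v ^+ 2 * gb d W a 0) ^+ 2 + om d W ^+ 2 + ma d W a 0 ^+ 2 + mb d W b 0 ^+ 2))).
  by apply: ler_sum => a _; apply: ler_sum => b _; rewrite mxE; apply: II_le.
have -> : \sum_a \sum_b 8 * ((7 * K ^+ 2 * v ^+ 2) ^+ 2 + (2 * v ^+ 2 * ga d W b 0) ^+ 2
    + (2 * v ^+ 2 * gb d W a 0) ^+ 2 + om d W ^+ 2 + ma d W a 0 ^+ 2 + mb d W b 0 ^+ 2)
  = 8 * (M * N * (49 * K ^+ 4 * v ^+ 4) + 4 * v ^+ 4 * M * nF (ga d W) + 4 * v ^+ 4 * N * nF (gb d W)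
     + M * N * om d W ^+ 2 + N * nF (ma d W) + M * nF (mb d W)).
  under eq_bigr do rewrite -mulr_sumr; rewrite -mulr_sumr; congr (8 * _).
  under eq_bigr => a _ do rewrite !big_split /= !sum_constM !card_ord -!/(nr R n).
  rewrite !big_split /= !sum_constM !card_ord -!/(mr R m).
  rewrite !nF_cv -!mulr_sumr.
  have -> (u : 'I_n -> R) : \sum_i (2 * v ^+ 2 * u i) ^+ 2 = 4 * v ^+ 4 * \sum_i u i ^+ 2.
    by rewrite mulr_sumr; apply: eq_bigr => i _; ring.
  have -> (u : 'I_m -> R) : \sum_i (2 * v ^+ 2 * u i) ^+ 2 = 4 * v ^+ 4 * \sum_i u i ^+ 2.
    by rewrite mulr_sumr; apply: eq_bigr => i _; ring.
  ring.
have g1 := nF_ge0 (ga d W); have g2 := nF_ge0 (gb d W); have g3 := nF_ge0 (Mv W).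
have v0 := v_ge0 H; have K0 := K_ge0 H; have K1 := okK H.
have t1 : M * N * (49 * K ^+ 4 * v ^+ 4) <= 49 * K ^+ 4 * v ^+ 8.
  rewrite (_ : 49 * K ^+ 4 * v ^+ 8 = v ^+ 4 * (49 * K ^+ 4 * v ^+ 4)); last by ring.
  by apply: ler_wpM2r; rewrite ?MN_le // !mulr_ge0 ?exprn_ge0.
have t2 : 4 * v ^+ 4 * M * nF (ga d W) <= 4 * v ^+ 6 * nF (ga d W).
  apply: ler_wpM2r => //; rewrite (_ : 4 * v ^+ 6 = 4 * v ^+ 4 * v ^+ 2); last by ring.
  by rewrite ler_wpM2l ?(okm H) // mulr_ge0 ?exprn_ge0.
have t3 : 4 * v ^+ 4 * N * nF (gb d W) <= 4 * v ^+ 6 * nF (gb d W).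
  apply: ler_wpM2r => //; rewrite (_ : 4 * v ^+ 6 = 4 * v ^+ 4 * v ^+ 2); last by ring.
  by rewrite ler_wpM2l ?(okn H) // mulr_ge0 ?exprn_ge0.
have t4 : M * N * om d W ^+ 2 <= v ^+ 4 * (K ^+ 2 * nF (gb d W)).
  by apply: ler_pM; rewrite ?MN_ge0 ?sqr_ge0 ?om_sqr ?MN_le.
have t5 : N * nF (ma d W) <= v ^+ 2 * (K ^+ 2 * nF (Mv W)).
  by apply: ler_pM; rewrite ?N_ge0 ?nF_ge0 ?nF_ma ?(okn H).
have t6 : M * nF (mb d W) <= v ^+ 2 * (K ^+ 2 * nF (Mv W)).
  by apply: ler_pM; rewrite ?M_ge0 ?nF_ge0 ?nF_mb ?(okm H).
apply: le_trans (_ : 8 * (49 * K ^+ 4 * v ^+ 8 + 4 * v ^+ 6 * nF (ga d W) + 4 * v ^+ 6 * nF (gb d W)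
  + v ^+ 4 * (K ^+ 2 * nF (gb d W)) + v ^+ 2 * (K ^+ 2 * nF (Mv W)) + v ^+ 2 * (K ^+ 2 * nF (Mv W))) <= _).
  lra.
have k46 : 10000 * K ^+ 4 <= K ^+ 6.
  rewrite (_ : K ^+ 6 = K ^+ 2 * K ^+ 4); last by ring.
  by rewrite ler_wpM2r ?exprn_ge0 //; nra.
have k26 : 100 * K ^+ 2 <= K ^+ 6.
  apply: le_trans k46; have k24 : K ^+ 2 <= K ^+ 4 by rewrite ler_weXn2l // (K_ge1 H).
  have := exprn_ge0 2 K0; lra.
have k06 : 100 <= K ^+ 6.
  apply: le_trans k26; have := exprn_ege1 2 (K_ge1 H); clear; lra.
have v46 : v ^+ 4 <= v ^+ 6 by rewrite ler_weXn2l // (v_ge1 H).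
have v6 := exprn_ge0 6 v0; have v8 := exprn_ge0 8 v0; have v2 := exprn_ge0 2 v0.
have u1 : 392 * K ^+ 4 * v ^+ 8 <= K ^+ 6 * v ^+ 8.
  by apply: ler_wpM2r => //; have := exprn_ge0 4 K0; move: k46; clear; lra.
have u2 : 32 * v ^+ 6 * nF (ga d W) <= K ^+ 6 * v ^+ 6 * nF (ga d W).
  by apply: ler_wpM2r => //; apply: ler_wpM2r => //; move: k06; clear; lra.
have u3 : (32 * v ^+ 6 + 8 * K ^+ 2 * v ^+ 4) * nF (gb d W) <= K ^+ 6 * v ^+ 6 * nF (gb d W).
  apply: ler_wpM2r => //.
  apply: (@le_trans _ _ ((32 + 8 * K ^+ 2) * v ^+ 6)).
    have : 8 * K ^+ 2 * v ^+ 4 <= 8 * K ^+ 2 * v ^+ 6 by rewrite ler_wpM2l // mulr_ge0 ?exprn_ge0.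
    clear; lra.
  by apply: ler_wpM2r => //; have := exprn_ege1 2 (K_ge1 H); move: k26; clear; lra.
have u4 : 16 * K ^+ 2 * (v ^+ 2 * nF (Mv W)) <= K ^+ 6 * (v ^+ 2 * nF (Mv W)).
  by apply: ler_wpM2r; [rewrite mulr_ge0|have := exprn_ge0 2 K0; move: k26; clear; lra].
move: u1 u2 u3 u4; clear; lra.
Qed.
End Moments.

Section Moments.
Variables (R : realFieldType) (m n : nat) (d : ensemble R m n) (H : ok d).
Implicit Types (W : 'M[R]_(m, n)).
Local Notation E := (Ex d).
Local Notation K := (KK d).
Local Notation v := (nu d).
Local Notation M := (mr R m).
Local Notation N := (nr R n).

Lemma mxBE p q (A B : 'M[R]_(p, q)) i j : (A - B) i j = A i j - B i j.
Proof. by rewrite mxE [X in _ + X]mxE. Qed.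

Lemma h_sqr a b : hm d a b ^+ 2 = hm d a b.
Proof. by case: (okh H a b) => ->; rewrite ?expr0n ?expr1n. Qed.

Lemma mbnd_W W : good d W -> mbnd W 1. Proof. exact: Wle1. Qed.
Lemma mbnd_Wt W : good d W -> mbnd W^T 1. Proof. by move=> h; apply: mbnd_tr; apply: mbnd_W. Qed.

Lemma mbnd_mulM p q (A : 'M[R]_(p, m)) (B : 'M[R]_(m, q)) c e :
  0 <= c -> 0 <= e -> mbnd A c -> mbnd B e -> mbnd (A *m B) (v ^+ 2 * (c * e)).
Proof.
move=> c0 e0 hA hB; apply: mbnd_le (mbnd_mul hA hB) _.
by apply: ler_wpM2r; rewrite ?mulr_ge0 // (okm H).
Qed.
Lemma mbnd_mulN p q (A : 'M[R]_(p, n)) (B : 'M[R]_(n, q)) c e :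
  0 <= c -> 0 <= e -> mbnd A c -> mbnd B e -> mbnd (A *m B) (v ^+ 2 * (c * e)).
Proof.
move=> c0 e0 hA hB; apply: mbnd_le (mbnd_mul hA hB) _.
by apply: ler_wpM2r; rewrite ?mulr_ge0 // (okn H).
Qed.

Lemma mbnd_Mv W W' : good d W -> good d W' -> mbnd (W^T *m W') (v ^+ 2).
Proof. by move=> h h'; apply: mbnd_le (mbnd_mulM _ _ (mbnd_Wt h) (mbnd_W h')) _; rewrite ?mulr1. Qed.
Lemma mbnd_Mu W W' : good d W -> good d W' -> mbnd (W *m W'^T) (v ^+ 2).
Proof. by move=> h h'; apply: mbnd_le (mbnd_mulN _ _ (mbnd_W h) (mbnd_Wt h')) _; rewrite ?mulr1. Qed.

(** The three factors of W W^T W are switched one after the other. *)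
Lemma VV_diff W a b c e : good d W -> good d (W + Dl R a c b e) ->
  mbnd (VV (W + Dl R a c b e) - VV W) (6 * v ^+ 2).
Proof.
set D := Dl R a c b e; set W' := W + D => gW gW'.
have -> : VV W' - VV W = D *m (W'^T *m W') + W *m (D^T *m W') + W *m W^T *m D.
  rewrite /VV /Mv (_ : D = W' - W); last by rewrite /W' addrC addKr.
  rewrite linearB /= !(mulmxBl, mulmxBr, mulmxA).
  by rewrite !addrA !subrK.
have v2 : 0 <= v ^+ 2 by rewrite exprn_ge0 // (v_ge0 H).
have b1 : mbnd (D *m (W'^T *m W')) (2 * v ^+ 2) by apply: Dl_mull; apply: mbnd_Mv.
have b2 : mbnd (W *m (D^T *m W')) (2 * v ^+ 2).
  rewrite (_ : 2 * v ^+ 2 = v ^+ 2 * (1 * (2 * 1))); last by ring.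
  have z : 0 <= 2 * 1 :> R by lra.
  by apply: (mbnd_mulN ler01 z (mbnd_W gW)); rewrite Dl_tr; apply: Dl_mull; apply: mbnd_W.
have b3 : mbnd (W *m W^T *m D) (2 * v ^+ 2) by apply: Dl_mulr; apply: mbnd_Mu.
by apply: mbnd_le (mbndD (mbndD b1 b2) b3) _; lra.
Qed.

Lemma EnFM_ge0 : 0 <= E (fun W => nF (Mv W)).
Proof. by apply: (Ege0 H) => W _; apply: nF_ge0. Qed.

Lemma amgm4 (x y : R) : `|x * y| <= 4^-1 * x ^+ 2 + y ^+ 2.
Proof. by apply: le_trans (amgm x y (_ : 0 < 2^-1)) _ => //; lra. Qed.

(* F = V: the leading term <V,V> + LL <V,W> has a good sign, which bounds two moments at once. *)
Lemma E_gram_le : E (fun W => nF (Mv W)) <= K ^+ 13 * v ^+ 6 /\ E (fun W => nF (VV W)) <= K ^+ 11 * v ^+ 10.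
Proof.
have v0 := v_ge0 H; have K0 := K_ge0 H.
have L : LL d * E (fun W => dot (VV W) W) + E (fun W => dot (VV W) (YY d W)) <=
  E (fun W => \sum_(a < m) \sum_(b < n) \sum_(c < m) \sum_(e < n) 6 * v ^+ 2)
  + (M * N * E (fun W => \sum_a \sum_b hm d a b * `|VV W a b|) + 3 * XX d * E (fun W => \sum_a \sum_b `|VV W a b|)).
  apply: le_trans (ler_norm _) _; apply: (loop_bound H (F := @VV _ _ _) (B := fun _ _ _ _ _ => 6 * v ^+ 2)).
    by move=> *; rewrite mulr_ge0 ?exprn_ge0.
  by move=> W a b c e gW gW' _ _; have := VV_diff gW gW' a b; rewrite mxBE.
have e1 : E (fun W => dot (VV W) W) = E (fun W => nF (Mv W)) by apply: (eqE H) => W _; apply: dot_VV_W.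
have e2 : 3%:R / 4%:R * E (fun W => nF (VV W)) - K ^+ 9 * v ^+ 10 <= E (fun W => dot (VV W) (YY d W)).
  rewrite -(EZ H) -[X in _ - X <= _](Ec H) -(EB H); apply: (Ele H) => W gW.
  rewrite YYE dotDr -/(nF (VV W)).
  have h1 : `|dot (VV W) (IIm d W)| <= 4^-1 * nF (VV W) + nF (IIm d W).
    by apply: le_trans (dot_amgm (VV W) (IIm d W) (_ : 0 < 2^-1)) _ => //; have := nF_ge0 (IIm d W); lra.
  (* At this stage only the trivial bounds on [ga], [gb] and [Mv] are at hand. They cost two powers
     of [v], which [E_nF_VV_le] recovers for V. *)
  have h2 : nF (IIm d W) <= K ^+ 9 * v ^+ 10.
    apply: le_trans (II_nF H gW) _.
    apply: (@le_trans _ _ (K ^+ 6 * (v ^+ 8 + v ^+ 6 * (K ^+ 2 * v ^+ 4 + K ^+ 2 * v ^+ 4) + v ^+ 2 * v ^+ 8))).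
      apply: ler_wpM2l; first by rewrite exprn_ge0.
      apply: lerD; first apply: lerD => //.
        by apply: ler_wpM2l; rewrite ?exprn_ge0 // lerD ?(nF_ga_det H) ?(nF_gb_det H).
      by apply: ler_wpM2l; rewrite ?exprn_ge0 // (nF_Mv_det H).
    have a1 := Kv_le H (_ : 10 <= 100) (_ : (6 < 9)%N) (_ : (8 <= 10)%N).
    have a2 := Kv_le H (_ : 10 <= 100) (_ : (8 < 9)%N) (_ : (10 <= 10)%N).
    have a3 := Kv_le H (_ : 10 <= 100) (_ : (6 < 9)%N) (_ : (10 <= 10)%N).
    have {}a1 := a1 _ isT isT; have {}a2 := a2 _ isT isT; have {}a3 := a3 _ isT isT.
    have c : (10 <= 100 :> R) by lra.
    move: (a1 c) (a2 c) (a3 c); have := Kv_ge0 H 9 10; lra.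
  by move: h1; rewrite ler_norml => /andP[h3 _]; lra.
have e3 : E (fun W => \sum_(a < m) \sum_(b < n) \sum_(c < m) \sum_(e < n) 6 * v ^+ 2) <= 6 * v ^+ 10.
  apply: (Ele_c H) => W _; rewrite sum4_const (_ : 6 * v ^+ 10 = v ^+ 8 * (6 * v ^+ 2)); last by ring.
  by apply: ler_wpM2r; rewrite ?(MN2_le H) // mulr_ge0 ?exprn_ge0.
have e4 : M * N * E (fun W => \sum_a \sum_b hm d a b * `|VV W a b|) <= 4^-1 * E (fun W => nF (VV W)) + K * v ^+ 10.
  rewrite -!(EZ H) -[X in _ <= _ + X](Ec H) -(ED H); apply: (Ele H) => W gW.
  apply: (@le_trans _ _ (4^-1 * nF (VV W) + (M * N) ^+ 2 * XX d)).
    rewrite -(sumh H) nFE !mulr_sumr -big_split /=; apply: ler_sum => a _.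
    rewrite !mulr_sumr -big_split /=; apply: ler_sum => b _.
    have := amgm4 (VV W a b) (M * N * hm d a b).
    rewrite [X in _ <= _ + X]exprMn h_sqr normrM (ger0_norm (_ : 0 <= M * N * hm d a b)) ?mulr_ge0 ?M_ge0 ?N_ge0 ?(h_ge0 H) //.
    by move=> h; apply: le_trans h; rewrite le_eqVlt; apply/orP; left; apply/eqP; ring.
  rewrite lerD2l (_ : K * v ^+ 10 = v ^+ 8 * (K * v ^+ 2)); last by ring.
  by apply: ler_pM; rewrite ?sqr_ge0 ?(XX_ge0 H) ?(MN2_le H) ?(XX_le H).
have e5 : 3 * XX d * E (fun W => \sum_a \sum_b `|VV W a b|) <= 4^-1 * E (fun W => nF (VV W)) + 9 * K ^+ 2 * v ^+ 8.
  rewrite -!(EZ H) -[X in _ <= _ + X](Ec H) -(ED H); apply: (Ele H) => W gW.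
  apply: (@le_trans _ _ (4^-1 * nF (VV W) + M * N * (3 * XX d) ^+ 2)).
    rewrite (_ : M * N * (3 * XX d) ^+ 2 = \sum_(a < m) \sum_(b < n) (3 * XX d) ^+ 2); last first.
      by rewrite !sum_constM !card_ord /mr /nr; ring.
    rewrite nFE !mulr_sumr -big_split /=; apply: ler_sum => a _.
    rewrite !mulr_sumr -big_split /=; apply: ler_sum => b _.
    have := amgm4 (VV W a b) (3 * XX d).
    have x3 : 0 <= 3 * XX d by have := XX_ge0 H; lra.
    by rewrite normrM (ger0_norm x3) (mulrC (`|_|)).
  rewrite lerD2l (_ : 9 * K ^+ 2 * v ^+ 8 = v ^+ 4 * (3 * (K * v ^+ 2)) ^+ 2); last by ring.
  apply: ler_pM; rewrite ?sqr_ge0 ?(MN_ge0) ?(MN_le H) //.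
  have x0 := XX_ge0 H; have x1 := XX_le H; have kv : 0 <= K * v ^+ 2 by rewrite mulr_ge0 ?exprn_ge0.
  by rewrite ler_sqr ?nnegrE; lra.
have V0 : 0 <= E (fun W => nF (VV W)) by apply: (Ege0 H) => W _; apply: nF_ge0.
(* A quarter of the norm of V was spent in each of [e2], [e4] and [e5]; the last quarter remains on
   the left. *)
have tot : LL d * E (fun W => nF (Mv W)) + 4^-1 * E (fun W => nF (VV W)) <= 4^-1 * (K ^+ 10 * v ^+ 10).
  have c : (10 <= 100 :> R) by lra. have c' : (100 <= 100 :> R) by lra.
  have a1 := Kv_le H c' (isT : (9 < 10)%N) (isT : (10 <= 10)%N).
  have a2 := Kv_le H c' (isT : (0 < 10)%N) (isT : (10 <= 10)%N).
  have a3 := Kv_le H c' (isT : (1 < 10)%N) (isT : (10 <= 10)%N).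
  have a4 := Kv_le H c' (isT : (2 < 10)%N) (isT : (8 <= 10)%N).
  rewrite e1 in L; move: a2 a3; rewrite expr0 expr1 => a2 a3; have kk := Kv_ge0 H 10 10.
  lra.
split.
  apply: (LL_div H (i := 10) EnFM_ge0); have := Kv_ge0 H 10 10; lra.
have := mulr_ge0 (ltW (LL_gt0 H)) EnFM_ge0.
have c : (1 <= 100 :> R) by lra.
have := Kv_le H c (isT : (10 < 11)%N) (isT : (10 <= 10)%N); lra.
Qed.

End Moments.

Ltac nneg := repeat (first [done | assumption | apply: nF_ge0 | apply: normr_ge0 | apply: ler0n | apply: sqr_ge0 | apply: divr_ge0 | apply: mulr_ge0 | apply: addr_ge0 | apply: exprn_ge0 ]).

(** * Second moments of W^T al and W be *)

Section LinearStatistics.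
Variables (R : realFieldType) (m n : nat) (d : ensemble R m n) (H : ok d).
Implicit Types (W : 'M[R]_(m, n)).
Local Notation E := (Ex d).
Local Notation K := (KK d).
Local Notation v := (nu d).
Local Notation M := (mr R m).
Local Notation N := (nr R n).

Lemma EnF_ge0 k l (F : 'M[R]_(m, n) -> 'M[R]_(k, l)) : 0 <= E (fun W => nF (F W)).
Proof. by apply: (Ege0 H) => W _; apply: nF_ge0. Qed.

(** [LL] is at least [v ^+ 4 / K ^+ 3], so it swallows any term with at most three powers of [v] and
    few enough of [K]. *)
Lemma LL_absorb i p : (i <= 90)%N -> (p <= 3)%N -> 1000 * (K ^+ i * v ^+ p) <= LL d.
Proof.
move=> hi hp.
have k3 : 0 < K ^+ 3 by rewrite exprn_gt0 // (K_gt0 H).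
rewrite -(ler_pM2l k3); apply: le_trans (LL_ge H).
apply: le_trans (_ : K ^+ 95 * v ^+ 3 <= _); last exact: K_le_v.
have c : 100 <= 100 :> R by rewrite ler_nat.
have := Kv_le H c (_ : (i.+3 < i.+4)%N) hp; rewrite ltnSn => /(_ isT) h1.
have := Kv_le H c (_ : (i.+4 < i.+4.+1)%N) (leqnn 3); rewrite ltnSn => /(_ isT) h2.
have h3 := Kv_le1 H (_ : (i.+4.+1 <= 95)%N) (leqnn 3).
apply: le_trans (h3 _); last by lia.
apply: le_trans (_ : 10 * (100 * (K ^+ i.+3 * v ^+ p)) <= _).
  by rewrite le_eqVlt; apply/orP; left; apply/eqP; rewrite !exprS; ring.
have := Kv_ge0 H i.+4 3; lra.
Qed.

(** This is al al^T W: paired with W it gives the squared norm of [ga], paired with V that of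
    [ma]. *)
Definition gaF W : 'M[R]_(m, n) := al d *m (ga d W)^T.

Lemma ga_tr W : (ga d W)^T = (al d)^T *m W.
Proof. by rewrite /ga trmx_mul trmxK. Qed.
Lemma gaF_W W : dot (gaF W) W = nF (ga d W).
Proof. by rewrite /gaF dot_mulr -ga_tr dot_tr. Qed.
Lemma gaF_V W : dot (gaF W) (VV W) = nF (ma d W).
Proof.
by rewrite /gaF dot_mulr /VV mulmxA -ga_tr /Mv mulmxA dotC dot_mull -[RHS]nF_tr /ma (trmx_mul W).
Qed.

Lemma gaE W b : ga d W b 0 = \sum_a W a b * al d a 0.
Proof. by rewrite mxE; apply: eq_bigr => a _; rewrite mxE. Qed.

Lemma gaFE W a b : gaF W a b = al d a 0 * ga d W b 0.
Proof. by rewrite mxE big_ord1 mxE. Qed.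

Lemma gaF_diff W a b c e : a != c -> b != e ->
  `|gaF (W + Dl R a c b e) a b - gaF W a b| <= 2 * (K / v) ^+ 2.
Proof.
move=> ac be0; rewrite !gaFE -mulrBr.
have -> : ga d (W + Dl R a c b e) b 0 - ga d W b 0 = al d a 0 - al d c 0.
  rewrite /ga linearD /= mulmxDl Dl_tr [X in X - _]mxE addrAC subrr add0r Dl_mullE pairv_a // mul1r //.
rewrite (_ : 2 * (K / v) ^+ 2 = (K / v) * (2 * (K / v))); last by ring.
by apply: normrM_le; [apply: al_le | apply: diff_le; apply: al_le].
Qed.

Lemma sum_norm_ga W : \sum_b `|ga d W b 0| <= (nF (ga d W) + v ^+ 2) / 2.
Proof.
apply: (@le_trans _ _ (\sum_b (ga d W b 0 ^+ 2 / 2 + 2^-1))).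
  apply: ler_sum => b _; rewrite -(real_normK (num_real (ga d W b 0))).
  by have := sqr_ge0 (`|ga d W b 0| - 1); lra.
rewrite big_split /= -mulr_suml -nF_cv sum_constM card_ord.
have := okn H; rewrite /nr; lra.
Qed.

(** The inequality is left unsolved: the bound on [II] brings in [gb] as well, so the system closes
    only after the transposed inequality is added, in [E_nF_ga_gb_le]. *)
Lemma E_nF_ga_half : LL d * E (fun W => nF (ga d W)) <=
  K ^+ 40 * v ^+ 6 + 3 * (K ^+ 14 * v ^+ 2) * (E (fun W => nF (ga d W)) + E (fun W => nF (gb d W)))
  + LL d / 2 * E (fun W => nF (ga d W)).
Proof.
have v0 := v_ge0 H; have v1 := v_gt0 H; have K0 := K_ge0 H; have K1 := K_gt0 H.
have L : LL d * E (fun W => dot (gaF W) W) + E (fun W => dot (gaF W) (YY d W)) <=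
  E (fun W => \sum_(a < m) \sum_(b < n) \sum_(c < m) \sum_(e < n) (2 * (K / v) ^+ 2))
  + (M * N * E (fun W => \sum_a \sum_b hm d a b * `|gaF W a b|) + 3 * XX d * E (fun W => \sum_a \sum_b `|gaF W a b|)).
  apply: le_trans (ler_norm _) _; apply: (loop_bound H (F := gaF) (B := fun _ _ _ _ _ => 2 * (K / v) ^+ 2)).
    by move=> *; rewrite mulr_ge0 ?sqr_ge0.
  by move=> W a b c e gW gW' ac be0; apply: gaF_diff.
set G := E (fun W => nF (ga d W)) in L *; set G' := E (fun W => nF (gb d W)).
have G0 : 0 <= G by apply: EnF_ge0. have G'0 : 0 <= G' by apply: EnF_ge0.
have e1 : E (fun W => dot (gaF W) W) = G by apply: (eqE H) => W _; apply: gaF_W.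
have LL0 := LL_gt0 H.
have EII : E (fun W => nF (IIm d W)) <= K ^+ 6 * (v ^+ 8 + v ^+ 6 * (G + G') + v ^+ 2 * (K ^+ 13 * v ^+ 6)).
  apply: le_trans (_ : E (fun W => K ^+ 6 * (v ^+ 8 + v ^+ 6 * (nF (ga d W) + nF (gb d W)) + v ^+ 2 * nF (Mv W))) <= _).
    by apply: (Ele H) => W gW; apply: II_nF.
  rewrite (EZ H) 2!(ED H) !(EZ H) (ED H) (Ec H) ler_wpM2l ?exprn_ge0 // lerD2l ler_wpM2l ?exprn_ge0 //.
  exact: (E_gram_le H).1.
have e2 : - (LL d / 4 * G) - 2 * K ^+ 2 / LL d * E (fun W => nF (IIm d W)) <= E (fun W => dot (gaF W) (YY d W)).
  rewrite -!(EZ H) -(EN H) -(EB H); apply: (Ele H) => W gW.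
  rewrite YYE dotDr gaF_V.
  (* Since the squared norm of [gaF] is at most [K ^+ 2] times that of [ga], this weight makes its
     share exactly a quarter of the leading term. *)
  have s0 : 0 < LL d / (2 * K ^+ 2) by rewrite divr_gt0 // mulr_gt0 // exprn_gt0.
  have := dot_amgm (gaF W) (IIm d W) s0.
  have nf : nF (gaF W) <= K ^+ 2 * nF (ga d W).
    by apply: le_trans (nF_mul _ _) _; rewrite nF_tr ler_wpM2r ?nF_ge0 //; apply: na_le.
  have := nF_ge0 (ma d W); rewrite ler_norml => m0 /andP[h _].
  have h2 : LL d / (2 * K ^+ 2) / 2 * nF (gaF W) <= LL d / 4 * nF (ga d W).
    rewrite (_ : LL d / 4 * nF (ga d W) = LL d / (2 * K ^+ 2) / 2 * (K ^+ 2 * nF (ga d W))); last by field; rewrite gt_eqF.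
    by rewrite ler_wpM2l // divr_ge0 // ltW.
  have h3 : nF (IIm d W) / (2 * (LL d / (2 * K ^+ 2))) = K ^+ 2 / LL d * nF (IIm d W).
    by field; rewrite !gt_eqF.
  have h4 : 0 <= K ^+ 2 / LL d * nF (IIm d W) by rewrite mulr_ge0 ?nF_ge0 // divr_ge0 ?exprn_ge0 // ltW.
  by rewrite h3 in h; lra.
have e2' : 2 * K ^+ 2 / LL d * E (fun W => nF (IIm d W)) <= K ^+ 30 * v ^+ 4 + 2 * (K ^+ 11 * v ^+ 2) * (G + G').
  apply: le_trans (_ : 2 * K ^+ 2 * (K ^+ 3 / v ^+ 4) * E (fun W => nF (IIm d W)) <= _).
    rewrite ler_wpM2r ?EnF_ge0 //; apply: ler_wpM2l; first by rewrite mulr_ge0 ?exprn_ge0.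
    by rewrite -[X in X <= _]mul1r ler_pdivrMr // mulrAC ler_pdivlMr ?exprn_gt0 // mul1r; exact: LL_ge.
  apply: le_trans (ler_wpM2l _ EII) _; first by rewrite !mulr_ge0 ?invr_ge0 ?exprn_ge0.
  have -> : 2 * K ^+ 2 * (K ^+ 3 / v ^+ 4) * (K ^+ 6 * (v ^+ 8 + v ^+ 6 * (G + G') + v ^+ 2 * (K ^+ 13 * v ^+ 6)))
     = 2 * (K ^+ 11 * v ^+ 4) + 2 * (K ^+ 24 * v ^+ 4) + 2 * (K ^+ 11 * v ^+ 2) * (G + G') by field; rewrite gt_eqF.
  rewrite lerD2r; have c : 10 <= 100 :> R by rewrite ler_nat.
  have a1 := Kv_le H c (isT : (11 < 30)%N) (leqnn 4).
  have a2 := Kv_le H c (isT : (24 < 30)%N) (leqnn 4).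
  by have := Kv_ge0 H 30 4; lra.
have e3 : E (fun W => \sum_(a < m) \sum_(b < n) \sum_(c < m) \sum_(e < n) (2 * (K / v) ^+ 2)) <= 2 * (K ^+ 2 * v ^+ 6).
  apply: (Ele_c H) => W _; rewrite sum4_const (_ : 2 * (K ^+ 2 * v ^+ 6) = v ^+ 8 * (2 * (K / v) ^+ 2)); last by field; rewrite gt_eqF.
  by apply: ler_wpM2r; rewrite ?(MN2_le H) // mulr_ge0 ?sqr_ge0.
have e4 : M * N * E (fun W => \sum_a \sum_b hm d a b * `|gaF W a b|) <= K ^+ 2 * v ^+ 3 * (G + v ^+ 2).
  rewrite /G -[X in _ <= _ * (_ + X)](Ec H) -(ED H) -!(EZ H); apply: (Ele H) => W gW.
  have t : \sum_a \sum_b hm d a b * `|gaF W a b| <= K * (K / v) * ((nF (ga d W) + v ^+ 2) / 2).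
    apply: (@le_trans _ _ (\sum_a \sum_b hm d a b * (K / v * `|ga d W b 0|))).
      apply: ler_sum => a _; apply: ler_sum => b _; rewrite ler_wpM2l ?(h_ge0 H) // gaFE normrM ler_wpM2r //.
      exact: al_le.
    rewrite exchange_big /=; under eq_bigr do rewrite -mulr_suml (oky H).
    rewrite -mulr_sumr -mulrA; apply: ler_pM; rewrite ?(oky0 H) ?(okyK H) //.
      by rewrite sumr_ge0 // => b _; rewrite mulr_ge0 // divr_ge0.
    by rewrite -mulr_sumr ler_wpM2l ?divr_ge0 // sum_norm_ga.
  apply: le_trans (ler_wpM2l (MN_ge0 R m n) t) _.
  apply: le_trans (ler_wpM2r _ (MN_le H)) _.
    by nneg.
  have -> : v ^+ 4 * (K * (K / v) * ((nF (ga d W) + v ^+ 2) / 2)) = K ^+ 2 * v ^+ 3 * (nF (ga d W) + v ^+ 2) / 2 by field; rewrite gt_eqF.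
  by rewrite ler_pdivrMr // ler_peMr ?ler1n //; nneg.
have e5 : 3 * XX d * E (fun W => \sum_a \sum_b `|gaF W a b|) <= 3 * K ^+ 2 * v ^+ 3 * (G + v ^+ 2).
  rewrite /G -[X in _ <= _ * (_ + X)](Ec H) -(ED H) -!(EZ H); apply: (Ele H) => W gW.
  have t : \sum_a \sum_b `|gaF W a b| <= v ^+ 2 * ((K / v) * ((nF (ga d W) + v ^+ 2) / 2)).
    apply: (@le_trans _ _ (\sum_(a < m) ((K / v) * ((nF (ga d W) + v ^+ 2) / 2)))).
      apply: ler_sum => a _; apply: (@le_trans _ _ (\sum_b (K / v * `|ga d W b 0|))).
        by apply: ler_sum => b _; rewrite gaFE normrM ler_wpM2r // al_le.
      by rewrite -mulr_sumr ler_wpM2l ?divr_ge0 // sum_norm_ga.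
    rewrite sum_constM card_ord ler_wpM2r ?(okm H) //.
    by nneg.
  have x3 : 0 <= 3 * XX d by rewrite mulr_ge0 ?(XX_ge0 H).
  apply: le_trans (ler_wpM2l x3 t) _.
  apply: (@le_trans _ _ (3 * (K * v ^+ 2) * (v ^+ 2 * ((K / v) * ((nF (ga d W) + v ^+ 2) / 2))))).
    apply: ler_wpM2r; last by rewrite ler_wpM2l ?(XX_le H).
    by nneg.
  have -> : 3 * (K * v ^+ 2) * (v ^+ 2 * ((K / v) * ((nF (ga d W) + v ^+ 2) / 2))) = 3 * K ^+ 2 * v ^+ 3 * (nF (ga d W) + v ^+ 2) / 2 by field; rewrite gt_eqF.
  by rewrite ler_pdivrMr // ler_peMr ?ler1n //; nneg.
have ab : 16 * (K ^+ 2 * v ^+ 3) * G <= LL d * G.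
  by rewrite ler_wpM2r //; have := @LL_absorb 2 3 isT isT; have := Kv_ge0 H 2 3; lra.
have c : 100 <= 100 :> R by rewrite ler_nat.
have a1 := Kv_le H c (isT : (30 < 40)%N) (isT : (4 <= 6)%N).
have a2 := Kv_le H c (isT : (2 < 40)%N) (isT : (6 <= 6)%N).
have a3 := Kv_le H c (isT : (2 < 40)%N) (isT : (5 <= 6)%N).
have k1 : 2 * (K ^+ 11 * v ^+ 2) * (G + G') <= 3 * (K ^+ 14 * v ^+ 2) * (G + G').
  apply: ler_wpM2r; first exact: addr_ge0.
  by have := Kv_le1 H (isT : (11 <= 14)%N) (leqnn 2); have := Kv_ge0 H 14 2; lra.
have kk := Kv_ge0 H 40 6.
rewrite e1 in L; lra.
Qed.

End LinearStatistics.

(** * Sharp order of the second moment of the cubic term *)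

Section CubicMoment.
Variables (R : realFieldType) (m n : nat) (d : ensemble R m n) (H : ok d).
Implicit Types (W : 'M[R]_(m, n)).
Local Notation E := (Ex d).
Local Notation K := (KK d).
Local Notation v := (nu d).
Local Notation M := (mr R m).
Local Notation N := (nr R n).

Lemma E_nF_ga_gb_le : E (fun W => nF (ga d W)) + E (fun W => nF (gb d W)) <= K ^+ 44 * v ^+ 2.
Proof.
have h1 := E_nF_ga_half H; have := E_nF_ga_half (ok_tr H); rewrite !trdK_E /=.
rewrite (eqE H (_ : forall W, good d W -> nF (ga (trd d) W^T) = nF (gb d W))); last first.
  by move=> W _; rewrite /ga /= trmxK.
have -> : LL (trd d) = LL d by rewrite /LL /=; ring.
rewrite -/(Ex d (fun W => nF (gb (trd d) W^T))).
rewrite (eqE H (_ : forall W, good d W -> nF (gb (trd d) W^T) = nF (ga d W))) //.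
move: h1; have := EnF_ge0 H (ga d); have := EnF_ge0 H (gb d).
set G := E (fun W => nF (ga d W)); set G' := E (fun W => nF (gb d W)) => G'0 G0 h1 h2.
have a1 := ler_wpM2r (addr_ge0 G0 G'0) (LL_absorb H (isT : (14 <= 90)%N) (isT : (2 <= 3)%N)).
have ll := LL_gt0 H.
have t : LL d * (G + G') <= K ^+ 41 * v ^+ (2 + 4).
  have c : 100 <= 100 :> R by rewrite ler_nat.
  have := Kv_le H c (isT : (40 < 41)%N) (leqnn 6).
  have := Kv_ge0 H 40 6; have := mulr_ge0 (Kv_ge0 H 14 2) (addr_ge0 G0 G'0).
  rewrite (_ : (2 + 4)%N = 6%N) //; lra.
rewrite (_ : 44 = 41 + 3)%N //; exact: (LL_div H (addr_ge0 G0 G'0) t).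
Qed.

Lemma E_nF_II_le : E (fun W => nF (IIm d W)) <= K ^+ 52 * v ^+ 8.
Proof.
have v0 := v_ge0 H; have K0 := K_ge0 H.
apply: le_trans (_ : E (fun W => K ^+ 6 * (v ^+ 8 + v ^+ 6 * (nF (ga d W) + nF (gb d W)) + v ^+ 2 * nF (Mv W))) <= _).
  by apply: (Ele H) => W gW; apply: II_nF.
rewrite (EZ H) 2!(ED H) !(EZ H) (ED H) (Ec H).
apply: le_trans (_ : K ^+ 6 * (v ^+ 8 + v ^+ 6 * (K ^+ 44 * v ^+ 2) + v ^+ 2 * (K ^+ 13 * v ^+ 6)) <= _).
  apply: ler_wpM2l; first by nneg.
  apply: lerD; first by rewrite lerD2l; apply: ler_wpM2l; [nneg|exact: E_nF_ga_gb_le].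
  by apply: ler_wpM2l; [nneg|exact: (E_gram_le H).1].
have -> : K ^+ 6 * (v ^+ 8 + v ^+ 6 * (K ^+ 44 * v ^+ 2) + v ^+ 2 * (K ^+ 13 * v ^+ 6))
  = K ^+ 6 * v ^+ 8 + K ^+ 50 * v ^+ 8 + K ^+ 19 * v ^+ 8 by ring.
have c : 100 <= 100 :> R by rewrite ler_nat.
have := Kv_le H c (isT : (6 < 52)%N) (leqnn 8); have := Kv_le H c (isT : (50 < 52)%N) (leqnn 8).
have := Kv_le H c (isT : (19 < 52)%N) (leqnn 8); have := Kv_ge0 H 52 8; lra.
Qed.

Definition VMm W := VV W *m Mv W.

Lemma VMmE W : VMm W = W *m W^T *m W *m W^T *m W.
Proof. by rewrite /VMm /VV /Mv !mulmxA. Qed.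

Lemma mbnd_VV W : good d W -> mbnd (VV W) (v ^+ 4).
Proof.
move=> gW; have v2 : 0 <= v ^+ 2 by rewrite exprn_ge0 // (v_ge0 H).
apply: mbnd_le (mbnd_mulN H ler01 v2 (mbnd_W H gW) (mbnd_Mv H gW gW)) _.
by rewrite le_eqVlt; apply/orP; left; apply/eqP; ring.
Qed.

(** Bounds the increment of [VMm] by the matrix before the switch alone, so that expectations can be
    taken. The first-order part is kept through entries of squared Gram matrices; all the rest is
    trivially of order [v ^+ 4]. *)
Definition VMm_var W (a : 'I_m) (b : 'I_n) (c : 'I_m) (e : 'I_n) : R :=
  `|(Mv W *m Mv W) b b| + `|(Mv W *m Mv W) e b| + (`|(Mu W *m Mu W) a a| + `|(Mu W *m Mu W) a c|) + 36 * v ^+ 4.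

Lemma VMm_diff W a b c e : good d W -> good d (W + Dl R a c b e) -> a != c -> b != e ->
  `|VMm (W + Dl R a c b e) a b - VMm W a b| <= VMm_var W a b c e.
Proof.
set D := Dl R a c b e; set W' := W + D => gW gW' ac be0.
have v0 := v_ge0 H; have v1 := v_ge1 H.
have v2 : 0 <= v ^+ 2 by nneg. have v4 : 0 <= v ^+ 4 by nneg.
(* Telescoping the fivefold product leaves a last term in which every factor to the left of [D] is
   [W']. The final four products of [r] turn these factors back into [W]. *)
set r := W' *m D^T *m VV W + W' *m W'^T *m D *m Mv W + VV W' *m D^T *m W
   + (D *m (W^T *m W *m W^T)) *m D + (W' *m D^T *m (W *m W^T)) *m D + (W' *m W'^T *m D *m W^T) *m D + (VV W' *m D^T) *m D.
have tel : VMm W' - VMm W = D *m (Mv W *m Mv W) + (Mu W *m Mu W) *m D + r.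
  rewrite !VMmE /r /VV /Mv /Mu (_ : D = W' - W); last by rewrite /W' addrC addKr.
  have -> : (W' - W)^T = W'^T - W^T by rewrite linearB.
  rewrite !(mulmxBl, mulmxBr, mulmxA).
  move: (W^T) (W'^T) => T T'.
  move: (W *m T *m W *m T *m W) => x0.
  move: (W' *m T *m W *m T *m W) => x1.
  move: (W' *m T' *m W *m T *m W) => x2.
  move: (W' *m T' *m W' *m T *m W) => x3.
  move: (W' *m T' *m W' *m T' *m W) => x4.
  move: (W' *m T' *m W' *m T' *m W') => x5.
  move: (W *m T *m W *m T *m W') => y0.
  move: (W' *m T *m W *m T *m W') => y1.
  move: (W' *m T' *m W *m T *m W') => y2.
  move: (W' *m T' *m W' *m T *m W') => y3.
  by apply/matrixP => i j; rewrite !mxE; ring.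
have bT : mbnd (W^T *m W *m W^T) (v ^+ 4).
  by rewrite (_ : W^T *m W *m W^T = (VV W)^T); [apply: mbnd_tr; apply: mbnd_VV | rewrite VV_Mu trmx_mul Mu_tr /Mu mulmxA].
have bW := mbnd_W H gW; have bW' := mbnd_W H gW'; have bV := mbnd_VV gW; have bV' := mbnd_VV gW'.
have bMu := mbnd_Mu H gW gW; have bMu' := mbnd_Mu H gW' gW'; have bMv := mbnd_Mv H gW gW.
have br : mbnd r (36 * v ^+ 4).
  have h1 : mbnd (W' *m D^T *m VV W) (4 * (1 * v ^+ 4)) by rewrite Dl_tr; apply: Dl_mid.
  have h2 : mbnd (W' *m W'^T *m D *m Mv W) (4 * (v ^+ 2 * v ^+ 2)) by apply: Dl_mid.
  have h3 : mbnd (VV W' *m D^T *m W) (4 * (v ^+ 4 * 1)) by rewrite Dl_tr; apply: Dl_mid.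
  have h4 : mbnd ((D *m (W^T *m W *m W^T)) *m D) (2 * (2 * v ^+ 4)) by apply: Dl_mulr; apply: Dl_mull.
  have h5 : mbnd ((W' *m D^T *m (W *m W^T)) *m D) (2 * (4 * (1 * v ^+ 2))).
    by apply: Dl_mulr; rewrite Dl_tr; apply: Dl_mid.
  have h6 : mbnd ((W' *m W'^T *m D *m W^T) *m D) (2 * (4 * (v ^+ 2 * 1))).
    by apply: Dl_mulr; apply: Dl_mid => //; apply: mbnd_tr.
  have h7 : mbnd ((VV W' *m D^T) *m D) (2 * (2 * v ^+ 4)) by apply: Dl_mulr; rewrite Dl_tr; apply: Dl_mulr.
  apply: mbnd_le (mbndD (mbndD (mbndD (mbndD (mbndD (mbndD h1 h2) h3) h4) h5) h6) h7) _.
  have : v ^+ 2 <= v ^+ 4 by rewrite ler_weXn2l.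
  have -> : v ^+ 2 * v ^+ 2 = v ^+ 4 by ring.
  by lra.
rewrite -mxBE tel mxE; apply: normrD_le; last exact: br.
rewrite mxE Dl_mullE Dl_mulrE !pairv_a // mul1r mulr1.
by apply: normrD_le; apply: ler_normB.
Qed.

Lemma VMm_W W : dot (VMm W) W = nF (VV W).
Proof. by rewrite /VMm dot_mull Mv_tr. Qed.
Lemma VMm_V W : dot (VMm W) (VV W) = nF (Mv W *m Mv W).
Proof. by rewrite /VMm /VV -mulmxA dot_mulr mulmxA. Qed.
Lemma VMm_I W (I : 'M[R]_(m, n)) : dot (VMm W) I = dot (Mv W *m Mv W) (W^T *m I).
Proof. by rewrite /VMm /VV -mulmxA dot_mulr. Qed.

Lemma VMm_le W a b : `|VMm W a b| <= \sum_k (VV W a k ^+ 2 / (2 * v ^+ 2) + v ^+ 2 / 2 * Mv W k b ^+ 2).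
Proof.
rewrite mxE; apply: ler_norm_sumD => k; rewrite addrC mulrC.
by apply: amgm; rewrite exprn_gt0 // (v_gt0 H).
Qed.

Lemma Mu2C W a c : (Mu W *m Mu W) a c = (Mu W *m Mu W) c a.
Proof. by rewrite -[in LHS](trmxK (Mu W *m Mu W)) mxE trmx_mul Mu_tr. Qed.

Lemma diag_sq k (A : 'M[R]_k) : A^T = A -> \sum_b `|(A *m A) b b| = nF A.
Proof.
move=> sA; rewrite nFE; apply: eq_bigr => b _; rewrite mxE ger0_norm.
  by apply: eq_bigr => e _; rewrite -{2}sA mxE expr2.
by apply: sumr_ge0 => e _; rewrite -{2}sA mxE; apply: sqr_ge0.
Qed.

Lemma off_sq k (A : 'M[R]_k) c : 0 <= c -> \sum_b \sum_e c * `|A e b| <= 8^-1 * nF A + k%:R ^+ 2 * (2 * c ^+ 2).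
Proof.
move=> c0; rewrite nF_col mulr_sumr (_ : k%:R ^+ 2 * (2 * c ^+ 2) = \sum_(b < k) \sum_(e < k) 2 * c ^+ 2); last first.
  by rewrite !sum_constM !card_ord; ring.
rewrite -big_split /=; apply: ler_sum => b _; rewrite mulr_sumr -big_split /=; apply: ler_sum => e _.
have := sqr_ge0 (`|A e b| - 4 * c); rewrite -(real_normK (num_real (A e b))); lra.
Qed.

(** The diagonal entries of the squared Gram matrix sum to the squared norm of [Mv]. The other ones
    are split by an arithmetic-geometric mean, so that only a quarter of the squared norm of the
    square of [Mv] is used. *)
Lemma sum_VMm_var W : \sum_a \sum_b \sum_c \sum_e VMm_var W a b c e <=
  2 * v ^+ 6 * nF (Mv W) + 4^-1 * nF (Mv W *m Mv W) + 40 * v ^+ 12.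
Proof.
have v0 := v_ge0 H; have hM := okm H; have hN := okn H; have m0 := M_ge0 R m; have n0 := N_ge0 R n.
have -> : \sum_a \sum_b \sum_c \sum_e VMm_var W a b c e =
   M ^+ 2 * N * (\sum_b `|(Mv W *m Mv W) b b|) + \sum_b \sum_e M ^+ 2 * `|(Mv W *m Mv W) e b|
   + (N ^+ 2 * M * (\sum_b `|(Mu W *m Mu W) b b|) + \sum_b \sum_e N ^+ 2 * `|(Mu W *m Mu W) e b|)
   + (M * N) ^+ 2 * (36 * v ^+ 4).
  rewrite /VMm_var.
  have s (f1 f2 : 'I_m -> 'I_n -> 'I_m -> 'I_n -> R) :
    \sum_a \sum_b \sum_c \sum_e (f1 a b c e + f2 a b c e) =
    \sum_a \sum_b \sum_c \sum_e f1 a b c e + \sum_a \sum_b \sum_c \sum_e f2 a b c e.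
    by rewrite -big_split; apply: eq_bigr => ? _; rewrite -big_split; apply: eq_bigr => ? _;
       rewrite -big_split; apply: eq_bigr => ? _; rewrite -big_split; apply: eq_bigr => ? _.
  rewrite !s sum4_const; congr (_ + _ + (_ + _) + _).
  - rewrite sum_constM card_ord -/(mr R m) mulr_sumr mulr_sumr; apply: eq_bigr => b _.
    by rewrite !sum_constM !card_ord -/(mr R m) -/(nr R n); ring.
  - rewrite sum_constM card_ord -/(mr R m) mulr_sumr; apply: eq_bigr => b _.
    by rewrite sum_constM card_ord -/(mr R m) -mulr_sumr; ring.
  - rewrite mulr_sumr; apply: eq_bigr => a _.
    by rewrite !sum_constM !card_ord -/(mr R m) -/(nr R n); ring.
  - rewrite exchange_big /= -/(nr R n).
    rewrite sum_constM card_ord -/(nr R n) exchange_big mulr_sumr; apply: eq_bigr => a _ /=.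
    by rewrite mulr_sumr; apply: eq_bigr => c _; rewrite sum_constM card_ord -/(nr R n) (Mu2C W c a); ring.
rewrite !diag_sq ?Mv_tr ?Mu_tr // nF_Mu.
have o1 := off_sq (Mv W *m Mv W) (sqr_ge0 M); have o2 := off_sq (Mu W *m Mu W) (sqr_ge0 N).
rewrite nF_Mu2 -/(mr R m) -/(nr R n) in o2; rewrite -/(nr R n) in o1.
have g0 := nF_ge0 (Mv W).
have p1 : M ^+ 2 * N <= v ^+ 6.
  by rewrite (_ : v ^+ 6 = (v ^+ 2) ^+ 2 * v ^+ 2); [rewrite ler_pM ?sqr_ge0 ?ler_sqr ?nnegrE ?exprn_ge0|ring].
have p2 : N ^+ 2 * M <= v ^+ 6.
  by rewrite (_ : v ^+ 6 = (v ^+ 2) ^+ 2 * v ^+ 2); [rewrite ler_pM ?sqr_ge0 ?ler_sqr ?nnegrE ?exprn_ge0|ring].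
have p3 : N ^+ 2 * (2 * (M ^+ 2) ^+ 2) <= 2 * v ^+ 12.
  rewrite (_ : N ^+ 2 * (2 * (M ^+ 2) ^+ 2) = 2 * (M ^+ 2 * N) ^+ 2); last by ring.
  rewrite (_ : v ^+ 12 = (v ^+ 6) ^+ 2); last by ring.
  by rewrite ler_wpM2l // ler_sqr ?nnegrE ?mulr_ge0 ?exprn_ge0.
have p4 : M ^+ 2 * (2 * (N ^+ 2) ^+ 2) <= 2 * v ^+ 12.
  rewrite (_ : M ^+ 2 * (2 * (N ^+ 2) ^+ 2) = 2 * (N ^+ 2 * M) ^+ 2); last by ring.
  rewrite (_ : v ^+ 12 = (v ^+ 6) ^+ 2); last by ring.
  by rewrite ler_wpM2l // ler_sqr ?nnegrE ?mulr_ge0 ?exprn_ge0.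
have p5 : (M * N) ^+ 2 * (36 * v ^+ 4) <= 36 * v ^+ 12.
  rewrite (_ : 36 * v ^+ 12 = v ^+ 8 * (36 * v ^+ 4)); last by ring.
  by rewrite ler_wpM2r ?(MN2_le H) // mulr_ge0 ?exprn_ge0.
have q1 := ler_wpM2r g0 p1; have q2 := ler_wpM2r g0 p2.
lra.
Qed.

(** The loop equation for F = V W^T W improves the order [v ^+ 10] to [v ^+ 8], which is the size V
    has when the operator norm of W is of order [v]. *)
Lemma E_nF_VV_le : E (fun W => nF (VV W)) <= K ^+ 58 * v ^+ 8.
Proof.
have v0 := v_ge0 H; have v1 := v_gt0 H; have K0 := K_ge0 H; have K1 := K_gt0 H.
have L : LL d * E (fun W => dot (VMm W) W) + E (fun W => dot (VMm W) (YY d W)) <=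
  E (fun W => \sum_a \sum_b \sum_c \sum_e VMm_var W a b c e)
  + (M * N * E (fun W => \sum_a \sum_b hm d a b * `|VMm W a b|) + 3 * XX d * E (fun W => \sum_a \sum_b `|VMm W a b|)).
  apply: le_trans (ler_norm _) _; apply: (loop_bound H (F := VMm) (B := VMm_var)).
    by move=> *; rewrite /VMm_var; nneg.
  by move=> W a b c e gW gW' ac be0; apply: VMm_diff.
have [m1 m2] := E_gram_le H.
have e1 : E (fun W => dot (VMm W) W) = E (fun W => nF (VV W)) by apply: (eqE H) => W _; apply: VMm_W.
have e2 : 3%:R / 4%:R * E (fun W => nF (Mv W *m Mv W)) - v ^+ 4 * E (fun W => nF (IIm d W)) <= E (fun W => dot (VMm W) (YY d W)).
  rewrite -!(EZ H) -(EB H); apply: (Ele H) => W gW.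
  rewrite YYE dotDr VMm_V VMm_I.
  have := dot_amgm (Mv W *m Mv W) (W^T *m IIm d W) (_ : 0 < 2^-1); rewrite ler_norml => h.
  have {}h : (0 : R) < 2^-1 by lra.
  have := dot_amgm (Mv W *m Mv W) (W^T *m IIm d W) h; rewrite ler_norml => /andP[h1 _].
  have h2 : nF (W^T *m IIm d W) <= v ^+ 4 * nF (IIm d W).
    by apply: le_trans (nF_mul _ _) _; rewrite nF_tr ler_wpM2r ?nF_ge0 // (nFW_le H).
  lra.
have e3 : E (fun W => \sum_a \sum_b \sum_c \sum_e VMm_var W a b c e) <=
   2 * v ^+ 6 * E (fun W => nF (Mv W)) + 4^-1 * E (fun W => nF (Mv W *m Mv W)) + 40 * v ^+ 12.
  rewrite -!(EZ H) -[X in _ <= _ + X](Ec H) -!(ED H); apply: (Ele H) => W _; exact: sum_VMm_var.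
(* Entries of [VMm] on [h] are split between a row of V and a column of [Mv]; the weight [v ^+ 2]
   balances the known orders [v ^+ 10] and [v ^+ 6]. *)
set P := E (fun W => nF (VV W) / (2 * v ^+ 2) + v ^+ 2 / 2 * nF (Mv W)).
have eP : P <= K ^+ 14 * v ^+ 8.
  rewrite /P (ED H) (_ : E (fun W => nF (VV W) / (2 * v ^+ 2)) = (2 * v ^+ 2)^-1 * E (fun W => nF (VV W))); last first.
    by rewrite -(EZ H); apply: (eqE H) => W _; rewrite mulrC.
  rewrite (EZ H).
  have u1 : (2 * v ^+ 2)^-1 * E (fun W => nF (VV W)) <= (2 * v ^+ 2)^-1 * (K ^+ 11 * v ^+ 10).
    by rewrite ler_wpM2l // invr_ge0; nneg.
  have u2 : v ^+ 2 / 2 * E (fun W => nF (Mv W)) <= v ^+ 2 / 2 * (K ^+ 13 * v ^+ 6).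
    by rewrite ler_wpM2l //; nneg.
  have u3 : (2 * v ^+ 2)^-1 * (K ^+ 11 * v ^+ 10) = 2^-1 * (K ^+ 11 * v ^+ 8) by field; rewrite gt_eqF.
  have u4 : v ^+ 2 / 2 * (K ^+ 13 * v ^+ 6) = 2^-1 * (K ^+ 13 * v ^+ 8) by field.
  rewrite u3 in u1; rewrite u4 in u2.
  have := Kv_le1 H (isT : (11 <= 14)%N) (leqnn 8); have := Kv_le1 H (isT : (13 <= 14)%N) (leqnn 8).
  lra.
have e4 : E (fun W => \sum_a \sum_b hm d a b * `|VMm W a b|) <= K * P.
  rewrite /P -(EZ H); apply: (Ele H) => W gW.
  apply: (@le_trans _ _ (\sum_a \sum_b hm d a b * (\sum_k VV W a k ^+ 2 / (2 * v ^+ 2)) + \sum_b \sum_a hm d a b * (\sum_k v ^+ 2 / 2 * Mv W k b ^+ 2))).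
    rewrite [X in _ <= _ + X]exchange_big -big_split /=; apply: ler_sum => a _.
    rewrite -big_split /=; apply: ler_sum => b _; rewrite -mulrDr -big_split /=.
    by rewrite ler_wpM2l ?(h_ge0 H) //; apply: VMm_le.
  under eq_bigr do rewrite -mulr_suml (okx H).
  under [X in _ + X <= _]eq_bigr do rewrite -mulr_suml (oky H).
  rewrite mulrDr -!mulr_sumr; apply: lerD.
    rewrite nFE mulr_suml; apply: ler_pM; rewrite ?(okx0 H) ?(okxK H) //.
      by apply: sumr_ge0 => a _; apply: sumr_ge0 => k _; nneg.
    by apply: ler_sum => a _; rewrite mulr_suml.
  rewrite nF_col [X in _ <= _ * X]mulr_sumr; apply: ler_pM; rewrite ?(oky0 H) ?(okyK H) //.
    by apply: sumr_ge0 => a _; apply: sumr_ge0 => k _; nneg.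
  by apply: ler_sum => a _; rewrite mulr_sumr.
have e5 : E (fun W => \sum_a \sum_b `|VMm W a b|) <= v ^+ 2 * P.
  rewrite /P -(EZ H); apply: (Ele H) => W gW.
  apply: (@le_trans _ _ (\sum_(a < m) \sum_(b < n) (\sum_k VV W a k ^+ 2 / (2 * v ^+ 2)) + \sum_(b < n) \sum_(a < m) (\sum_k v ^+ 2 / 2 * Mv W k b ^+ 2))).
    rewrite [X in _ <= _ + X]exchange_big -big_split /=; apply: ler_sum => a _.
    by rewrite -big_split /=; apply: ler_sum => b _; rewrite -big_split /=; apply: VMm_le.
  under eq_bigr do rewrite sum_constM card_ord.
  under [X in _ + X <= _]eq_bigr do rewrite sum_constM card_ord.
  rewrite mulrDr -!mulr_sumr; apply: lerD.
    rewrite nFE mulr_suml; apply: ler_pM; rewrite ?ler0n ?(okn H) //.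
      by apply: sumr_ge0 => a _; apply: sumr_ge0 => k _; nneg.
    by apply: ler_sum => a _; rewrite mulr_suml.
  rewrite nF_col [X in _ <= _ * X]mulr_sumr; apply: ler_pM; rewrite ?ler0n ?(okm H) //.
    by apply: sumr_ge0 => a _; apply: sumr_ge0 => k _; nneg.
  by apply: ler_sum => a _; rewrite mulr_sumr.
have f4 : M * N * E (fun W => \sum_a \sum_b hm d a b * `|VMm W a b|) <= K ^+ 15 * v ^+ 12.
  apply: le_trans (ler_wpM2l (MN_ge0 R m n) (le_trans e4 (ler_wpM2l K0 eP))) _.
  rewrite (_ : K ^+ 15 * v ^+ 12 = v ^+ 4 * (K * (K ^+ 14 * v ^+ 8))); last by ring.
  by apply: ler_wpM2r (MN_le H); nneg.
have f5 : 3 * XX d * E (fun W => \sum_a \sum_b `|VMm W a b|) <= 3 * (K ^+ 15 * v ^+ 12).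
  have x3 : 0 <= 3 * XX d by have := XX_ge0 H; lra.
  have v2 : 0 <= v ^+ 2 by nneg.
  apply: le_trans (ler_wpM2l x3 (le_trans e5 (ler_wpM2l v2 eP))) _.
  rewrite (_ : 3 * (K ^+ 15 * v ^+ 12) = 3 * (K * v ^+ 2) * (v ^+ 2 * (K ^+ 14 * v ^+ 8))); last by ring.
  by apply: ler_wpM2r; [nneg|rewrite ler_wpM2l ?(XX_le H)].
have f2 : v ^+ 4 * E (fun W => nF (IIm d W)) <= K ^+ 52 * v ^+ 12.
  rewrite (_ : K ^+ 52 * v ^+ 12 = v ^+ 4 * (K ^+ 52 * v ^+ 8)); last by ring.
  by rewrite ler_wpM2l ?E_nF_II_le //; nneg.
have f3 : v ^+ 6 * E (fun W => nF (Mv W)) <= K ^+ 13 * v ^+ 12.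
  rewrite (_ : K ^+ 13 * v ^+ 12 = v ^+ 6 * (K ^+ 13 * v ^+ 6)); last by ring.
  by rewrite ler_wpM2l //; nneg.
have t : LL d * E (fun W => nF (VV W)) <= K ^+ 53 * v ^+ (8 + 4).
  have c : 100 <= 100 :> R by rewrite ler_nat.
  have := Kv_le H c (isT : (52 < 53)%N) (leqnn 12); have := Kv_le H c (isT : (15 < 53)%N) (leqnn 12).
  have := Kv_le H c (isT : (13 < 53)%N) (leqnn 12); have := Kv_le H c (isT : (0 < 53)%N) (leqnn 12).
  have := EnF_ge0 H (fun W => Mv W *m Mv W); have := Kv_ge0 H 53 12.
  rewrite e1 in L; rewrite (_ : (8 + 4)%N = 12%N) // expr0.
  lra.
apply: le_trans (LL_div H (EnF_ge0 H _) t) _.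
exact: Kv_le1.
Qed.

Lemma E_nF_YY_le : E (fun W => nF (YY d W)) <= K ^+ 59 * v ^+ 8.
Proof.
apply: le_trans (_ : E (fun W => 2 * nF (VV W) + 2 * nF (IIm d W)) <= _).
  apply: (Ele H) => W _; rewrite YYE !nFE !mulr_sumr -big_split /=; apply: ler_sum => a _.
  rewrite !mulr_sumr -big_split /=; apply: ler_sum => b _.
  have -> : (VV W + IIm d W) a b = VV W a b + IIm d W a b by rewrite mxE.
  by have := sqrD_le (VV W a b) (IIm d W a b); lra.
rewrite (ED H) !(EZ H); have c : 10 <= 100 :> R by rewrite ler_nat.
have := Kv_le H c (isT : (58 < 59)%N) (leqnn 8); have := Kv_le H c (isT : (52 < 59)%N) (leqnn 8).
have := E_nF_VV_le; have := E_nF_II_le; have := Kv_ge0 H 59 8; lra.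
Qed.

End CubicMoment.

(** * Test functions supported on h *)
Section TestFunctions.
Variables (R : realFieldType) (m n : nat) (d : ensemble R m n) (H : ok d).
Implicit Types (W : 'M[R]_(m, n)).
Local Notation E := (Ex d).
Local Notation K := (KK d).
Local Notation v := (nu d).
Local Notation M := (mr R m).
Local Notation N := (nr R n).

(** Normalising constant of a single edge of density [dens] whose absence is weighted by [q]. The
    quotient [th] is then its probability of being present, the leading edge density on [h]. *)
Definition DD : R := dens d + qd d * (1 - dens d).
Definition th : R := dens d / DD.

Lemma DD_ge : dens d <= DD.
Proof. by rewrite /DD lerDl mulr_ge0 ?ltW ?(okq0 H) // subr_gt0 (dens_lt1 H). Qed.
Lemma DD_gt0 : 0 < DD. Proof. exact: lt_le_trans (dens_gt0 H) DD_ge. Qed.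
Lemma DD_le1 : DD <= 1.
Proof. by rewrite /DD; have := okq1 H; have := dens_lt1 H; nra. Qed.
Lemma th01 : 0 <= th <= 1.
Proof.
by rewrite /th (divr_ge0 (ltW (dens_gt0 H)) (ltW DD_gt0)) ler_pdivrMr ?DD_gt0 // mul1r DD_ge.
Qed.
Lemma LLD_ge : v ^+ 4 <= K ^+ 4 * (LL d * DD).
Proof.
have h : 1 <= K * DD by apply: le_trans (okdens H) _; rewrite ler_wpM2l ?DD_ge // (K_ge0 H).
apply: le_trans (LL_ge H) _.
rewrite (_ : K ^+ 4 * (LL d * DD) = K ^+ 3 * LL d * (K * DD)); last by ring.
by rewrite ler_peMr // mulr_ge0 ?exprn_ge0 ?(K_ge0 H) // ltW ?(LL_gt0 H).
Qed.
Lemma LLD_gt0 : 0 < LL d * DD.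
Proof. by rewrite mulr_gt0 ?(LL_gt0 H) ?DD_gt0. Qed.
Lemma LLD_div (X Y : R) : LL d * DD * `|X| <= v ^+ 4 * Y -> `|X| <= K ^+ 4 * Y.
Proof.
move=> h; have v4 : 0 < v ^+ 4 by rewrite exprn_gt0 // (v_gt0 H).
rewrite -(ler_pM2l v4); apply: le_trans (ler_wpM2r (normr_ge0 _) LLD_ge) _.
rewrite -mulrA (mulrCA (v ^+ 4)); apply: ler_wpM2l => //; rewrite exprn_ge0 // (K_ge0 H) //.
Qed.

(** Cauchy-Schwarz for an [f] that is a sum of products: a bound by the whole family of
    arithmetic-geometric means is enough, and [s = B / A] is the optimal member. *)
Lemma EcsS (S1 S2 f : 'M[R]_(m, n) -> R) A B : 0 < A -> 0 < B -> E S1 <= A ^+ 2 -> E S2 <= B ^+ 2 ->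
  (forall W s, good d W -> 0 < s -> f W <= s / 2 * S1 W + S2 W / (2 * s)) -> E f <= A * B.
Proof.
move=> A0 B0 h1 h2 hf.
apply: (@le_trans _ _ (E (fun W => B / A / 2 * S1 W + (2 * (B / A))^-1 * S2 W))).
  by apply: (Ele H) => W gW; rewrite [X in _ <= _ + X]mulrC; apply: hf => //; rewrite divr_gt0.
rewrite (ED H) !(EZ H) (_ : A * B = B / A / 2 * A ^+ 2 + (2 * (B / A))^-1 * B ^+ 2); last by field; rewrite !gt_eqF.
apply: lerD; apply: ler_wpM2l => //; rewrite ?invr_ge0; first by rewrite !divr_ge0 // ltW.
by rewrite mulr_ge0 // divr_ge0 // ltW.
Qed.

Definition devm W a b := Fm d W a b - LL d * dens d.
Definition devp W a b := Fp d W a b - LL d * (1 - dens d).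

Lemma dev_le W a b : good d W -> devm W a b ^+ 2 + devp W a b ^+ 2 <=
  32 * ((9 * K ^+ 2 * v ^+ 3) ^+ 2 + (2 * v ^+ 2 * ga d W b 0) ^+ 2 + (2 * v ^+ 2 * gb d W a 0) ^+ 2
    + om d W ^+ 2 + ma d W a 0 ^+ 2 + mb d W b 0 ^+ 2) + 4 * VV W a b ^+ 2.
Proof.
move=> gW; have ha := al_le1 H a; have hb := be_le1 H b.
have /andP[l0 l1] := dens01 H.
have ka : `|al d a 0| <= K / v := al_le H a. have kb : `|be d b 0| <= K / v := be_le H b.
have v0 := v_gt0 H; have v1 := v_ge1 H; have K0 := K_ge0 H.
have hN : `|N| <= v ^+ 2 by rewrite ger0_norm ?N_ge0 ?(okn H).
have hM : `|M| <= v ^+ 2 by rewrite ger0_norm ?M_ge0 ?(okm H).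
have hMN : `|M * N| <= v ^+ 4 by rewrite ger0_norm ?(MN_ge0) ?(MN_le H).
have hna : `|na d| <= K ^+ 2 by rewrite ger0_norm ?na_ge0 //; apply: na_le.
have hnb : `|nb d| <= K ^+ 2 by rewrite ger0_norm ?nb_ge0 //; apply: nb_le.
have cla : `|dens d + al d a 0| <= 2 by move: ha; rewrite !ler_norml => /andP[? ?]; lra.
have clb : `|dens d + be d b 0| <= 2 by move: hb; rewrite !ler_norml => /andP[? ?]; lra.
have cla1 : `|dens d + al d a 0 - 1| <= 2 by move: ha; rewrite !ler_norml => /andP[? ?]; lra.
have clb1 : `|dens d + be d b 0 - 1| <= 2 by move: hb; rewrite !ler_norml => /andP[? ?]; lra.
have sab : `|dens d * (al d a 0 + be d b 0) + al d a 0 * be d b 0| <= 3 * (K / v).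
  apply: le_trans (_ : 1 * (K / v + K / v) + 2^-1 * (K / v) <= _); last by have : 0 <= K / v; [rewrite divr_ge0 // ltW|lra].
  apply: normrD_le; apply: normrM_le => //; last by apply: normrD_le.
  by rewrite ger0_norm ltW.
have v23 : v ^+ 2 <= v ^+ 3 by rewrite ler_weXn2l.
have k12 : K <= K ^+ 2 by rewrite -[leLHS]expr1 ler_weXn2l // (K_ge1 H).
have big : 4 * (K * v ^+ 3) + 4 * (K ^+ 2 * v ^+ 2) <= 9 * K ^+ 2 * v ^+ 3.
  have : K * v ^+ 3 <= K ^+ 2 * v ^+ 3 by rewrite ler_wpM2r // exprn_ge0 // ltW.
  have : K ^+ 2 * v ^+ 2 <= K ^+ 2 * v ^+ 3 by rewrite ler_wpM2l // exprn_ge0.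
  have := Kv_ge0 H 2 3; lra.
have kv3 : v ^+ 4 * (3 * (K / v)) = 3 * (K * v ^+ 3) by field; rewrite gt_eqF.
have sq (k x z : R) : `|k| <= z -> (k * x) ^+ 2 <= (z * x) ^+ 2.
  by move=> h; rewrite !exprMn ler_wpM2r ?sqr_ge0 //; apply: sqr_le_norm.
have cN (z : R) : `|z| <= 2 -> `|N * z| <= 2 * v ^+ 2 by move=> h; rewrite mulrC; apply: normrM_le.
have cM (z : R) : `|z| <= 2 -> `|M * z| <= 2 * v ^+ 2 by move=> h; rewrite mulrC; apply: normrM_le.
have s1 : `|1 - dens d| <= 1 by rewrite ger0_norm; lra.
have p1 : devm W a b ^+ 2 <= 16 * ((9 * K ^+ 2 * v ^+ 3) ^+ 2 + (2 * v ^+ 2 * ga d W b 0) ^+ 2 + (2 * v ^+ 2 * gb d W a 0) ^+ 2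
    + om d W ^+ 2 + ma d W a 0 ^+ 2 + mb d W b 0 ^+ 2) + 2 * VV W a b ^+ 2.
  rewrite /devm (Fm_eq H) // /epsT.
  set A := M * N * (1 - dens d) * (dens d * (al d a 0 + be d b 0) + al d a 0 * be d b 0)
    - N * (dens d + al d a 0) * na d - M * (dens d + be d b 0) * nb d.
  set B := - (N * (dens d + al d a 0)) * ga d W b 0; set C := - (M * (dens d + be d b 0)) * gb d W a 0.
  rewrite (_ : _ - LL d * dens d = (A + B + C + - om d W + - ma d W a 0 + - mb d W b 0) + - VV W a b); last first.
    by rewrite /A /B /C /LL; ring.
  have hA : `|A| <= 9 * K ^+ 2 * v ^+ 3.
    apply: le_trans big.
    apply: le_trans (_ : v ^+ 4 * 1 * (3 * (K / v)) + v ^+ 2 * 2 * K ^+ 2 + v ^+ 2 * 2 * K ^+ 2 <= _).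
      apply: normrB_le; first apply: normrB_le.
      - by apply: normrM_le => //; apply: normrM_le.
      - by apply: normrM_le => //; apply: normrM_le.
      - by apply: normrM_le => //; apply: normrM_le.
    have : 0 <= v ^+ 4 * (3 * (K / v)) by rewrite kv3; have := Kv_ge0 H 1 3; rewrite expr1; clear; lra.
    by rewrite kv3 mulr1; have := Kv_ge0 H 1 3; rewrite expr1; lra.
  apply: le_trans (sqrD_le _ _) _; rewrite mulrDr sqrrN lerD2r.
  rewrite (_ : 16 = 2 * 8); last by ring.
  rewrite -[leRHS]mulrA ler_wpM2l //; apply: le_trans (sqr_sum6_le _ _ _ _ _ _) _; rewrite ler_wpM2l // !sqrrN !lerD2r.
  apply: lerD; first apply: lerD; [exact: sqr_le_norm| |].
    by apply: sq; rewrite normrN; apply: cN.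
  by apply: sq; rewrite normrN; apply: cM.
have p2 : devp W a b ^+ 2 <= 16 * ((9 * K ^+ 2 * v ^+ 3) ^+ 2 + (2 * v ^+ 2 * ga d W b 0) ^+ 2 + (2 * v ^+ 2 * gb d W a 0) ^+ 2
    + om d W ^+ 2 + ma d W a 0 ^+ 2 + mb d W b 0 ^+ 2) + 2 * VV W a b ^+ 2.
  rewrite /devp (Fp_eq H) // /epsT.
  set A := M * N * (al d a 0 * be d b 0 - (1 - dens d) * (dens d * (al d a 0 + be d b 0) + al d a 0 * be d b 0))
    + N * (dens d + al d a 0 - 1) * na d + M * (dens d + be d b 0 - 1) * nb d.
  set B := (N * (dens d + al d a 0 - 1)) * ga d W b 0; set C := (M * (dens d + be d b 0 - 1)) * gb d W a 0.
  rewrite (_ : _ - LL d * (1 - dens d) = (A + B + C + om d W + ma d W a 0 + mb d W b 0) + VV W a b); last first.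
    by rewrite /A /B /C /LL; ring.
  have hA : `|A| <= 9 * K ^+ 2 * v ^+ 3.
    apply: le_trans big.
    apply: le_trans (_ : v ^+ 4 * (2^-1 * (K / v) + 1 * (3 * (K / v))) + v ^+ 2 * 2 * K ^+ 2 + v ^+ 2 * 2 * K ^+ 2 <= _).
      apply: normrD_le; first apply: normrD_le.
      - by apply: normrM_le => //; apply: normrB_le; apply: normrM_le.
      - by apply: normrM_le => //; apply: normrM_le.
      - by apply: normrM_le => //; apply: normrM_le.
    have -> : v ^+ 4 * (2^-1 * (K / v) + 1 * (3 * (K / v))) = 7 / 2 * (K * v ^+ 3) by field; rewrite gt_eqF.
    by have := Kv_ge0 H 1 3; rewrite expr1; clear; lra.
  apply: le_trans (sqrD_le _ _) _; rewrite mulrDr lerD2r.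
  rewrite (_ : 16 = 2 * 8); last by ring.
  rewrite -[leRHS]mulrA ler_wpM2l //; apply: le_trans (sqr_sum6_le _ _ _ _ _ _) _; rewrite ler_wpM2l // !lerD2r.
  apply: lerD; first apply: lerD; [exact: sqr_le_norm| |].
    by apply: sq; apply: cN.
  by apply: sq; apply: cM.
lra.
Qed.

Lemma sum_h_row (u : 'I_m -> R) : \sum_a \sum_b hm d a b * u a = xd d * \sum_a u a.
Proof. by rewrite mulr_sumr; apply: eq_bigr => a _; rewrite -mulr_suml (okx H). Qed.
Lemma sum_h_col (u : 'I_n -> R) : \sum_a \sum_b hm d a b * u b = yd d * \sum_b u b.
Proof. by rewrite exchange_big mulr_sumr; apply: eq_bigr => a _ /=; rewrite -mulr_suml (oky H). Qed.
Lemma sum_h_const (c : R) : \sum_a \sum_b hm d a b * c = XX d * c.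
Proof. by rewrite -(sumh H) mulr_suml; apply: eq_bigr => a _; rewrite mulr_suml. Qed.
Lemma sum2D (f1 f2 : 'I_m -> 'I_n -> R) :
  \sum_a \sum_b (f1 a b + f2 a b) = \sum_a \sum_b f1 a b + \sum_a \sum_b f2 a b.
Proof. by rewrite -big_split; apply: eq_bigr => a _; rewrite -big_split. Qed.
Lemma sum2Z c (f1 : 'I_m -> 'I_n -> R) :
  \sum_a \sum_b (c * f1 a b) = c * \sum_a \sum_b f1 a b.
Proof. by rewrite mulr_sumr; apply: eq_bigr => a _; rewrite mulr_sumr. Qed.
Lemma sum2_le (f1 f2 : 'I_m -> 'I_n -> R) :
  (forall a b, f1 a b <= f2 a b) -> \sum_a \sum_b f1 a b <= \sum_a \sum_b f2 a b.
Proof. by move=> h; apply: ler_sum => a _; apply: ler_sum => b _. Qed.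

(** Deviations of order [v ^+ 3] are squared and summed over order [v ^+ 2] edges. The part with V
    is summed over all pairs, since its total second moment already has order [v ^+ 8]. *)
Lemma Edev : E (fun W => \sum_a \sum_b hm d a b * (devm W a b ^+ 2 + devp W a b ^+ 2)) <= (K ^+ 31 * v ^+ 4) ^+ 2.
Proof.
have v0 := v_ge0 H; have K0 := K_ge0 H; have K1 := K_ge1 H.
apply: (@le_trans _ _ (E (fun W => 32 * (XX d * (9 * K ^+ 2 * v ^+ 3) ^+ 2 + 4 * v ^+ 4 * (yd d * nF (ga d W)) + 4 * v ^+ 4 * (xd d * nF (gb d W))
    + XX d * (K ^+ 2 * nF (gb d W)) + xd d * (K ^+ 2 * nF (Mv W)) + yd d * (K ^+ 2 * nF (Mv W))) + 4 * nF (VV W)))).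
  apply: (Ele H) => W gW.
  apply: (@le_trans _ _ (\sum_a \sum_b (32 * (hm d a b * (9 * K ^+ 2 * v ^+ 3) ^+ 2 + 4 * v ^+ 4 * (hm d a b * ga d W b 0 ^+ 2) + 4 * v ^+ 4 * (hm d a b * gb d W a 0 ^+ 2)
     + hm d a b * om d W ^+ 2 + hm d a b * ma d W a 0 ^+ 2 + hm d a b * mb d W b 0 ^+ 2) + 4 * VV W a b ^+ 2))).
    apply: sum2_le => a b; apply: le_trans (ler_wpM2l (h_ge0 H a b) (dev_le a b gW)) _.
    have : hm d a b * VV W a b ^+ 2 <= VV W a b ^+ 2 by rewrite ler_piMl ?sqr_ge0 ?(h_le1 H).
    move: (hm d a b) => hh; set V2 := VV W a b ^+ 2 => hV.
    rewrite mulrDr lerD //; last by rewrite mulrCA ler_wpM2l.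
    by rewrite le_eqVlt; apply/orP; left; apply/eqP; ring.
  rewrite sum2D !sum2Z !sum2D !sum2Z !sum_h_const !sum_h_col !sum_h_row -!nF_cv -nFE lerD2r ler_wpM2l //.
  apply: lerD; first apply: lerD; first (by rewrite lerD2l; apply: ler_wpM2l; [exact: XX_ge0|exact: om_sqr]).
    by apply: ler_wpM2l; [exact: (okx0 H)|exact: nF_ma].
  by apply: ler_wpM2l; [exact: (oky0 H)|exact: nF_mb].
rewrite (ED H) !(EZ H) 5!(ED H) !(EZ H) (Ec H).
have [m1 _] := E_gram_le H; have m2 := E_nF_ga_gb_le H; have m3 := E_nF_VV_le H.
have g0 := EnF_ge0 H (ga d); have g1 := EnF_ge0 H (gb d); have g2 := EnF_ge0 H (@Mv _ _ _).
move: m1 m2 m3 g0 g1 g2.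
set Ga := E (fun W => nF (ga d W)); set Gb := E (fun W => nF (gb d W)); set MM := E (fun W => nF (Mv W)); set V2 := E _.
move=> m1 m2 m3 g0 g1 g2.
have xl := XX_le H; have x0 := XX_ge0 H.
have t1 : XX d * (9 * K ^+ 2 * v ^+ 3) ^+ 2 <= 81 * (K ^+ 5 * v ^+ 8).
  rewrite (_ : 81 * (K ^+ 5 * v ^+ 8) = (K * v ^+ 2) * (9 * K ^+ 2 * v ^+ 3) ^+ 2); last by ring.
  by rewrite ler_wpM2r ?sqr_ge0.
have t2 : 4 * v ^+ 4 * (yd d * Ga) <= 4 * (K ^+ 45 * v ^+ 6).
  rewrite (_ : 4 * (K ^+ 45 * v ^+ 6) = 4 * v ^+ 4 * (K * (K ^+ 44 * v ^+ 2))); last by ring.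
  by rewrite ler_wpM2l ?ler_pM ?(oky0 H) ?(okyK H) //; [nneg|lra].
have t3 : 4 * v ^+ 4 * (xd d * Gb) <= 4 * (K ^+ 45 * v ^+ 6).
  rewrite (_ : 4 * (K ^+ 45 * v ^+ 6) = 4 * v ^+ 4 * (K * (K ^+ 44 * v ^+ 2))); last by ring.
  by rewrite ler_wpM2l ?ler_pM ?(okx0 H) ?(okxK H) //; [nneg|lra].
have t4 : XX d * (K ^+ 2 * Gb) <= K ^+ 47 * v ^+ 4.
  rewrite (_ : K ^+ 47 * v ^+ 4 = (K * v ^+ 2) * (K ^+ 2 * (K ^+ 44 * v ^+ 2))); last by ring.
  apply: ler_pM => //; first by nneg.
  by rewrite ler_wpM2l ?exprn_ge0 //; lra.
have t5 : xd d * (K ^+ 2 * MM) <= K ^+ 16 * v ^+ 6.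
  rewrite (_ : K ^+ 16 * v ^+ 6 = K * (K ^+ 2 * (K ^+ 13 * v ^+ 6))); last by ring.
  apply: ler_pM => //; [exact: (okx0 H)|nneg|exact: (okxK H)|].
  by rewrite ler_wpM2l ?exprn_ge0.
have t6 : yd d * (K ^+ 2 * MM) <= K ^+ 16 * v ^+ 6.
  rewrite (_ : K ^+ 16 * v ^+ 6 = K * (K ^+ 2 * (K ^+ 13 * v ^+ 6))); last by ring.
  apply: ler_pM => //; [exact: (oky0 H)|nneg|exact: (okyK H)|].
  by rewrite ler_wpM2l ?exprn_ge0.
have c : 100 <= 100 :> R by rewrite ler_nat.
have K60 : 100 * (K ^+ 61 * v ^+ 8) <= K ^+ 62 * v ^+ 8 := Kv_le H c (isT : (61 < 62)%N) (leqnn 8).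
have a1 := Kv_le H c (isT : (5 < 61)%N) (leqnn 8).
have a2 := Kv_le H c (isT : (45 < 61)%N) (isT : (6 <= 8)%N).
have a3 := Kv_le H c (isT : (47 < 61)%N) (isT : (4 <= 8)%N).
have a4 := Kv_le H c (isT : (16 < 61)%N) (isT : (6 <= 8)%N).
have a5 := Kv_le H c (isT : (58 < 61)%N) (isT : (8 <= 8)%N).
rewrite (_ : (K ^+ 31 * v ^+ 4) ^+ 2 = K ^+ 62 * v ^+ 8); last by ring.
have kk := Kv_ge0 H 61 8.
lra.
Qed.

End TestFunctions.

Section TestFunctionSwitch.
Variables (R : realFieldType) (m n : nat) (d : ensemble R m n) (H : ok d).
Implicit Types (W : 'M[R]_(m, n)).
Local Notation E := (Ex d).
Local Notation K := (KK d).
Local Notation v := (nu d).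
Local Notation M := (mr R m).
Local Notation N := (nr R n).
Local Notation g := (gm d).

Lemma sum2B (f1 f2 : 'I_m -> 'I_n -> R) :
  \sum_a \sum_b f1 a b - \sum_a \sum_b f2 a b = \sum_a \sum_b (f1 a b - f2 a b).
Proof. by rewrite -sumrB; apply: eq_bigr => a _; rewrite -sumrB. Qed.

Lemma DDth : DD d * th d = dens d.
Proof. by rewrite /th mulrC divfK // gt_eqF ?(DD_gt0 H). Qed.

Lemma h_kap a b : hm d a b * kap d a b = hm d a b * qd d.
Proof. by rewrite /kap; case: (okh H a b) => ->; ring. Qed.

Lemma sum_h3 a b : \sum_c \sum_e (hm d c e + hm d a e + hm d c b) = 3 * XX d.
Proof.
under eq_bigr do rewrite !big_split /= !(okx H) sum_constM card_ord -/(nr R n).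
by rewrite !big_split /= !sum_constM card_ord -/(mr R m) -mulr_sumr (oky H) -(XXn H) /XX; ring.
Qed.

(** The effect of the weights at the three corners other than ab. Each of these corners lies in [h]
    for exactly [XX] choices of [(c, e)]. *)
Definition remh W a b := \sum_c \sum_e
  ((1 - kap d a e * kap d c b) * chim d W a b c e - qd d * (1 - kap d c e) * chip d W a b c e).

Lemma remh_le W a b : good d W -> `|remh W a b| <= 3 * XX d.
Proof.
move=> gW; rewrite -(sum_h3 a b); apply: ler_norm_sumD => c; apply: ler_norm_sumD => e.
have /andP[p0 p1] := chip01 a b c e gW; have /andP[m0 m1] := chim01 a b c e gW.
have /andP[l0 l1] := kap2_le H a e c b.
have q0 := okq0 H; have q1 := okq1 H.
have r0 : 0 <= qd d * (1 - kap d c e) <= hm d c e.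
  by rewrite /kap; case: (okh H c e) => ->; nra.
case/andP: r0 => r0 r1.
rewrite (_ : hm d c e + hm d a e + hm d c b = (hm d a e + hm d c b) * 1 + hm d c e * 1); last by ring.
by apply: normrB_le; apply: normrM_le; rewrite ger0_norm.
Qed.

Lemma h_inner W a b : hm d a b * (\sum_c \sum_e (chip d W a b c e * (kap d a b * kap d c e)
     - chim d W a b c e * (kap d a e * kap d c b)))
  = hm d a b * (qd d * (g W a b * Fp d W a b) - (1 - g W a b) * Fm d W a b + remh W a b).
Proof.
rewrite -sum_chip -sum_chim /remh -sum2Z sum2B -sum2D -!sum2Z; apply: eq_bigr => c _; apply: eq_bigr => e _.
apply/eqP; rewrite -subr_eq0; apply/eqP.
transitivity ((hm d a b * kap d a b - hm d a b * qd d) * (chip d W a b c e * kap d c e)); first by ring.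
by rewrite h_kap subrr mul0r.
Qed.

(** With the leading values [LL * (1 - dens)] of [Fp] and [LL * dens] of [Fm], the biased balance q
    g [Fp] = (1 - g) [Fm] has the solution g = [th]. *)
Lemma main_split W a b : qd d * (g W a b * Fp d W a b) - (1 - g W a b) * Fm d W a b =
  LL d * DD d * (g W a b - th d) + (qd d * g W a b * devp d W a b - (1 - g W a b) * devm d W a b).
Proof.
rewrite /devp /devm mulrBr -(mulrA (LL d) (DD d) (th d)) DDth /DD; ring.
Qed.

(* F = h o phi: on the edges of h the switching is biased towards [th], up to the increments of phi. *)
Lemma test_switch (phi : 'M[R]_(m, n) -> 'I_m -> 'I_n -> R) A : 0 < A ->
  E (fun W => \sum_a \sum_b hm d a b * phi W a b ^+ 2) <= A ^+ 2 ->
  `|LL d * DD d * E (fun W => \sum_a \sum_b hm d a b * phi W a b * (g W a b - th d))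
    - E (fun W => \sum_a \sum_b \sum_c \sum_e hm d a b * (phi (W + Dl R a c b e) a b - phi W a b) * wk d W a b c e)|
  <= K ^+ 33 * v ^+ 4 * A.
Proof.
move=> A0 hA; have K0 := K_ge0 H; have v0 := v_ge0 H.
have sw := Eswitch H (fun W a b => hm d a b * phi W a b).
rewrite (eqE H (_ : forall W, good d W -> \sum_a \sum_b \sum_c \sum_e hm d a b * (phi (W + Dl R a c b e) a b - phi W a b) * wk d W a b c e
  = \sum_a \sum_b \sum_c \sum_e (hm d a b * phi (W + Dl R a c b e) a b - hm d a b * phi W a b) * (chim d W a b c e * (kap d a e * kap d c b)))); last first.
  by move=> W _; do 4 (apply: eq_bigr => ? _); rewrite mulrBr.
rewrite -sw -(EZ H) -(EB H).
apply: (@le_trans _ _ (E (fun W => \sum_a \sum_b hm d a b * (`|phi W a b| * (`|devp d W a b| + `|devm d W a b|)))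
   + 3 * XX d * E (fun W => \sum_a \sum_b hm d a b * `|phi W a b|))).
  rewrite -(EZ H) -(ED H); apply: (Eabs_le H) => W gW.
  rewrite -!sum2Z -sum2D -sumrB; apply: ler_norm_sumD => a; rewrite -sumrB; apply: ler_norm_sumD => b.
  have -> : \sum_c \sum_e hm d a b * phi W a b * (chip d W a b c e * (kap d a b * kap d c e) - chim d W a b c e * (kap d a e * kap d c b))
    = phi W a b * (hm d a b * (\sum_c \sum_e (chip d W a b c e * (kap d a b * kap d c e) - chim d W a b c e * (kap d a e * kap d c b)))).
    rewrite !mulr_sumr; apply: eq_bigr => c _; rewrite !mulr_sumr; apply: eq_bigr => e _; ring.
  rewrite h_inner main_split.
  rewrite (_ : _ - _ = - (hm d a b * phi W a b * (qd d * g W a b * devp d W a b - (1 - g W a b) * devm d W a b + remh W a b))); last by ring.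
  rewrite normrN !normrM (ger0_norm (h_ge0 H a b)) -mulrA.
  rewrite (_ : _ + 3 * XX d * (hm d a b * `|phi W a b|) =
     hm d a b * (`|phi W a b| * (1 * `|devp d W a b| + 1 * `|devm d W a b| + 3 * XX d))); last by ring.
  rewrite ler_wpM2l ?(h_ge0 H) // ler_wpM2l //.
  apply: normrD_le (remh_le a b gW); apply: normrB_le; apply: normrM_le => //.
    have /andP[g0 g1] := gm01 a b gW; have q0 := okq0 H; have q1 := okq1 H.
    by rewrite ger0_norm ?mulr_ge0 ?(ltW q0) // mulr_ile1 // ltW.
  by have /andP[? ?] := gm01 a b gW; rewrite ger0_norm; lra.
have kv : 0 < K ^+ 31 * v ^+ 4 := Kv_gt0 H 31 4.
have A2 : 0 < 2 * A by lra.
have b1 : E (fun W => \sum_a \sum_b hm d a b * (`|phi W a b| * (`|devp d W a b| + `|devm d W a b|))) <= 2 * A * (K ^+ 31 * v ^+ 4).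
  apply: (EcsS H (S1 := fun W => 2 * \sum_a \sum_b hm d a b * phi W a b ^+ 2) A2 kv _ (Edev H)).
    rewrite (EZ H); have := sqr_ge0 A; lra.
  move=> W s gW s0; rewrite mulr_suml -!sum2Z [X in _ <= _ + X](eq_bigr (fun a => \sum_b (2 * s)^-1 * (hm d a b * (devm d W a b ^+ 2 + devp d W a b ^+ 2)))); last first.
    by move=> a _; rewrite mulr_suml; apply: eq_bigr => b _; rewrite mulrC.
  rewrite -sum2D; apply: sum2_le => a b.
  rewrite [leRHS](_ : _ = hm d a b * ((s / 2 * phi W a b ^+ 2 + devp d W a b ^+ 2 / (2 * s)) + (s / 2 * phi W a b ^+ 2 + devm d W a b ^+ 2 / (2 * s)))); last by field; rewrite gt_eqF.
  rewrite ler_wpM2l ?(h_ge0 H) // mulrDr -!normrM; apply: lerD; exact: amgm.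
have Kv0 : 0 < K * v by rewrite mulr_gt0 ?(K_gt0 H) ?(v_gt0 H).
have b2 : E (fun W => \sum_a \sum_b hm d a b * `|phi W a b|) <= A * (K * v).
  apply: (EcsS H (S2 := fun=> XX d) A0 Kv0 hA).
    rewrite (Ec H); apply: le_trans (XX_le H) _; rewrite exprMn ler_wpM2r ?exprn_ge0 //.
    by rewrite -[leLHS]expr1 ler_weXn2l // (K_ge1 H).
  move=> W s gW s0; rewrite -(sumh H) mulr_suml -!sum2Z [X in _ <= _ + X](eq_bigr (fun a => \sum_b hm d a b / (2 * s))); last first.
    by move=> a _; rewrite mulr_suml.
  rewrite -sum2D; apply: sum2_le => a b.
  have := amgm (phi W a b) 1 s0; rewrite mulr1 expr1n => h1.
  rewrite [leRHS](_ : _ = hm d a b * (s / 2 * phi W a b ^+ 2 + 1 / (2 * s))); last by field; rewrite gt_eqF.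
  by rewrite ler_wpM2l ?(h_ge0 H).
have x3 : 0 <= 3 * XX d by have := XX_ge0 H; lra.
apply: le_trans (lerD b1 (ler_wpM2l x3 b2)) _.
apply: le_trans (_ : 2 * (K ^+ 31 * v ^+ 4) * A + 3 * (K ^+ 2 * v ^+ 3) * A <= _).
  rewrite [X in X <= _](_ : _ = 2 * (K ^+ 31 * v ^+ 4) * A + (3 * XX d) * (A * (K * v))) ?lerD2l; last by ring.
  rewrite (_ : 3 * (K ^+ 2 * v ^+ 3) * A = 3 * (K * v ^+ 2) * (A * (K * v))); last by ring.
  by rewrite ler_wpM2r ?mulr_ge0 ?(ltW A0) ?K0 // ler_wpM2l ?(XX_le H).
rewrite -mulrDl ler_wpM2r ?(ltW A0) //.
have c : 10 <= 100 :> R by rewrite ler_nat.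
have := Kv_le H c (isT : (31 < 33)%N) (leqnn 4); have := Kv_le H c (isT : (2 < 33)%N) (isT : (3 <= 4)%N).
have := Kv_ge0 H 33 4; lra.
Qed.

Lemma test_bound (phi : 'M[R]_(m, n) -> 'I_m -> 'I_n -> R) A c : 0 < A -> 0 <= c ->
  E (fun W => \sum_a \sum_b hm d a b * phi W a b ^+ 2) <= A ^+ 2 ->
  (forall W a b c' e, good d W -> good d (W + Dl R a c' b e) -> a != c' -> b != e ->
    `|phi (W + Dl R a c' b e) a b - phi W a b| <= c) ->
  `|E (fun W => \sum_a \sum_b hm d a b * phi W a b * (g W a b - th d))| <= K ^+ 37 * A + K ^+ 5 * v ^+ 2 * c.
Proof.
move=> A0 c0 hA hc; have h1 := test_switch A0 hA.
have K0 := K_ge0 H; have v0 := v_ge0 H.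
have h2 : `|E (fun W => \sum_a \sum_b \sum_c' \sum_e hm d a b * (phi (W + Dl R a c' b e) a b - phi W a b) * wk d W a b c' e)|
   <= K * v ^+ 6 * c.
  rewrite (eqE H (_ : forall W, good d W -> _ = \sum_a \sum_b \sum_c' \sum_e (hm d a b * phi (W + Dl R a c' b e) a b - hm d a b * phi W a b) * wk d W a b c' e)); last first.
    by move=> W _; do 4 (apply: eq_bigr => ? _); rewrite mulrBr.
  apply: le_trans (switch_diff_le H (F := fun W a b => hm d a b * phi W a b) (B := fun _ a b _ _ => hm d a b * c) _ _) _.
  - by move=> W a b c' e _; rewrite mulr_ge0 ?(h_ge0 H).
  - move=> W a b c' e gW gW' ac be0; rewrite -mulrBr normrM (ger0_norm (h_ge0 H a b)).
    by rewrite ler_wpM2l ?(h_ge0 H) // hc.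
  apply: (Ele_c H) => W _.
  rewrite (eq_bigr (fun a => \sum_b hm d a b * (M * N * c))); last first.
    by move=> a _; apply: eq_bigr => b _; rewrite !sum_constM !card_ord /mr /nr; ring.
  rewrite (sum_h_const H) (_ : K * v ^+ 6 * c = K * v ^+ 2 * (v ^+ 4 * c)); last by ring.
  apply: ler_pM; rewrite ?(XX_ge0 H) ?(XX_le H) ?mulr_ge0 ?M_ge0 ?N_ge0 //.
  by rewrite ler_wpM2r ?(MN_le H).
set X := E _ in h1 *; set Y := E _ in h1 h2.
rewrite (_ : K ^+ 37 * A + K ^+ 5 * v ^+ 2 * c = K ^+ 4 * (K ^+ 33 * A + K * v ^+ 2 * c)); last by ring.
apply: (LLD_div H).
rewrite -[X in X * _](gtr0_norm (LLD_gt0 H)) -normrM.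
rewrite -(subrK Y (LL d * DD d * X)); apply: le_trans (normrD_le h1 h2) _.
by rewrite le_eqVlt; apply/orP; left; apply/eqP; ring.
Qed.

End TestFunctionSwitch.

(** * Mean and second moment of the overlap, and statistics weighted by the overlap *)

Section TestedExpectations.
Variables (R : realFieldType) (m n : nat) (d : ensemble R m n) (H : ok d).
Implicit Types (W : 'M[R]_(m, n)).
Local Notation E := (Ex d).
Local Notation K := (KK d).
Local Notation v := (nu d).
Local Notation N := (nr R n).
Local Notation g := (gm d).

Definition Ov W : R := \sum_a \sum_b hm d a b * g W a b.
(** [xi] and [ze] are the degree vectors of the common part of G and [h]. *)
Definition xi W : 'cV[R]_m := \col_a \sum_b hm d a b * g W a b.
Definition ze W : 'cV[R]_n := \col_b \sum_a hm d a b * g W a b.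

Lemma gm_shift W D a b : g (W + D) a b = g W a b + D a b.
Proof. by rewrite /gm mxE addrA. Qed.

Lemma hg01 W a b : good d W -> 0 <= hm d a b * g W a b <= hm d a b.
Proof. by move=> gW; have /andP[g0 g1] := gm01 a b gW; rewrite mulr_ge0 ?(h_ge0 H) //= ler_piMr ?(h_ge0 H). Qed.

Lemma Ov01 W : good d W -> 0 <= Ov W <= XX d.
Proof.
move=> gW; rewrite -(sumh H); apply/andP; split.
  by apply: sumr_ge0 => a _; apply: sumr_ge0 => b _; case/andP: (hg01 a b gW).
by apply: sum2_le => a b; case/andP: (hg01 a b gW).
Qed.

Lemma xi01 W a : good d W -> 0 <= xi W a 0 <= xd d.
Proof.
move=> gW; rewrite mxE -(okx H a); apply/andP; split.
  by apply: sumr_ge0 => b _; case/andP: (hg01 a b gW).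
by apply: ler_sum => b _; case/andP: (hg01 a b gW).
Qed.

Lemma ze01 W b : good d W -> 0 <= ze W b 0 <= yd d.
Proof.
move=> gW; rewrite mxE -(oky H b); apply/andP; split.
  by apply: sumr_ge0 => a _; case/andP: (hg01 a b gW).
by apply: ler_sum => a _; case/andP: (hg01 a b gW).
Qed.

Lemma Ov_xi W : Ov W = \sum_a xi W a 0.
Proof. by apply: eq_bigr => a _; rewrite mxE. Qed.

Lemma hth_sum (phi : 'I_m -> 'I_n -> R) W : \sum_a \sum_b hm d a b * phi a b * (g W a b - th d)
  = \sum_a \sum_b hm d a b * g W a b * phi a b - th d * \sum_a \sum_b hm d a b * phi a b.
Proof. by rewrite -sum2Z sum2B; apply: eq_bigr => a _; apply: eq_bigr => b _; ring. Qed.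

Lemma sqr_leX (a b : R) k : 0 <= a -> a <= b -> a ^+ k <= b ^+ k.
Proof. by move=> a0 ab; rewrite lerXn2r ?nnegrE // (le_trans a0). Qed.

Lemma XX_le1 : XX d <= (K * v) ^+ 2.
Proof.
apply: le_trans (XX_le H) _; rewrite exprMn ler_wpM2r ?exprn_ge0 ?(v_ge0 H) //.
by rewrite -[leLHS]expr1 ler_weXn2l // (K_ge1 H).
Qed.

Lemma E_Ov_le : `|E (fun W => Ov W) - th d * XX d| <= K ^+ 39 * v.
Proof.
have h := test_bound H (phi := fun _ _ _ => 1) (A := K * v) (c := 0) _ (lexx 0) _ _.
have Kv0 : 0 < K * v by rewrite mulr_gt0 ?(K_gt0 H) ?(v_gt0 H).
rewrite (_ : E (fun W => Ov W) - th d * XX d = E (fun W => \sum_a \sum_b hm d a b * 1 * (g W a b - th d))).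
  apply: le_trans (h _ _ _) _ => //.
  - apply: (Ele_c H) => W _; rewrite expr1n (sum_h_const H) mulr1; exact: XX_le1.
  - by move=> *; rewrite subrr normr0.
  - rewrite mulr0 addr0 mulrA -exprSr ler_wpM2r ?(v_ge0 H) // ler_weXn2l // (K_ge1 H) //.
rewrite -[th d * _](Ec H) -(EB H); apply: (eqE H) => W _.
rewrite hth_sum (sum_h_const H) mulr1; congr (_ - _).
by apply: eq_bigr => a _; apply: eq_bigr => b _; rewrite mulr1.
Qed.

Lemma pairv_sum_le k (a c : 'I_k) (u : 'I_k -> R) c0 : (forall i, `|u i| <= c0) -> `|\sum_i pairv R a c i 0 * u i| <= 2 * c0.
Proof. by move=> h; rewrite pairv_dot; apply: diff_le. Qed.

Lemma Ov_diff W a c b e : `|Ov (W + Dl R a c b e) - Ov W| <= 4.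
Proof.
have -> : Ov (W + Dl R a c b e) - Ov W = \sum_i pairv R a c i 0 * (\sum_j pairv R b e j 0 * hm d i j).
  rewrite /Ov sum2B; apply: eq_bigr => i _; rewrite mulr_sumr; apply: eq_bigr => j _.
  by rewrite gm_shift DlE !mxE; ring.
rewrite (_ : 4 = 2 * (2 * 1)); last by ring.
by apply: pairv_sum_le => i; apply: pairv_sum_le => j; rewrite ger0_norm ?(h_ge0 H) ?(h_le1 H).
Qed.

(** The overlap itself serves as test function: a switch changes it by at most 4, so the mean of
    [Ov] times ([Ov] - [th * XX]) is small, and [E_Ov_le] finishes. *)
Lemma E_Ov_sqr_le : `|E (fun W => Ov W ^+ 2) - (th d * XX d) ^+ 2| <= K ^+ 42 * v ^+ 3.
Proof.
have K0 := K_ge0 H; have v0 := v_ge0 H; have K1 := K_gt0 H; have v1 := v_gt0 H.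
have A0 : 0 < K ^+ 2 * v ^+ 3 := Kv_gt0 H 2 3.
have h : `|E (fun W => \sum_a \sum_b hm d a b * Ov W * (g W a b - th d))| <= K ^+ 37 * (K ^+ 2 * v ^+ 3) + K ^+ 5 * v ^+ 2 * 4.
  apply: (test_bound H (phi := fun W _ _ => Ov W) A0) => //.
    apply: (Ele_c H) => W gW; rewrite (sum_h_const H); have /andP[o0 o1] := Ov01 gW.
    apply: le_trans (_ : XX d * XX d ^+ 2 <= _).
      by rewrite ler_wpM2l ?(XX_ge0 H) // sqr_leX.
    rewrite -exprS; apply: le_trans (sqr_leX 3 (XX_ge0 H) (XX_le H)) _.
    rewrite (_ : (K * v ^+ 2) ^+ 3 = K ^+ 3 * v ^+ 6); last by ring.
    by rewrite (_ : (K ^+ 2 * v ^+ 3) ^+ 2 = K ^+ 4 * v ^+ 6); [exact: Kv_le1|ring].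
  by move=> W a b c e _ _ _ _; apply: Ov_diff.
have e1 : E (fun W => \sum_a \sum_b hm d a b * Ov W * (g W a b - th d)) = E (fun W => Ov W ^+ 2) - th d * XX d * E (fun W => Ov W).
  rewrite -(EZ H) -(EB H); apply: (eqE H) => W _; rewrite (hth_sum (fun _ _ => Ov W)) (sum_h_const H).
  rewrite mulrA; congr (_ - _); rewrite expr2 {2}/Ov mulr_suml; apply: eq_bigr => a _; by rewrite mulr_suml.
rewrite e1 in h; have h2 := E_Ov_le.
have tx : 0 <= th d * XX d <= K * v ^+ 2.
  have /andP[t0 t1] := th01 H; rewrite mulr_ge0 ?(XX_ge0 H) //=.
  by rewrite -[leRHS]mul1r; apply: ler_pM; rewrite ?(XX_ge0 H) ?(XX_le H).
case/andP: tx => tx0 tx1.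
have h3 : `|th d * XX d * (E (fun W => Ov W) - th d * XX d)| <= K * v ^+ 2 * (K ^+ 39 * v).
  by apply: normrM_le => //; rewrite ger0_norm.
rewrite (_ : _ - _ = (E (fun W => Ov W ^+ 2) - th d * XX d * E (fun W => Ov W)) + th d * XX d * (E (fun W => Ov W) - th d * XX d)); last by ring.
apply: le_trans (normrD_le h h3) _.
have c : 10 <= 100 :> R by rewrite ler_nat.
have := Kv_le H c (isT : (39 < 42)%N) (leqnn 3); have := Kv_le H c (isT : (5 < 42)%N) (isT : (2 <= 3)%N).
have := Kv_le H c (isT : (40 < 42)%N) (leqnn 3); have := Kv_ge0 H 42 3; lra.
Qed.

(** The test function is [ga]. Its product with [th] contributes nothing, because [ga] sums to zero
    and all columns of [h] have the same sum. *)
Lemma E_hg_ga_le : `|E (fun W => \sum_a \sum_b hm d a b * g W a b * ga d W b 0)| <= K ^+ 61 * v.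
Proof.
have K0 := K_ge0 H; have v0 := v_ge0 H; have K1 := K_gt0 H; have v1 := v_gt0 H.
have A0 : 0 < K ^+ 23 * v by rewrite mulr_gt0 ?exprn_gt0.
have kv : 0 <= 2 * (K / v) by nneg.
have h := test_bound H (phi := fun W _ b => ga d W b 0) A0 kv.
rewrite (eqE H (_ : forall W, good d W -> _ = \sum_a \sum_b hm d a b * ga d W b 0 * (g W a b - th d))); last first.
  by move=> W gW; rewrite (hth_sum (fun _ b => ga d W b 0)) (sum_h_col H) sum_ga // !mulr0 subr0.
apply: le_trans (h _ _) _.
- rewrite (eqE H (_ : forall W, good d W -> _ = yd d * nF (ga d W))); last first.
    by move=> W _; rewrite nF_cv -(sum_h_col H (fun b => ga d W b 0 ^+ 2)).
  rewrite (EZ H); apply: le_trans (_ : K * (K ^+ 44 * v ^+ 2) <= _).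
    apply: ler_pM; rewrite ?(oky0 H) ?(okyK H) ?EnF_ge0 //.
    by have := E_nF_ga_gb_le H; have := EnF_ge0 H (gb d); lra.
  rewrite (_ : (K ^+ 23 * v) ^+ 2 = K ^+ 46 * v ^+ 2); last by ring.
  by rewrite mulrA -exprS; apply: (Kv_le1 H).
- move=> W a b c e _ _ ac be0.
  have -> : ga d (W + Dl R a c b e) b 0 - ga d W b 0 = al d a 0 - al d c 0.
    by rewrite /ga linearD /= mulmxDl Dl_tr [X in X - _]mxE addrAC subrr add0r Dl_mullE pairv_a // mul1r.
  by apply: diff_le; apply: al_le.
have -> : K ^+ 5 * v ^+ 2 * (2 * (K / v)) = 2 * (K ^+ 6 * v ^+ 1) by field; rewrite gt_eqF.
have c : 10 <= 100 :> R by rewrite ler_nat.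
have := Kv_le H c (isT : (60 < 61)%N) (leqnn 1); have := Kv_le H c (isT : (6 < 61)%N) (leqnn 1).
rewrite !expr1; have := Kv_ge0 H 61 1; rewrite expr1.
rewrite (_ : K ^+ 37 * (K ^+ 23 * v) = K ^+ 60 * v); last by ring.
lra.
Qed.

Lemma gb_bnd W a : good d W -> `|gb d W a 0| <= K * v.
Proof.
move=> gW; rewrite mxE; apply: le_trans (_ : \sum_(b < n) K / v <= _).
  apply: ler_norm_sumD => b; rewrite -[leRHS]mul1r; apply: normrM_le; [exact: (Wle1 H gW)|exact: be_le].
rewrite sum_constM card_ord -/(nr R n); have v1 := v_gt0 H.
rewrite (_ : K * v = v ^+ 2 * (K / v)); last by field; rewrite gt_eqF.
by rewrite ler_wpM2r ?(okn H) // divr_ge0 ?(K_ge0 H) ?(v_ge0 H).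
Qed.

Lemma E_hg_mb_le : `|E (fun W => \sum_a \sum_b hm d a b * g W a b * mb d W b 0)| <= K ^+ 46 * v ^+ 3.
Proof.
have K0 := K_ge0 H; have v0 := v_ge0 H; have K1 := K_gt0 H; have v1 := v_gt0 H.
have A0 : 0 < K ^+ 8 * v ^+ 3 := Kv_gt0 H 8 3.
have kv : 0 <= 6 * (K * v) by nneg.
have h := test_bound H (phi := fun W _ b => mb d W b 0) A0 kv.
rewrite (eqE H (_ : forall W, good d W -> _ = \sum_a \sum_b hm d a b * mb d W b 0 * (g W a b - th d))); last first.
  by move=> W gW; rewrite (hth_sum (fun _ b => mb d W b 0)) (sum_h_col H) sum_mb // !mulr0 subr0.
apply: le_trans (h _ _) _.
- rewrite (eqE H (_ : forall W, good d W -> _ = yd d * nF (mb d W))); last first.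
    by move=> W _; rewrite nF_cv -(sum_h_col H (fun b => mb d W b 0 ^+ 2)).
  rewrite (EZ H); apply: le_trans (_ : K * (K ^+ 2 * (K ^+ 13 * v ^+ 6)) <= _).
    apply: ler_pM; rewrite ?(oky0 H) ?(okyK H) ?EnF_ge0 //.
    apply: le_trans (_ : K ^+ 2 * E (fun W => nF (Mv W)) <= _).
      by rewrite -(EZ H); apply: (Ele H) => W _; apply: nF_mb.
    by rewrite ler_wpM2l ?exprn_ge0 //; have [] := E_gram_le H.
  by rewrite le_eqVlt; apply/orP; left; apply/eqP; ring.
- move=> W a b c e gW gW' ac be0; set D := Dl R a c b e in gW' *.
  have -> : mb d (W + D) b 0 - mb d W b 0 = (gb d (W + D) a 0 - gb d (W + D) c 0) + (W a b - W c b) * (be d b 0 - be d e 0).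
    have -> : mb d (W + D) = D^T *m gb d (W + D) + (W^T *m pairv R a c) *m ((pairv R b e)^T *m be d) + mb d W.
      have eg : gb d (W + D) = gb d W + D *m be d by rewrite /gb mulmxDl.
      have e2 : W^T *m (D *m be d) = W^T *m pairv R a c *m ((pairv R b e)^T *m be d) by rewrite /D /Dl !mulmxA.
      by rewrite /mb linearD /= mulmxDl {1}eg mulmxDr e2 addrC addrA [RHS]addrAC.
    rewrite [X in X - _]mxE addrK [LHS]mxE Dl_tr Dl_mullE pairv_a // mul1r; congr (_ + _).
    by rewrite mxE big_ord1 pairv_mulr pairv_mull !mxE.
  apply: le_trans (normrD_le (diff_le (gb_bnd a gW') (gb_bnd c gW')) (normrM_le (diff_le (Wle1 H gW a b) (Wle1 H gW c b)) (diff_le (be_le H b) (be_le H e)))) _.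
  have : K / v <= K * v.
    by rewrite ler_pdivrMr // -mulrA ler_peMr // -expr2 exprn_ege1 // (v_ge1 H).
  lra.
have -> : K ^+ 5 * v ^+ 2 * (6 * (K * v)) = 6 * (K ^+ 6 * v ^+ 3) by ring.
have c : 10 <= 100 :> R by rewrite ler_nat.
have := Kv_le H c (isT : (45 < 46)%N) (leqnn 3); have := Kv_le H c (isT : (6 < 46)%N) (leqnn 3).
have := Kv_ge0 H 46 3.
rewrite (_ : K ^+ 37 * (K ^+ 8 * v ^+ 3) = K ^+ 45 * v ^+ 3); last by ring.
lra.
Qed.

Lemma sum_Wz W (z : 'cV[R]_n) : good d W -> \sum_a (W *m z) a 0 = 0.
Proof.
case=> _ _ h; under eq_bigr do rewrite mxE; rewrite exchange_big big1 //= => e _.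
by rewrite -mulr_suml h mul0r.
Qed.

(** This bilinear form appears when the count [C1] is expanded in W. It is tested with W [ze], whose
    increments are bounded because the degrees in [h] are at most [K]. *)
Lemma E_xi_W_ze_le : `|E (fun W => dot (xi W) (W *m ze W))| <= K ^+ 40 * v ^+ 3.
Proof.
have K0 := K_ge0 H; have v0 := v_ge0 H; have K1 := K_gt0 H; have v1 := v_gt0 H.
have A0 : 0 < K ^+ 2 * v ^+ 3 := Kv_gt0 H 2 3.
have kv : 0 <= 6 * K by nneg.
have h := test_bound H (phi := fun W a _ => (W *m ze W) a 0) A0 kv.
rewrite (eqE H (_ : forall W, good d W -> _ = \sum_a \sum_b hm d a b * (W *m ze W) a 0 * (g W a b - th d))); last first.
  move=> W gW; rewrite (hth_sum (fun a _ => (W *m ze W) a 0)) (sum_h_row H) sum_Wz // !mulr0 subr0.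
  by apply: eq_bigr => a _; rewrite big_ord1 [in LHS]mxE mulr_suml.
have zb W : good d W -> nF (ze W) <= v ^+ 2 * K ^+ 2.
  move=> gW; rewrite nF_cv; apply: le_trans (_ : \sum_(b < n) K ^+ 2 <= _).
    by apply: ler_sum => b _; have /andP[z0 z1] := ze01 b gW; apply: sqr_leX => //; apply: le_trans z1 (okyK H).
  by rewrite sum_constM card_ord ler_wpM2r ?exprn_ge0 // (okn H).
apply: le_trans (h _ _) _.
- apply: (Ele_c H) => W gW; rewrite (sum_h_row H (fun a => (W *m ze W) a 0 ^+ 2)) -nF_cv.
  apply: le_trans (_ : K * (v ^+ 4 * (v ^+ 2 * K ^+ 2)) <= _).
    apply: ler_pM; rewrite ?(okx0 H) ?(okxK H) ?nF_ge0 //.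
    apply: le_trans (nF_mul _ _) _; apply: ler_pM; rewrite ?nF_ge0 ?zb ?(nFW_le H) //.
  rewrite (_ : K * (v ^+ 4 * (v ^+ 2 * K ^+ 2)) = K ^+ 3 * v ^+ 6); last by ring.
  by rewrite (_ : (K ^+ 2 * v ^+ 3) ^+ 2 = K ^+ 4 * v ^+ 6); [exact: (Kv_le1 H)|ring].
- move=> W a b c e gW gW' ac be0; set D := Dl R a c b e in gW' *.
  have -> : ((W + D) *m ze (W + D)) a 0 - (W *m ze W) a 0 = (ze (W + D) b 0 - ze (W + D) e 0) + (W *m (ze (W + D) - ze W)) a 0.
    rewrite mulmxDl mulmxBr [X in X - _ = _]mxE [X in _ = _ + X]mxE [X in _ = _ + (_ + X)]mxE Dl_mullE pairv_a //; ring.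
  have zK b' W' : good d W' -> `|ze W' b' 0| <= K.
    by move=> g'; have /andP[z0 z1] := ze01 b' g'; rewrite ger0_norm // (le_trans z1) ?(okyK H).
  have hW : `|(W *m (ze (W + D) - ze W)) a 0| <= 4.
    have -> : (W *m (ze (W + D) - ze W)) a 0 = \sum_j pairv R b e j 0 * (W a j * (hm d a j - hm d c j)).
      rewrite mxE; apply: eq_bigr => j _; rewrite mxBE [ze (W + D) j 0]mxE [ze W j 0]mxE -sumrB.
      rewrite -(pairv_dot a c (fun i => hm d i j)) !mulr_sumr; apply: eq_bigr => i _.
      by rewrite gm_shift DlE !mxE; ring.
    rewrite (_ : 4 = 2 * (1 * 2)); last by ring.
    apply: pairv_sum_le => j; apply: normrM_le; first exact: (Wle1 H gW).
    rewrite -[leRHS]mulr1; apply: diff_le; rewrite ger0_norm ?(h_ge0 H) ?(h_le1 H) //.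
  apply: le_trans (normrD_le (diff_le (zK b _ gW') (zK e _ gW')) hW) _.
  by have := okK H; lra.
have c : 10 <= 100 :> R by rewrite ler_nat.
have := Kv_le H c (isT : (39 < 40)%N) (leqnn 3); have := Kv_le H c (isT : (6 < 40)%N) (isT : (2 <= 3)%N).
have := Kv_ge0 H 40 3.
lra.
Qed.

End TestedExpectations.

(** * Second moment of the overlap degrees; test matrices local to h *)

Section Pairs.
Variables (R : realFieldType) (m n : nat) (d : ensemble R m n) (H : ok d).
Implicit Types (W : 'M[R]_(m, n)).
Local Notation E := (Ex d).
Local Notation K := (KK d).
Local Notation v := (nu d).
Local Notation M := (mr R m).
Local Notation N := (nr R n).
Local Notation g := (gm d).

Lemma E_h_devm : E (fun W => \sum_a \sum_b hm d a b * `|devm d W a b|) <= K ^+ 32 * v ^+ 5.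
Proof.
have Kv0 : 0 < K * v by rewrite mulr_gt0 ?(K_gt0 H) ?(v_gt0 H).
rewrite (_ : K ^+ 32 * v ^+ 5 = (K * v) * (K ^+ 31 * v ^+ 4)); last by ring.
apply: (EcsS H (S1 := fun=> XX d) Kv0 (Kv_gt0 H 31 4) _ (Edev H)).
  by rewrite (Ec H); apply: XX_le1.
move=> W s gW s0; rewrite -(sumh H) mulrC mulr_suml [X in _ <= _ + X]mulr_suml -big_split /=; apply: ler_sum => a _.
rewrite mulr_suml [X in _ <= _ + X]mulr_suml -big_split /=; apply: ler_sum => b _.
have h1 := amgm 1 (devm d W a b) s0; rewrite mul1r expr1n mulr1 in h1.
apply: le_trans (ler_wpM2l (h_ge0 H a b) h1) _.
rewrite mulrDr lerD2l -mulrA ler_wpM2l ?(h_ge0 H) // ler_wpM2r ?invr_ge0 ?mulr_ge0 ?(ltW s0) //.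
by rewrite lerDl sqr_ge0.
Qed.

Lemma xi_diff W (a c : 'I_m) (b e : 'I_n) : a != c ->
  xi d (W + Dl R a c b e) a 0 - xi d W a 0 = hm d a b - hm d a e.
Proof.
move=> ac; rewrite !mxE -sumrB -(pairv_dot b e (fun j => hm d a j)); apply: eq_bigr => j _.
by rewrite gm_shift DlE !mxE eqxx (negPf ac) ?mulr1n ?mulr0n; ring.
Qed.

Lemma sum_xi_h W : \sum_a \sum_b hm d a b * (1 - g W a b) = XX d - Ov d W.
Proof. by rewrite -(sumh H) /Ov sum2B; apply: eq_bigr => a _; apply: eq_bigr => b _; ring. Qed.

(** Here the increments are the main term: a switch that inserts an edge ab of [h] raises [xi] at a
    by one unless ae lies in [h] too. The sum is therefore close to the number of switchings
    inserting an edge of [h]. *)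
Lemma dxi_le : `|E (fun W => \sum_a \sum_b \sum_c \sum_e hm d a b * (xi d (W + Dl R a c b e) a 0 - xi d W a 0) * wk d W a b c e)
   - LL d * dens d * (XX d - E (fun W => Ov d W))| <= K ^+ 33 * v ^+ 5.
Proof.
rewrite -[X in _ * (X - _)](Ec H) -(EB H) -(EZ H) -(EB H).
apply: le_trans (Eabs H _) _.
apply: (@le_trans _ _ (E (fun W => XX d * (6 * XX d) + \sum_a \sum_b hm d a b * `|devm d W a b|))).
  apply: (Ele H) => W gW.
  have e1 : \sum_a \sum_b \sum_c \sum_e hm d a b * chim d W a b c e =
     LL d * dens d * (XX d - Ov d W) + \sum_a \sum_b hm d a b * (1 - g W a b) * devm d W a b.
    rewrite -sum_xi_h -sum2Z -sum2D; apply: eq_bigr => a _; apply: eq_bigr => b _.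
    under eq_bigr do rewrite -mulr_sumr; rewrite -mulr_sumr sum_chim /devm; ring.
  rewrite [X in `|X| <= _](_ : _ = (\sum_a \sum_b \sum_c \sum_e hm d a b * (xi d (W + Dl R a c b e) a 0 - xi d W a 0) * wk d W a b c e
     - \sum_a \sum_b \sum_c \sum_e hm d a b * chim d W a b c e) + \sum_a \sum_b hm d a b * (1 - g W a b) * devm d W a b); last by rewrite e1; ring.
  apply: normrD_le; last first.
    apply: ler_norm_sumD => a; apply: ler_norm_sumD => b.
    rewrite !normrM (ger0_norm (h_ge0 H a b)) ler_wpM2r // ler_piMr ?(h_ge0 H) //.
    by have /andP[? ?] := gm01 a b gW; rewrite ger0_norm; lra.
  rewrite -(sumh H) mulr_suml -sumrB; apply: ler_norm_sumD => a; rewrite mulr_suml -sumrB; apply: ler_norm_sumD => b.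
  rewrite (_ : 6 * _ = 2 * (3 * XX d)); last by rewrite (sumh H); ring.
  rewrite -(sum_h3 H a b) -!sum2Z sum2B; apply: ler_norm_sumD => c; apply: ler_norm_sumD => e.
  have [z|nz] := eqVneq (chim d W a b c e) 0.
    rewrite /wk z !(mul0r, mulr0) subr0 normr0 mulr_ge0 ?(h_ge0 H) // mulr_ge0 // !addr_ge0 ?(h_ge0 H) //.
  have /andP[ac be0] := chim_neq gW nz.
  rewrite xi_diff // /wk -mulrA -mulrBr normrM (ger0_norm (h_ge0 H a b)).
  have [hz|h1] := okh H a b; first by rewrite hz !mul0r.
  rewrite h1 !mul1r.
  have /andP[m0 m1] := chim01 a b c e gW.
  have /andP[k0 k1] := kap01 H a e; have /andP[l0 l1] := kap01 H c b.
  have /andP[kl0 kl1] := kap2_le H a e c b.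
  have hc := h_ge0 H c e; have hcb := h_ge0 H c b.
  rewrite [X in `|X| <= _](_ : _ = - (chim d W a b c e * (1 - (1 - hm d a e) * (kap d a e * kap d c b)))); last by ring.
  rewrite normrN normrM (ger0_norm m0) -[leRHS]mul1r; apply: ler_pM => //.
  by have [z|z] := okh H a e; rewrite z ?subr0 ?mul1r ?subrr ?mul0r ?subr0 ?normr1; [rewrite ger0_norm; lra|lra].
rewrite (ED H) (Ec H); have e2 := E_h_devm; have x0 := XX_ge0 H; have x1 := XX_le H.
have : XX d * (6 * XX d) <= 6 * (K ^+ 2 * v ^+ 4).
  rewrite (_ : 6 * (K ^+ 2 * v ^+ 4) = (K * v ^+ 2) * (6 * (K * v ^+ 2))); last by ring.
  by apply: ler_pM; lra.
have c : 10 <= 100 :> R by rewrite ler_nat.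
have := Kv_le H c (isT : (32 < 33)%N) (leqnn 5); have := Kv_le H c (isT : (2 < 33)%N) (isT : (4 <= 5)%N).
have := Kv_ge0 H 33 5; lra.
Qed.

(** The value is that of independent edges: were each edge of [h] present with probability [th],
    every entry of [xi] would be binomial. *)
Lemma E_nF_xi_le : `|E (fun W => nF (xi d W)) - (th d ^+ 2 * xd d + th d * (1 - th d)) * XX d| <= K ^+ 42 * v.
Proof.
have K0 := K_ge0 H; have v0 := v_ge0 H; have K1 := K_gt0 H; have v1 := v_gt0 H.
have A0 : 0 < K ^+ 2 * v by rewrite mulr_gt0 ?exprn_gt0.
have h : `|LL d * DD d * E (fun W => \sum_a \sum_b hm d a b * xi d W a 0 * (g W a b - th d))
    - E (fun W => \sum_a \sum_b \sum_c \sum_e hm d a b * (xi d (W + Dl R a c b e) a 0 - xi d W a 0) * wk d W a b c e)|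
   <= K ^+ 33 * v ^+ 4 * (K ^+ 2 * v).
  apply: (test_switch H (phi := fun W a _ => xi d W a 0) A0).
  apply: (Ele_c H) => W gW; apply: le_trans (_ : \sum_a \sum_b hm d a b * K ^+ 2 <= _).
    apply: sum2_le => a b; rewrite ler_wpM2l ?(h_ge0 H) //; have /andP[x0 x1] := xi01 H a gW.
    by apply: sqr_leX => //; apply: le_trans x1 (okxK H).
  rewrite (sum_h_const H) (_ : (K ^+ 2 * v) ^+ 2 = (K * v) ^+ 2 * K ^+ 2); last by ring.
  by rewrite ler_wpM2r ?exprn_ge0 // XX_le1.
have e1 : E (fun W => \sum_a \sum_b hm d a b * xi d W a 0 * (g W a b - th d)) = E (fun W => nF (xi d W)) - th d * xd d * E (fun W => Ov d W).
  rewrite -(EZ H) -(EB H); apply: (eqE H) => W _; rewrite (hth_sum d (fun a _ => xi d W a 0)) (sum_h_row H) -Ov_xi mulrA; congr (_ - _).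
  rewrite nF_cv; apply: eq_bigr => a _; rewrite expr2 [X in _ = X * _]mxE mulr_suml //.
rewrite e1 in h; have h2 := dxi_le; have h3 := E_Ov_le H.
set S := E (fun W => nF (xi d W)) in h *; set O := E (fun W => Ov d W) in h h2 h3 *.
have h4 : `|(S - th d * xd d * O) - th d * (XX d - O)| <= K ^+ 4 * (2 * (K ^+ 35 * v)).
  apply: (LLD_div H); rewrite -[X in X * _](gtr0_norm (LLD_gt0 H)) -normrM.
  have -> : v ^+ 4 * (2 * (K ^+ 35 * v)) = K ^+ 33 * v ^+ 4 * (K ^+ 2 * v) + K ^+ 35 * v ^+ 5 by ring.
  have h2' : `|E (fun W => \sum_a \sum_b \sum_c \sum_e hm d a b * (xi d (W + Dl R a c b e) a 0 - xi d W a 0) * wk d W a b c e)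
   - LL d * dens d * (XX d - O)| <= K ^+ 35 * v ^+ 5 by apply: le_trans h2 _; apply: Kv_le1.
  apply: le_trans (normrD_le h h2'); rewrite le_eqVlt; apply/orP; left; apply/eqP; congr (`|_|).
  by rewrite -(DDth H); ring.
have tx : `|th d * (xd d - 1)| <= 1 * K.
  have /andP[t0 t1] := th01 H; apply: normrM_le; first by rewrite ger0_norm.
  by rewrite ler_norml; have := okx0 H; have := okxK H; have := okK H; move=> *; apply/andP; split; lra.
have h5 := normrM_le tx h3.
rewrite [X in `|X| <= _](_ : _ = ((S - th d * xd d * O) - th d * (XX d - O)) + th d * (xd d - 1) * (O - th d * XX d)); last by ring.
apply: le_trans (normrD_le h4 h5) _.
have c : 10 <= 100 :> R by rewrite ler_nat.
have := Kv_le H c (isT : (39 < 42)%N) (leqnn 1); have := Kv_le H c (isT : (40 < 42)%N) (leqnn 1).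
rewrite !expr1 => u1 u2; have := Kv_ge0 H 42 1; rewrite expr1.
rewrite (_ : 1 * K * (K ^+ 39 * v) = K ^+ 40 * v); last by ring.
rewrite (_ : K ^+ 4 * (2 * (K ^+ 35 * v)) = 2 * (K ^+ 39 * v)); last by ring.
lra.
Qed.

(** Meant for products of W with local matrices. Increments that are sizeable only when a corner
    lies in [h] sum to order [v ^+ 6] instead of [v ^+ 8], and division by [LL] leaves order
    [v ^+ 2]. *)
Lemma loop_small (F : 'M[R]_(m, n) -> 'M[R]_(m, n)) (B : 'I_m -> 'I_n -> 'I_m -> 'I_n -> R) :
  (forall a b c e, 0 <= B a b c e) ->
  (forall W a b c e, good d W -> good d (W + Dl R a c b e) -> a != c -> b != e ->
     `|F (W + Dl R a c b e) a b - F W a b| <= B a b c e) ->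
  \sum_a \sum_b \sum_c \sum_e B a b c e <= K ^+ 10 * v ^+ 6 ->
  (forall W, good d W -> nF (F W) <= K ^+ 4 * v ^+ 4) ->
  (forall W, good d W -> mbnd (F W) (K ^+ 2)) ->
  `|E (fun W => dot (F W) W)| <= K ^+ 37 * v ^+ 2.
Proof.
move=> B0 hB sB nf mf; have K0 := K_ge0 H; have v0 := v_ge0 H.
have := loop_bound H (B := fun=> B) (fun _ _ _ _ _ _ => B0 _ _ _ _) hB.
rewrite (Ec H) => L.
have x3 : 0 <= 3 * XX d by have := XX_ge0 H; lra.
have e1 : M * N * E (fun W => \sum_a \sum_b hm d a b * `|F W a b|) <= K ^+ 3 * v ^+ 6.
  rewrite (_ : K ^+ 3 * v ^+ 6 = v ^+ 4 * (K * v ^+ 2 * K ^+ 2)); last by ring.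
  have e0 : 0 <= E (fun W => \sum_a \sum_b hm d a b * `|F W a b|).
    by apply: (Ege0 H) => W gW; apply: sumr_ge0 => a _; apply: sumr_ge0 => b _; rewrite mulr_ge0 ?(h_ge0 H).
  apply: ler_pM => //; rewrite ?(MN_ge0) ?(MN_le H) //.
  apply: (Ele_c H) => W gW; apply: le_trans (_ : \sum_a \sum_b hm d a b * K ^+ 2 <= _).
    by apply: sum2_le => a b; rewrite ler_wpM2l ?(h_ge0 H) //; apply: mf.
  by rewrite (sum_h_const H) ler_wpM2r ?exprn_ge0 ?(XX_le H).
have e2 : 3 * XX d * E (fun W => \sum_a \sum_b `|F W a b|) <= 3 * (K ^+ 3 * v ^+ 6).
  rewrite (_ : 3 * (K ^+ 3 * v ^+ 6) = 3 * (K * v ^+ 2) * (v ^+ 4 * K ^+ 2)); last by ring.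
  have e0 : 0 <= E (fun W => \sum_a \sum_b `|F W a b|).
    by apply: (Ege0 H) => W gW; apply: sumr_ge0 => a _; apply: sumr_ge0 => b _.
  apply: ler_pM => //; first by rewrite ler_wpM2l ?(XX_le H).
  apply: (Ele_c H) => W gW; apply: le_trans (_ : \sum_(a < m) \sum_(b < n) K ^+ 2 <= _).
    by apply: sum2_le => a b; apply: mf.
  by rewrite !sum_constM !card_ord mulrA ler_wpM2r ?exprn_ge0 // (MN_le H).
have e3 : `|E (fun W => dot (F W) (YY d W))| <= K ^+ 32 * v ^+ 6.
  apply: le_trans (Eabs H _) _.
  rewrite (_ : K ^+ 32 * v ^+ 6 = (K ^+ 2 * v ^+ 2) * (K ^+ 30 * v ^+ 4)); last by ring.
  apply: (EcsS H (S1 := fun W => nF (F W)) (S2 := fun W => nF (YY d W)) (Kv_gt0 H 2 2) (Kv_gt0 H 30 4)).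
  - by apply: (Ele_c H) => W gW; rewrite (_ : (K ^+ 2 * v ^+ 2) ^+ 2 = K ^+ 4 * v ^+ 4); [exact: nf|ring].
  - apply: le_trans (E_nF_YY_le H) _; rewrite (_ : (K ^+ 30 * v ^+ 4) ^+ 2 = K ^+ 60 * v ^+ 8); last by ring.
    exact: (Kv_le1 H).
  - by move=> W s gW s0; apply: dot_amgm.
have t : LL d * `|E (fun W => dot (F W) W)| <= K ^+ 33 * v ^+ (2 + 4).
  rewrite -[X in X * _](gtr0_norm (LL_gt0 H)) -normrM -[X in `|X|](addrK (E (fun W => dot (F W) (YY d W)))).
  apply: le_trans (normrB_le L e3) _.
  have c : 10 <= 100 :> R by rewrite ler_nat.
  have := Kv_le H c (isT : (10 < 33)%N) (leqnn 6); have := Kv_le H c (isT : (32 < 33)%N) (leqnn 6).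
  have := Kv_le H c (isT : (3 < 33)%N) (leqnn 6); have := Kv_ge0 H 33 6.
  rewrite (_ : (2 + 4)%N = 6%N) //; lra.
apply: le_trans (LL_div H (normr_ge0 _) t) _; exact: (Kv_le1 H).
Qed.

(** Matrices supported on [h] whose entries are 1-Lipschitz functions of the entry of W at the same
    place. Their rows and columns have at most [K] nonzero entries, so products with them cost
    powers of [K] only. *)
Definition loc (G : 'M[R]_(m, n) -> 'M[R]_(m, n)) :=
  (forall W a b, good d W -> `|G W a b| <= hm d a b) /\
  (forall W D a b, `|G (W + D) a b - G W a b| <= hm d a b * `|D a b|).

Lemma sum_pairv_abs k (a c : 'I_k) (u : 'I_k -> R) : (forall i, 0 <= u i) ->
  \sum_i `|pairv R a c i 0| * u i <= u a + u c.
Proof.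
move=> u0; apply: (@le_trans _ _ (\sum_i ((i == a)%:R + (i == c)%:R) * u i)).
  apply: ler_sum => i _; rewrite ler_wpM2r // mxE; apply: le_trans (ler_normB _ _) _.
  by rewrite !ger0_norm ?ler0n.
under eq_bigr do rewrite mulrDl; rewrite big_split /=.
have s (x : 'I_k) : \sum_(i < k) (i == x)%:R * u i = u x.
  by rewrite (bigD1 x) //= eqxx mul1r big1 ?addr0 // => i /negPf ->; rewrite mul0r.
by rewrite !s.
Qed.

Lemma loc_row G W a (u : 'I_n -> R) c : loc G -> good d W -> (forall k, `|u k| <= c) -> 0 <= c ->
  `|\sum_k G W a k * u k| <= K * c.
Proof.
move=> [l1 _] gW hu c0; apply: le_trans (_ : \sum_k hm d a k * c <= _).
  by apply: ler_norm_sumD => k; apply: normrM_le => //; apply: l1.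
by rewrite -mulr_suml (okx H) ler_wpM2r // (okxK H).
Qed.

Lemma loc_col G W b (u : 'I_m -> R) c : loc G -> good d W -> (forall k, `|u k| <= c) -> 0 <= c ->
  `|\sum_k u k * G W k b| <= c * K.
Proof.
move=> [l1 _] gW hu c0; apply: le_trans (_ : \sum_k c * hm d k b <= _).
  by apply: ler_norm_sumD => k; apply: normrM_le => //; apply: l1.
by rewrite -mulr_sumr (oky H) ler_wpM2l // (okyK H).
Qed.

Lemma loc_drow G W (a c : 'I_m) (b e : 'I_n) (u : 'I_n -> R) c0 i : loc G -> (forall k, `|u k| <= c0) ->
  `|\sum_k (G (W + Dl R a c b e) i k - G W i k) * u k| <= (hm d i b + hm d i e) * c0.
Proof.
move=> [_ l2] hu; have c00 : 0 <= c0 by apply: le_trans (hu b).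
apply: (@le_trans _ _ (\sum_k `|pairv R b e k 0| * (hm d i k * c0))); last first.
  apply: le_trans (sum_pairv_abs b e (u := fun k => hm d i k * c0) _) _; last by rewrite mulrDl.
  by move=> k; rewrite mulr_ge0 ?(h_ge0 H).
apply: ler_norm_sumD => k; rewrite mulrA; apply: normrM_le => //.
apply: le_trans (l2 _ _ _ _) _; rewrite mulrC ler_wpM2r ?(h_ge0 H) //.
rewrite [Dl _ _ _ _ _ _ _]mxE big_ord1 normrM -[leRHS]mul1r ler_pM //; first exact: pairv_le.
by rewrite [X in `|X|]mxE.
Qed.

Lemma loc_dcol G W (a c : 'I_m) (b e : 'I_n) (u : 'I_m -> R) c0 j : loc G -> (forall k, `|u k| <= c0) ->
  `|\sum_k u k * (G (W + Dl R a c b e) k j - G W k j)| <= c0 * (hm d a j + hm d c j).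
Proof.
move=> [_ l2] hu; have c00 : 0 <= c0 by apply: le_trans (hu a).
apply: (@le_trans _ _ (\sum_k `|pairv R a c k 0| * (hm d k j * c0))); last first.
  apply: le_trans (sum_pairv_abs a c (u := fun k => hm d k j * c0) _) _; last by rewrite -mulrDl mulrC.
  by move=> k; rewrite mulr_ge0 ?(h_ge0 H).
apply: ler_norm_sumD => k; rewrite (mulrC (u k)) mulrA; apply: normrM_le => //.
apply: le_trans (l2 _ _ _ _) _; rewrite mulrC ler_wpM2r ?(h_ge0 H) //.
rewrite [Dl _ _ _ _ _ _ _]mxE big_ord1 normrM -[leRHS]mulr1 ler_pM //; first by rewrite [X in `|X|]mxE pairv_le.
Qed.

Lemma loc_nF k G W (A : 'M[R]_(n, k)) : loc G -> good d W -> nF (G W *m A) <= K ^+ 2 * nF A.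
Proof.
move=> [l1 _] gW; rewrite expr2; apply: (nF_dom (h := hm d)).
- exact: K_ge0.
- by move=> i j; apply: l1.
- by move=> i; rewrite (okx H) (okxK H).
- by move=> i; rewrite (oky H) (okyK H).
Qed.

Lemma loc_nFt k G W (A : 'M[R]_(m, k)) : loc G -> good d W -> nF ((G W)^T *m A) <= K ^+ 2 * nF A.
Proof.
move=> [l1 _] gW; rewrite expr2; apply: (nF_dom (h := (hm d)^T)).
- exact: K_ge0.
- by move=> i j; rewrite !mxE; apply: l1.
- by move=> i; under eq_bigr do rewrite mxE; rewrite (oky H) (okyK H).
- by move=> i; under eq_bigr do rewrite mxE; rewrite (okx H) (okxK H).
Qed.

Lemma sum4_h : [/\ \sum_a \sum_(b < n) \sum_(c < m) \sum_e hm d a e = XX d * (M * N),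
  \sum_a \sum_b \sum_(c < m) \sum_(e < n) hm d a b = XX d * (M * N) &
  \sum_(a < m) \sum_b \sum_c \sum_(e < n) hm d c b = XX d * (M * N)].
Proof.
split.
- under eq_bigr do rewrite !sum_constM !card_ord (okx H).
  by rewrite sum_constM card_ord /XX /mr /nr; ring.
- under eq_bigr => a _ do (under eq_bigr do rewrite !sum_constM !card_ord; rewrite -!mulr_sumr (okx H)).
  by rewrite sum_constM card_ord /XX /mr /nr; ring.
- rewrite sum_constM card_ord; under eq_bigr do (under eq_bigr do rewrite sum_constM card_ord; rewrite -mulr_sumr (oky H)).
  by rewrite sum_constM card_ord (XXn H) /mr /nr; ring.
Qed.
End Pairs.

(** * Forms with two local factors *)

Section Quad.
Variables (R : realFieldType) (m n : nat) (d : ensemble R m n) (H : ok d).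
Implicit Types (W : 'M[R]_(m, n)).
Local Notation E := (Ex d).
Local Notation K := (KK d).
Local Notation v := (nu d).
Local Notation M := (mr R m).
Local Notation N := (nr R n).

Lemma sum4D (f1 f2 : 'I_m -> 'I_n -> 'I_m -> 'I_n -> R) :
  \sum_a \sum_b \sum_c \sum_e (f1 a b c e + f2 a b c e) =
  \sum_a \sum_b \sum_c \sum_e f1 a b c e + \sum_a \sum_b \sum_c \sum_e f2 a b c e.
Proof.
by rewrite -big_split; apply: eq_bigr => ? _; rewrite -big_split; apply: eq_bigr => ? _;
   rewrite -big_split; apply: eq_bigr => ? _; rewrite -big_split.
Qed.
Lemma sum4Z c (f1 : 'I_m -> 'I_n -> 'I_m -> 'I_n -> R) :
  \sum_a \sum_b \sum_a' \sum_b' (c * f1 a b a' b') = c * \sum_a \sum_b \sum_a' \sum_b' f1 a b a' b'.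
Proof.
by rewrite mulr_sumr; apply: eq_bigr => ? _; rewrite mulr_sumr; apply: eq_bigr => ? _;
   rewrite mulr_sumr; apply: eq_bigr => ? _; rewrite mulr_sumr.
Qed.

Lemma XMN_le : XX d * (M * N) <= K * v ^+ 6.
Proof.
rewrite (_ : K * v ^+ 6 = K * v ^+ 2 * v ^+ 4); last by ring.
by apply: ler_pM; rewrite ?(XX_ge0 H) ?(XX_le H) ?MN_ge0 ?(MN_le H).
Qed.

Section Q.
Variables (G1 G2 : 'M[R]_(m, n) -> 'M[R]_(m, n)).
Hypotheses (L1 : loc d G1) (L2 : loc d G2).

Lemma mbnd_WtG W b : good d W -> forall k, `|(W^T *m G2 W) k b| <= K.
Proof.
move=> gW k; rewrite mxE -[leRHS]mul1r; apply: (loc_col H (u := fun j => W^T k j) b L2 gW) => // j.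
by rewrite mxE; apply: (Wle1 H gW).
Qed.
Lemma mbnd_GWt W a : good d W -> forall k, `|(G1 W *m W^T) a k| <= K.
Proof.
move=> gW k; rewrite mxE -[leRHS]mulr1; apply: (loc_row H (u := fun j => W^T j k) a L1 gW) => // j.
by rewrite mxE; apply: (Wle1 H gW).
Qed.

Lemma mbnd_WGt W a k : good d W -> `|(W *m (G1 W)^T) a k| <= K.
Proof.
move=> gW; rewrite mxE; under eq_bigr do rewrite mxE mulrC.
rewrite -[leRHS]mulr1; apply: (loc_row H (u := fun j => W a j) k L1 gW) => // j.
exact: (Wle1 H gW).
Qed.

(** Changing either local factor, or W between them, is felt at ab only if ab, ae or cb is an edge
    of [h]. *)
Lemma loop_quadratic : `|E (fun W => dot (G1 W *m W^T *m G2 W) W)| <= K ^+ 37 * v ^+ 2.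
Proof.
have K0 := K_ge0 H; have v0 := v_ge0 H; have K100 := okK H.
apply: (loop_small H (F := fun W => G1 W *m W^T *m G2 W)
  (B := fun a b c e => 4 * K * (hm d a e + hm d a b + hm d c b))).
- by move=> a b c e; rewrite mulr_ge0 ?mulr_ge0 // !addr_ge0 ?(h_ge0 H).
- move=> W a b c e gW gW' ac be0; set D := Dl R a c b e in gW' *; set W' := W + D in gW' *.
  have -> : (G1 W' *m W'^T *m G2 W') a b - (G1 W *m W^T *m G2 W) a b =
    \sum_k (G1 W' a k - G1 W a k) * (W'^T *m G2 W') k b
    + (G1 W *m D^T *m G2 W') a b + \sum_k (G1 W *m W^T) a k * (G2 W' k b - G2 W k b).
    have e1 : \sum_k (G1 W' a k - G1 W a k) * (W'^T *m G2 W') k b = (G1 W' *m W'^T *m G2 W') a b - (G1 W *m W'^T *m G2 W') a b.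
      by rewrite -!mulmxA [X in X - _]mxE [X in _ - X]mxE -sumrB; apply: eq_bigr => k _; rewrite mulrBl.
    have e2 : \sum_k (G1 W *m W^T) a k * (G2 W' k b - G2 W k b) = (G1 W *m W^T *m G2 W') a b - (G1 W *m W^T *m G2 W) a b.
      by rewrite [X in X - _]mxE [X in _ - X]mxE -sumrB; apply: eq_bigr => k _; rewrite mulrBr.
    have e3 : (G1 W *m D^T *m G2 W') a b = (G1 W *m W'^T *m G2 W') a b - (G1 W *m W^T *m G2 W') a b.
      rewrite -mxBE -mulmxBl -mulmxBr; congr ((_ *m _ *m _) _ _).
      by rewrite /W' linearD /= addrC addKr.
    by rewrite e1 e2 e3; ring.
  have t1 : `|\sum_k (G1 W' a k - G1 W a k) * (W'^T *m G2 W') k b| <= (hm d a b + hm d a e) * K.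
    by apply: (loc_drow H W a c b e (u := fun k => (W'^T *m G2 W') k b) a L1) => k; apply: mbnd_WtG.
  have t3 : `|\sum_k (G1 W *m W^T) a k * (G2 W' k b - G2 W k b)| <= K * (hm d a b + hm d c b).
    by apply: (loc_dcol H W a c b e (u := fun k => (G1 W *m W^T) a k) b L2) => k; apply: mbnd_GWt.
  have t2 : `|(G1 W *m D^T *m G2 W') a b| <= (hm d a b + hm d a e) * 2.
    rewrite Dl_tr (_ : G1 W *m Dl R b e a c *m G2 W' = (G1 W *m pairv R b e) *m ((pairv R a c)^T *m G2 W')); last by rewrite /Dl !mulmxA.
    rewrite mxE big_ord1 pairv_mulr pairv_mull; case: L1 => l1 _; case: L2 => l2 _.
    apply: normrM_le; first by apply: normrB_le; apply: l1.
    by rewrite -[leRHS]mulr1; apply: diff_le; apply: le_trans (l2 _ _ _ gW') (h_le1 H _ _).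
  apply: le_trans (normrD_le (normrD_le t1 t2) t3) _.
  have := h_ge0 H a b; have := h_ge0 H a e; have := h_ge0 H c b.
  move: (hm d a b) (hm d a e) (hm d c b) => p q r r0 q0 p0.
  have := mulr_ge0 K0 p0; have := mulr_ge0 K0 q0; have := mulr_ge0 K0 r0.
  have : 2 * p <= K * p by rewrite ler_wpM2r //; lra.
  have : 2 * q <= K * q by rewrite ler_wpM2r //; lra.
  lra.
- have [s1 s2 s3] := sum4_h H.
  rewrite sum4Z !sum4D s1 s2 s3.
  have := XMN_le; have := Kv_le H (_ : 12 <= 100) (isT : (2 < 10)%N) (leqnn 6).
  have c : 12 <= 100 :> R by rewrite ler_nat.
  move=> /(_ c) h1 h2; apply: le_trans h1.
  rewrite (_ : 12 * (K ^+ 2 * v ^+ 6) = 4 * K * (3 * (K * v ^+ 6))); last by ring.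
  by apply: ler_wpM2l; [nneg|lra].
- move=> W gW; rewrite -mulmxA; apply: le_trans (loc_nF H _ L1 gW) _.
  rewrite (_ : K ^+ 4 * v ^+ 4 = K ^+ 2 * (K ^+ 2 * v ^+ 4)); last by ring.
  rewrite ler_wpM2l ?exprn_ge0 //.
  rewrite -nF_tr trmx_mul trmxK; apply: le_trans (loc_nFt H _ L2 gW) _.
  by rewrite ler_wpM2l ?exprn_ge0 // (nFW_le H).
- move=> W gW a b; rewrite -mulmxA mxE expr2.
  by apply: (loc_row H (u := fun k => (W^T *m G2 W) k b) a L1 gW) => // k; apply: mbnd_WtG.
Qed.

Definition Nt W : 'M[R]_n := (G1 W)^T *m G2 W.

(** The pairing of W [Nt] with W is the sum of the entries of [Nt] times those of [Mv]. Diagonal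
    entries of [Mv] are sums of squares of order [v ^+ 2], so a diagonal of [Nt] would contribute
    order [v ^+ 4]. *)
Hypothesis Nt0 : forall W b, good d W -> Nt W b b = 0.

Lemma Nt_le W b e : good d W -> `|Nt W b e| <= ((hm d)^T *m hm d) b e.
Proof.
move=> gW; rewrite !mxE; apply: ler_norm_sumD => j; rewrite !mxE.
by apply: normrM_le; [case: L1 => l _; apply: l | case: L2 => l _; apply: l].
Qed.

Lemma sum_hh : \sum_b \sum_e ((hm d)^T *m hm d) b e = XX d * xd d.
Proof.
under eq_bigr do under eq_bigr do rewrite mxE.
under eq_bigr do rewrite exchange_big /=.
rewrite exchange_big /= -(sumh H) mulr_suml; apply: eq_bigr => a _; rewrite mulr_suml; apply: eq_bigr => b _.
by rewrite -(okx H a) mulr_sumr; apply: eq_bigr => e _; rewrite mxE.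
Qed.

Lemma loop_Nt : `|E (fun W => dot (W *m Nt W) W)| <= K ^+ 37 * v ^+ 2.
Proof.
have K0 := K_ge0 H; have v0 := v_ge0 H; have K100 := okK H.
have hh0 b e : 0 <= ((hm d)^T *m hm d) b e.
  by rewrite mxE; apply: sumr_ge0 => j _; rewrite mxE mulr_ge0 ?(h_ge0 H).
apply: (loop_small H (F := fun W => W *m Nt W)
  (B := fun a b c e => ((hm d)^T *m hm d) e b + 4 * K * (hm d a b + hm d c b))).
- by move=> a b c e; rewrite addr_ge0 // mulr_ge0 ?mulr_ge0 // !addr_ge0 ?(h_ge0 H).
- move=> W a b c e gW gW' ac be0; set D := Dl R a c b e in gW' *; set W' := W + D in gW' *.
  have -> : (W' *m Nt W') a b - (W *m Nt W) a b = (D *m Nt W') a b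
    + \sum_j (W *m (G1 W' - G1 W)^T) a j * G2 W' j b + \sum_j (W *m (G1 W)^T) a j * (G2 W' j b - G2 W j b).
    have e1 : \sum_j (W *m (G1 W' - G1 W)^T) a j * G2 W' j b = (W *m (G1 W')^T *m G2 W') a b - (W *m (G1 W)^T *m G2 W') a b.
      rewrite -mxBE -mulmxBl -mulmxBr (_ : (G1 W')^T - (G1 W)^T = (G1 W' - G1 W)^T); last by rewrite linearB.
      by rewrite [RHS]mxE.
    have e2 : \sum_j (W *m (G1 W)^T) a j * (G2 W' j b - G2 W j b) = (W *m (G1 W)^T *m G2 W') a b - (W *m (G1 W)^T *m G2 W) a b.
      by rewrite [X in X - _]mxE [X in _ - X]mxE -sumrB; apply: eq_bigr => k _; rewrite mulrBr.
    have e3 : (D *m Nt W') a b = (W' *m Nt W') a b - (W *m Nt W') a b.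
      by rewrite -mxBE -mulmxBl /W' (addrC W) addrK.
    by rewrite e1 e2 e3 /Nt !mulmxA; ring.
  have t1 : `|(D *m Nt W') a b| <= ((hm d)^T *m hm d) e b.
    by rewrite Dl_mullE pairv_a // mul1r Nt0 // sub0r normrN; apply: Nt_le.
  have t3 : `|\sum_j (W *m (G1 W)^T) a j * (G2 W' j b - G2 W j b)| <= K * (hm d a b + hm d c b).
    apply: (loc_dcol H W a c b e (u := fun j => (W *m (G1 W)^T) a j) b L2) => k; apply: (mbnd_WGt _ _ gW).
  have t2 : `|\sum_j (W *m (G1 W' - G1 W)^T) a j * G2 W' j b| <= 2 * (hm d a b + hm d c b).
    apply: (@le_trans _ _ (\sum_j `|pairv R a c j 0| * (2 * hm d j b))); last first.
      apply: le_trans (sum_pairv_abs a c (u := fun j => 2 * hm d j b) _) _; last by lra.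
      by move=> j; rewrite mulr_ge0 ?(h_ge0 H).
    apply: ler_norm_sumD => j; rewrite mulrA; apply: normrM_le; last by case: L2 => l _; apply: l.
    rewrite mxE; apply: le_trans (_ : \sum_k `|pairv R b e k 0| * `|pairv R a c j 0| <= _); last first.
      apply: le_trans (sum_pairv_abs b e (u := fun=> `|pairv R a c j 0|) _) _ => //; lra.
    apply: ler_norm_sumD => k; rewrite normrM -[leRHS]mul1r; apply: ler_pM => //; first exact: (Wle1 H gW).
    rewrite mxE mxBE; case: L1 => _ l; apply: le_trans (l _ _ _ _) _.
    rewrite -[leRHS]mul1r; apply: ler_pM; rewrite ?(h_ge0 H) ?(h_le1 H) //.
    by rewrite DlE normrM mulrC !mxE.
  apply: le_trans (normrD_le (normrD_le t1 t2) t3) _.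
  have := h_ge0 H a b; have := h_ge0 H c b.
  move: (hm d a b) (hm d c b) => p r r0 p0.
  have := mulr_ge0 K0 p0; have := mulr_ge0 K0 r0.
  have : 2 * p <= K * p by rewrite ler_wpM2r //; lra.
  have : 2 * r <= K * r by rewrite ler_wpM2r //; lra.
  lra.
- have [_ s2 s3] := sum4_h H.
  rewrite sum4D sum4Z sum4D s2 s3.
  have -> : \sum_(a < m) \sum_b \sum_(c < m) \sum_e ((hm d)^T *m hm d) e b = M ^+ 2 * (XX d * xd d).
    transitivity (\sum_(a < m) \sum_b M * \sum_e ((hm d)^T *m hm d) e b).
      by apply: eq_bigr => a _; apply: eq_bigr => b _; rewrite sum_constM card_ord.
    by rewrite sum_constM card_ord -mulr_sumr exchange_big /= sum_hh /mr; ring.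
  have h2 := XMN_le; have c : 12 <= 100 :> R by rewrite ler_nat.
  have h1 := Kv_le H c (isT : (2 < 10)%N) (leqnn 6).
  have h3 : M ^+ 2 * (XX d * xd d) <= K ^+ 2 * v ^+ 6.
    rewrite (_ : K ^+ 2 * v ^+ 6 = (v ^+ 2) ^+ 2 * (K * v ^+ 2 * K)); last by ring.
    apply: ler_pM; rewrite ?sqr_ge0 ?mulr_ge0 ?(XX_ge0 H) ?(okx0 H) //.
      by apply: sqr_leX (okm H); apply: M_ge0.
    by apply: ler_pM; rewrite ?(XX_ge0 H) ?(okx0 H) ?(XX_le H) ?(okxK H).
  have h4 : 4 * K * (XX d * (M * N) + XX d * (M * N)) <= 8 * (K ^+ 2 * v ^+ 6).
    rewrite (_ : 8 * (K ^+ 2 * v ^+ 6) = 4 * K * (2 * (K * v ^+ 6))); last by ring.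
    by apply: ler_wpM2l; [nneg|lra].
  have := Kv_ge0 H 2 6; lra.
- move=> W gW; rewrite -nF_tr trmx_mul /Nt trmx_mul trmxK -mulmxA; apply: le_trans (loc_nFt H _ L2 gW) _.
  rewrite (_ : K ^+ 4 * v ^+ 4 = K ^+ 2 * (K ^+ 2 * v ^+ 4)); last by ring.
  rewrite ler_wpM2l ?exprn_ge0 //; apply: le_trans (loc_nF H _ L1 gW) _.
  by rewrite nF_tr ler_wpM2l ?exprn_ge0 // (nFW_le H).
- move=> W gW a b; rewrite /Nt mulmxA mxE expr2.
  apply: (loc_col H (u := fun j => (W *m (G1 W)^T) a j) b L2 gW) => // k; apply: (mbnd_WGt _ _ gW).
Qed.

End Q.
End Quad.

(** * Column codegrees and the first-order increment of W G^T W *)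

Section Columns.
Variables (R : realFieldType) (m n : nat) (d : ensemble R m n) (H : ok d).
Implicit Types (W : 'M[R]_(m, n)).
Local Notation E := (Ex d).
Local Notation K := (KK d).
Local Notation v := (nu d).
Local Notation M := (mr R m).
Local Notation N := (nr R n).
Local Notation g := (gm d).

(** Number of rows with an edge in column [b] and none in column [e]. Summed over both rows, [chim]
    factors into the two codegrees of its columns. *)
Definition Kc W b e : R := \sum_c (1 - g W c e) * g W c b.
Definition c0 : R := M * (dens d * (1 - dens d)).
Definition kd W b e : R := Kc W b e - c0.

Lemma Kc_eq W b e : good d W -> Kc W b e =
  M * (dens d + be d b 0) * (1 - dens d - be d e 0) - na d - ga d W b 0 - ga d W e 0 - Mv W b e.
Proof.
move=> gW; rewrite /Kc.
have -> : \sum_c (1 - g W c e) * g W c b = (1 - dens d - be d e 0) * \sum_c g W c b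
   - \sum_c g W c b * al d c 0 - \sum_c W c e * g W c b.
  by rewrite mulr_sumr -!sumrB; apply: eq_bigr => c _; rewrite {1}/gm; ring.
rewrite (sum_g_col H) // (sum_g_al H) //.
have -> : \sum_c W c e * g W c b = ga d W e 0 + Mv W b e.
  transitivity (\sum_c ((dens d + be d b 0) * W c e + W c e * al d c 0 + W c b * W c e)).
    by apply: eq_bigr => c _; rewrite /gm; ring.
  case: gW => _ _ h; rewrite !big_split /= -mulr_sumr h mulr0 add0r gaE mxE; congr (_ + _).
  by apply: eq_bigr => c _; rewrite mxE.
ring.
Qed.

Lemma Kc_bnd W b e : good d W -> `|Kc W b e| <= v ^+ 2.
Proof.
move=> gW; apply: le_trans (_ : \sum_(c < m) 1 <= _); last by rewrite sum_constM card_ord mulr1 (okm H).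
apply: ler_norm_sumD => c; have /andP[? ?] := gm01 c e gW; have /andP[? ?] := gm01 c b gW.
by rewrite ger0_norm ?mulr_ge0 ?mulr_ile1 ?subr_ge0 // lerBlDr lerDl.
Qed.

Lemma c0_bnd : `|c0| <= v ^+ 2.
Proof.
have l0 := dens_gt0 H; have l1 := dens_lt1 H.
have z0 : 0 <= dens d * (1 - dens d) by nra.
have z1 : dens d * (1 - dens d) <= 1 by nra.
rewrite /c0 -[leRHS]mulr1; apply: normrM_le; rewrite ger0_norm ?M_ge0 ?(okm H) //.
Qed.

Lemma kd_le W b e : good d W -> `|kd W b e| <= 4 * (K * v) + (`|ga d W b 0| + `|ga d W e 0|) + `|Mv W b e|.
Proof.
move=> gW; have K0 := K_gt0 H; have v0 := v_gt0 H.
have hb := be_le1 H b; have he := be_le1 H e; have kb := be_le H b; have ke := be_le H e.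
rewrite /kd Kc_eq //.
set A := M * (be d b 0 * (1 - dens d) - dens d * be d e 0 - be d b 0 * be d e 0) - na d.
rewrite (_ : _ - c0 = A - (ga d W b 0 + ga d W e 0) - Mv W b e); last by rewrite /A /c0; ring.
apply: normrB_le => //; apply: normrB_le; last exact: ler_normD.
have l0 := dens_gt0 H; have l1 := dens_lt1 H.
apply: le_trans (_ : v ^+ 2 * (K / v * 1 + 1 * (K / v) + K / v * 1) + K ^+ 2 <= _).
  apply: normrB_le; last by rewrite ger0_norm ?na_ge0 //; apply: na_le.
  apply: normrM_le; first by rewrite ger0_norm ?M_ge0 ?(okm H).
  have n1 : `|1 - dens d| <= 1 by rewrite ger0_norm; lra.
  have n2 : `|dens d| <= 1 by rewrite ger0_norm; lra.
  have n3 : `|be d e 0| <= 1 by lra.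
  by apply: normrB_le; [apply: normrB_le|]; apply: normrM_le.
have -> : v ^+ 2 * (K / v * 1 + 1 * (K / v) + K / v * 1) = 3 * (K * v) by field; rewrite gt_eqF.
have : K ^+ 2 <= K * v by rewrite expr2 ler_wpM2l ?(v_geK H) // ltW.
lra.
Qed.

Lemma Ekd : E (fun W => \sum_b \sum_e kd W b e ^+ 2) <= K ^+ 16 * v ^+ 6.
Proof.
have K0 := K_ge0 H; have v0 := v_ge0 H.
apply: le_trans (_ : E (fun W => 4 * (N ^+ 2 * (16 * (K ^+ 2 * v ^+ 2)) + 2 * N * nF (ga d W) + nF (Mv W))) <= _).
  apply: (Ele H) => W gW.
  apply: (@le_trans _ _ (\sum_b \sum_e 4 * (16 * (K ^+ 2 * v ^+ 2) + (ga d W b 0 ^+ 2 + ga d W e 0 ^+ 2) + Mv W b e ^+ 2))).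
    apply: ler_sum => b _; apply: ler_sum => e _; apply: le_trans (sqr_le_norm (kd_le b e gW)) _.
    rewrite -(real_normK (num_real (ga d W b 0))) -(real_normK (num_real (ga d W e 0))) -(real_normK (num_real (Mv W b e))).
    move: `|ga d W b 0| `|ga d W e 0| `|Mv W b e| => p q r.
    have -> : 16 * (K ^+ 2 * v ^+ 2) = (4 * (K * v)) ^+ 2 by ring.
    move: (4 * (K * v)) => k.
    have := sqr_ge0 (k - p); have := sqr_ge0 (k - q); have := sqr_ge0 (k - r); have := sqr_ge0 (p - q).
    have := sqr_ge0 (p - r); have := sqr_ge0 (q - r); lra.
  under eq_bigr do rewrite -mulr_sumr; rewrite -mulr_sumr ler_wpM2l //.
  under eq_bigr do rewrite !big_split /= !sum_constM card_ord -/(nr R n) -nF_cv.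
  rewrite !big_split /= !sum_constM card_ord -/(nr R n) -mulr_sumr -nF_cv -nFE.
  by rewrite le_eqVlt; apply/orP; left; apply/eqP; ring.
rewrite (EZ H) 2!(ED H) (Ec H) (EZ H).
have t1 : N ^+ 2 * (16 * (K ^+ 2 * v ^+ 2)) <= 16 * (K ^+ 2 * v ^+ 6).
  rewrite (_ : 16 * (K ^+ 2 * v ^+ 6) = (v ^+ 2) ^+ 2 * (16 * (K ^+ 2 * v ^+ 2))); last by ring.
  by rewrite ler_wpM2r ?sqr_leX ?N_ge0 ?(okn H) //; nneg.
have t2 : 2 * N * E (fun W => nF (ga d W)) <= 2 * (K ^+ 44 * v ^+ 4).
  rewrite (_ : 2 * (K ^+ 44 * v ^+ 4) = 2 * v ^+ 2 * (K ^+ 44 * v ^+ 2)); last by ring.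
  apply: ler_pM; rewrite ?mulr_ge0 ?N_ge0 ?EnF_ge0 ?ler_wpM2l ?(okn H) //.
  by have := E_nF_ga_gb_le H; have := EnF_ge0 H (gb d); lra.
have [t3 _] := E_gram_le H.
have t4 := K_le_v H 4 (isT : (44 <= 100)%N).
have c : 100 <= 100 :> R by rewrite ler_nat.
have := Kv_le H c (isT : (2 < 16)%N) (leqnn 6); have := Kv_le H c (isT : (0 < 16)%N) (isT : (5 <= 6)%N).
have := Kv_le H c (isT : (13 < 16)%N) (leqnn 6); have := Kv_ge0 H 16 6; rewrite expr0.
lra.
Qed.

Lemma sum_chim_col W (p : 'I_n -> 'I_n -> R) :
  \sum_a \sum_b \sum_c \sum_e p b e * chim d W a b c e = \sum_b \sum_e p b e * (Kc W e b * Kc W b e).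
Proof.
rewrite exchange_big /=; apply: eq_bigr => b _.
transitivity (\sum_a \sum_e \sum_c p b e * chim d W a b c e).
  by apply: eq_bigr => a _; rewrite exchange_big.
rewrite exchange_big /=; apply: eq_bigr => e _.
rewrite /Kc mulr_suml mulr_sumr; apply: eq_bigr => a _; rewrite mulr_sumr mulr_sumr; apply: eq_bigr => c _.
by rewrite /chim; ring.
Qed.

(** The first-order change of W G^T W at ab caused by the left factor W. *)
Definition pc (G : 'M[R]_(m, n) -> 'M[R]_(m, n)) W b e : R := ((G W)^T *m W) b b - ((G W)^T *m W) e b.

Lemma GtW_bnd G W b e : loc d G -> good d W -> `|((G W)^T *m W) e b| <= K.
Proof.
move=> L gW; rewrite mxE; under eq_bigr do rewrite mxE mulrC; rewrite -[leRHS]mul1r.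
by apply: (loc_col H (u := fun j => W j b) e L gW) => // j; apply: (Wle1 H gW).
Qed.

(** Both codegrees are replaced by [c0]. The second part of [pc] then sums to zero because W has
    zero row sums, and the first leaves n times the pairing of G with W. *)
Lemma E_sum_pc_chim G : loc d G ->
  `|E (fun W => \sum_a \sum_b \sum_c \sum_e pc G W b e * chim d W a b c e)
    - LL d * (dens d * (1 - dens d)) * M * E (fun W => dot (G W) W)| <= K ^+ 12 * v ^+ 7.
Proof.
move=> L; have K0 := K_ge0 H; have v0 := v_ge0 H.
rewrite -(EZ H) -(EB H); apply: le_trans (Eabs H _) _.
have a0 : 0 < 2 * (K * v ^+ 2) by rewrite mulr_gt0 // -[K]expr1 (Kv_gt0 H).
apply: (@le_trans _ _ (2 * (K * v ^+ 2) * (K ^+ 9 * v ^+ 5))); last first.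
  rewrite (_ : 2 * (K * v ^+ 2) * (K ^+ 9 * v ^+ 5) = 2 * (K ^+ 10 * v ^+ 7)); last by ring.
  by apply: (Kv_le H) => //; lra.
have hS2 : E (fun W => 4 * v ^+ 4 * \sum_b \sum_e kd W b e ^+ 2) <= (K ^+ 9 * v ^+ 5) ^+ 2.
  rewrite (EZ H); apply: le_trans (_ : 4 * v ^+ 4 * (K ^+ 16 * v ^+ 6) <= _).
    by apply: ler_wpM2l Ekd; nneg.
  rewrite (_ : 4 * v ^+ 4 * (K ^+ 16 * v ^+ 6) = 4 * (K ^+ 16 * v ^+ 10)); last by ring.
  rewrite (_ : (K ^+ 9 * v ^+ 5) ^+ 2 = K ^+ 18 * v ^+ 10); last by ring.
  by apply: (Kv_le H) => //; lra.
have hS1 : E (fun W => \sum_b \sum_e pc G W b e ^+ 2) <= (2 * (K * v ^+ 2)) ^+ 2.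
  apply: (Ele_c H) => W gW.
  apply: (@le_trans _ _ (\sum_b \sum_e (2 * K ^+ 2 + 2 * ((G W)^T *m W) e b ^+ 2))).
    apply: ler_sum => b _; apply: ler_sum => e _; rewrite /pc.
    have := sqr_le_norm (GtW_bnd b b L gW); have := sqrD_le (((G W)^T *m W) b b) (- ((G W)^T *m W) e b).
    rewrite sqrrN; lra.
  under eq_bigr do rewrite big_split /= sum_constM card_ord -mulr_sumr -/(nr R n).
  rewrite big_split /= sum_constM card_ord -mulr_sumr -/(nr R n) -nF_col.
  have h1 : nF ((G W)^T *m W) <= K ^+ 2 * v ^+ 4.
    by apply: le_trans (loc_nFt H _ L gW) _; rewrite ler_wpM2l ?exprn_ge0 // (nFW_le H).
  have h2 : N * (N * (2 * K ^+ 2)) <= v ^+ 2 * (v ^+ 2 * (2 * K ^+ 2)).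
    by apply: ler_pM; rewrite ?N_ge0 ?(okn H) ?mulr_ge0 ?N_ge0 ?exprn_ge0 // ler_wpM2r ?(okn H) // mulr_ge0 ?exprn_ge0.
  rewrite (_ : (2 * (K * v ^+ 2)) ^+ 2 = v ^+ 2 * (v ^+ 2 * (2 * K ^+ 2)) + 2 * (K ^+ 2 * v ^+ 4)); last by ring.
  lra.
have c9 : 0 < K ^+ 9 * v ^+ 5 := Kv_gt0 H 9 5.
apply: (EcsS H (S1 := fun W => \sum_b \sum_e pc G W b e ^+ 2) (S2 := fun W => 4 * v ^+ 4 * \sum_b \sum_e kd W b e ^+ 2) a0 c9 hS1 hS2).
move=> W s gW s0.
rewrite sum_chim_col.
have e1 : \sum_b \sum_e pc G W b e * (c0 * c0) = LL d * (dens d * (1 - dens d)) * M * dot (G W) W.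
  under eq_bigr do rewrite -mulr_suml; rewrite -mulr_suml.
  have -> : \sum_b \sum_e pc G W b e = N * dot (G W) W.
    rewrite /pc; under eq_bigr do rewrite sumrB sum_constM card_ord -/(nr R n).
    rewrite sumrB -mulr_sumr exchange_big /= [X in _ - X]big1 ?subr0; last first.
      move=> e _; under eq_bigr do rewrite mxE; rewrite exchange_big big1 //= => j _.
      by rewrite -mulr_sumr; case: gW => _ h _; rewrite h mulr0.
    congr (_ * _); rewrite /dot [RHS]exchange_big /=; apply: eq_bigr => b _.
    by rewrite mxE; apply: eq_bigr => j _; rewrite mxE.
  by rewrite /c0 /LL; ring.
rewrite -e1 sum2B.
apply: (@le_trans _ _ (\sum_b \sum_e (s / 2 * pc G W b e ^+ 2 + (2 * v ^+ 4 * (kd W b e ^+ 2 + kd W e b ^+ 2)) / (2 * s)))).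
  apply: ler_norm_sumD => b; apply: ler_norm_sumD => e; rewrite -mulrBr.
  apply: le_trans (amgm _ _ s0) _; rewrite lerD2l ler_wpM2r ?invr_ge0 ?mulr_ge0 ?(ltW s0) //.
  have -> : Kc W e b * Kc W b e - c0 * c0 = Kc W e b * kd W b e + c0 * kd W e b by rewrite /kd; ring.
  apply: le_trans (sqrD_le _ _) _; rewrite -mulrA ler_wpM2l // [leRHS]mulrDr.
  rewrite (_ : v ^+ 4 = (v ^+ 2) ^+ 2); last by ring.
  apply: lerD; rewrite [leLHS]exprMn; apply: ler_wpM2r; rewrite ?sqr_ge0 //; apply: sqr_le_norm; [exact: Kc_bnd | exact: c0_bnd].
have ex : \sum_b \sum_e kd W e b ^+ 2 = \sum_b \sum_e kd W b e ^+ 2 by rewrite exchange_big.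
rewrite (eq_bigr (fun b => \sum_e (s / 2 * pc G W b e ^+ 2 + (v ^+ 4 / s * kd W b e ^+ 2 + v ^+ 4 / s * kd W e b ^+ 2)))); last first.
  by move=> b _; apply: eq_bigr => e _; field; rewrite gt_eqF.
rewrite !sum2D !sum2Z ex lerD2l le_eqVlt; apply/orP; left; apply/eqP; field; rewrite gt_eqF //.
Qed.

End Columns.

Section LocalCubic.
Variables (R : realFieldType) (m n : nat) (d : ensemble R m n) (H : ok d).
Implicit Types (W : 'M[R]_(m, n)).
Local Notation E := (Ex d).
Local Notation K := (KK d).
Local Notation v := (nu d).
Local Notation N := (nr R n).
Variable (G : 'M[R]_(m, n) -> 'M[R]_(m, n)).
Hypothesis L : loc d G.

Definition Gtr (W : 'M[R]_(n, m)) : 'M[R]_(n, m) := (G W^T)^T.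

Lemma loc_tr : loc (trd d) Gtr.
Proof.
case: L => l1 l2; split=> [W a b gW|W D a b]; rewrite /Gtr /= !mxE.
  by apply: l1; have := good_tr gW; rewrite /good; case=> h1 h2 h3; split=> //; move=> i j; have := h1 i j; rewrite /gm /=.
by rewrite linearD /=; apply: le_trans (l2 _ _ _ _) _; rewrite mxE.
Qed.

(** Counterpart of [pc] for the right factor W. *)
Definition pr W a c : R := (W *m (G W)^T) a a - (W *m (G W)^T) a c.

Lemma E_sum_pr_chim :
  `|E (fun W => \sum_a \sum_b \sum_c \sum_e pr W a c * chim d W a b c e)
    - LL d * (dens d * (1 - dens d)) * N * E (fun W => dot (G W) W)| <= K ^+ 12 * v ^+ 7.
Proof.
have := E_sum_pc_chim (ok_tr H) loc_tr; rewrite !trdK_E.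
rewrite (eqE H (_ : forall W, good d W -> _ = \sum_a \sum_b \sum_c \sum_e pr W a c * chim d W a b c e)); last first.
  move=> W gW; rewrite exchange_big /=; apply: eq_bigr => a _; apply: eq_bigr => b _.
  rewrite exchange_big /=; apply: eq_bigr => c _; apply: eq_bigr => e _.
  rewrite chim_tr; congr (_ * _); rewrite /pc /pr /Gtr !trmxK.
  have -> : G W *m W^T = (W *m (G W)^T)^T by rewrite trmx_mul trmxK.
  by rewrite !mxE.
rewrite [X in `|_ - _ * X|](eqE H (_ : forall W, good d W -> _ = dot (G W) W)); last first.
  by move=> W _; rewrite /Gtr !trmxK dot_tr.
by rewrite (_ : LL (trd d) = LL d) //; rewrite /LL /=; ring.
Qed.

End LocalCubic.

(** * The cubic term paired with a local matrix *)

Section LocalCubic.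
Variables (R : realFieldType) (m n : nat) (d : ensemble R m n) (H : ok d).
Implicit Types (W : 'M[R]_(m, n)).
Local Notation E := (Ex d).
Local Notation K := (KK d).
Local Notation v := (nu d).
Local Notation M := (mr R m).
Local Notation N := (nr R n).
Local Notation g := (gm d).

Definition hW W : 'M[R]_(m, n) := \matrix_(a, b) (hm d a b * W a b).
Definition hg W : 'M[R]_(m, n) := \matrix_(a, b) (hm d a b * g W a b).
Definition hgc W : 'M[R]_(m, n) := \matrix_(a, b) (hm d a b * (1 - g W a b)).

Lemma loc_hW : loc d hW.
Proof.
split=> [W a b gW|W D a b]; rewrite !mxE.
  by rewrite normrM (ger0_norm (h_ge0 H a b)) ler_piMr ?(h_ge0 H) // (Wle1 H gW).
by rewrite -mulrBr addrAC subrr add0r normrM (ger0_norm (h_ge0 H a b)).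
Qed.
Lemma loc_hg : loc d hg.
Proof.
split=> [W a b gW|W D a b]; rewrite !mxE.
  by have /andP[? ?] := hg01 H a b gW; rewrite ger0_norm.
by rewrite gm_shift -mulrBr addrAC subrr add0r normrM (ger0_norm (h_ge0 H a b)).
Qed.
Lemma loc_hgc : loc d hgc.
Proof.
split=> [W a b gW|W D a b]; rewrite !mxE.
  by have /andP[? ?] := gm01 a b gW; rewrite normrM (ger0_norm (h_ge0 H a b)) ler_piMr ?(h_ge0 H) // ger0_norm; lra.
rewrite gm_shift -mulrBr (_ : _ - _ - _ = - D a b); last by ring.
by rewrite normrM normrN (ger0_norm (h_ge0 H a b)).
Qed.

Variable (G : 'M[R]_(m, n) -> 'M[R]_(m, n)).
Hypothesis L : loc d G.

Definition WGW W := W *m (G W)^T *m W.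
(** Vanishing on [h] removes from [loop_estimate] the term with the large factor m n. The pairing
    with the part cut off is a quadratic form handled by [loop_quadratic]. *)
Definition F4 W : 'M[R]_(m, n) := \matrix_(a, b) ((1 - hm d a b) * WGW W a b).
Definition h4 a b c e : R := hm d a b + hm d a e + hm d c b + hm d c e.

Lemma h4_ge0 a b c e : 0 <= h4 a b c e.
Proof. by rewrite /h4 !addr_ge0 ?(h_ge0 H). Qed.

(** Beyond first order only entries of G, or increments of G, at the four corners enter, and these
    are dominated by [h]. *)
Lemma WGW_diff W a b c e : good d W -> good d (W + Dl R a c b e) -> a != c -> b != e ->
  `|WGW (W + Dl R a c b e) a b - WGW W a b - (pc G W b e + pr G W a c)| <= 2 * h4 a b c e.
Proof.
set D := Dl R a c b e; set W' := W + D => gW gW' ac be0.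
have -> : WGW W' a b - WGW W a b - (pc G W b e + pr G W a c) =
   ((G W a b - G W c b) - (G W a e - G W c e)) + (W' *m (G W' - G W)^T *m W') a b.
  have e1 : (W' *m (G W' - G W)^T *m W') a b = WGW W' a b - (W' *m (G W)^T *m W') a b.
    rewrite /WGW -mxBE -mulmxBl -mulmxBr; congr ((_ *m _ *m _) _ _).
    by rewrite linearB.
  have e2 : (W' *m (G W)^T *m W') a b = WGW W a b + (D *m ((G W)^T *m W)) a b + (W *m (G W)^T *m D) a b + (D *m ((G W)^T *m D)) a b.
    have -> : W' *m (G W)^T *m W' = WGW W + D *m ((G W)^T *m W) + W *m (G W)^T *m D + D *m ((G W)^T *m D).
      rewrite /W' /WGW !(mulmxDl, mulmxDr, mulmxA).
      move: (W *m (G W)^T *m W) (W *m (G W)^T *m D) (D *m (G W)^T *m W) (D *m (G W)^T *m D) => p q r t.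
      by apply/matrixP => i j; rewrite !mxE; ring.
    by rewrite [LHS]mxE [X in X + _]mxE [X in X + _ + _]mxE.
  rewrite e1 e2 /pc /pr !Dl_mullE !Dl_mulrE !pairv_a // !mxE.
  by ring.
rewrite mulr_natl mulr2n; apply: normrD_le.
  have [l1 _] := L; apply: le_trans (normrB_le (normrB_le (l1 _ a b gW) (l1 _ c b gW)) (normrB_le (l1 _ a e gW) (l1 _ c e gW))) _.
  by rewrite /h4; lra.
rewrite mxE; apply: (@le_trans _ _ (\sum_k `|pairv R a c k 0| * (hm d k b + hm d k e))); last first.
  apply: le_trans (sum_pairv_abs a c (u := fun k => hm d k b + hm d k e) _) _.
    by move=> k; rewrite addr_ge0 ?(h_ge0 H).
  by rewrite /h4; lra.
apply: ler_norm_sumD => k; rewrite -[leRHS]mulr1; apply: normrM_le; last exact: (Wle1 H gW').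
rewrite mxE; apply: le_trans (_ : \sum_j `|pairv R b e j 0| * (`|pairv R a c k 0| * hm d k j) <= _); last first.
  apply: le_trans (sum_pairv_abs b e (u := fun j => `|pairv R a c k 0| * hm d k j) _) _.
    by move=> j; rewrite mulr_ge0 ?(h_ge0 H).
  by rewrite -mulrDr.
apply: ler_norm_sumD => j; rewrite -[leRHS]mul1r; apply: normrM_le; first exact: (Wle1 H gW').
rewrite mxE mxBE; have [_ l2] := L; apply: le_trans (l2 _ _ _ _) _.
by rewrite DlE normrM !mxE le_eqVlt; apply/orP; left; apply/eqP; ring.
Qed.

Lemma pc_bnd W b e : good d W -> `|pc G W b e| <= 2 * K.
Proof. by move=> gW; apply: diff_le; apply: (GtW_bnd H). Qed.
Lemma pr_bnd W a c : good d W -> `|pr G W a c| <= 2 * K.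
Proof. by move=> gW; apply: diff_le; apply: (mbnd_WGt H L _ _ gW). Qed.

Lemma F4_diff W a b c e : good d W ->
  `|(F4 (W + Dl R a c b e) a b - F4 W a b) * wk d W a b c e - (pc G W b e * chim d W a b c e + pr G W a c * chim d W a b c e)|
  <= 6 * K * h4 a b c e.
Proof.
move=> gW; have K100 := okK H.
have [z|nz] := eqVneq (chim d W a b c e) 0.
  rewrite /wk z !(mul0r, mulr0, addr0, subr0) normr0 mulr_ge0 ?h4_ge0 // mulr_ge0 //; lra.
have /andP[ac be0] := chim_neq gW nz.
have gW' := good_shift gW nz; have df := WGW_diff gW gW' ac be0.
have f W1 : F4 W1 a b = (1 - hm d a b) * WGW W1 a b by rewrite mxE.
rewrite !f -mulrBr.
set D := WGW _ a b - WGW _ a b in df *; set S := pc G W b e + pr G W a c in df.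
rewrite /wk; have /andP[m0 m1] := chim01 a b c e gW.
have /andP[k0 k1] := mul01 (kap01 H a e) (kap01 H c b).
have /andP[kl0 kl1] := kap2_le H a e c b.
move: m0 m1 k0 k1 kl0 kl1; move: (chim d W a b c e) => ch; move: (kap d a e * kap d c b) => kk m0 m1 k0 k1 kl0 kl1.
rewrite [X in `|X| <= _](_ : _ = ch * (S * ((1 - hm d a b) * kk - 1) + (1 - hm d a b) * kk * (D - S))); last by rewrite /S; ring.
have h0 := h_ge0 H a b; have h1 := h_le1 H a b; have hce := h_ge0 H c e; have hae := h_ge0 H a e; have hcb := h_ge0 H c b.
have Sb : `|S| <= 4 * K by apply: le_trans (normrD_le (pc_bnd b e gW) (pr_bnd a c gW)) _; lra.
have t0 : `|(1 - hm d a b) * kk - 1| <= h4 a b c e.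
  by rewrite ler0_norm; [rewrite /h4; case: (okh H a b) => ->; lra | nra].
have t1 := normrM_le Sb t0.
have t2 : `|(1 - hm d a b) * kk * (D - S)| <= 1 * (2 * h4 a b c e).
  by apply: normrM_le => //; rewrite ger0_norm; nra.
rewrite -[leRHS]mul1r; apply: normrM_le; first by rewrite ger0_norm.
apply: le_trans (normrD_le t1 t2) _.
have := h4_ge0 a b c e; move: (h4 a b c e) => hh hh0.
by rewrite mul1r -mulrDl ler_wpM2r //; lra.
Qed.

Lemma dF4 : `|E (fun W => \sum_a \sum_b \sum_c \sum_e (F4 (W + Dl R a c b e) a b - F4 W a b) * wk d W a b c e)
   - LL d * (dens d * (1 - dens d)) * (M + N) * E (fun W => dot (G W) W)| <= K ^+ 13 * v ^+ 7.
Proof.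
have K0 := K_ge0 H; have v0 := v_ge0 H.
have h1 := E_sum_pc_chim H L; have h2 := E_sum_pr_chim H L.
set C1 := E (fun W => \sum_a \sum_b \sum_c \sum_e pc G W b e * chim d W a b c e) in h1.
set C2 := E (fun W => \sum_a \sum_b \sum_c \sum_e pr G W a c * chim d W a b c e) in h2.
have h3 : `|E (fun W => \sum_a \sum_b \sum_c \sum_e (F4 (W + Dl R a c b e) a b - F4 W a b) * wk d W a b c e) - (C1 + C2)| <= 24 * (K ^+ 2 * v ^+ 6).
  rewrite -(ED H) -(EB H); apply: le_trans (Eabs_le H (g := fun=> \sum_a \sum_b \sum_c \sum_e 6 * K * h4 a b c e) _) _.
    move=> W gW; rewrite -sum4D -sumrB; apply: ler_norm_sumD => a; rewrite -sumrB; apply: ler_norm_sumD => b.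
    rewrite -sumrB; apply: ler_norm_sumD => c; rewrite -sumrB; apply: ler_norm_sumD => e; exact: F4_diff.
  rewrite (Ec H) sum4Z /h4 !sum4D; have [-> -> ->] := sum4_h H.
  have -> : \sum_(a < m) \sum_(b < n) \sum_c \sum_e hm d c e = XX d * (M * N).
    by rewrite (sumh H) !sum_constM !card_ord /mr /nr; ring.
  rewrite (_ : 24 * (K ^+ 2 * v ^+ 6) = 6 * K * (4 * (K * v ^+ 6))); last by ring.
  by apply: ler_wpM2l; [nneg|have := XMN_le H; lra].
rewrite [X in `|X| <= _](_ : _ = (E (fun W => \sum_a \sum_b \sum_c \sum_e (F4 (W + Dl R a c b e) a b - F4 W a b) * wk d W a b c e) - (C1 + C2))
  + (C1 - LL d * (dens d * (1 - dens d)) * M * E (fun W => dot (G W) W)) + (C2 - LL d * (dens d * (1 - dens d)) * N * E (fun W => dot (G W) W))); last by ring.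
apply: le_trans (normrD_le (normrD_le h3 h1) h2) _.
have c : 100 <= 100 :> R by rewrite ler_nat.
have := Kv_le H c (isT : (12 < 13)%N) (leqnn 7); have := Kv_le H c (isT : (2 < 13)%N) (isT : (6 <= 7)%N).
have := Kv_ge0 H 13 7; lra.
Qed.

(** By cyclicity of the trace the squared norm equals the pairing of G [Mv] with [Mu] G;
    Cauchy-Schwarz and Schur's test then apply. *)
Lemma nF_WGW W : good d W -> nF (WGW W) <= K ^+ 2 * nF (Mv W).
Proof.
move=> gW; have K0 := K_ge0 H.
have e1 : nF (WGW W) = dot (G W *m Mv W) (Mu W *m G W).
  rewrite /nF !dotE.
  have -> : WGW W *m (WGW W)^T = (W *m (G W)^T *m W *m W^T) *m (G W *m W^T) by rewrite /WGW !trmx_mul !trmxK !mulmxA.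
  have -> : G W *m Mv W *m (Mu W *m G W)^T = (G W *m W^T) *m (W *m (G W)^T *m W *m W^T) by rewrite /Mv /Mu !trmx_mul !trmxK !mulmxA.
  exact: mxtrace_mulC.
rewrite e1; apply: ler_normlW; apply: ler_norm_sqr; first by rewrite mulr_ge0 ?exprn_ge0 ?nF_ge0.
apply: le_trans (cs_dot _ _) _.
rewrite (_ : (K ^+ 2 * nF (Mv W)) ^+ 2 = (K ^+ 2 * nF (Mv W)) * (K ^+ 2 * nF (Mu W))); last by rewrite nF_Mu; ring.
apply: ler_pM; rewrite ?nF_ge0 //; first exact: (loc_nF H).
by rewrite -nF_tr trmx_mul Mu_tr; apply: (loc_nFt H).
Qed.

Lemma dot_WGW W A : dot A (WGW W) = dot (A *m W^T *m G W) W.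
Proof. by rewrite !dotE /WGW !trmx_mul trmxK !mulmxA. Qed.

(** The increments of W G^T W through its left and right factor, [pc] and [pr], supply the summands
    [M] and [N] of the scalar by which V acts on local matrices. *)
Lemma E_dot_VV_local : `|E (fun W => dot (G W) (VV W)) - dens d * (1 - dens d) * (M + N) * E (fun W => dot (G W) W)| <= K ^+ 45 * v ^+ 3.
Proof.
have K0 := K_ge0 H; have v0 := v_ge0 H.
have lg := loop_estimate H F4.
have e0 : E (fun W => \sum_a \sum_b hm d a b * `|F4 W a b|) = 0.
  transitivity (E (fun=> 0)); last exact: (E0 H). apply: (eqE H) => W _ /=; rewrite big1 // => a _; rewrite big1 // => b _.
  by rewrite mxE; case: (okh H a b) => ->; rewrite ?subrr ?mul0r ?normr0 ?mulr0.
rewrite e0 mulr0 add0r in lg.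
have nF4 W : good d W -> nF (F4 W) <= K ^+ 2 * nF (Mv W).
  move=> gW; apply: le_trans (nF_WGW gW); rewrite !nFE; apply: sum2_le => a b; rewrite mxE exprMn ler_piMl ?sqr_ge0 //.
  by case: (okh H a b) => ->; rewrite ?subr0 ?subrr ?expr1n ?expr0n ?ler01.
have EF4 : E (fun W => nF (F4 W)) <= (K ^+ 8 * v ^+ 3) ^+ 2.
  apply: le_trans (_ : E (fun W => K ^+ 2 * nF (Mv W)) <= _); first exact: (Ele H).
  rewrite (EZ H); have [m1 _] := E_gram_le H; apply: le_trans (ler_wpM2l _ m1) _; first by nneg.
  rewrite mulrA -exprD (_ : (K ^+ 8 * v ^+ 3) ^+ 2 = K ^+ 16 * v ^+ 6); last by ring.
  exact: (Kv_le1 H).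
have t1 : E (fun W => \sum_a \sum_b `|F4 W a b|) <= (K ^+ 8 * v ^+ 3) * v ^+ 2.
  have v20 : 0 < v ^+ 2 by rewrite exprn_gt0 // (v_gt0 H).
  apply: (EcsS H (S1 := fun W => nF (F4 W)) (S2 := fun=> M * N) (Kv_gt0 H 8 3) v20 EF4).
    by rewrite (Ec H) (_ : (v ^+ 2) ^+ 2 = v ^+ 4); [exact: (MN_le H)|ring].
  move=> W s gW s0; rewrite nFE.
  have -> : M * N / (2 * s) = \sum_(a < m) \sum_(b < n) (2 * s)^-1.
    by rewrite !sum_constM !card_ord /mr /nr; ring.
  rewrite -sum2Z -sum2D; apply: sum2_le => a b.
  by have := amgm (F4 W a b) 1 s0; rewrite mulr1 expr1n mul1r.
have t2 : `|E (fun W => dot (F4 W) (YY d W))| <= (K ^+ 8 * v ^+ 3) * (K ^+ 30 * v ^+ 4).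
  apply: le_trans (Eabs H _) _.
  apply: (EcsS H (S1 := fun W => nF (F4 W)) (S2 := fun W => nF (YY d W)) (Kv_gt0 H 8 3) (Kv_gt0 H 30 4) EF4).
    apply: le_trans (E_nF_YY_le H) _; rewrite (_ : (K ^+ 30 * v ^+ 4) ^+ 2 = K ^+ 60 * v ^+ 8); last by ring.
    exact: (Kv_le1 H).
  by move=> W s gW s0; apply: dot_amgm.
have t3 : 3 * XX d * E (fun W => \sum_a \sum_b `|F4 W a b|) <= 3 * (K ^+ 9 * v ^+ 7).
  rewrite (_ : 3 * (K ^+ 9 * v ^+ 7) = 3 * (K * v ^+ 2) * (K ^+ 8 * v ^+ 3 * v ^+ 2)); last by ring.
  have x0 := XX_ge0 H; apply: ler_pM => //; [lra| |by rewrite ler_wpM2l ?(XX_le H)].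
  by apply: (Ege0 H) => W _; apply: sumr_ge0 => a _; apply: sumr_ge0.
have q : `|E (fun W => dot (hW W *m W^T *m G W) W)| <= K ^+ 37 * v ^+ 2 := loop_quadratic H loc_hW L.
have e1 : E (fun W => dot (F4 W) W) = E (fun W => dot (G W) (VV W)) - E (fun W => dot (hW W *m W^T *m G W) W).
  rewrite -(EB H); apply: (eqE H) => W gW; rewrite -dot_WGW.
  have -> : dot (G W) (VV W) = dot W (WGW W).
    rewrite dotC !dotE.
    rewrite -(mxtrace_tr (VV W *m (G W)^T)).
    have -> : (VV W *m (G W)^T)^T = (G W *m W^T) *m (W *m W^T) by rewrite /VV /Mv !trmx_mul !trmxK !mulmxA.
    have -> : W *m (WGW W)^T = (W *m W^T) *m (G W *m W^T) by rewrite /WGW !trmx_mul !trmxK !mulmxA.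
    exact: mxtrace_mulC.
  rewrite /dot sum2B; apply: eq_bigr => a _; apply: eq_bigr => b _; rewrite [F4 W a b]mxE [hW W a b]mxE; ring.
have df := dF4.
set DF := E (fun W => \sum_a \sum_b \sum_c \sum_e (F4 (W + Dl R a c b e) a b - F4 W a b) * wk d W a b c e) in lg df.
set GW := E (fun W => dot (G W) W) in df *; set GV := E (fun W => dot (G W) (VV W)) in e1 *.
set Q := E (fun W => dot (hW W *m W^T *m G W) W) in q e1; set FY := E (fun W => dot (F4 W) (YY d W)) in lg t2.
rewrite e1 in lg.
have LLv : `|LL d * Q| <= v ^+ 4 * (K ^+ 37 * v ^+ 2).
  apply: normrM_le => //; rewrite ger0_norm ?(ltW (LL_gt0 H)) //.
  apply: le_trans (MN_le H); rewrite /LL -mulrA ler_piMl ?MN_ge0 //.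
  by have := dens_gt0 H; have := dens_lt1 H; nra.
have t : LL d * `|GV - dens d * (1 - dens d) * (M + N) * GW| <= K ^+ 40 * v ^+ (3 + 4).
  rewrite -[X in X * _](gtr0_norm (LL_gt0 H)) -normrM.
  rewrite (_ : LL d * _ = (LL d * (GV - Q) + FY - DF) - FY + (DF - LL d * (dens d * (1 - dens d)) * (M + N) * GW) + LL d * Q); last by ring.
  apply: le_trans (normrD_le (normrD_le (normrB_le (le_trans lg t3) t2) df) LLv) _.
  have c : 10 <= 100 :> R by rewrite ler_nat.
  have := Kv_le H c (isT : (9 < 40)%N) (leqnn 7); have := Kv_le H c (isT : (38 < 40)%N) (leqnn 7).
  have := Kv_le H c (isT : (13 < 40)%N) (leqnn 7); have := Kv_le H c (isT : (37 < 40)%N) (isT : (6 <= 7)%N).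
  have := Kv_ge0 H 40 7; rewrite (_ : (3 + 4)%N = 7%N) //.
  rewrite (_ : K ^+ 8 * v ^+ 3 * (K ^+ 30 * v ^+ 4) = K ^+ 38 * v ^+ 7); last by ring.
  rewrite (_ : v ^+ 4 * (K ^+ 37 * v ^+ 2) = K ^+ 37 * v ^+ 6); last by ring.
  lra.
apply: le_trans (LL_div H (normr_ge0 _) t) _; exact: (Kv_le1 H).
Qed.

End LocalCubic.

(** * Switchings with two corners in h *)

Section CodegreeSums.
Variables (R : realFieldType) (m n : nat) (d : ensemble R m n) (H : ok d).
Implicit Types (W : 'M[R]_(m, n)).
Local Notation E := (Ex d).
Local Notation K := (KK d).
Local Notation v := (nu d).
Local Notation M := (mr R m).
Local Notation N := (nr R n).
Local Notation g := (gm d).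

(** These counts arise from the weights [kap] at a second corner lying in [h]. They are of order
    [v ^+ 4], hence visible at the required accuracy [v ^+ 3]. *)
Definition C1 W : R := \sum_a \sum_b \sum_c \sum_e hm d a b * hm d c e * chip d W a b c e.
Definition C2 W : R := \sum_a \sum_b \sum_c \sum_e hm d a b * hm d a e * chim d W a b c e.
Definition C3 W : R := \sum_a \sum_b \sum_c \sum_e hm d a b * hm d c b * chim d W a b c e.

Lemma sum4_swap (f : 'I_m -> 'I_n -> 'I_m -> 'I_n -> R) :
  \sum_a \sum_b \sum_c \sum_e f a b c e = \sum_a \sum_b \sum_c \sum_e f c e a b.
Proof.
rewrite (pair_bigA _ (fun a b => \sum_c \sum_e f a b c e)) /=.
rewrite (eq_bigr (fun p => \sum_(r : 'I_m * 'I_n) f p.1 p.2 r.1 r.2)); last by move=> p _; rewrite pair_bigA.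
rewrite exchange_big /= [RHS](pair_bigA _ (fun a b => \sum_c \sum_e f c e a b)) /=.
by apply: eq_bigr => p _; rewrite (pair_bigA _ (fun c e => f c e p.1 p.2)).
Qed.

(** Dropping the degree deviations from the factors 1 - g costs order [K / v] for each of the order
    [v ^+ 4] pairs of edges. *)
Lemma C1_pt W : good d W ->
  `|C1 W - ((1 - dens d) ^+ 2 * Ov d W ^+ 2 - (1 - dens d) * (2 * dot (xi d W) (W *m ze d W))
     + dot (hg d W *m W^T *m hg d W) W)| <= 12 * (K ^+ 3 * v ^+ 3).
Proof.
move=> gW; have K0 := K_ge0 H; have v0 := v_gt0 H.
pose u a e := 1 - dens d - W a e.
pose Ga a b := hm d a b * g W a b.
have e0 : Ov d W ^+ 2 = \sum_a \sum_b \sum_c \sum_e Ga a b * Ga c e.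
  rewrite expr2 {1}/Ov mulr_suml; apply: eq_bigr => a _; rewrite mulr_suml; apply: eq_bigr => b _.
  by rewrite /Ov mulr_sumr; apply: eq_bigr => c _; rewrite mulr_sumr.
have e1 : dot (xi d W) (W *m ze d W) = \sum_a \sum_b \sum_c \sum_e Ga a b * Ga c e * W a e.
  apply: eq_bigr => a _; rewrite big_ord1 [xi d W a 0]mxE mulr_suml; apply: eq_bigr => b _.
  rewrite [(W *m _) a 0]mxE exchange_big mulr_sumr; apply: eq_bigr => e _ /=.
  by rewrite [ze d W e 0]mxE !mulr_sumr; apply: eq_bigr => c _; rewrite /Ga; ring.
have e2 : dot (xi d W) (W *m ze d W) = \sum_a \sum_b \sum_c \sum_e Ga a b * Ga c e * W c b.
  rewrite e1 sum4_swap; do 4 (apply: eq_bigr => ? _); ring.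
have e3 : dot (hg d W *m W^T *m hg d W) W = \sum_a \sum_b \sum_c \sum_e Ga a b * Ga c e * (W a e * W c b).
  transitivity (\sum_a \sum_e \sum_c \sum_b Ga a b * Ga c e * (W a e * W c b)).
    apply: eq_bigr => a _; apply: eq_bigr => e _; rewrite mxE mulr_suml; apply: eq_bigr => c _.
    rewrite [(hg d W *m _) a c]mxE !mulr_suml; apply: eq_bigr => b _; rewrite [hg d W a b]mxE [hg d W c e]mxE [W^T b c]mxE /Ga; ring.
  apply: eq_bigr => a _; rewrite exchange_big /=; under eq_bigr do rewrite exchange_big /=.
  rewrite exchange_big /=; apply: eq_bigr => b _.
  by [].
have -> : (1 - dens d) ^+ 2 * Ov d W ^+ 2 - (1 - dens d) * (2 * dot (xi d W) (W *m ze d W)) + dot (hg d W *m W^T *m hg d W) W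
   = \sum_a \sum_b \sum_c \sum_e Ga a b * Ga c e * (u a e * u c b).
  transitivity (\sum_a \sum_b \sum_c \sum_e ((1 - dens d) ^+ 2 * (Ga a b * Ga c e) + - (1 - dens d) * (Ga a b * Ga c e * W a e)
     + - (1 - dens d) * (Ga a b * Ga c e * W c b) + Ga a b * Ga c e * (W a e * W c b))).
    by rewrite !sum4D !sum4Z -e0 -e1 -e2 -e3; ring.
  by do 4 (apply: eq_bigr => ? _); rewrite /u; ring.
have e4 : C1 W = \sum_a \sum_b \sum_c \sum_e Ga a b * Ga c e * ((1 - g W a e) * (1 - g W c b)).
  by do 4 (apply: eq_bigr => ? _); rewrite /chip /Ga; ring.
rewrite e4.
apply: (@le_trans _ _ (\sum_a \sum_b \sum_c \sum_e (12 * (K / v)) * (Ga a b * Ga c e))).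
  rewrite -sumrB; apply: ler_norm_sumD => a; rewrite -sumrB; apply: ler_norm_sumD => b.
  rewrite -sumrB; apply: ler_norm_sumD => c; rewrite -sumrB; apply: ler_norm_sumD => e.
  have /andP[g0 _] := hg01 H a b gW; have /andP[g1 _] := hg01 H c e gW.
  rewrite -mulrBr normrM (ger0_norm (mulr_ge0 g0 g1)) mulrC; apply: ler_wpM2r; first exact: mulr_ge0 g0 g1.
  have kv : K / v <= 2^-1.
    have := Kv_small H (isT : (1 < 100)%N); rewrite expr1 => h; apply: le_trans h _.
    by rewrite lef_pV2 ?posrE ?(K_gt0 H) //; have := okK H; lra.
  have kv0 : 0 <= K / v by rewrite divr_ge0 // ltW.
  have ka := normrD_le (al_le H a) (be_le H e); have kb := normrD_le (al_le H c) (be_le H b).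
  have w1 := Wle1 H gW a e; have w2 := Wle1 H gW c b.
  have l0 := dens_gt0 H; have l1 := dens_lt1 H.
  have ub (w : R) : `|w| <= 1 -> `|1 - dens d - w| <= 2.
    move=> hw; apply: le_trans (normrB_le (_ : `|1 - dens d| <= 1) hw) _; last by lra.
    by rewrite ger0_norm; lra.
  rewrite [X in `|X| <= _](_ : _ = (al d a 0 + be d e 0) * (al d c 0 + be d b 0) - (al d a 0 + be d e 0) * u c b - u a e * (al d c 0 + be d b 0)); last by rewrite /u /gm; ring.
  apply: le_trans (normrB_le (normrB_le (normrM_le ka kb) (normrM_le ka (ub _ w2))) (normrM_le (ub _ w1) kb)) _.
  nra.
rewrite sum4Z -e0; have /andP[o0 o1] := Ov01 H gW.
have o2 : Ov d W ^+ 2 <= (K * v ^+ 2) ^+ 2 by apply: sqr_leX => //; apply: le_trans o1 (XX_le H).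
rewrite (_ : 12 * (K ^+ 3 * v ^+ 3) = 12 * (K / v) * (K * v ^+ 2) ^+ 2); last by field; rewrite gt_eqF.
by rewrite ler_wpM2l // mulr_ge0 // divr_ge0 // ltW.
Qed.

Lemma E_C1 : `|E C1 - (1 - dens d) ^+ 2 * (th d * XX d) ^+ 2| <= K ^+ 43 * v ^+ 3.
Proof.
have l0 := dens_gt0 H; have l1 := dens_lt1 H.
have b1 : `|E C1 - ((1 - dens d) ^+ 2 * E (fun W => Ov d W ^+ 2) - (1 - dens d) * (2 * E (fun W => dot (xi d W) (W *m ze d W)))
     + E (fun W => dot (hg d W *m W^T *m hg d W) W))| <= 12 * (K ^+ 3 * v ^+ 3).
  rewrite -!(EZ H) -(EB H) -(ED H) -(EB H); apply: le_trans (Eabs H _) _; apply: (Ele_c H); exact: C1_pt.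
have b2 := E_Ov_sqr_le H; have b3 := E_xi_W_ze_le H; have b4 := loop_quadratic H (loc_hg H) (loc_hg H).
have n1 : `|(1 - dens d) ^+ 2| <= 1 by rewrite ger0_norm ?sqr_ge0 // expr_le1 //; lra.
have n2 : `|(1 - dens d) * 2| <= 2 by rewrite ger0_norm; lra.
have c1 := normrM_le n1 b2; have c2 := normrM_le n2 b3.
move: b1 b2 b3 b4 c1 c2.
set A := E (fun W => Ov d W ^+ 2); set B := E (fun W => dot (xi d W) (W *m ze d W)); set C := E (fun W => dot _ W) => b1 b2 b3 b4 c1 c2.
rewrite [X in `|X| <= _](_ : _ = (E C1 - ((1 - dens d) ^+ 2 * A - (1 - dens d) * (2 * B) + C)) + (1 - dens d) ^+ 2 * (A - (th d * XX d) ^+ 2) - (1 - dens d) * 2 * B + C); last by ring.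
apply: le_trans (normrD_le (normrB_le (normrD_le b1 c1) c2) b4) _.
have c : 100 <= 100 :> R by rewrite ler_nat.
have := Kv_le H c (isT : (3 < 43)%N) (leqnn 3); have := Kv_le H c (isT : (42 < 43)%N) (leqnn 3).
have := Kv_le H c (isT : (40 < 43)%N) (leqnn 3); have := Kv_le H c (isT : (37 < 43)%N) (isT : (2 <= 3)%N).
have := Kv_ge0 H 43 3; lra.
Qed.

Lemma sum_norm_le (u : 'cV[R]_n) : \sum_b `|u b 0| <= nF u + v ^+ 2.
Proof.
apply: (@le_trans _ _ (\sum_b (u b 0 ^+ 2 + 1))).
  apply: ler_sum => b _; rewrite -(real_normK (num_real (u b 0))).
  by have := sqr_ge0 (`|u b 0| - 1); have := sqr_ge0 (`|u b 0|); lra.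
by rewrite big_split /= -nF_cv sum_constM card_ord mulr1 lerD2l (okn H).
Qed.

(** Summation over [c] produces the codegree [Kc], which is [c0] minus an entry of [Mv] up to degree
    terms and [ga]. The remaining weights [nt] count pairs of edges of [h] in one row, the first
    absent and the second present. *)
Lemma C2_pt W : good d W ->
  `|C2 W - (c0 d * (xd d * Ov d W - nF (xi d W)) - dot (W *m Nt (hgc d) (hg d) W) W)| <=
  4 * (K ^+ 3 * v ^+ 3) + 2 * K ^+ 2 * (nF (ga d W) + v ^+ 2).
Proof.
move=> gW; have K0 := K_ge0 H; have v0 := v_gt0 H.
pose nt b e : R := \sum_a hm d a b * (1 - g W a b) * (hm d a e * g W a e).
have nt0 b e : 0 <= nt b e.
  apply: sumr_ge0 => a _; have /andP[? ?] := gm01 a b gW; have /andP[? ?] := gm01 a e gW.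
  by rewrite mulr_ge0 // mulr_ge0 ?(h_ge0 H) // subr_ge0.
have e1 : C2 W = \sum_b \sum_e nt b e * Kc d W b e.
  rewrite /C2 exchange_big /=; apply: eq_bigr => b _.
  transitivity (\sum_a \sum_e \sum_c hm d a b * hm d a e * chim d W a b c e).
    by apply: eq_bigr => a _; rewrite exchange_big.
  rewrite exchange_big /=; apply: eq_bigr => e _; rewrite /nt mulr_suml; apply: eq_bigr => a _.
  by rewrite /Kc mulr_sumr; apply: eq_bigr => c _; rewrite /chim; ring.
have e2 : \sum_b \sum_e nt b e = xd d * Ov d W - nF (xi d W).
  rewrite Ov_xi mulr_sumr nF_cv -sumrB /nt.
  under eq_bigr do rewrite exchange_big /=.
  rewrite exchange_big /=; apply: eq_bigr => a _.
  have -> : xd d * xi d W a 0 - xi d W a 0 ^+ 2 = (\sum_b hm d a b * (1 - g W a b)) * xi d W a 0.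
    have -> : \sum_b hm d a b * (1 - g W a b) = xd d - xi d W a 0.
      by rewrite -(okx H a) mxE -sumrB; apply: eq_bigr => b _; ring.
    ring.
  by rewrite mulr_suml; apply: eq_bigr => b _; rewrite mxE mulr_sumr.
have e3 : \sum_b \sum_e nt b e * Mv W b e = dot (W *m Nt (hgc d) (hg d) W) W.
  rewrite dot_mulr -/(Mv W); apply: eq_bigr => b _; apply: eq_bigr => e _; congr (_ * _).
  by rewrite mxE; apply: eq_bigr => a _; rewrite !mxE.
have ntr b : \sum_e nt b e <= K ^+ 2.
  apply: (@le_trans _ _ (\sum_a hm d a b * \sum_e hm d a e)).
    rewrite /nt exchange_big /=; apply: ler_sum => a _; rewrite mulr_sumr; apply: ler_sum => e _.
    have /andP[? ?] := gm01 a b gW; have /andP[? ?] := hg01 H a e gW.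
    apply: ler_pM => //; first by rewrite mulr_ge0 ?(h_ge0 H) // subr_ge0.
    by rewrite ler_piMr ?(h_ge0 H) //; lra.
  under eq_bigr do rewrite (okx H); rewrite -mulr_suml (oky H) expr2.
  by apply: ler_pM; rewrite ?(okx0 H) ?(oky0 H) ?(okxK H) ?(okyK H).
have ntc e : \sum_b nt b e <= K ^+ 2.
  apply: (@le_trans _ _ (\sum_a hm d a e * \sum_b hm d a b)).
    rewrite /nt exchange_big /=; apply: ler_sum => a _; rewrite mulr_sumr; apply: ler_sum => b _.
    have /andP[? ?] := gm01 a b gW; have /andP[? ?] := hg01 H a e gW.
    rewrite mulrC; apply: ler_pM => //; first by rewrite mulr_ge0 ?(h_ge0 H) // subr_ge0.
    by rewrite ler_piMr ?(h_ge0 H) //; lra.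
  under eq_bigr do rewrite (okx H); rewrite -mulr_suml (oky H) expr2.
  by apply: ler_pM; rewrite ?(okx0 H) ?(oky0 H) ?(okxK H) ?(okyK H).
have e5 : c0 d * (\sum_b \sum_e nt b e) = \sum_b \sum_e nt b e * c0 d.
  by rewrite -sum2Z; apply: eq_bigr => b _; apply: eq_bigr => e _; rewrite mulrC.
rewrite e1 -e2 -e3 e5 !sum2B.
have split b e : nt b e * Kc d W b e - (nt b e * c0 d - nt b e * Mv W b e) = nt b e *
   (M * (be d b 0 * (1 - dens d) - dens d * be d e 0 - be d b 0 * be d e 0) - na d - ga d W b 0 - ga d W e 0).
  by rewrite Kc_eq // /c0; ring.
under eq_bigr do under eq_bigr do rewrite split.
have bb b e : `|M * (be d b 0 * (1 - dens d) - dens d * be d e 0 - be d b 0 * be d e 0) - na d - ga d W b 0 - ga d W e 0| <=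
   4 * (K * v) + `|ga d W b 0| + `|ga d W e 0|.
  apply: normrB_le => //; apply: normrB_le => //.
  have hb := be_le1 H b; have he := be_le1 H e; have kb := be_le H b; have ke := be_le H e.
  have l0 := dens_gt0 H; have l1 := dens_lt1 H.
  apply: le_trans (_ : v ^+ 2 * (K / v * 1 + 1 * (K / v) + K / v * 1) + K ^+ 2 <= _).
    apply: normrB_le; last by rewrite ger0_norm ?na_ge0 //; apply: na_le.
    apply: normrM_le; first by rewrite ger0_norm ?M_ge0 ?(okm H).
    have n1 : `|1 - dens d| <= 1 by rewrite ger0_norm; lra.
    have n2 : `|dens d| <= 1 by rewrite ger0_norm; lra.
    have n3 : `|be d e 0| <= 1 by lra.
    by apply: normrB_le; [apply: normrB_le|]; apply: normrM_le.
  have -> : v ^+ 2 * (K / v * 1 + 1 * (K / v) + K / v * 1) = 3 * (K * v) by field; rewrite gt_eqF.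
  have : K ^+ 2 <= K * v by rewrite expr2 ler_wpM2l ?(v_geK H).
  lra.
apply: (@le_trans _ _ (\sum_b \sum_e (4 * (K * v) * nt b e + (`|ga d W b 0| * nt b e + `|ga d W e 0| * nt b e)))).
  apply: ler_norm_sumD => b; apply: ler_norm_sumD => e; rewrite normrM (ger0_norm (nt0 b e)).
  by apply: le_trans (ler_wpM2l (nt0 b e) (bb b e)) _; rewrite le_eqVlt; apply/orP; left; apply/eqP; ring.
rewrite !sum2D sum2Z; have sg := sum_norm_le (ga d W); have k2 : 0 <= K ^+ 2 by nneg.
apply: lerD.
  rewrite (_ : 4 * (K ^+ 3 * v ^+ 3) = 4 * (K * v) * (v ^+ 2 * K ^+ 2)); last by ring.
  apply: ler_wpM2l; first by rewrite !mulr_ge0 ?(ltW v0).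
  apply: le_trans (ler_sum_const (c := K ^+ 2) ntr) _.
  by rewrite card_ord ler_wpM2r // (okn H).
rewrite (_ : 2 * K ^+ 2 * _ = (nF (ga d W) + v ^+ 2) * K ^+ 2 + (nF (ga d W) + v ^+ 2) * K ^+ 2); last by ring.
apply: lerD.
  apply: le_trans (ler_wpM2r k2 sg); rewrite mulr_suml; apply: ler_sum => b _.
  by rewrite -mulr_sumr ler_wpM2l.
rewrite exchange_big /=; apply: le_trans (ler_wpM2r k2 sg); rewrite mulr_suml; apply: ler_sum => b _.
by rewrite -mulr_sumr ler_wpM2l.
Qed.

Lemma Nt_hg0 W b : good d W -> Nt (hgc d) (hg d) W b b = 0.
Proof.
case=> h _ _; rewrite mxE big1 // => a _; rewrite !mxE.
by case: (h a b) => ->; ring.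
Qed.

Lemma E_C2 : `|E C2 - c0 d * (th d * (1 - th d) * XX d * (xd d - 1))| <= K ^+ 47 * v ^+ 3.
Proof.
have K0 := K_ge0 H; have v0 := v_ge0 H.
have b1 : `|E C2 - (c0 d * (xd d * E (fun W => Ov d W) - E (fun W => nF (xi d W))) - E (fun W => dot (W *m Nt (hgc d) (hg d) W) W))| <=
   4 * (K ^+ 3 * v ^+ 3) + 2 * K ^+ 2 * (K ^+ 44 * v ^+ 2 + v ^+ 2).
  rewrite -(EZ H) -(EB H) -(EZ H) -!(EB H); apply: le_trans (Eabs H _) _.
  apply: le_trans (Ele H C2_pt) _.
  rewrite (ED H) (Ec H) (EZ H) (ED H) (Ec H) lerD2l ler_wpM2l ?mulr_ge0 ?exprn_ge0 // lerD2r.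
  by have := E_nF_ga_gb_le H; have := EnF_ge0 H (gb d); lra.
have b2 := E_Ov_le H; have b3 := E_nF_xi_le H.
have b4 : `|E (fun W => dot (W *m Nt (hgc d) (hg d) W) W)| <= K ^+ 37 * v ^+ 2 := loop_Nt H (loc_hgc H) (loc_hg H) Nt_hg0.
move: b1 b2 b3 b4; set A := E (fun W => Ov d W); set B := E (fun W => nF _); set C := E (fun W => dot _ W) => b1 b2 b3 b4.
have xK : `|xd d| <= K by rewrite ger0_norm ?(okx0 H) ?(okxK H).
have k1 : `|c0 d * (xd d * (A - th d * XX d) - (B - (th d ^+ 2 * xd d + th d * (1 - th d)) * XX d))| <= v ^+ 2 * (K * (K ^+ 39 * v) + K ^+ 42 * v).
  by apply: normrM_le; [exact: c0_bnd | apply: normrB_le => //; apply: normrM_le].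
rewrite [X in `|X| <= _](_ : _ = (E C2 - (c0 d * (xd d * A - B) - C)) + c0 d * (xd d * (A - th d * XX d) - (B - (th d ^+ 2 * xd d + th d * (1 - th d)) * XX d)) - C); last by ring.
apply: le_trans (normrB_le (normrD_le b1 k1) b4) _.
have c : 100 <= 100 :> R by rewrite ler_nat.
have := Kv_le H c (isT : (3 < 47)%N) (leqnn 3); have := Kv_le H c (isT : (46 < 47)%N) (isT : (2 <= 3)%N).
have := Kv_le H c (isT : (2 < 47)%N) (isT : (2 <= 3)%N); have := Kv_le H c (isT : (40 < 47)%N) (leqnn 3).
have := Kv_le H c (isT : (42 < 47)%N) (leqnn 3); have := Kv_le H c (isT : (37 < 47)%N) (isT : (2 <= 3)%N).
have := Kv_ge0 H 47 3.
rewrite (_ : v ^+ 2 * (K * (K ^+ 39 * v) + K ^+ 42 * v) = K ^+ 40 * v ^+ 3 + K ^+ 42 * v ^+ 3); last by ring.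
rewrite (_ : 2 * K ^+ 2 * (K ^+ 44 * v ^+ 2 + v ^+ 2) = 2 * (K ^+ 46 * v ^+ 2) + 2 * (K ^+ 2 * v ^+ 2)); last by ring.
lra.
Qed.

End CodegreeSums.

Section TransposedSums.
Variables (R : realFieldType) (m n : nat) (d : ensemble R m n) (H : ok d).
Implicit Types (W : 'M[R]_(m, n)).
Local Notation E := (Ex d).
Local Notation K := (KK d).
Local Notation v := (nu d).
Local Notation N := (nr R n).
Local Notation g := (gm d).

Lemma XX_tr : XX (trd d) = XX d.
Proof. by rewrite (XXn H). Qed.

Lemma E_C3 : `|E (C3 d) - N * (dens d * (1 - dens d)) * (th d * (1 - th d) * XX d * (yd d - 1))| <= K ^+ 47 * v ^+ 3.
Proof.
have := E_C2 (ok_tr H); rewrite trdK_E XX_tr.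
rewrite (eqE H (_ : forall W, good d W -> C2 (trd d) W^T = C3 d W)) // => W _.
rewrite /C2 /C3 exchange_big /=; apply: eq_bigr => a _; apply: eq_bigr => b _.
rewrite exchange_big /=; apply: eq_bigr => c _; apply: eq_bigr => e _.
by rewrite chim_tr !mxE.
Qed.

Lemma E_hg_gb_le : `|E (fun W => \sum_a \sum_b hm d a b * g W a b * gb d W a 0)| <= K ^+ 61 * v.
Proof.
have := E_hg_ga_le (ok_tr H); rewrite trdK_E.
rewrite (eqE H (_ : forall W, good d W -> _ = \sum_a \sum_b hm d a b * g W a b * gb d W a 0)) // => W _.
rewrite exchange_big /=; apply: eq_bigr => a _; apply: eq_bigr => b _.
by rewrite gm_tr mxE /ga /= trmxK.
Qed.

Lemma E_hg_ma_le : `|E (fun W => \sum_a \sum_b hm d a b * g W a b * ma d W a 0)| <= K ^+ 46 * v ^+ 3.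
Proof.
have := E_hg_mb_le (ok_tr H); rewrite trdK_E.
rewrite (eqE H (_ : forall W, good d W -> _ = \sum_a \sum_b hm d a b * g W a b * ma d W a 0)) // => W _.
rewrite exchange_big /=; apply: eq_bigr => a _; apply: eq_bigr => b _.
by rewrite gm_tr mxE /mb /gb /= trmxK.
Qed.
End TransposedSums.

(** * The expected overlap with h *)
Section MainPhi.
Variables (R : realFieldType) (m n : nat) (d : ensemble R m n) (H : ok d).
Implicit Types (W : 'M[R]_(m, n)).
Local Notation K := (KK d).
Local Notation v := (nu d).
Local Notation M := (mr R m).
Local Notation N := (nr R n).
Local Notation q := (qd d).
Local Notation r := (1 - qd d).
Local Notation l := (dens d).

(** [rho] and [kp] are the coefficients that make [fpm] an identity. *)
Definition rho : R := r / DD d.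
Definition kp : R := (r + q / (1 - l)) / (l * DD d).
Definition uu (a : 'I_m) (b : 'I_n) : R := rho * (al d a 0 + be d b 0).
Definition ww (a : 'I_m) (b : 'I_n) : R := kp * (al d a 0 * be d b 0).
Definition phi (a : 'I_m) (b : 'I_n) : R := 1 - uu a b + uu a b ^+ 2 - ww a b.
(** [fm] and [fp] are the leading parts of [Fm] and [Fp], read off from [Fm_eq] and [Fp_eq]. *)
Definition fm (a : 'I_m) (b : 'I_n) : R := M * N * (1 - l) * (l + al d a 0) * (l + be d b 0).
Definition fp (a : 'I_m) (b : 'I_n) : R :=
  M * N * ((1 - l) * (l - (l + al d a 0) * (l + be d b 0)) + al d a 0 * be d b 0).
Definition ZZ : R := \sum_a \sum_b hm d a b * (al d a 0 * be d b 0).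
Definition SS : R := xd d * na d + yd d * nb d.

Lemma r01 : 0 <= r <= 1. Proof. by have := okq0 H; have := okq1 H; lra. Qed.
Lemma Dinv : 0 <= (DD d)^-1 <= K.
Proof.
rewrite invr_ge0 (ltW (DD_gt0 H)) /= invf_ple ?posrE ?(K_gt0 H) ?(DD_gt0 H) //.
apply: le_trans (DD_ge H); rewrite -(ler_pM2l (K_gt0 H)) divff ?gt_eqF ?(K_gt0 H) //; exact: (okdens H).
Qed.
Lemma linv : 0 <= l^-1 <= K.
Proof.
rewrite invr_ge0 (ltW (dens_gt0 H)) /= invf_ple ?posrE ?(K_gt0 H) ?(dens_gt0 H) //.
by rewrite -(ler_pM2l (K_gt0 H)) divff ?gt_eqF ?(K_gt0 H) //; exact: (okdens H).
Qed.
Lemma l1inv : 0 <= (1 - l)^-1 <= K.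
Proof.
have l1 := dens_lt1 H; have p : 0 < 1 - l by lra.
rewrite invr_ge0 (ltW p) /= invf_ple ?posrE ?(K_gt0 H) //.
by rewrite -(ler_pM2l (K_gt0 H)) divff ?gt_eqF ?(K_gt0 H) //; exact: (okdens1 H).
Qed.
Lemma rho_bnd : 0 <= rho <= K.
Proof.
have /andP[r0 r1] := r01; have /andP[d0 d1] := Dinv; rewrite /rho mulr_ge0 //=.
by rewrite -[leRHS]mul1r; apply: ler_pM.
Qed.
Lemma kp_bnd : 0 <= kp <= 2 * K ^+ 3.
Proof.
have /andP[r0 r1] := r01; have /andP[d0 d1] := Dinv; have /andP[a0 a1] := linv; have /andP[b0 b1] := l1inv.
have q0 := okq0 H; have q1 := okq1 H; have K0 := K_ge0 H; have k1 := K_ge1 H.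
rewrite /kp invfM.
have e0 : 0 <= r + q / (1 - l) by rewrite addr_ge0 // mulr_ge0 // ltW.
have e1 : r + q / (1 - l) <= 2 * K.
  have : q / (1 - l) <= 1 * K by apply: ler_pM => //; exact: ltW.
  lra.
rewrite !mulr_ge0 //= (_ : 2 * K ^+ 3 = 2 * K * (K * K)); last by ring.
by apply: ler_pM => //; [rewrite mulr_ge0 | apply: ler_pM].
Qed.

Lemma sg_le a b : `|al d a 0 + be d b 0| <= 2 * (K / v).
Proof. by have := normrD_le (al_le H a) (be_le H b); lra. Qed.
Lemma p_le a b : `|al d a 0 * be d b 0| <= (K / v) ^+ 2.
Proof. by rewrite expr2; apply: normrM_le (al_le H a) (be_le H b). Qed.
Lemma uu_le a b : `|uu a b| <= 2 * K ^+ 2 / v.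
Proof.
have /andP[r0 r1] := rho_bnd; rewrite (_ : 2 * K ^+ 2 / v = K * (2 * (K / v))); last by ring.
by apply: normrM_le; rewrite ?sg_le // ger0_norm.
Qed.
Lemma ww_le a b : `|ww a b| <= 2 * K ^+ 5 / v ^+ 2.
Proof.
have /andP[r0 r1] := kp_bnd; rewrite (_ : 2 * K ^+ 5 / v ^+ 2 = 2 * K ^+ 3 * (K / v) ^+ 2); last by field; rewrite gt_eqF ?(v_gt0 H).
by apply: normrM_le; rewrite ?p_le // ger0_norm.
Qed.

Lemma Kd_ge0 i s : 0 <= K ^+ i / v ^+ s.
Proof. by rewrite divr_ge0 ?exprn_ge0 ?(K_ge0 H) ?(v_ge0 H). Qed.
Lemma Kd_le c i j p s : c <= 100 -> (i < j)%N -> (p <= s)%N -> c * (K ^+ i / v ^+ s) <= K ^+ j / v ^+ p.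
Proof.
move=> hc ij ps; have v0 := v_gt0 H.
apply: (@le_trans _ _ (K * (K ^+ i / v ^+ s))).
  by apply: ler_wpM2r; rewrite ?Kd_ge0 //; apply: le_trans hc (okK H).
rewrite mulrA -exprS; apply: ler_pM; rewrite ?invr_ge0 ?exprn_ge0 ?(K_ge0 H) ?(v_ge0 H) //.
  by rewrite ler_weXn2l // (K_ge1 H).
by rewrite lef_pV2 ?posrE ?exprn_gt0 // ler_weXn2l // (v_ge1 H).
Qed.

Lemma phi_bnd a b : `|phi a b - 1| <= K ^+ 3 / v.
Proof.
have hu := uu_le a b; have hw := ww_le a b; have v0 := v_gt0 H; have K0 := K_gt0 H.
rewrite /phi (_ : _ - _ = - uu a b + uu a b * uu a b - ww a b); last by ring.
apply: le_trans (normrB_le (normrD_le (_ : `|- uu a b| <= _) (normrM_le hu hu)) hw) _; first by rewrite normrN; exact: hu.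
have c : 10 <= 100 :> R by rewrite ler_nat.
have k1 := Kd_le c (isT : (2 < 3)%N) (leqnn 1); rewrite !expr1 in k1.
have k2 := Kd_le c (isT : (4 < 5)%N) (leqnn 2).
have k3 : 10 * (K ^+ 5 / v ^+ 2) <= K ^+ 3 / v.
  rewrite (_ : 10 * (K ^+ 5 / v ^+ 2) = 10 * (K ^+ 5 / v) / v); last by field; rewrite gt_eqF.
  rewrite ler_pM2r ?invr_gt0 //; have := Kv_small H (isT : (6 < 100)%N) => h.
  have : K ^+ 5 / v <= K ^+ 3 / 10; last by lra.
  apply: le_trans (_ : K^-1 <= _).
    by apply: le_trans h; rewrite ler_pM2r ?invr_gt0 // ler_weXn2l // (K_ge1 H).
  rewrite ler_pdivlMr // -(ler_pM2l K0) mulrA divff ?gt_eqF // mul1r.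
  by apply: le_trans (_ : K ^+ 1 <= _); [have := okK H; rewrite expr1; lra | rewrite -exprS ler_weXn2l // (K_ge1 H)].
rewrite (_ : 2 * K ^+ 2 / v * (2 * K ^+ 2 / v) = 4 * (K ^+ 4 / v ^+ 2)); last by field; rewrite gt_eqF.
have := Kd_ge0 5 2; lra.
Qed.

Lemma delta_le : K ^+ 3 / v <= 10^-1.
Proof.
apply: le_trans (Kv_small H (isT : (3 < 100)%N)) _.
by rewrite lef_pV2 ?posrE ?(K_gt0 H) //; have := okK H; lra.
Qed.
Lemma phi_le2 a b : `|phi a b| <= 2.
Proof.
have h := phi_bnd a b; have h2 := delta_le.
have -> : phi a b = (phi a b - 1) + 1 by ring.
by apply: le_trans (ler_normD _ _) _; rewrite normr1; lra.
Qed.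

(* This is what dictates the choice of [phi]. *)
Lemma phi_inv a b : `|phi a b * (1 + uu a b + ww a b) - 1| <= K ^+ 11 / v ^+ 3.
Proof.
have hu := uu_le a b; have hw := ww_le a b; have v0 := v_gt0 H; have K0 := K_gt0 H.
rewrite /phi; move: (uu a b) (ww a b) hu hw => u w hu hw.
rewrite (_ : _ - _ = u * (u * u) - 2 * u * w + u * u * w - w * w); last by ring.
have h2u : `|2 * u| <= 2 * (2 * K ^+ 2 / v) by apply: normrM_le => //; rewrite ger0_norm.
apply: le_trans (normrB_le (normrD_le (normrB_le (normrM_le hu (normrM_le hu hu)) (normrM_le h2u hw))
  (normrM_le (normrM_le hu hu) hw)) (normrM_le hw hw)) _.
rewrite (_ : _ + _ = 8 * (K ^+ 6 / v ^+ 3) + 8 * (K ^+ 7 / v ^+ 3) + 8 * (K ^+ 9 / v ^+ 4) + 4 * (K ^+ 10 / v ^+ 4)); last by field; rewrite gt_eqF.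
have c : 40 <= 100 :> R by rewrite ler_nat.
have := Kd_le c (isT : (6 < 11)%N) (leqnn 3); have := Kd_le c (isT : (7 < 11)%N) (leqnn 3).
have := Kd_le c (isT : (9 < 11)%N) (isT : (3 <= 4)%N); have := Kd_le c (isT : (10 < 11)%N) (isT : (3 <= 4)%N).
by have := Kd_ge0 11 3; have := Kd_ge0 6 3; have := Kd_ge0 7 3; have := Kd_ge0 9 4; have := Kd_ge0 10 4; lra.
Qed.

Lemma fpm a b : q * fp a b + fm a b = LL d * DD d * (1 + uu a b + ww a b).
Proof.
have D0 := DD_gt0 H; have l0 := dens_gt0 H; have l1 := dens_lt1 H; have p : 0 < 1 - l by lra.
rewrite /uu /ww /rho /kp /fp /fm /LL.
have e : DD d = l + q * (1 - l) by [].
transitivity (LL d * DD d + M * N * (1 - l) * l * (r * (al d a 0 + be d b 0)) + M * N * (1 - l) * (r + q / (1 - l)) * (al d a 0 * be d b 0)).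
  by rewrite /LL e; field; rewrite gt_eqF.
by rewrite /LL; field; rewrite !gt_eqF.
Qed.

Lemma LLD_le : LL d * DD d <= v ^+ 4.
Proof.
have l0 := dens_gt0 H; have l1 := dens_lt1 H; have D1 := DD_le1 H; have D0 := DD_gt0 H.
apply: le_trans (MN_le H); rewrite -[leRHS]mul1r /LL -mulrA -mulrA (mulrC (l * _)) -!mulrA.
rewrite [leLHS](_ : _ = (DD d * (l * (1 - l))) * (M * N)); last by ring.
by rewrite ler_wpM2r ?mulr_ge0 ?M_ge0 ?N_ge0 // mulr_ile1 //; nra.
Qed.

Lemma fpm_phi a b : `|phi a b * (q * fp a b + fm a b) - LL d * DD d| <= K ^+ 11 * v.
Proof.
rewrite fpm (_ : _ - _ = LL d * DD d * (phi a b * (1 + uu a b + ww a b) - 1)); last by ring.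
rewrite (_ : K ^+ 11 * v = v ^+ 4 * (K ^+ 11 / v ^+ 3)); last by field; rewrite gt_eqF ?(v_gt0 H).
by apply: normrM_le; [rewrite ger0_norm ?(ltW (LLD_gt0 H)) // LLD_le | exact: phi_inv].
Qed.

Lemma sum_h_sg : \sum_a \sum_b hm d a b * (al d a 0 + be d b 0) = 0.
Proof.
under eq_bigr do under eq_bigr do rewrite mulrDr; rewrite sum2D.
by rewrite (sum_h_row H (fun a => al d a 0)) (sum_h_col H (fun b => be d b 0)) (oksal H) (oksbe H) !mulr0 addr0.
Qed.
Lemma sum_h_sg2 : \sum_a \sum_b hm d a b * (al d a 0 + be d b 0) ^+ 2 = SS + 2 * ZZ.
Proof.
have e a b : hm d a b * (al d a 0 + be d b 0) ^+ 2 = hm d a b * al d a 0 ^+ 2 + hm d a b * be d b 0 ^+ 2 + 2 * (hm d a b * (al d a 0 * be d b 0)) by ring.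
under eq_bigr do under eq_bigr do rewrite e.
by rewrite !sum2D sum2Z (sum_h_row H (fun a => al d a 0 ^+ 2)) (sum_h_col H (fun b => be d b 0 ^+ 2)) -!nF_cv.
Qed.

(** Second-order expansion in the deviations of the sum treated in [phi_pi]. First-order terms are
    absent since [al] and [be] sum to zero and [h] is regular. *)
Definition Phi2 : R := l ^+ 2 * XX d + (1 - l ^+ 2 * kp) * ZZ + (rho ^+ 2 * l ^+ 2 - rho * l) * (SS + 2 * ZZ).

Lemma phi_pi : `|\sum_a \sum_b hm d a b * (phi a b * ((l + al d a 0) * (l + be d b 0))) - Phi2| <= K ^+ 10 / v.
Proof.
have v0 := v_gt0 H; have K0 := K_gt0 H; have l0 := dens_gt0 H; have l1 := dens_lt1 H.
have -> : Phi2 = \sum_a \sum_b hm d a b * (l ^+ 2 + (l - l ^+ 2 * rho) * (al d a 0 + be d b 0)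
   + (1 - l ^+ 2 * kp) * (al d a 0 * be d b 0) + (rho ^+ 2 * l ^+ 2 - rho * l) * (al d a 0 + be d b 0) ^+ 2).
  have e a b : hm d a b * (l ^+ 2 + (l - l ^+ 2 * rho) * (al d a 0 + be d b 0)
   + (1 - l ^+ 2 * kp) * (al d a 0 * be d b 0) + (rho ^+ 2 * l ^+ 2 - rho * l) * (al d a 0 + be d b 0) ^+ 2) =
    hm d a b * l ^+ 2 + (l - l ^+ 2 * rho) * (hm d a b * (al d a 0 + be d b 0))
   + (1 - l ^+ 2 * kp) * (hm d a b * (al d a 0 * be d b 0)) + (rho ^+ 2 * l ^+ 2 - rho * l) * (hm d a b * (al d a 0 + be d b 0) ^+ 2) by ring.
  under [RHS]eq_bigr do under eq_bigr do rewrite e.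
  by rewrite !sum2D !sum2Z (sum_h_const H) sum_h_sg sum_h_sg2 /Phi2 /ZZ; ring.
rewrite sum2B; apply: le_trans (_ : \sum_a \sum_b hm d a b * (K ^+ 9 / v ^+ 3) <= _); last first.
  rewrite (sum_h_const H) (_ : K ^+ 10 / v = (K * v ^+ 2) * (K ^+ 9 / v ^+ 3)); last by field; rewrite gt_eqF.
  by rewrite ler_wpM2r ?Kd_ge0 ?(XX_le H).
apply: ler_norm_sumD => a; apply: ler_norm_sumD => b; rewrite -mulrBr normrM (ger0_norm (h_ge0 H a b)) ler_wpM2l ?(h_ge0 H) //.
have hu := uu_le a b; have hw := ww_le a b; have hp := p_le a b; have hs := sg_le a b.
have hl : `|l| <= 1 by rewrite ger0_norm; lra.
rewrite [X in `|X| <= _](_ : _ = uu a b * (uu a b * (l * (al d a 0 + be d b 0))) - uu a b * (al d a 0 * be d b 0) +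
   uu a b * (uu a b * (al d a 0 * be d b 0)) - ww a b * (l * (al d a 0 + be d b 0)) - ww a b * (al d a 0 * be d b 0)); last first.
  by rewrite /phi /uu /ww; ring.
move: hu hw hp hs; move: (uu a b) (ww a b) (al d a 0 * be d b 0) (al d a 0 + be d b 0) => u w p s hu hw hp hs.
have hls : `|l * s| <= 1 * (2 * (K / v)) by apply: normrM_le.
apply: le_trans (normrB_le (normrB_le (normrD_le (normrB_le (normrM_le hu (normrM_le hu hls)) (normrM_le hu hp))
  (normrM_le hu (normrM_le hu hp))) (normrM_le hw hls)) (normrM_le hw hp)) _.
rewrite (_ : _ + _ = 8 * (K ^+ 5 / v ^+ 3) + 2 * (K ^+ 4 / v ^+ 3) + 4 * (K ^+ 6 / v ^+ 4) + 4 * (K ^+ 6 / v ^+ 3) + 2 * (K ^+ 7 / v ^+ 4)); last by field; rewrite gt_eqF.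
have c : 60 <= 100 :> R by rewrite ler_nat.
have := Kd_le c (isT : (5 < 9)%N) (leqnn 3); have := Kd_le c (isT : (4 < 9)%N) (leqnn 3); have := Kd_le c (isT : (6 < 9)%N) (leqnn 3).
have := Kd_le c (isT : (6 < 9)%N) (isT : (3 <= 4)%N); have := Kd_le c (isT : (7 < 9)%N) (isT : (3 <= 4)%N).
by have := Kd_ge0 9 3; lra.
Qed.

(** The predicted overlap, defined as the solution of the linear equation in [Otar_eq]: the leading
    [th * XX] plus corrections that are bounded up to powers of [K]. *)
Definition Otar : R := th d * XX d - r * q / DD d ^+ 3 * (l * (1 - l) * (xd d * yd d - xd d - yd d) + SS)
  + q * ((1 - 2 * l) / DD d ^+ 2 - 2 * r * l * (1 - l) / DD d ^+ 3) / (l * (1 - l)) * ZZ.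

(** The right side collects [Phi2] and the limits of [C1], [C2] and [C3]. The square of [XX] coming
    from [C1] yields the term x y, because [XX] equals both m x and n y. *)
Lemma Otar_eq : LL d * DD d * Otar = M * N * (1 - l) * Phi2
  + q * r * ((1 - l) ^+ 2 * (th d * XX d) ^+ 2)
  - r * (c0 d * (th d * (1 - th d) * XX d * (xd d - 1)) + N * (l * (1 - l)) * (th d * (1 - th d) * XX d * (yd d - 1))).
Proof.
have D0 := DD_gt0 H; have l0 := dens_gt0 H; have l1 := dens_lt1 H; have p : 0 < 1 - l by lra.
have n0 := N_gt0 H; have m0 := M_gt0 H.
have yE : yd d = M * xd d / N by rewrite -/(XX d) (XXn H) (mulrC N) mulfK ?gt_eqF.
rewrite /Otar /Phi2 /LL /rho /kp /c0 /th /XX yE.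
(* With [q] expressed through [DD], and [yd] through [xd], the identity becomes rational in
   independent variables. *)
have qE : q = (DD d - l) / (1 - l) by rewrite /DD (addrC l) addrK mulfK ?gt_eqF.
move: D0 qE; move: (DD d) q => D q0 D0 ->.
by field; rewrite !gt_eqF.
Qed.

End MainPhi.

(** * The switching balance on h tested against phi *)

Section MainTerm.
Variables (R : realFieldType) (m n : nat) (d : ensemble R m n) (H : ok d).
Implicit Types (W : 'M[R]_(m, n)).
Local Notation K := (KK d).
Local Notation v := (nu d).
Local Notation M := (mr R m).
Local Notation N := (nr R n).
Local Notation g := (gm d).
Local Notation q := (qd d).
Local Notation r := (1 - qd d).
Local Notation l := (dens d).

(** Half the coefficient of V in the tested balance. The half keeps the matrix in the class [loc],
    since [phi] may reach 2. *)
Definition Gp W : 'M[R]_(m, n) := \matrix_(a, b) (hm d a b * (phi d a b * (1 - r * g W a b) / 2)).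

Lemma rg01 W a b : good d W -> 0 <= 1 - r * g W a b <= 1.
Proof. move=> gW; apply: opp01; apply: mul01; [exact: r01 | exact: gm01]. Qed.

Lemma loc_Gp : loc d Gp.
Proof.
split=> [W a b gW|W D a b]; rewrite !mxE.
  rewrite normrM (ger0_norm (h_ge0 H a b)) ler_piMr ?(h_ge0 H) //.
  have /andP[r0 r1] := rg01 a b gW.
  apply: (@le_trans _ _ (2 * 1 / 2)); last by lra.
  rewrite normrM (ger0_norm (_ : 0 <= 2^-1)) ?invr_ge0 //; apply: ler_wpM2r; first (by lra); apply: normrM_le; [exact: phi_le2 | by rewrite ger0_norm].
rewrite gm_shift -mulrBr normrM (ger0_norm (h_ge0 H a b)) ler_wpM2l ?(h_ge0 H) //.
rewrite (_ : _ - _ = phi d a b * (r / 2) * - D a b); last by ring.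
rewrite -[leRHS]mul1r; apply: normrM_le; last by rewrite normrN.
apply: (@le_trans _ _ (2 * 2^-1)); last by lra.
have /andP[r0 r1] := r01 H.
by apply: normrM_le; [exact: phi_le2 | rewrite ger0_norm; lra].
Qed.

Definition Tb W (u : 'I_n -> R) : R := \sum_a \sum_b hm d a b * g W a b * u b.
Definition Ta W (u : 'I_m -> R) : R := \sum_a \sum_b hm d a b * g W a b * u a.

(** The tested balance with [phi] kept only next to [fm] and V, and replaced by 1 elsewhere; small
    terms such as [om] are left to [errW]. *)
Definition mainW W : R := LL d * DD d * Ov d W
  - M * N * (1 - l) * (\sum_a \sum_b hm d a b * (phi d a b * ((l + al d a 0) * (l + be d b 0))))
  + l * (N * na d + M * nb d) * (XX d - r * Ov d W) - q * (M * nb d + N * na d) * Ov d W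
  - N * (r * l + q) * Tb W (fun b => ga d W b 0) - M * (r * l + q) * Ta W (fun a => gb d W a 0)
  - r * Ta W (fun a => ma d W a 0) - r * Tb W (fun b => mb d W b 0)
  + 2 * dot (Gp W) (VV W).

Definition swW W : R := \sum_a \sum_b hm d a b * (phi d a b * (q * (g W a b * Fp d W a b) - (1 - g W a b) * Fm d W a b)).

(** The statistics [ga], [gb], [ma], [mb] sum to zero and [h] is regular, so they survive only in
    products with g. *)
Lemma mainW_sum W : good d W -> mainW W = \sum_a \sum_b hm d a b *
  (LL d * DD d * g W a b - phi d a b * fm d a b + l * (N * na d + M * nb d) * (1 - r * g W a b)
   - q * (M * nb d + N * na d) * g W a b
   + N * (l * ga d W b 0 - (r * l + q) * g W a b * ga d W b 0)
   + M * (l * gb d W a 0 - (r * l + q) * g W a b * gb d W a 0)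
   + (1 - r * g W a b) * (ma d W a 0 + mb d W b 0) + phi d a b * (1 - r * g W a b) * VV W a b).
Proof.
move=> gW.
have e a b : hm d a b * (LL d * DD d * g W a b - phi d a b * fm d a b + l * (N * na d + M * nb d) * (1 - r * g W a b)
   - q * (M * nb d + N * na d) * g W a b
   + N * (l * ga d W b 0 - (r * l + q) * g W a b * ga d W b 0)
   + M * (l * gb d W a 0 - (r * l + q) * g W a b * gb d W a 0)
   + (1 - r * g W a b) * (ma d W a 0 + mb d W b 0) + phi d a b * (1 - r * g W a b) * VV W a b)
 = LL d * DD d * (hm d a b * g W a b) + (- (M * N * (1 - l))) * (hm d a b * (phi d a b * ((l + al d a 0) * (l + be d b 0))))
   + l * (N * na d + M * nb d) * hm d a b + (- (l * (N * na d + M * nb d) * r + q * (M * nb d + N * na d))) * (hm d a b * g W a b)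
   + N * l * (hm d a b * ga d W b 0) + (- (N * (r * l + q))) * (hm d a b * g W a b * ga d W b 0)
   + M * l * (hm d a b * gb d W a 0) + (- (M * (r * l + q))) * (hm d a b * g W a b * gb d W a 0)
   + hm d a b * ma d W a 0 + hm d a b * mb d W b 0 + (- r) * (hm d a b * g W a b * ma d W a 0) + (- r) * (hm d a b * g W a b * mb d W b 0)
   + 2 * (Gp W a b * VV W a b).
  by rewrite [Gp W a b]mxE /fm; field.
under eq_bigr do under eq_bigr do rewrite e.
rewrite !sum2D !sum2Z (sumh H) (sum_h_col H (fun b => ga d W b 0)) (sum_h_row H (fun a => gb d W a 0)).
rewrite (sum_h_row H (fun a => ma d W a 0)) (sum_h_col H (fun b => mb d W b 0)).
rewrite (sum_ga gW) (sum_gb gW) (sum_ma gW) (sum_mb gW) /mainW /Ov /Ta /Tb /dot.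
ring.
Qed.

Definition errW W : R := K ^+ 13 * v ^+ 3 + 2 * (K * v ^+ 2) * `|om d W|
  + 3 * (K ^+ 4 * v) * (\sum_b `|ga d W b 0| + \sum_a `|gb d W a 0|)
  + K ^+ 4 / v * (\sum_a `|ma d W a 0| + \sum_b `|mb d W b 0|).

(** Replacing [phi] by 1 costs a factor [K ^+ 3 / v], while [phi] was built so that its product with
    [q fp + fm] is constant up to order [v]. *)
Lemma sw_main W : good d W -> `|swW W - mainW W| <= errW W.
Proof.
move=> gW; have v0 := v_gt0 H; have v0' := ltW v0; have K0 := K_ge0 H; have l0 := dens_gt0 H; have l1 := dens_lt1 H.
have q0 := okq0 H; have q1 := okq1 H; have m0 := M_ge0 R m; have n0 := N_ge0 R n.
pose dl := K ^+ 3 / v; have dl0 : 0 <= dl by rewrite divr_ge0 // exprn_ge0.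
rewrite mainW_sum // sum2B.
apply: (@le_trans _ _ (\sum_a \sum_b (hm d a b * (K ^+ 11 * v + 6 * (K ^+ 5 * v) + 2 * `|om d W|)
   + 3 * (K ^+ 3 * v) * (hm d a b * `|ga d W b 0|) + 3 * (K ^+ 3 * v) * (hm d a b * `|gb d W a 0|)
   + dl * (hm d a b * `|ma d W a 0|) + dl * (hm d a b * `|mb d W b 0|)))); last first.
  rewrite !sum2D !sum2Z (sum_h_const H) (sum_h_col H (fun b => `|ga d W b 0|)) (sum_h_row H (fun a => `|gb d W a 0|)).
  rewrite (sum_h_row H (fun a => `|ma d W a 0|)) (sum_h_col H (fun b => `|mb d W b 0|)) /errW.
  set s1 := \sum_b _; set s2 := \sum_a _; set s3 := \sum_a _; set s4 := \sum_b _.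
  have s10 : 0 <= s1 by apply: sumr_ge0. have s20 : 0 <= s2 by apply: sumr_ge0.
  have s30 : 0 <= s3 by apply: sumr_ge0. have s40 : 0 <= s4 by apply: sumr_ge0.
  have t1 : xd d * s2 <= K * s2 by rewrite ler_wpM2r ?(okxK H).
  have t2 : yd d * s1 <= K * s1 by rewrite ler_wpM2r ?(okyK H).
  have t3 : xd d * s3 <= K * s3 by rewrite ler_wpM2r ?(okxK H).
  have t4 : yd d * s4 <= K * s4 by rewrite ler_wpM2r ?(okyK H).
  have c3 : 0 <= 3 * (K ^+ 3 * v) by rewrite !mulr_ge0 ?exprn_ge0.
  have t5 : XX d * (K ^+ 11 * v + 6 * (K ^+ 5 * v) + 2 * `|om d W|) <= K * v ^+ 2 * (K ^+ 11 * v + 6 * (K ^+ 5 * v) + 2 * `|om d W|).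
    by rewrite ler_wpM2r ?(XX_le H) // !addr_ge0 ?mulr_ge0 ?exprn_ge0.
  have c : 20 <= 100 :> R by rewrite ler_nat.
  have t6 := Kv_le H c (isT : (12 < 13)%N) (leqnn 3); have t7 := Kv_le H c (isT : (6 < 13)%N) (leqnn 3).
  have t8 := Kv_ge0 H 13 3.
  have e1 := ler_wpM2l c3 t1; have e2 := ler_wpM2l c3 t2; have e3 := ler_wpM2l dl0 t3; have e4 := ler_wpM2l dl0 t4.
  rewrite (_ : K ^+ 4 / v * (s3 + s4) = dl * (K * s3) + dl * (K * s4)); last by rewrite /dl; ring.
  rewrite (_ : 3 * (K ^+ 4 * v) * (s1 + s2) = 3 * (K ^+ 3 * v) * (K * s1) + 3 * (K ^+ 3 * v) * (K * s2)); last by ring.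
  have e5 : K * v ^+ 2 * (K ^+ 11 * v + 6 * (K ^+ 5 * v) + 2 * `|om d W|) = K ^+ 12 * v ^+ 3 + 6 * (K ^+ 6 * v ^+ 3) + 2 * (K * v ^+ 2) * `|om d W| by ring.
  move: t5 t6 t7 t8 e1 e2 e3 e4 e5; clear; lra.
apply: ler_norm_sumD => a; apply: ler_norm_sumD => b.
have /andP[g0 g1] := gm01 a b gW; have /andP[rg0 rg1] := rg01 a b gW.
have hphi := phi_bnd H a b; have hfp := fpm_phi H a b; have ha := al_le H a; have hb := be_le H b.
have P1 : 0 <= l + al d a 0 <= 1 /\ 0 <= l + be d b 0 <= 1.
  have k1 : K / v <= K^-1 by have := Kv_small H (isT : (1 < 100)%N); rewrite expr1.
  have k2 : K^-1 <= l by rewrite -(ler_pM2l (K_gt0 H)) divff ?gt_eqF ?(K_gt0 H) //; exact: (okdens H).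
  have k3 : K^-1 <= 1 - l by rewrite -(ler_pM2l (K_gt0 H)) divff ?gt_eqF ?(K_gt0 H) //; exact: (okdens1 H).
  by move: ha hb; rewrite !ler_norml => /andP[? ?] /andP[? ?]; split; lra.
case: P1 => /andP[p1 p2] /andP[p3 p4].
have kd : K / v <= dl by rewrite /dl ler_pM2r ?invr_gt0 // -[leLHS]expr1 ler_weXn2l // (K_ge1 H).
rewrite Fp_eq // Fm_eq // -/(fp d a b) -/(fm d a b) /epsT.
rewrite -mulrBr.
rewrite [X in `|_ * X|](_ : _ = g W a b * (phi d a b * (q * fp d a b + fm d a b) - LL d * DD d)
  + (1 - r * g W a b) * (N * (((phi d a b - 1) * (l + al d a 0) + al d a 0) * (na d + ga d W b 0)))
  + (1 - r * g W a b) * (M * (((phi d a b - 1) * (l + be d b 0) + be d b 0) * (nb d + gb d W a 0)))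
  - g W a b * q * ((phi d a b - 1) * (M * (nb d + gb d W a 0) + N * (na d + ga d W b 0)))
  + (1 - r * g W a b) * (phi d a b * om d W) + (1 - r * g W a b) * ((phi d a b - 1) * (ma d W a 0 + mb d W b 0))); last by ring.
have na1 : `|na d + ga d W b 0| <= K ^+ 2 + `|ga d W b 0|.
  by apply: normrD_le => //; rewrite ger0_norm ?na_ge0 //; exact: na_le.
have nb1 : `|nb d + gb d W a 0| <= K ^+ 2 + `|gb d W a 0|.
  by apply: normrD_le => //; rewrite ger0_norm ?nb_ge0 //; exact: nb_le.
have f1 (z w : R) : `|z| <= w -> 0 <= w -> `|(phi d a b - 1) * z| <= dl * w by move=> h _; apply: normrM_le.
have f2 (z : R) : 0 <= l + z <= 1 -> `|z| <= K / v -> `|(phi d a b - 1) * (l + z) + z| <= 2 * dl.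
  move=> /andP[z0 z1] hz; have h2 : `|(phi d a b - 1) * (l + z)| <= dl * 1 by apply: normrM_le => //; rewrite ger0_norm.
  by have := normrD_le h2 hz; move: kd; clear; lra.
have Mv : `|M| <= v ^+ 2 by rewrite ger0_norm ?(okm H).
have Nv : `|N| <= v ^+ 2 by rewrite ger0_norm ?(okn H).
have rg : `|1 - r * g W a b| <= 1 by rewrite ger0_norm.
have gq : `|g W a b * q| <= 1 by rewrite ger0_norm ?mulr_ge0 ?(ltW q0) // mulr_ile1 // ltW.
have gg : `|g W a b| <= 1 by rewrite ger0_norm.
have A1 := normrM_le gg hfp.
have A2 := normrM_le rg (normrM_le Nv (normrM_le (f2 _ (introT andP (conj p1 p2)) ha) na1)).
have A3 := normrM_le rg (normrM_le Mv (normrM_le (f2 _ (introT andP (conj p3 p4)) hb) nb1)).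
have A4 := normrM_le gq (normrM_le hphi (normrD_le (normrM_le Mv nb1) (normrM_le Nv na1))).
have A5 := normrM_le rg (normrM_le (phi_le2 H a b) (lexx `|om d W|)).
have A6 := normrM_le rg (normrM_le hphi (ler_normD (ma d W a 0) (mb d W b 0))).
rewrite normrM (ger0_norm (h_ge0 H a b)).
apply: le_trans (ler_wpM2l (h_ge0 H a b) (normrD_le (normrD_le (normrB_le (normrD_le (normrD_le A1 A2) A3) A4) A5) A6)) _.
rewrite le_eqVlt; apply/orP; left; apply/eqP; rewrite /dl; field; by rewrite gt_eqF.
Qed.

End MainTerm.

(** * Expectations of the remainder and of the error terms *)

Section MainEstimate.
Variables (R : realFieldType) (m n : nat) (d : ensemble R m n) (H : ok d).
Implicit Types (W : 'M[R]_(m, n)).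
Local Notation E := (Ex d).
Local Notation K := (KK d).
Local Notation v := (nu d).
Local Notation M := (mr R m).
Local Notation N := (nr R n).
Local Notation g := (gm d).
Local Notation q := (qd d).
Local Notation r := (1 - qd d).
Local Notation l := (dens d).

Definition remW W : R := \sum_a \sum_b hm d a b * (phi d a b * remh d W a b).

(** Because [phi] does not depend on W, the increments in [Eswitch] vanish and the balance is
    exact. *)
Lemma E_swrem : E (swW d) + E remW = 0.
Proof.
rewrite -(ED H).
have := Eswitch H (fun _ a b => hm d a b * phi d a b).
rewrite [RHS](eqE H (_ : forall W, good d W -> _ = 0)); last first.
  by move=> W _; do 4 (rewrite big1 // => ? _); rewrite subrr mul0r.
rewrite (E0 H) => <-; apply: (eqE H) => W _.
rewrite /swW /remW -sum2D; apply: eq_bigr => a _; apply: eq_bigr => b _.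
under [RHS]eq_bigr do rewrite -mulr_sumr.
rewrite -mulr_sumr mulrAC (h_inner H); ring.
Qed.

(** The products of [kap] are expanded in [h]. Terms with three corners in [h] have order [v ^+ 2]
    only, and replacing [phi] by 1 costs order [v ^+ 3]. *)
Lemma rem_pt W : good d W ->
  `|remW W - (r * (C2 d W + C3 d W) - q * r * C1 d W)| <= K ^+ 7 * v ^+ 3.
Proof.
move=> gW; have v0 := v_gt0 H; have v0' := ltW v0; have K0 := K_ge0 H.
have X0 := XX_ge0 H; have X1 := XX_le H; have /andP[r0 r1] := r01 H.
pose C4 := \sum_a \sum_b \sum_c \sum_e hm d a b * hm d a e * hm d c b * chim d W a b c e.
have e1 : \sum_a \sum_b hm d a b * remh d W a b = r * (C2 d W + C3 d W) - q * r * C1 d W - r ^+ 2 * C4.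
  rewrite (_ : r * (C2 d W + C3 d W) - q * r * C1 d W - r ^+ 2 * C4 =
    r * C2 d W + r * C3 d W + (- (q * r)) * C1 d W + (- r ^+ 2) * C4); last by ring.
  rewrite /C1 /C2 /C3 /C4 -!sum4Z -!sum4D; apply: eq_bigr => a _; apply: eq_bigr => b _.
  rewrite /remh mulr_sumr; apply: eq_bigr => c _; rewrite mulr_sumr; apply: eq_bigr => e _.
  by rewrite /kap; ring.
have c40 : `|C4| <= K * v ^+ 2 * K ^+ 2.
  apply: le_trans (_ : \sum_a \sum_b \sum_c \sum_e hm d a b * (hm d a e * hm d c b) <= _).
    apply: ler_norm_sumD => a; apply: ler_norm_sumD => b; apply: ler_norm_sumD => c; apply: ler_norm_sumD => e; have /andP[m0 m1] := chim01 a b c e gW.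
    have p0 : 0 <= hm d a b * (hm d a e * hm d c b) by rewrite !mulr_ge0 ?(h_ge0 H).
    by rewrite -(mulrA (hm d a b)) normrM (ger0_norm p0) (ger0_norm m0) ler_piMr.
  have e a b : \sum_c \sum_e hm d a b * (hm d a e * hm d c b) = hm d a b * (xd d * yd d).
    under eq_bigr do rewrite -mulr_sumr -mulr_suml (okx H).
    by rewrite -mulr_sumr -mulr_sumr (oky H).
  under eq_bigr do under eq_bigr do rewrite e.
  rewrite (sum_h_const H) expr2; apply: ler_pM => //; first by rewrite mulr_ge0 ?(okx0 H) ?(oky0 H).
  by apply: ler_pM; rewrite ?(okx0 H) ?(oky0 H) ?(okxK H) ?(okyK H).
have e2 : `|remW W - \sum_a \sum_b hm d a b * remh d W a b| <= K * v ^+ 2 * (K ^+ 3 / v * (3 * (K * v ^+ 2))).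
  rewrite /remW sum2B; apply: le_trans (_ : \sum_a \sum_b hm d a b * (K ^+ 3 / v * (3 * (K * v ^+ 2))) <= _).
    apply: ler_norm_sumD => a; apply: ler_norm_sumD => b.
    rewrite -mulrBr normrM (ger0_norm (h_ge0 H a b)) ler_wpM2l ?(h_ge0 H) //.
    rewrite (_ : _ - _ = (phi d a b - 1) * remh d W a b); last by ring.
    apply: normrM_le; first exact: phi_bnd.
    by apply: le_trans (remh_le H a b gW) _; rewrite ler_wpM2l.
  by rewrite (sum_h_const H) ler_wpM2r // !mulr_ge0 ?invr_ge0 ?exprn_ge0.
have rr : `|r ^+ 2| <= 1 by rewrite ger0_norm ?exprn_ge0 // exprn_ile1.
rewrite (_ : _ - _ = (remW W - \sum_a \sum_b hm d a b * remh d W a b) - r ^+ 2 * C4); last by rewrite e1; ring.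
apply: le_trans (normrB_le e2 (normrM_le rr c40)) _.
rewrite (_ : K * v ^+ 2 * (K ^+ 3 / v * (3 * (K * v ^+ 2))) = 3 * (K ^+ 5 * v ^+ 3)); last by field; rewrite gt_eqF.
have c : 20 <= 100 :> R by rewrite ler_nat.
have := Kv_le H c (isT : (5 < 7)%N) (leqnn 3); have := Kv_le H c (isT : (3 < 7)%N) (isT : (2 <= 3)%N).
have := Kv_ge0 H 7 3; rewrite (_ : 1 * (K * v ^+ 2 * K ^+ 2) = K ^+ 3 * v ^+ 2); last by ring.
lra.
Qed.

(** For g equal to 0 or 1 one has (1 - r g)(g - l) = [DD] (g - [th]). *)
Lemma GpW_pt W : good d W -> `|2 * dot (Gp d W) W - DD d * (Ov d W - th d * XX d)| <= K ^+ 5 * v.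
Proof.
move=> gW; have v0 := v_gt0 H; have K0 := K_ge0 H.
have e : DD d * (Ov d W - th d * XX d) = \sum_a \sum_b hm d a b * (DD d * (g W a b - th d)).
  rewrite -(sumh H) /Ov -sum2Z sum2B -sum2Z; apply: eq_bigr => a _; apply: eq_bigr => b _; ring.
rewrite e /dot -sum2Z sum2B.
apply: le_trans (_ : \sum_a \sum_b hm d a b * (K ^+ 4 / v) <= _); last first.
  rewrite (sum_h_const H) (_ : K ^+ 5 * v = (K * v ^+ 2) * (K ^+ 4 / v)); last by field; rewrite gt_eqF.
  by rewrite ler_wpM2r ?(XX_le H) // divr_ge0 ?exprn_ge0 // ltW.
apply: ler_norm_sumD => a; apply: ler_norm_sumD => b; rewrite [Gp d W a b]mxE.
have /andP[rg0 rg1] := rg01 H a b gW.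
rewrite [X in `|X| <= _](_ : _ = hm d a b * ((phi d a b - 1) * (DD d * (g W a b - th d)) - phi d a b * ((1 - r * g W a b) * (al d a 0 + be d b 0)))); last first.
  have W0 : W a b = g W a b - l - al d a 0 - be d b 0 by rewrite /gm; ring.
  have gg : g W a b ^+ 2 = g W a b by case: gW => h _ _; case: (h a b) => ->; ring.
  have e3 : (1 - r * g W a b) * (g W a b - l) = DD d * (g W a b - th d).
    by rewrite [RHS]mulrBr (DDth H) (_ : _ * (g W a b - l) = g W a b - l - r * g W a b ^+ 2 + r * l * g W a b); [rewrite gg /DD; ring | ring].
  transitivity (hm d a b * (phi d a b * ((1 - r * g W a b) * (g W a b - l)) - phi d a b * ((1 - r * g W a b) * (al d a 0 + be d b 0)) - DD d * (g W a b - th d))).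
    by rewrite {1}W0; field.
  by rewrite e3; ring.
rewrite normrM (ger0_norm (h_ge0 H a b)) ler_wpM2l ?(h_ge0 H) //.
have D1 := DD_le1 H; have D0 := DD_gt0 H; have /andP[t0 t1] := th01 H; have /andP[g0 g1] := gm01 a b gW.
have gt : `|g W a b - th d| <= 1 by rewrite ler_norml; lra.
have DDn : `|DD d| <= 1 by rewrite ger0_norm // ltW.
have rg : `|1 - r * g W a b| <= 1 by rewrite ger0_norm.
apply: le_trans (normrB_le (normrM_le (phi_bnd H a b) (normrM_le DDn gt)) (normrM_le (phi_le2 H a b) (normrM_le rg (sg_le H a b)))) _.
have c : 20 <= 100 :> R by rewrite ler_nat.
have := Kd_le H c (isT : (3 < 4)%N) (leqnn 1); have := Kd_le H c (isT : (1 < 4)%N) (leqnn 1); rewrite !expr1.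
have : 0 <= K ^+ 4 / v by rewrite divr_ge0 ?exprn_ge0 // ltW.
lra.
Qed.

(** [E_dot_VV_local] reduces the pairing with V to the pairing of [Gp] with W. By [GpW_pt] that is a
    multiple of [Ov - th * XX] up to order [v], whose mean has order [v] by [E_Ov_le]. *)
Lemma E_GpVV : `|2 * E (fun W => dot (Gp d W) (VV W))| <= K ^+ 46 * v ^+ 3.
Proof.
have b1 := E_dot_VV_local H (loc_Gp H); have v0 := v_gt0 H; have K0 := K_gt0 H; have l0 := dens_gt0 H; have l1 := dens_lt1 H.
have b2 : `|2 * E (fun W => dot (Gp d W) W) - DD d * (E (fun W => Ov d W) - th d * XX d)| <= K ^+ 5 * v.
  rewrite -[X in _ * (_ - X)](Ec H) -(EB H) -!(EZ H) -(EB H); apply: le_trans (Eabs H _) _.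
  by apply: (Ele_c H) => W gW; apply: GpW_pt.
have DDn : `|DD d| <= 1 by rewrite ger0_norm ?(DD_le1 H) // ltW ?(DD_gt0 H).
have b3 := normrM_le DDn (E_Ov_le H).
move: b1 b2 b3; set A := E _; set B := E _; set C := DD d * _ => b1 b2 b3.
have b4 : `|2 * B| <= K ^+ 5 * v + 1 * (K ^+ 39 * v).
  by rewrite (_ : 2 * B = (2 * B - C) + C); [apply: normrD_le | ring].
rewrite (_ : 2 * A = 2 * (A - l * (1 - l) * (M + N) * B) + l * (1 - l) * (M + N) * (2 * B)); last by ring.
have n1 : `|l * (1 - l) * (M + N)| <= 1 * (2 * v ^+ 2).
  have hM := okm H; have N1 := okn H; have M0 := M_ge0 R m; have N0 := N_ge0 R n.
  apply: normrM_le; rewrite ger0_norm; first by nra.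
  - by nra.
  - by lra.
  - by lra.
have n2 : `|2 : R| <= 2 by rewrite ger0_norm.
apply: le_trans (normrD_le (normrM_le n2 b1) (normrM_le n1 b4)) _.
rewrite (_ : 1 * (2 * v ^+ 2) * _ = 2 * (K ^+ 5 * v ^+ 3) + 2 * (K ^+ 39 * v ^+ 3)); last by ring.
have c : 20 <= 100 :> R by rewrite ler_nat.
have := Kv_le H c (isT : (45 < 46)%N) (leqnn 3); have := Kv_le H c (isT : (5 < 46)%N) (leqnn 3); have := Kv_le H c (isT : (39 < 46)%N) (leqnn 3).
have := Kv_ge0 H 46 3; lra.
Qed.

Lemma E_sum_ma : E (fun W => \sum_a `|ma d W a 0|) <= K ^+ 8 * v ^+ 4.
Proof.
have v0 := v_ge0 H; have K0 := K_ge0 H.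
rewrite (eqE H (_ : forall W, good d W -> _ = `|\sum_a `|ma d W a 0| |)); last first.
  by move=> W _; rewrite ger0_norm // sumr_ge0.
apply: (Ecs1 H (Kv_gt0 H 8 4)).
apply: le_trans (_ : E (fun W => v ^+ 2 * K ^+ 2 * nF (Mv W)) <= _).
  apply: (Ele H) => W gW; apply: le_trans (sum_norm_cv _) _; rewrite -mulrA.
  by apply: ler_pM; rewrite ?ler0n ?nF_ge0 ?(nF_ma H) ?(okm H).
rewrite (EZ H); have [h _] := E_gram_le H.
apply: le_trans (ler_wpM2l _ h) _; first by rewrite mulr_ge0 ?exprn_ge0.
rewrite (_ : v ^+ 2 * K ^+ 2 * (K ^+ 13 * v ^+ 6) = K ^+ 15 * v ^+ 8); last by ring.
rewrite (_ : (K ^+ 8 * v ^+ 4) ^+ 2 = K ^+ 16 * v ^+ 8); last by ring.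
exact: Kv_le1.
Qed.

Lemma E_om : E (fun W => `|om d W|) <= K ^+ 23 * v.
Proof.
have v0 := v_ge0 H; have K0 := K_ge0 H.
have Kv0 : 0 < K ^+ 23 * v by rewrite mulr_gt0 ?exprn_gt0 ?(K_gt0 H) ?(v_gt0 H).
apply: (Ecs1 H Kv0).
apply: le_trans (_ : E (fun W => K ^+ 2 * nF (gb d W)) <= _).
  by apply: (Ele H) => W gW; apply: om_sqr.
rewrite (EZ H); have := E_nF_ga_gb_le H; have := EnF_ge0 H (ga d) => h1 h2.
apply: le_trans (ler_wpM2l (exprn_ge0 2 K0) (_ : _ <= K ^+ 44 * v ^+ 2)) _; first by lra.
by rewrite le_eqVlt; apply/orP; left; apply/eqP; ring.
Qed.
End MainEstimate.

Section MainExpansion.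
Variables (R : realFieldType) (m n : nat) (d : ensemble R m n) (H : ok d).
Implicit Types (W : 'M[R]_(m, n)).
Local Notation E := (Ex d).
Local Notation K := (KK d).
Local Notation v := (nu d).
Local Notation M := (mr R m).
Local Notation N := (nr R n).
Local Notation q := (qd d).
Local Notation r := (1 - qd d).
Local Notation l := (dens d).

Lemma E_sum_mb : E (fun W => \sum_b `|mb d W b 0|) <= K ^+ 8 * v ^+ 4.
Proof.
have := E_sum_ma (ok_tr H); rewrite trdK_E.
by rewrite (eqE H (_ : forall W, good d W -> _ = \sum_b `|mb d W b 0|)) // => W _; rewrite /ma /ga /mb /gb /= trmxK.
Qed.

Lemma E_errW : E (errW d) <= K ^+ 50 * v ^+ 3.
Proof.
have v0 := v_gt0 H; have v0' := ltW v0; have K0 := K_ge0 H.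
apply: le_trans (_ : K ^+ 13 * v ^+ 3 + 2 * (K * v ^+ 2) * (K ^+ 23 * v) + 3 * (K ^+ 4 * v) * (K ^+ 44 * v ^+ 2 + 2 * v ^+ 2)
  + K ^+ 4 / v * (K ^+ 8 * v ^+ 4 + K ^+ 8 * v ^+ 4) <= _).
  rewrite (_ : E (errW d) = K ^+ 13 * v ^+ 3 + 2 * (K * v ^+ 2) * E (fun W => `|om d W|)
    + 3 * (K ^+ 4 * v) * E (fun W => \sum_b `|ga d W b 0| + \sum_a `|gb d W a 0|)
    + K ^+ 4 / v * (E (fun W => \sum_a `|ma d W a 0|) + E (fun W => \sum_b `|mb d W b 0|))); last first.
    rewrite -[X in X + _ + _ + _](Ec H) -(ED H (fun W => \sum_a `|ma d W a 0|)) -(EZ H _ (fun W => `|om d W|)).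
    rewrite -(EZ H _ (fun W => \sum_b `|ga d W b 0| + \sum_a `|gb d W a 0|)).
    by rewrite -(EZ H _ (fun W => \sum_a `|ma d W a 0| + \sum_b `|mb d W b 0|)) -!(ED H).
  apply: lerD; first apply: lerD; first apply: lerD => //.
  - by rewrite ler_wpM2l ?(E_om H) // !mulr_ge0 ?exprn_ge0.
  - apply: ler_wpM2l; first by rewrite !mulr_ge0 ?exprn_ge0.
    apply: le_trans (_ : E (fun W => nF (ga d W) + (nF (gb d W) + 2 * v ^+ 2)) <= _).
      apply: (Ele H) => W gW; have h1 := sum_norm_le H (ga d W); have h2 : _ <= nF (gb d W) + v ^+ 2 := sum_norm_le (ok_tr H) (gb d W); lra.
    by rewrite !(ED H) (Ec H) addrA lerD2r; exact: (E_nF_ga_gb_le H).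
  - by apply: ler_wpM2l; [rewrite divr_ge0 ?exprn_ge0 | apply: lerD; [exact: E_sum_ma|exact: E_sum_mb]].
rewrite (_ : _ + _ = K ^+ 13 * v ^+ 3 + 2 * (K ^+ 24 * v ^+ 3) + 3 * (K ^+ 48 * v ^+ 3) + 6 * (K ^+ 4 * v ^+ 3) + 2 * (K ^+ 12 * v ^+ 3)); last by field; rewrite gt_eqF.
have c : 20 <= 100 :> R by rewrite ler_nat.
have := Kv_le H c (isT : (13 < 50)%N) (leqnn 3); have := Kv_le H c (isT : (24 < 50)%N) (leqnn 3); have := Kv_le H c (isT : (48 < 50)%N) (leqnn 3).
have := Kv_le H c (isT : (4 < 50)%N) (leqnn 3); have := Kv_le H c (isT : (12 < 50)%N) (leqnn 3).
have := Kv_ge0 H 50 3; lra.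
Qed.

Lemma E_mainW : `|E (mainW d) - (LL d * DD d * E (fun W => Ov d W) - M * N * (1 - l) * Phi2 d)| <= K ^+ 65 * v ^+ 3.
Proof.
have v0 := v_gt0 H; have v0' := ltW v0; have K0 := K_ge0 H; have l0 := dens_gt0 H; have l1 := dens_lt1 H.
have q0 := okq0 H; have q1 := okq1 H; have /andP[r0 r1] := r01 H.
set PP := \sum_a \sum_b hm d a b * (phi d a b * ((l + al d a 0) * (l + be d b 0))).
have -> : E (mainW d) = LL d * DD d * E (fun W => Ov d W) - M * N * (1 - l) * PP
  + l * (N * na d + M * nb d) * (XX d - r * E (fun W => Ov d W)) - q * (M * nb d + N * na d) * E (fun W => Ov d W)
  - N * (r * l + q) * E (fun W => Tb d W (fun b => ga d W b 0)) - M * (r * l + q) * E (fun W => Ta d W (fun a => gb d W a 0))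
  - r * E (fun W => Ta d W (fun a => ma d W a 0)) - r * E (fun W => Tb d W (fun b => mb d W b 0))
  + 2 * E (fun W => dot (Gp d W) (VV W)).
  rewrite (_ : _ + _ = (- (M * N * (1 - l) * PP) + l * (N * na d + M * nb d) * XX d)
   + ((LL d * DD d - l * (N * na d + M * nb d) * r - q * (M * nb d + N * na d)) * E (fun W => Ov d W)
   + (- (N * (r * l + q)) * E (fun W => Tb d W (fun b => ga d W b 0)) + (- (M * (r * l + q)) * E (fun W => Ta d W (fun a => gb d W a 0))
   + (- r * E (fun W => Ta d W (fun a => ma d W a 0)) + (- r * E (fun W => Tb d W (fun b => mb d W b 0))
   + 2 * E (fun W => dot (Gp d W) (VV W)))))))); last by ring.
  rewrite -!(EZ H) -[X in X + _](Ec H) -!(ED H); apply: (eqE H) => W _.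
  by rewrite /mainW -/PP; ring.
have t1 := E_Ov_le H; have t2 := E_hg_ga_le H; have t3 := E_hg_gb_le H; have t4 := E_hg_ma_le H; have t5 := E_hg_mb_le H; have t6 := E_GpVV H.
have t7 := phi_pi H; rewrite -/PP in t7.
move: t1 t2 t3 t4 t5 t6 t7.
rewrite -/(Tb d _ _); set EO := E (fun W => Ov d W).
set T1 := E (fun W => Tb d W (fun b => ga d W b 0)); set T2 := E (fun W => Ta d W (fun a => gb d W a 0)).
set T3 := E (fun W => Ta d W (fun a => ma d W a 0)); set T4 := E (fun W => Tb d W (fun b => mb d W b 0)).
set VVt := 2 * _ => t1 t2 t3 t4 t5 t6 t7.
have t2' : `|T1| <= K ^+ 61 * v := t2. have t3' : `|T2| <= K ^+ 61 * v := t3.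
have t4' : `|T3| <= K ^+ 46 * v ^+ 3 := t4. have t5' : `|T4| <= K ^+ 46 * v ^+ 3 := t5.
have Mv : `|M| <= v ^+ 2 by rewrite ger0_norm ?M_ge0 ?(okm H).
have Nv : `|N| <= v ^+ 2 by rewrite ger0_norm ?N_ge0 ?(okn H).
have nak : `|na d| <= K ^+ 2 by rewrite ger0_norm ?na_ge0 ?(na_le H).
have nbk : `|nb d| <= K ^+ 2 by rewrite ger0_norm ?nb_ge0 ?(nb_le H).
have ln : `|l| <= 1 by rewrite ger0_norm; move: l0 l1; clear; lra.
have l1n : `|1 - l| <= 1 by rewrite ger0_norm; move: l0 l1; clear; lra.
have rn : `|r| <= 1 by rewrite ger0_norm.
have qn : `|q| <= 1 by rewrite ger0_norm // ltW.
have rlq : `|r * l + q| <= 1 * 1 + 1 by apply: normrD_le => //; apply: normrM_le.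
have nn : `|N * na d + M * nb d| <= v ^+ 2 * K ^+ 2 + v ^+ 2 * K ^+ 2 by apply: normrD_le; apply: normrM_le.
(* The terms with [na] and [nb] are of order [v ^+ 4] each, too large to discard. This identity
   cancels them once the overlap is replaced by [th * XX]. *)
have key : l * (1 - r * th d) = q * th d.
  have := DDth H; rewrite {1}/DD => e; rewrite mulrBr mulr1 -{1}e; ring.
rewrite [X in `|X| <= _](_ : _ = - (M * N * (1 - l) * (PP - Phi2 d)) - (r * l + q) * ((N * na d + M * nb d) * (EO - th d * XX d))
   - N * (r * l + q) * T1 - M * (r * l + q) * T2 - r * T3 - r * T4 + VVt); last first.
  transitivity (- (M * N * (1 - l) * (PP - Phi2 d)) - (r * l + q) * ((N * na d + M * nb d) * (EO - th d * XX d))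
    - N * (r * l + q) * T1 - M * (r * l + q) * T2 - r * T3 - r * T4 + VVt + (l * (1 - r * th d) - q * th d) * ((N * na d + M * nb d) * XX d)).
    by ring.
  by rewrite key subrr mul0r addr0.
have A0 : `|- (M * N * (1 - l) * (PP - Phi2 d))| <= v ^+ 2 * v ^+ 2 * 1 * (K ^+ 10 / v).
  by rewrite normrN; do 3 (apply: normrM_le => //).
have A1 := normrM_le rlq (normrM_le nn t1).
have A2 := normrM_le (normrM_le Nv rlq) t2'. have A3 := normrM_le (normrM_le Mv rlq) t3'.
have A4 := normrM_le rn t4'. have A5 := normrM_le rn t5'.
apply: le_trans (normrD_le (normrB_le (normrB_le (normrB_le (normrB_le (normrB_le A0 A1) A2) A3) A4) A5) t6) _.
rewrite [leLHS](_ : _ = K ^+ 10 * v ^+ 3 + 4 * (K ^+ 41 * v ^+ 3) + 4 * (K ^+ 61 * v ^+ 3) + 3 * (K ^+ 46 * v ^+ 3)); last by field; rewrite gt_eqF.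
have c : 40 <= 100 :> R by rewrite ler_nat.
have := Kv_le H c (isT : (10 < 65)%N) (leqnn 3); have := Kv_le H c (isT : (41 < 65)%N) (leqnn 3); have := Kv_le H c (isT : (61 < 65)%N) (leqnn 3).
have := Kv_le H c (isT : (46 < 65)%N) (leqnn 3).
have := Kv_ge0 H 65 3; clear; lra.
Qed.

(** All errors in the balance have order [v ^+ 3]; division by [LL * DD], of order [v ^+ 4], leaves
    order [1 / v]. *)
Theorem E_Ov_main : `|E (fun W => Ov d W) - Otar d| <= K ^+ 70 / v.
Proof.
have v0 := v_gt0 H; have v0' := ltW v0; have K0 := K_ge0 H.
have q0 := okq0 H; have q1 := okq1 H; have /andP[r0 r1] := r01 H.
rewrite (_ : K ^+ 70 / v = K ^+ 4 * (K ^+ 66 / v)); last by field; rewrite gt_eqF.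
apply: (LLD_div H); rewrite -[X in X * _](gtr0_norm (LLD_gt0 H)) -normrM mulrBr (Otar_eq H).
have b1 : `|E (swW d) - E (mainW d)| <= K ^+ 50 * v ^+ 3.
  rewrite -(EB H); apply: le_trans (E_errW); apply: (Eabs_le H) => W gW; exact: sw_main.
have b2 : `|E (remW d) - (r * (E (C2 d) + E (C3 d)) - q * r * E (C1 d))| <= K ^+ 7 * v ^+ 3.
  rewrite -(ED H) -!(EZ H) -!(EB H); apply: le_trans (Eabs H _) _; apply: (Ele_c H) => W gW; exact: rem_pt.
have b3 := E_swrem H; have b4 := E_mainW; have b5 := E_C1 H; have b6 := E_C2 H; have b7 := E_C3 H.
move: b1 b2 b3 b4 b5 b6 b7.
set c1 := (1 - l) ^+ 2 * _; set c2 := c0 d * _; set c3 := N * _ * _.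
set EO := E (fun W => Ov d W); set P2 := _ * Phi2 d.
move: (E (swW d)) (E (mainW d)) (E (remW d)) (E (C1 d)) (E (C2 d)) (E (C3 d)) => s ma re d1 d2 d3 b1 b2 b3 b4 b5 b6 b7.
have rn : `|r| <= 1 by rewrite ger0_norm.
have qr : `|q * r| <= 1 by rewrite ger0_norm ?mulr_ge0 ?(ltW q0) // mulr_ile1 // ltW.
have A1 := normrM_le rn (normrD_le b6 b7); have A2 := normrM_le qr b5.
rewrite [X in `|X| <= _](_ : _ = s + re - (s - ma) - (ma - (LL d * DD d * EO - P2)) - (re - (r * (d2 + d3) - q * r * d1))
   - r * ((d2 - c2) + (d3 - c3)) + q * r * (d1 - c1)); last by ring.
rewrite b3 sub0r.
apply: le_trans (normrD_le (normrB_le (normrB_le (normrB_le (_ : `|- (s - ma)| <= _) b4) b2) A1) A2) _.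
  by rewrite normrN; exact: b1.
rewrite (_ : v ^+ 4 * (K ^+ 66 / v) = K ^+ 66 * v ^+ 3); last by field; rewrite gt_eqF.
have c : 40 <= 100 :> R by rewrite ler_nat.
have := Kv_le H c (isT : (50 < 66)%N) (leqnn 3); have := Kv_le H c (isT : (65 < 66)%N) (leqnn 3); have := Kv_le H c (isT : (7 < 66)%N) (leqnn 3).
have := Kv_le H c (isT : (47 < 66)%N) (leqnn 3); have := Kv_le H c (isT : (43 < 66)%N) (leqnn 3).
have := Kv_ge0 H 66 3; clear; lra.
Qed.

End MainExpansion.

(** * The ensemble of bipartite graphs with given degrees *)
Section GraphEnsemble.
Variables (R : realType) (m n : nat) (s : 'I_m -> nat) (t : 'I_n -> nat) (H : bgraph m n).
Implicit Types (G : bgraph m n) (p : 'I_m * 'I_n).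
Definition edge G p : R := (p \in G)%:R.

Lemma deg_uE G a : (deg_u G a)%:R = \sum_b edge G (a, b) :> R.
Proof. by rewrite /deg_u -sum1_card natr_sum big_mkcond; apply: eq_bigr => b _; rewrite inE /edge; case: (_ \in G). Qed.
Lemma deg_vE G b : (deg_v G b)%:R = \sum_a edge G (a, b) :> R.
Proof. by rewrite /deg_v -sum1_card natr_sum big_mkcond; apply: eq_bigr => a _; rewrite inE /edge; case: (_ \in G). Qed.

Lemma BstP G : reflect ((forall a, \sum_b edge G (a, b) = (s a)%:R) /\ (forall b, \sum_a edge G (a, b) = (t b)%:R)) (G \in Bst s t).
Proof.
rewrite inE; apply: (iffP andP) => [[/forallP h1 /forallP h2]|[h1 h2]]; split.
- by move=> i; rewrite -deg_uE (eqP (h1 i)).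
- by move=> i; rewrite -deg_vE (eqP (h2 i)).
- by apply/forallP => j; rewrite -(eqr_nat R) deg_uE h1.
- by apply/forallP => j; rewrite -(eqr_nat R) deg_vE h2.
Qed.

Definition lm : R := Defs.lam n R s.
Definition alv : 'cV[R]_m := \col_a (((s a)%:R - smean R s) / n%:R).
Definition bev : 'cV[R]_n := \col_b (((t b)%:R - tmean R t) / m%:R).
Definition Wm G : 'M[R]_(m, n) := \matrix_(a, b) (edge G (a, b) - (lm + alv a 0 + bev b 0)).
Definition hmx : 'M[R]_(m, n) := \matrix_(a, b) edge H (a, b).
Definition kapp (q : R) p : R := 1 - (1 - q) * edge H p.
Definition wt q G : R := \prod_(p | p \notin G) kapp q p.
Definition Zw q : R := \sum_(G in Bst s t) wt q G.
Definition Exw q (f : 'M[R]_(m, n) -> R) : R := (\sum_(G in Bst s t) wt q G * f (Wm G)) / Zw q.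
Definition ens (K v x y q : R) : ensemble R m n := Ensemble lm alv bev hmx x y q (Exw q) K v.

Lemma kapp_gt0 q p : 0 < q -> q <= 1 -> 0 < kapp q p.
Proof. by move=> q0 q1; rewrite /kapp /edge; case: (p \in H); rewrite /= ?mulr1 ?mulr0; lra. Qed.
Lemma wt_gt0 q G : 0 < q -> q <= 1 -> 0 < wt q G.
Proof. by move=> q0 q1; apply: prodr_gt0 => p _; apply: kapp_gt0. Qed.
Lemma Zw_gt0 q : Bst s t != set0 -> 0 < q -> q <= 1 -> 0 < Zw q.
Proof.
case/set0Pn => G GB q0 q1; rewrite /Zw (bigD1 G) //= ltr_pwDl ?wt_gt0 // sumr_ge0 // => G' _.
exact/ltW/wt_gt0.
Qed.

Lemma wt_add q G p : p \notin G -> wt q G = kapp q p * wt q (p |: G).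
Proof.
move=> pG; rewrite /wt (bigD1 p) //=; congr (_ * _); apply: eq_bigl => p'.
by rewrite !inE negb_or andbC.
Qed.

Section Switch.
Variables (a c : 'I_m) (b e : 'I_n).
Definition quad : bgraph m n := [set (a, b); (c, e); (a, e); (c, b)].
(** Toggling the four corners is an involution on all edge sets, hence available for reindexing; it
    preserves degrees on the patterns where the switch is possible. *)
Definition sw G : bgraph m n := [set p | (p \in G) (+) (p \in quad)].

Lemma swK : involutive sw.
Proof. by move=> G; apply/setP => p; rewrite !inE -addbA addbb addbF. Qed.

Lemma edge_sw G p : p \in quad -> edge (sw G) p = 1 - edge G p.
Proof. by move=> pq; rewrite /edge inE pq addbT; case: (p \in G); rewrite ?subrr ?subr0. Qed.

Lemma quad_in : [/\ (a, b) \in quad, (c, e) \in quad, (a, e) \in quad & (c, b) \in quad].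
Proof. by rewrite !inE !eqxx !orbT. Qed.

Lemma DlEq i j : Dl R a c b e i j = ((i == a)%:R - (i == c)%:R) * ((j == b)%:R - (j == e)%:R).
Proof. by rewrite !mxE big_ord1 !mxE. Qed.

Section Pattern.
Variable G : bgraph m n.
Hypotheses (ab : (a, b) \notin G) (ce : (c, e) \notin G) (ae : (a, e) \in G) (cb : (c, b) \in G).

Lemma ac_neq : a != c. Proof. by apply: contraNneq ab => ->. Qed.
Lemma be_neq : b != e. Proof. by apply: contraNneq ab => ->. Qed.

Lemma edge_swD i j : edge (sw G) (i, j) = edge G (i, j) + Dl R a c b e i j.
Proof.
have ac := ac_neq; have be := be_neq.
have q : ((i, j) \in quad) = ((i == a) || (i == c)) && ((j == b) || (j == e)).
  by rewrite !inE !xpair_eqE; do 4 case: eqP.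
have ca : (c == a) = false by rewrite eq_sym (negPf ac).
have eb : (e == b) = false by rewrite eq_sym (negPf be).
rewrite DlEq /edge inE q.
have [->|ia] := eqVneq i a.
  rewrite (negPf ac) subr0 mul1r; have [->|jb] := eqVneq j b.
    by rewrite (negPf be) (negPf ab) subr0 add0r.
  have [->|je] := eqVneq j e; first by rewrite ae sub0r subrr.
  by rewrite subr0 addr0 addbF.
have [->|ic] := eqVneq i c; last by rewrite subrr mul0r addr0 addbF.
rewrite sub0r; have [->|jb] := eqVneq j b.
  by rewrite (negPf be) cb subr0 mulr1 subrr.
have [->|je] := eqVneq j e; first by rewrite (negPf ce) sub0r mulrNN mulr1 add0r.
by rewrite subr0 mulr0 addr0 addbF.
Qed.

Lemma sw_Bst : (sw G \in Bst s t) = (G \in Bst s t).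
Proof.
have ha i : \sum_j edge (sw G) (i, j) = \sum_j edge G (i, j).
  under eq_bigr do rewrite edge_swD; rewrite big_split /= -[RHS]addr0; congr (_ + _).
  under eq_bigr do rewrite DlEq; rewrite -mulr_sumr sumrB.
  have o (k : 'I_n) : \sum_(j < n) (j == k)%:R = 1 :> R by rewrite (bigD1 k) //= eqxx big1 ?addr0 // => i' /negPf ->.
  by rewrite !o subrr mulr0.
have hb j : \sum_i edge (sw G) (i, j) = \sum_i edge G (i, j).
  under eq_bigr do rewrite edge_swD; rewrite big_split /= -[RHS]addr0; congr (_ + _).
  under eq_bigr do rewrite DlEq; rewrite -mulr_suml sumrB.
  have o (k : 'I_m) : \sum_(j < m) (j == k)%:R = 1 :> R by rewrite (bigD1 k) //= eqxx big1 ?addr0 // => i' /negPf ->.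
  by rewrite !o subrr mul0r.
by apply/BstP/BstP => -[h1 h2]; split=> i; rewrite ?ha ?hb // -?ha -?hb.
Qed.

Lemma Wm_sw : Wm (sw G) = Wm G + Dl R a c b e.
Proof. by apply/matrixP => i j; rewrite mxE [RHS]mxE [Wm G i j]mxE edge_swD; ring. Qed.

(** Both sides are compared with the weight of G without ae and cb, a graph from which all four
    corners are missing. *)
Lemma wt_sw q : wt q (sw G) * (kapp q (a, b) * kapp q (c, e)) = wt q G * (kapp q (a, e) * kapp q (c, b)).
Proof.
have ac := ac_neq; have be := be_neq.
pose G0 := G :\ (a, e) :\ (c, b).
have e1 : wt q G0 = kapp q (c, b) * (kapp q (a, e) * wt q G).
  rewrite (@wt_add q _ (c, b)) ?inE ?eqxx //; congr (_ * _).
  rewrite (@wt_add q _ (a, e)); last by rewrite !inE !xpair_eqE !eqxx (negPf ac).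
  congr (_ * wt _ _); apply/setP => p; rewrite !inE.
  by case: eqP => [->|_] //=; case: eqP => [->|].
have e2 : wt q G0 = kapp q (a, b) * (kapp q (c, e) * wt q (sw G)).
  rewrite (@wt_add q _ (a, b)); last by rewrite !inE (negPf ab) !andbF.
  congr (_ * _).
  rewrite (@wt_add q _ (c, e)); last by rewrite !inE !xpair_eqE eq_sym (negPf ac) (negPf ce) !andbF.
  congr (_ * wt _ _); apply/setP => p; rewrite !inE.
  have [->|p1] := eqVneq p (c, e); first by rewrite (negPf ce) orbT.
  have [->|p2] := eqVneq p (a, b); first by rewrite (negPf ab).
  have [->|p3] := eqVneq p (c, b); first by rewrite cb orbT.
  have [->|p4] := eqVneq p (a, e); first by rewrite ae.
  by rewrite addbF.
rewrite mulrC -mulrA -e2 e1; ring.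
Qed.
End Pattern.

Lemma switch_sum q (psi : 'M[R]_(m, n) -> R) (d : ensemble R m n) :
  dens d = lm -> al d = alv -> be d = bev ->
  \sum_(G in Bst s t) wt q G * (psi (Wm G) * (chip d (Wm G) a b c e * (kapp q (a, b) * kapp q (c, e))))
  = \sum_(G in Bst s t) wt q G * (psi (Wm G + Dl R a c b e) * (chim d (Wm G) a b c e * (kapp q (a, e) * kapp q (c, b)))).
Proof.
move=> dl da db; have [q1 q2 q3 q4] := quad_in.
have gE G i j : gm d (Wm G) i j = edge G (i, j) by rewrite /gm [Wm G i j]mxE dl da db; ring.
rewrite big_mkcond [RHS]big_mkcond (reindex_inj (inv_inj swK)); apply: eq_bigr => G _ /=.
rewrite /chip /chim !gE !edge_sw //.
have [ab|ab] := boolP ((a, b) \in G).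
  by rewrite [edge G (a, b)](_ : _ = 1) ?/edge ?ab // subrr !(mul0r, mulr0) !if_same.
have [ce|ce] := boolP ((c, e) \in G).
  by rewrite [edge G (c, e)](_ : _ = 1) ?/edge ?ce // subrr !(mul0r, mulr0) !if_same.
have [ae|ae] := boolP ((a, e) \in G); last first.
  by rewrite [edge G (a, e)](_ : _ = 0) ?/edge ?(negPf ae) // subr0 subrr !(mul0r, mulr0) !if_same.
have [cb|cb] := boolP ((c, b) \in G); last first.
  by rewrite [edge G (c, b)](_ : _ = 0) ?/edge ?(negPf cb) // subr0 subrr !(mul0r, mulr0) !if_same.
rewrite sw_Bst // Wm_sw //; case: ifP => // _.
rewrite /edge (negPf ab) (negPf ce) ae cb !subr0 subKr !mulr1.
by have := wt_sw ab ce ae cb q => h; rewrite mul1r mulrCA h; ring.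
Qed.
End Switch.
End GraphEnsemble.

(** * Bipartite graphs with given degrees form an admissible ensemble *)

Section OkEnsemble.
Variables (R : realType) (m n : nat) (s : 'I_m -> nat) (t : 'I_n -> nat) (H : bgraph m n).
Local Notation l := (lm R n s).
(** Finite form of the asymptotic hypotheses, stable under relabelling H and, as [regularC] shows,
    under complementation. *)
Record regular (K v : R) (x y : nat) : Prop := Regular {
  rgB : Bst s t != set0;
  rgK : 100 <= K; rgnu : K ^+ 100 <= v;
  rgm : m%:R <= v ^+ 2; rgn : n%:R <= v ^+ 2; rgmn : v ^+ 4 <= K * (m%:R * n%:R);
  rgl : 1 <= K * l; rgl1 : 1 <= K * (1 - l);
  rgal : forall a, `|alv R n s a 0| * v <= K; rgbe : forall b, `|bev R m t b 0| * v <= K;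
  rgx : forall a, deg_u H a = x; rgy : forall b, deg_v H b = y;
  rgxK : x%:R <= K; rgyK : y%:R <= K }.

Variables (K v : R) (x y : nat).
Hypothesis rg : regular K v x y.

Lemma mn_gt0 : 0 < m%:R :> R /\ 0 < n%:R :> R.
Proof.
have K0 : 0 < K by have := rgK rg; lra.
have v0 : 0 < v by apply: lt_le_trans (rgnu rg); rewrite exprn_gt0.
have := lt_le_trans (exprn_gt0 4 v0) (rgmn rg); rewrite pmulr_rgt0 // !ltr0n.
by rewrite -natrM ltr0n muln_gt0 => /andP.
Qed.

Lemma sum_st : \sum_a (s a)%:R = \sum_b (t b)%:R :> R.
Proof.
have /set0Pn[G /(BstP R)[h1 h2]] := rgB rg.
under eq_bigr do rewrite -h1; rewrite exchange_big /=.
by apply: eq_bigr => b _; rewrite h2.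
Qed.

Lemma sum_alv : \sum_a alv R n s a 0 = 0.
Proof.
have [m0 n0] := mn_gt0; under eq_bigr do rewrite mxE; rewrite -mulr_suml sumrB sum_constM card_ord /smean mulrCA mulfV ?gt_eqF // mulr1 subrr mul0r //.
Qed.
Lemma sum_bev : \sum_b bev R m t b 0 = 0.
Proof.
have [m0 n0] := mn_gt0; under eq_bigr do rewrite mxE; rewrite -mulr_suml sumrB sum_constM card_ord /tmean mulrCA mulfV ?gt_eqF // mulr1 subrr mul0r //.
Qed.

Lemma lm_s : n%:R * l = smean R s.
Proof. by have [m0 n0] := mn_gt0; rewrite /lm /Defs.lam mulrC divfK // gt_eqF. Qed.
Lemma lm_t : m%:R * l = tmean R t.
Proof.
have [m0 n0] := mn_gt0; rewrite /lm /Defs.lam /smean /tmean sum_st; field; by rewrite !gt_eqF.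
Qed.

Section Q.
Variable q : R.
Hypotheses (q0 : 0 < q) (q1 : q <= 1).
Local Notation d := (ens s t H K v x%:R y%:R q).

Lemma good_Wm G : G \in Bst s t -> good d (Wm R s t G).
Proof.
move=> /(BstP R)[h1 h2]; have [m0 n0] := mn_gt0; split=> [a b|a|b].
- by rewrite /gm /= [Wm _ _ _ _ a b]mxE subrKC /edge; case: (_ \in G); [right|left].
- under eq_bigr do rewrite mxE; rewrite sumrB h1 big_split /= sum_bev addr0 sum_constM card_ord mulrDr lm_s.
  by rewrite [alv _ _ _ _ _]mxE; field; rewrite gt_eqF.
- under eq_bigr do rewrite mxE; rewrite sumrB h2 big_split /= big_split /= sum_alv addr0 !sum_constM card_ord lm_t.
  by rewrite [bev _ _ _ _ _]mxE; field; rewrite gt_eqF.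
Qed.

Lemma ok_ens : ok d.
Proof.
have Z0 := Zw_gt0 H (rgB rg) q0 q1; have [m0 n0] := mn_gt0.
split=> //=; try by case: rg.
- exact: sum_alv.
- exact: sum_bev.
- by move=> a b; rewrite mxE /edge; case: (_ \in H); [right|left].
- by move=> a; under eq_bigr do rewrite mxE; rewrite -deg_uE (rgx rg).
- by move=> b; under eq_bigr do rewrite mxE; rewrite -deg_vE (rgy rg).
- move=> c f g; rewrite /Exw mulrA -mulrDl; congr (_ / _); rewrite mulr_sumr -big_split /=.
  by apply: eq_bigr => G _; ring.
- move=> f g h; rewrite /Exw ler_pM2r ?invr_gt0 //; apply: ler_sum => G GB.
  by rewrite ler_wpM2l ?(ltW (wt_gt0 H G q0 q1)) //; apply: h; apply: good_Wm.
- by rewrite /Exw -[RHS](@divff _ (Zw s t H q)) ?gt_eqF //; congr (_ / _); apply: eq_bigr => G _; rewrite mulr1.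
- move=> psi a b c e; rewrite /Exw /kap /=; congr (_ / _); rewrite !mxE.
  exact: (@switch_sum R m n s t H a c b e q psi d).
Qed.

Definition EOq : R := (\sum_(G in Bst s t) wt H q G * (#|G :&: H|)%:R) / Zw s t H q.

Lemma EOqE : EOq = Ex d (fun W => Ov d W).
Proof.
rewrite /EOq /= /Exw; congr (_ / _); apply: eq_bigr => G GB; congr (_ * _).
rewrite /Ov pair_bigA /= -sum1_card natr_sum big_mkcond /=; apply: eq_bigr => p _.
rewrite mxE /gm /= [Wm _ _ _ _ _ _]mxE subrKC /edge -surjective_pairing inE.
by case: (p \in G); case: (p \in H); rewrite ?mulr1 ?mulr0.
Qed.

Lemma EOq_main : `|EOq - Otar d| <= K ^+ 70 / v.
Proof. rewrite EOqE; exact: E_Ov_main ok_ens. Qed.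
End Q.
End OkEnsemble.

(** * Integration over the weight parameter *)
Section LogMVT.
Import all_classical topology normedtype derive realfun.
Import numFieldNormedType.Exports.
Local Open Scope classical_set_scope.
Variable R : realType.
Lemma mvt_le (f df : R -> R) (a : R) : 0 < a -> a < 1 ->
  (forall x : R, 0 < x -> is_derive x 1 f (df x)) ->
  (forall x, a <= x <= 1 -> 0 <= df x) -> f a <= f 1.
Proof.
move=> a0 a1 hd hp.
have hc : {within `[a, 1], continuous f}.
  apply: derivable_within_continuous => x; rewrite in_itv /= => /andP[ax _].
  have x0 : 0 < x by apply: lt_le_trans ax.
  by have [] := hd x x0.
have hd' (x : R) : x \in `]a, 1[%R -> is_derive x 1 f (df x).
  by rewrite in_itv /= => /andP[ax _]; apply: hd; apply: lt_trans ax.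
have [c] := MVT a1 hd' hc; rewrite in_itv /= => /andP[ac c1] e.
rewrite -subr_ge0 e mulr_ge0 ?subr_ge0 ?(ltW a1) //; apply: hp; rewrite !ltW //.
Qed.

Lemma log_mvt (f df : R -> R) (e a : R) : 0 < a -> a < 1 ->
  (forall x : R, 0 < x -> is_derive x 1 f (df x)) ->
  (forall x, a <= x <= 1 -> `|x * df x| <= e) -> `|f 1 - f a| <= e * - ln a.
Proof.
move=> a0 a1 hd hp.
have b x : a <= x <= 1 -> 0 <= e * x^-1 + df x /\ 0 <= e * x^-1 - df x.
  move=> hx; have x0 : 0 < x by case/andP: hx => ax _; apply: lt_le_trans ax.
  have := hp x hx; rewrite ler_norml => /andP[h1 h2].
  split; rewrite -(pmulr_rge0 _ x0) ?mulrDr mulrCA divff ?gt_eqF // mulr1 ?mulrN; lra.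
have m1 : (fun x => e * ln x + f x) a <= (fun x => e * ln x + f x) 1.
  apply: (@mvt_le (fun x => e * ln x + f x) (fun x => e * x^-1 + df x)) => // [x x0|x hx]; last by case: (b x hx).
  have h1 := is_derive1_ln x0; have h2 := hd x x0; exact: is_deriveD.
have m2 : (fun x => e * ln x - f x) a <= (fun x => e * ln x - f x) 1.
  apply: (@mvt_le (fun x => e * ln x - f x) (fun x => e * x^-1 - df x)) => // [x x0|x hx]; last by case: (b x hx).
  have h1 := is_derive1_ln x0; have h2 := hd x x0; exact: is_deriveB.
by move: m1 m2; rewrite ln1 mulr0 ler_norml; lra.
Qed.

Lemma is_derive_frac (l q : R) : l + q * (1 - l) != 0 ->
  is_derive q 1 (fun x : R => (1 - x) / (l + x * (1 - l))) (- (l + q * (1 - l)) ^- 2).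
Proof.
move=> D0.
have h1 : is_derive q (1 : R) (fun x : R => l + x * (1 - l)) (1 - l).
  have -> : (fun x : R => l + x * (1 - l)) = horner (l%:P + (1 - l)%:P * 'X).
    by apply/funext => x; rewrite !hornerE mulrC.
  have := is_derive_poly (l%:P + (1 - l)%:P * 'X) q.
  by rewrite derivD derivC derivM derivC mul0r !add0r derivX mulr1 hornerC.
have h2 : is_derive q (1 : R) (fun x : R => 1 - x) (- 1).
  have -> : (fun x : R => 1 - x) = horner (1 - 'X).
    by apply/funext => x; rewrite !hornerE.
  have := is_derive_poly (1 - 'X) q.
  by rewrite derivB derivX derivC sub0r !hornerE.
have h3 := @is_deriveV R (fun x : R => l + x * (1 - l)) q _ _ D0 h1.
have h4 := is_deriveM h2 h3.
apply: is_derive_eq h4 _; rewrite /GRing.scale /=; field; exact: D0.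
Qed.

Lemma is_derive_Psi (l X B Z q : R) : 0 < l + q * (1 - l) ->
  is_derive q 1 (fun x => X * ln (l + x * (1 - l)) - B / 2 * ((1 - x) / (l + x * (1 - l))) ^+ 2
     + Z * ((1 - 2 * l) * ((1 - x) / (l + x * (1 - l))) - l * (1 - l) * ((1 - x) / (l + x * (1 - l))) ^+ 2))
   (X * (1 - l) / (l + q * (1 - l)) + B * ((1 - q) / (l + q * (1 - l)) ^+ 3)
     - Z * ((1 - 2 * l) / (l + q * (1 - l)) ^+ 2 - 2 * (1 - q) * l * (1 - l) / (l + q * (1 - l)) ^+ 3)).
Proof.
move=> D0.
have Dn : l + q * (1 - l) != 0 by rewrite gt_eqF.
set u := fun x : R => (1 - x) / (l + x * (1 - l)).
have hu : is_derive q 1 u (- (l + q * (1 - l)) ^- 2) := is_derive_frac Dn.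
have h1 : is_derive q (1 : R) (fun x : R => l + x * (1 - l)) (1 - l).
  have -> : (fun x : R => l + x * (1 - l)) = horner (l%:P + (1 - l)%:P * 'X).
    by apply/funext => x; rewrite !hornerE mulrC.
  have := is_derive_poly (l%:P + (1 - l)%:P * 'X) q.
  by rewrite derivD derivC derivM derivC mul0r !add0r derivX mulr1 hornerC.
have hl := is_derive1_ln D0.
have h2 : is_derive q (1 : R) (fun x => ln (l + x * (1 - l))) ((l + q * (1 - l))^-1 * (1 - l)).
  exact: (@is_derive1_comp R (@ln R) (fun x => l + x * (1 - l)) q).
have hu2 := is_deriveX 2 hu.
have h3 := is_deriveD (is_deriveB (is_deriveZ X h2) (is_deriveZ (B / 2) hu2))
  (is_deriveZ Z (is_deriveB (is_deriveZ (1 - 2 * l) hu) (is_deriveZ (l * (1 - l)) hu2))).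
apply: is_derive_eq h3 _; rewrite /GRing.scale /= /u; field; exact: Dn.
Qed.
End LogMVT.

(** * The probability that a random graph contains H *)

Section Contain.
Import all_classical topology normedtype derive realfun.
Import numFieldNormedType.Exports.
Variables (R : realType) (m n : nat) (s : 'I_m -> nat) (t : 'I_n -> nat) (H : bgraph m n).
Variables (K v : R) (x y : nat).
Hypothesis rg : regular s t H K v x y.
Hypothesis lnv : ln v <= K.
Local Notation l := (lm R n s).
Local Notation X := (#|H|%:R : R).

Definition Sg : R := x%:R * nF (alv R n s) + y%:R * nF (bev R m t).
Definition Zg : R := \sum_a \sum_b edge R H (a, b) * (alv R n s a 0 * bev R m t b 0).
Definition Bg : R := l * (1 - l) * (x%:R * y%:R - x%:R - y%:R) + Sg.
Definition Zc : R := Zg / (l * (1 - l)).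
Definition Dq (q : R) : R := l + q * (1 - l).
Definition uq (q : R) : R := (1 - q) / Dq q.
(* [Psi] is the antiderivative of [(X - Otar q) / q] with [Psi 1 = 0]. *)
Definition Psi (q : R) : R := X * ln (Dq q) - Bg / 2 * uq q ^+ 2 + Zc * ((1 - 2 * l) * uq q - l * (1 - l) * uq q ^+ 2).
Definition dPsi (q : R) : R := X * (1 - l) / Dq q + Bg * ((1 - q) / Dq q ^+ 3)
     - Zc * ((1 - 2 * l) / Dq q ^+ 2 - 2 * (1 - q) * l * (1 - l) / Dq q ^+ 3).
(** The value of [Psi] at q = 0, where [Dq] is [l] and [uq] is its inverse. *)
Definition Psi0 : R := X * ln l - Bg / 2 / l ^+ 2 - Zc.

Lemma wtE (q : R) G : wt H q G = q ^+ #|H :\: G|.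
Proof.
rewrite /wt (bigID (fun p => p \in H)) /= [X in _ * X]big1 ?mulr1; last first.
  by move=> p /andP[_ pH]; rewrite /kapp /edge (negPf pH) mulr0 subr0.
rewrite -prodr_const; apply: eq_big => [p|p /andP[_ pH]]; first by rewrite inE.
by rewrite /kapp /edge pH mulr1; ring.
Qed.

(** The total weight as a polynomial in q, whose formal derivative counts the missing edges of H. *)
Definition Zp : {poly R} := \sum_(G in Bst s t) 'X^#|H :\: G|.

Lemma ZpE (q : R) : Zp.[q] = Zw s t H q.
Proof. by rewrite /Zp horner_sum; apply: eq_bigr => G _; rewrite hornerXn wtE. Qed.

Lemma dZpE (q : R) : q * (deriv Zp).[q] = \sum_(G in Bst s t) wt H q G * #|H :\: G|%:R.
Proof.
rewrite /Zp (raddf_sum deriv) horner_sum mulr_sumr /=; apply: eq_bigr => G _.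
rewrite derivXn hornerMn hornerXn wtE -mulr_natr mulrA; case: #|_| => [|k] /=; first by rewrite !mulr0.
by rewrite -exprS.
Qed.

Lemma l01 : 0 < l < 1.
Proof. by have K0 := rgK rg; have h1 := rgl rg; have h2 := rgl1 rg; apply/andP; split; nra. Qed.

Lemma Zw_pos (q : R) : 0 < q -> 0 < Zw s t H q.
Proof.
move=> q0; have /set0Pn[G GB] := rgB rg; rewrite /Zw (bigD1 G) //= ltr_pwDl ?wtE ?exprn_gt0 //.
by rewrite sumr_ge0 // => G' _; rewrite wtE exprn_ge0 // ltW.
Qed.

Lemma missE (q : R) : 0 < q -> \sum_(G in Bst s t) wt H q G * #|H :\: G|%:R = Zw s t H q * (X - EOq s t H q).
Proof.
move=> q0; have Z0 := Zw_pos q0.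
rewrite mulrBr /EOq mulrC mulrCA divff ?gt_eqF // mulr1 /Zw mulr_sumr -sumrB.
apply: eq_bigr => G _; rewrite -(cardsID G H) natrD finset.setIC; ring.
Qed.

Lemma X_xm : X = m%:R * x%:R.
Proof.
have := @sumh R m n (ens s t H K v x%:R y%:R 1) (ok_ens rg ltr01 (lexx _)) => /= h.
rewrite /XX /= in h; rewrite -h pair_bigA /= -sum1_card natr_sum big_mkcond /=; apply: eq_bigr => p _.
by rewrite mxE /edge -surjective_pairing; case: (_ \in H).
Qed.

Lemma dPsi_Otar (q : R) : 0 < q -> q <= 1 -> q * dPsi q = X - Otar (ens s t H K v x%:R y%:R q).
Proof.
move=> q0 q1; have /andP[l0 l1] := l01.
have D0 : 0 < Dq q by rewrite /Dq ltr_wpDr // mulr_ge0 ?ltW // subr_gt0.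
rewrite /Otar /th /DD /XX /= -/(Dq q) -X_xm.
have -> : SS (ens s t H K v x%:R y%:R q) = Sg by [].
have -> : ZZ (ens s t H K v x%:R y%:R q) = Zg.
  by apply: eq_bigr => a _; apply: eq_bigr => b _; rewrite [hm _ a b]mxE.
rewrite /dPsi /Zc -/Bg.
rewrite (_ : X * (1 - l) / Dq q = (X - l / Dq q * X) / q); last by rewrite /Dq; field; rewrite !gt_eqF.
by field; rewrite !gt_eqF // subr_gt0.
Qed.

Lemma is_derive_J (q : R) : 0 < q -> is_derive q 1 (fun z : R => ln (Zp.[z]) - Psi z) ((deriv Zp).[q] / Zp.[q] - dPsi q).
Proof.
move=> q0; have /andP[l0 l1] := l01.
have D0 : 0 < l + q * (1 - l) by rewrite ltr_wpDr // mulr_ge0 ?ltW // subr_gt0.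
have h1 := is_derive_Psi #|H|%:R Bg Zc D0.
have Z0 : 0 < Zp.[q] by rewrite ZpE Zw_pos.
have h2 := is_derive_poly Zp q.
have h3 := is_derive1_ln Z0.
have h4 := @is_derive1_comp R (@ln R) (horner Zp) q _ _ h3 h2.
by apply: is_derive_eq (is_deriveB h4 h1) _; rewrite mulrC.
Qed.

(** Since the number of edges of H is at most [K * v ^+ 2], its product with this cut-off is below
    [1 / v]; on the other side [- ln q0 = 4 * ln v] is at most [4 * K]. *)
Local Notation q0 := (v ^- 4).

Lemma v_facts : [/\ 100 <= v, 0 < q0, q0 < 1 & K <= v].
Proof.
have k := rgK rg; have kv := rgnu rg.
have Kv : K <= v by apply: le_trans kv; rewrite -{1}[K]expr1 ler_weXn2l //; lra.
have v1 : 100 <= v by lra.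
have v4 : 1 < v ^+ 4 by rewrite exprn_egt1 //; lra.
split=> //; first by rewrite invr_gt0; lra.
by rewrite invf_lt1 //; lra.
Qed.

(** By [EOq_main] the logarithmic derivatives of the total weight and of the exponential of [Psi]
    differ by at most [K ^+ 70 / v], and [log_mvt] integrates this. *)
Lemma J_bnd : `|ln (#|Bst s t|%:R) - (ln (Zw s t H q0) - Psi q0)| <= K ^+ 70 / v * (4 * K).
Proof.
have [v1 p0 p1 Kv] := v_facts; have K0 : 0 <= K by have := rgK rg; lra.
have h := log_mvt p0 p1 is_derive_J (e := K ^+ 70 / v).
have J1 : ln Zp.[1] - Psi 1 = ln (#|Bst s t|%:R).
  have -> : Psi 1 = 0.
    have D1 : Dq 1 = 1 by rewrite /Dq; ring.
    have u1 : uq 1 = 0 by rewrite /uq subrr mul0r.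
    by rewrite /Psi D1 u1 ln1; ring.
  by rewrite subr0 ZpE /Zw; congr ln; rewrite -sum1_card natr_sum; apply: eq_bigr => G _; rewrite wtE expr1n.
rewrite J1 !ZpE in h; apply: le_trans (h _) _.
  move=> q /andP[hq hq1]; have q_gt0 : 0 < q by apply: lt_le_trans hq.
  rewrite mulrBr mulrA dZpE ZpE missE // mulrAC divff ?gt_eqF ?Zw_pos // mul1r.
  rewrite dPsi_Otar // (_ : _ - _ = - (EOq s t H q - Otar (ens s t H K v x%:R y%:R q))); last by ring.
  by rewrite normrN; exact: EOq_main.
rewrite ler_wpM2l ?divr_ge0 ?exprn_ge0 //; first by lra.
have v0 : 0 < v by lra.
by rewrite lnV ?posrE ?exprn_gt0 // opprK lnXn // mulr_natl lerMn2r lnv orbT.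
Qed.

Lemma Bg_bnd : `|Bg| <= K ^+ 4.
Proof.
have ok1 := ok_ens rg ltr01 (lexx _); have k := rgK rg; have /andP[l0 l1] := l01.
have h1 : nF (alv R n s) <= K ^+ 2 := na_le ok1. have h2 : nF (bev R m t) <= K ^+ 2 := nb_le ok1.
have f1 := nF_ge0 (alv R n s); have f2 := nF_ge0 (bev R m t).
have x0 : 0 <= x%:R :> R := ler0n _ _. have y0 : 0 <= y%:R :> R := ler0n _ _.
have xK := rgxK rg; have yK := rgyK rg.
have c1 : `|x%:R * y%:R - x%:R - y%:R : R| <= K * K + K + K.
  by apply: normrB_le; [apply: normrB_le; [apply: normrM_le|]|]; rewrite ger0_norm.
have c2 : `|l * (1 - l)| <= 1 by rewrite ger0_norm; nra.
have c3 : `|Sg| <= K * K ^+ 2 + K * K ^+ 2 by apply: normrD_le; apply: normrM_le; rewrite ger0_norm.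
apply: le_trans (normrD_le (normrM_le c2 c1) c3) _.
rewrite (_ : 1 * _ + _ = K ^+ 2 + 2 * K + 2 * K ^+ 3); last by ring.
have K2 : 100 * K <= K ^+ 2 by rewrite expr2; nra.
have K3 : 100 * K ^+ 2 <= K ^+ 3 by rewrite exprS; apply: ler_wpM2r => //; nra.
have K4 : 100 * K ^+ 3 <= K ^+ 4 by rewrite (exprS _ 3); apply: ler_wpM2r => //; rewrite exprn_ge0; lra.
lra.
Qed.

Lemma Zc_bnd : `|Zc| <= K ^+ 5.
Proof.
have ok1 := ok_ens rg ltr01 (lexx _); have K0 := K_ge0 ok1; have v0 := v_gt0 ok1; rewrite /= in K0 v0.
have /andP[l0 l1] := l01.
have h : `|Zg| <= K ^+ 3.
  apply: (@le_trans _ _ (\sum_a \sum_b hm (ens s t H K v x%:R y%:R 1) a b * (K / v) ^+ 2)).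
    apply: ler_norm_sumD => a; apply: ler_norm_sumD => b; rewrite normrM [hm _ a b]mxE.
    apply: ler_pM => //; first by rewrite ger0_norm // ler0n.
    exact: (p_le ok1 a b).
  rewrite (sum_h_const ok1) (_ : K ^+ 3 = (K * v ^+ 2) * (K / v) ^+ 2); last by field; rewrite gt_eqF.
  by rewrite ler_wpM2r ?sqr_ge0 ?(XX_le ok1).
rewrite /Zc (_ : K ^+ 5 = K ^+ 3 * (K * K)); last by ring.
apply: normrM_le => //; have /andP[a0 a1] := linv ok1; have /andP[b0 b1] := l1inv ok1.
by rewrite invfM ger0_norm ?mulr_ge0 //; apply: ler_pM.
Qed.

Lemma uq_facts : [/\ `|uq q0 - l^-1| <= K ^+ 2 * q0, `|uq q0| <= K, 0 <= l^-1 <= K & (Dq q0)^-1 <= K].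
Proof.
have [v1 p0 p1 Kv] := v_facts; have ok1 := ok_ens rg ltr01 (lexx _); have K0 := K_ge0 ok1; rewrite /= in K0.
have /andP[l0 l1] := l01; have /andP[a0 a1] := linv ok1; rewrite /= in a0 a1.
have D0 : 0 < Dq q0 by rewrite /Dq ltr_wpDr // mulr_ge0 ?ltW // subr_gt0.
have Dl : l <= Dq q0 by rewrite /Dq lerDl mulr_ge0 ?ltW // subr_gt0.
have Di : (Dq q0)^-1 <= l^-1 by rewrite lef_pV2 ?posrE.
have Di0 : 0 <= (Dq q0)^-1 by rewrite invr_ge0 ltW.
split=> //; last by lra.
- have e (z : R) : 0 < Dq z -> uq z - l^-1 = - (l^-1 * (Dq z)^-1 * z).
    by rewrite /uq /Dq => D1; field; rewrite !gt_eqF.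
  rewrite e //.
  rewrite normrN ger0_norm ?mulr_ge0 ?(ltW p0) // ler_wpM2r ?(ltW p0) // expr2 ler_pM //; lra.
- rewrite /uq -[leRHS]mul1r; apply: normrM_le; rewrite ger0_norm //; lra.
- by rewrite a0 a1.
Qed.

Lemma ln_le_sub1 (z : R) : 0 < z -> ln z <= z - 1.
Proof. by move=> z0; have := expR_ge1Dx (ln z); rewrite lnK ?posrE //; lra. Qed.

Lemma q0_le (c : R) i p : c <= 100 -> (i < 12)%N -> (p <= 3)%N -> c * (K ^+ i * v ^+ p * q0) <= K ^+ 12 / v.
Proof.
move=> hc hi hp; have ok1 := ok_ens rg ltr01 (lexx _); have [v1 p0 p1 Kv] := v_facts.
have := Kv_le ok1 hc hi hp => /= h.
rewrite mulrA (_ : K ^+ 12 / v = K ^+ 12 * v ^+ 3 * q0); last by field; lra.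
by rewrite ler_wpM2r // ltW.
Qed.

Lemma X_le : 0 <= X <= K * v ^+ 2.
Proof.
have ok1 := ok_ens rg ltr01 (lexx _); rewrite ler0n /= X_xm mulrC.
by apply: ler_pM; rewrite ?ler0n ?(rgxK rg) ?(rgm rg).
Qed.

Lemma Psi_bnd : `|Psi q0 - Psi0| <= K ^+ 12 / v.
Proof.
have [v1 p0 p1 Kv] := v_facts; have /andP[l0 l1] := l01; have [u1 u2 /andP[a0 a1] d1] := uq_facts.
have K0 := rgK rg; have /andP[X0 X1] := X_le; have B1 := Bg_bnd; have Z1 := Zc_bnd.
have D0 : 0 < Dq q0 by rewrite /Dq ltr_wpDr // mulr_ge0 ?ltW // subr_gt0.
have L1 : `|ln (Dq q0) - ln l| <= K * q0.
  rewrite -ln_div ?posrE // ger0_norm; last first.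
    by rewrite ln_ge0 // ler_pdivlMr // mul1r /Dq lerDl mulr_ge0 ?ltW // subr_gt0.
  apply: le_trans (ln_le_sub1 (divr_gt0 D0 l0)) _.
  rewrite (_ : _ - _ = (1 - l) * l^-1 * q0); last by rewrite /Dq; field; rewrite !gt_eqF //; lra.
  rewrite ler_wpM2r ?(ltW p0) // -[leRHS]mul1r; apply: ler_pM => //; lra.
have u3 : `|uq q0 ^+ 2 - l^-1 ^+ 2| <= 2 * K ^+ 3 * q0.
  rewrite subr_sqr (_ : 2 * K ^+ 3 * q0 = (K ^+ 2 * q0) * (K + K)); last by ring.
  by apply: normrM_le => //; apply: normrD_le => //; rewrite ger0_norm.
rewrite (_ : Psi q0 - Psi0 = X * (ln (Dq q0) - ln l) - Bg / 2 * (uq q0 ^+ 2 - l^-1 ^+ 2)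
  + Zc * ((1 - 2 * l) * (uq q0 - l^-1) - l * (1 - l) * (uq q0 ^+ 2 - l^-1 ^+ 2))); last first.
  by rewrite /Psi /Psi0; field; rewrite !gt_eqF.
have X2 : `|X| <= K * v ^+ 2 by rewrite ger0_norm.
have hBg : `|Bg / 2| <= K ^+ 4 * 1 by apply: normrM_le => //; rewrite ger0_norm //; clear -rg lnv; lra.
have n1 : `|1 - 2 * l| <= 1 by rewrite ler_norml; move: l0 l1; clear -rg lnv; lra.
have n2 : `|l * (1 - l)| <= 1 by rewrite ger0_norm; move: l0 l1; clear -rg lnv; nra.
apply: le_trans (normrD_le (normrB_le (normrM_le X2 L1) (normrM_le hBg u3)) (normrM_le Z1 (normrB_le (normrM_le n1 u1) (normrM_le n2 u3)))) _.
rewrite [leLHS](_ : _ = K ^+ 2 * v ^+ 2 * q0 + 2 * (K ^+ 7 * v ^+ 0 * q0) + K ^+ 7 * v ^+ 0 * q0 + 2 * (K ^+ 8 * v ^+ 0 * q0)); last by ring.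
have c : 60 <= 100 :> R by rewrite ler_nat.
have := q0_le c (isT : (2 < 12)%N) (isT : (2 <= 3)%N); have := q0_le c (isT : (7 < 12)%N) (isT : (0 <= 3)%N); have := q0_le c (isT : (8 < 12)%N) (isT : (0 <= 3)%N).
have : 0 <= K ^+ 12 / v by rewrite divr_ge0 ?exprn_ge0 //; move: K0 v1; clear -rg lnv; lra.
clear -rg lnv; lra.
Qed.

Lemma dPsi_bnd : `|q0 * dPsi q0| <= K ^+ 12 / v.
Proof.
have [v1 p0 p1 Kv] := v_facts; have /andP[l0 l1] := l01; have [u1 u2 /andP[a0 a1] d1] := uq_facts.
have K0 := rgK rg; have /andP[X0 X1] := X_le; have B1 := Bg_bnd; have Z1 := Zc_bnd.
have D0 : 0 < Dq q0 by rewrite /Dq ltr_wpDr // mulr_ge0 ?ltW // subr_gt0.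
have i0 : 0 <= (Dq q0)^-1 by rewrite invr_ge0 ltW.
have dn : `|(Dq q0)^-1| <= K by rewrite ger0_norm.
have X2 : `|X| <= K * v ^+ 2 by rewrite ger0_norm.
have qn : `|q0| <= q0 by rewrite ger0_norm // ltW.
have n1 : `|1 - 2 * l| <= 1 by rewrite ler_norml; lra.
have n0 : `|1 - l| <= 1 by rewrite ger0_norm; move: l0 l1; clear -rg lnv; lra.
have nq : `|1 - q0| <= 1 by rewrite ger0_norm; move: p0 p1; clear -rg lnv; lra.
have n2 : `|2 * ((1 - q0) * (l * (1 - l)))| <= 2 * (1 * 1).
  by apply: normrM_le; [rewrite ger0_norm|apply: normrM_le => //; rewrite ger0_norm; (move: l0 l1; clear -rg lnv; nra)].
have d3 : `|(Dq q0)^-1 ^+ 3| <= K ^+ 3 by rewrite normrX lerXn2r ?nnegrE //; move: K0; clear -rg lnv; lra.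
have d2 : `|(Dq q0)^-1 ^+ 2| <= K ^+ 2 by rewrite normrX lerXn2r ?nnegrE //; move: K0; clear -rg lnv; lra.
rewrite (_ : q0 * dPsi q0 = q0 * (X * (1 - l) * (Dq q0)^-1 + Bg * ((1 - q0) * (Dq q0)^-1 ^+ 3)
   - Zc * ((1 - 2 * l) * (Dq q0)^-1 ^+ 2 - 2 * ((1 - q0) * (l * (1 - l))) * (Dq q0)^-1 ^+ 3))); last first.
  by rewrite /dPsi -!exprVn; ring.
apply: le_trans (normrM_le qn (normrB_le (normrD_le (normrM_le (normrM_le X2 n0) dn) (normrM_le B1 (normrM_le nq d3)))
  (normrM_le Z1 (normrB_le (normrM_le n1 d2) (normrM_le n2 d3))))) _.
rewrite [leLHS](_ : _ = K ^+ 2 * v ^+ 2 * q0 + 2 * (K ^+ 7 * v ^+ 0 * q0) + 2 * (K ^+ 8 * v ^+ 0 * q0)); last by ring.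
have c : 60 <= 100 :> R by rewrite ler_nat.
have := q0_le c (isT : (2 < 12)%N) (isT : (2 <= 3)%N); have := q0_le c (isT : (7 < 12)%N) (isT : (0 <= 3)%N); have := q0_le c (isT : (8 < 12)%N) (isT : (0 <= 3)%N).
have : 0 <= K ^+ 12 / v by rewrite divr_ge0 ?exprn_ge0 //; move: K0 v1; clear -rg lnv; lra.
clear -rg lnv; lra.
Qed.

Definition NH : R := \sum_(G in Bst s t) (H \subset G)%:R.

(* Markov's inequality for the number of edges of H missing from G. *)
Lemma NH_Zw : Zw s t H q0 * (1 - (X - EOq s t H q0)) <= NH <= Zw s t H q0.
Proof.
have [v1 p0 p1 Kv] := v_facts; have Z0 := Zw_pos p0.
rewrite mulrBr mulr1 -missE // /NH /Zw -sumrB.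
apply/andP; split; apply: ler_sum => G _; rewrite -finset.setD_eq0 wtE -cards_eq0; case: #|_| => [|k] /=.
- by rewrite expr0 mulr0 subr0.
- rewrite subr_le0 ler_peMr ?exprn_ge0 ?(ltW p0) //; by rewrite ler1n.
- by rewrite expr0.
- by rewrite exprn_ge0 // ltW.
Qed.

Theorem containment_prob : exists2 e : R, `|e| <= K ^+ 73 / v & NH / #|Bst s t|%:R = expR (Psi0 + e).
Proof.
have [v1 p0 p1 Kv] := v_facts; have Z0 := Zw_pos p0; have k := rgK rg.
have v0 : 0 < v by lra.
have /andP[N1 N2] := NH_Zw; have j := J_bnd; have pb := Psi_bnd; have db := dPsi_bnd.
have B0 : 0 < #|Bst s t|%:R :> R by rewrite ltr0n card_gt0 (rgB rg).
set eta := X - EOq s t H q0 in N1.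
have ok1 := ok_ens rg ltr01 (lexx _).
have k3 : K ^+ 12 / v <= K ^+ 70 / v by rewrite ler_pM2r ?invr_gt0 // ler_weXn2l //; lra.
have k7 : 0 <= K ^+ 70 / v by rewrite divr_ge0 ?exprn_ge0 //; move: k v0; clear -rg lnv; lra.
have eta1 : eta <= 2 * (K ^+ 70 / v).
  have eo := EOq_main rg p0 (ltW p1); rewrite dPsi_Otar // in db; last exact: ltW.
  by move: db eo; rewrite !ler_norml /eta => /andP[_ h1] /andP[h2 h3]; lra.
have eta2 : eta <= 2^-1.
  have := Kv_small ok1 (isT : (71 < 100)%N) => /= h.
  have h2 : 4 * (K ^+ 70 / v) <= K ^+ 71 / v.
    by rewrite mulrA ler_pM2r ?invr_gt0 // (exprS K 70) ler_wpM2r ?exprn_ge0 //; move: k; clear -rg lnv; lra.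
  have : K^-1 <= 2^-1 by rewrite lef_pV2 ?posrE //; move: k; clear -rg lnv; lra.
  lra.
have N0 : 0 < NH by apply: lt_le_trans N1; rewrite mulr_gt0 //; lra.
exists (ln NH - ln #|Bst s t|%:R - Psi0); last first.
  by rewrite subrKC -ln_div ?posrE // lnK // posrE divr_gt0.
have a1 : ln NH <= ln (Zw s t H q0) by rewrite ler_ln ?posrE.
(* The Markov bound [N1] loses the factor 1 - [eta]; as [eta] is at most one half, its inverse is at
   most 1 + 2 [eta]. *)
have a2 : ln (Zw s t H q0) - 4 * (K ^+ 70 / v) <= ln NH.
  have p : 0 < 1 - eta by lra.
  have : ln (Zw s t H q0 / NH) <= Zw s t H q0 / NH - 1 by apply: ln_le_sub1; rewrite divr_gt0.
  rewrite ln_div ?posrE //.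
  have : Zw s t H q0 / NH <= (1 - eta)^-1.
    by rewrite ler_pdivrMr // mulrC ler_pdivlMr.
  have : (1 - eta)^-1 <= 1 + 4 * (K ^+ 70 / v).
    rewrite -(ler_pM2r p) mulVf ?gt_eqF //; nra.
  lra.
have k8 : 0 <= K ^+ 71 / v by rewrite divr_ge0 ?exprn_ge0 //; move: k v0; clear -rg lnv; lra.
have e1 : K ^+ 70 / v * (4 * K) = 4 * (K ^+ 71 / v) by rewrite (exprS K 70); ring.
have h2 : 10 * (K ^+ 70 / v) <= K ^+ 71 / v.
  by rewrite mulrA ler_pM2r ?invr_gt0 // (exprS K 70) ler_wpM2r ?exprn_ge0 //; lra.
have h3 : 10 * (K ^+ 71 / v) <= K ^+ 73 / v.
  rewrite mulrA ler_pM2r ?invr_gt0 // (exprD K 2 71) ler_wpM2r ?exprn_ge0 //; first by lra.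
  by rewrite expr2; nra.
rewrite e1 in j.
have A : `|ln NH - ln (Zw s t H q0)| <= 4 * (K ^+ 70 / v) by rewrite ler_norml; lra.
rewrite (_ : _ - Psi0 = (ln NH - ln (Zw s t H q0)) - (ln #|Bst s t|%:R - (ln (Zw s t H q0) - Psi q0)) + (Psi q0 - Psi0)); last by ring.
apply: le_trans (normrD_le (normrB_le A j) pb) _; lra.
Qed.
End Contain.

(** * Averaging over the isomorphism class *)
Section Iso.
Variables m n : nat.
Implicit Types (H G : bgraph m n).
Lemma in_relabel (sg : {perm 'I_m}) (tau : {perm 'I_n}) H p :
  (p \in relabel sg tau H) = (((sg^-1)%g p.1, (tau^-1)%g p.2) \in H).
Proof.
apply/imsetP/idP => [[r rH ->]|h]; first by rewrite /= !permK -surjective_pairing.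
by exists ((sg^-1)%g p.1, (tau^-1)%g p.2) => //=; rewrite !permKV -surjective_pairing.
Qed.

Definition colsw (b e : 'I_n) H : bgraph m n := relabel 1%g (tperm b e) H.

Lemma in_colsw b e H p : (p \in colsw b e H) = ((p.1, tperm b e p.2) \in H).
Proof. by rewrite in_relabel invg1 perm1 tpermV. Qed.

Lemma colswK b e : involutive (colsw b e).
Proof. by move=> H; apply/setP => p; rewrite !in_colsw /= tpermK -surjective_pairing. Qed.

Lemma colsw_iso b e H H' : (colsw b e H' \in isoClass H) = (H' \in isoClass H).
Proof.
have h H1 : H1 \in isoClass H -> colsw b e H1 \in isoClass H.
  rewrite !inE => /existsP[sg /existsP[tau /eqP ->]]; apply/existsP; exists sg; apply/existsP; exists (tau * tperm b e)%g.
  by apply/eqP/setP => p; rewrite in_colsw !in_relabel /= invMg permM tpermV.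
by apply/idP/idP => [/h|/h //]; rewrite colswK.
Qed.

Lemma iso_refl H : H \in isoClass H.
Proof.
rewrite inE; apply/existsP; exists 1%g; apply/existsP; exists 1%g; apply/eqP/setP => p.
by rewrite in_relabel !invg1 !perm1 -surjective_pairing.
Qed.

Lemma deg_iso H H' x y : H' \in isoClass H -> (forall a, deg_u H a = x) -> (forall b, deg_v H b = y) ->
  (forall a, deg_u H' a = x) /\ (forall b, deg_v H' b = y).
Proof.
rewrite inE => /existsP[sg /existsP[tau /eqP ->]] hx hy; split=> [a|b].
  rewrite -(hx ((sg^-1)%g a)) /deg_u -[RHS](card_preimset _ (@perm_inj _ (tau^-1)%g)).
  by apply: eq_card => k; rewrite !inE in_relabel.
rewrite -(hy ((tau^-1)%g b)) /deg_v -[RHS](card_preimset _ (@perm_inj _ (sg^-1)%g)).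
by apply: eq_card => k; rewrite !inE in_relabel.
Qed.
End Iso.

(** * Exponential moment of the bilinear statistic over the isomorphism class *)

Section Average.
Variables (R : realType) (m n : nat) (s : 'I_m -> nat) (t : 'I_n -> nat) (H : bgraph m n).
Variables (K v : R) (x y : nat).
Hypothesis rg : regular s t H K v x y.
Hypothesis lnv : ln v <= K.
Local Notation l := (lm R n s).
Local Notation alp := (alv R n s).
Local Notation bet := (bev R m t).
Local Notation I := (isoClass H).
Local Notation Z := (Zg R s t).

Lemma rg_iso H' : H' \in I -> regular s t H' K v x y.
Proof.
move=> hI; have [h1 h2] := deg_iso hI (rgx rg) (rgy rg).
by case: rg => *; split.
Qed.

Definition pcol (H' : bgraph m n) (b : 'I_n) : R := \sum_a edge R H' (a, b) * alp a 0.

Lemma ZE H' : Z H' = \sum_b pcol H' b * bet b 0.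
Proof.
rewrite /Zg exchange_big; apply: eq_bigr => b _; rewrite mulr_suml; apply: eq_bigr => a _ /=; ring.
Qed.

Lemma Zsw b e H' : Z H' - Z (colsw b e H') = (pcol H' b - pcol H' e) * (bet b 0 - bet e 0).
Proof.
have hp c : pcol (colsw b e H') c = pcol H' (tperm b e c).
  by apply: eq_bigr => a _; rewrite /edge in_colsw.
have -> : Z (colsw b e H') = \sum_c pcol H' c * bet (tperm b e c) 0.
  rewrite ZE (reindex_inj (@perm_inj _ (tperm b e))); apply: eq_bigr => c _.
  by rewrite hp tpermK.
rewrite ZE -sumrB.
have [->|ne] := eqVneq b e.
  by rewrite !subrr mul0r big1 // => c _; rewrite tperm1 perm1 subrr.
rewrite (bigD1 b) //= (bigD1 e) 1?eq_sym //= tpermL tpermR big1 ?addr0; first by ring.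
by move=> c /andP[cb ce]; rewrite tpermD 1?eq_sym // subrr.
Qed.

(* Z is an average of its increments under column transpositions, as in Stein's method of
   exchangeable pairs; this bounds its exponential moment. *)
Lemma sum_Zsw H' : \sum_b \sum_e (Z H' - Z (colsw b e H')) = 2 * n%:R * Z H'.
Proof.
under eq_bigr do under eq_bigr do rewrite Zsw.
have e b e' : (pcol H' b - pcol H' e') * (bet b 0 - bet e' 0) =
  pcol H' b * bet b 0 + (- pcol H' b) * bet e' 0 + (- bet b 0) * pcol H' e' + pcol H' e' * bet e' 0 by ring.
under eq_bigr do under eq_bigr do rewrite e.
rewrite !sum2D.
have s1 : \sum_b \sum_(e' < n) pcol H' b * bet b 0 = n%:R * Z H'.
  by rewrite ZE mulr_sumr; apply: eq_bigr => b _; rewrite sum_constM card_ord.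
have s2 : \sum_b \sum_e' - pcol H' b * bet e' 0 = 0.
  by rewrite big1 // => b _; rewrite -mulr_sumr (sum_bev rg) mulr0.
have s3 : \sum_(b < n) \sum_e' - bet b 0 * pcol H' e' = 0.
  by rewrite exchange_big big1 //= => b _; rewrite -mulr_suml sumrN (sum_bev rg) oppr0 mul0r.
have s4 : \sum_(b < n) \sum_e' pcol H' e' * bet e' 0 = n%:R * Z H'.
  by rewrite sum_constM card_ord -ZE.
rewrite s1 s2 s3 s4; ring.
Qed.

Lemma sum_iso_sw (f : bgraph m n -> R) b e : \sum_(H' in I) f (colsw b e H') = \sum_(H' in I) f H'.
Proof.
rewrite [RHS](reindex_inj (inv_inj (@colswK m n b e))); apply: eq_bigl => H'; by rewrite colsw_iso.
Qed.

Lemma n2_neq0 : 2 * n%:R != 0 :> R.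
Proof. by have [_ n0] := mn_gt0 rg; rewrite mulf_neq0 // gt_eqF. Qed.

Lemma sum_Z : \sum_(H' in I) Z H' = 0.
Proof.
apply: (mulfI n2_neq0); rewrite mulr0 mulr_sumr.
under eq_bigr do rewrite -sum_Zsw.
rewrite exchange_big big1 //= => b _; rewrite exchange_big big1 //= => e _.
by rewrite sumrB sum_iso_sw subrr.
Qed.

(** The coefficient with which [Zg] enters [Psi0]. *)
Definition cc : R := - (l * (1 - l))^-1.

Lemma pcol_bnd H' b : H' \in I -> `|pcol H' b| <= K ^+ 2 / v.
Proof.
move=> hI; have r' := rg_iso hI; have ok1 := ok_ens r' ltr01 (lexx _); have K0 := K_ge0 ok1; have v0 := v_gt0 ok1; rewrite /= in K0 v0.
apply: le_trans (_ : \sum_a edge R H' (a, b) * (K / v) <= _).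
  apply: ler_norm_sumD => a; rewrite normrM ger0_norm ?ler0n // ler_wpM2l ?ler0n //; exact: (al_le ok1).
rewrite -mulr_suml -deg_vE (rgy r') expr2 -mulrA ler_wpM2r ?divr_ge0 ?(rgyK rg) ?(ltW v0) //.
Qed.

Lemma cc_bnd : `|cc| <= K ^+ 2.
Proof.
have ok1 := ok_ens rg ltr01 (lexx _); have /andP[a0 a1] := linv ok1; have /andP[b0 b1] := l1inv ok1; rewrite /= in a0 a1 b0 b1.
by rewrite /cc normrN invfM expr2 ger0_norm ?mulr_ge0 // ler_pM.
Qed.

Lemma Ysw_bnd b e H' : H' \in I -> (cc * Z H' - cc * Z (colsw b e H')) ^+ 2 <= 16 * K ^+ 10 / v ^+ 4.
Proof.
move=> hI; have ok1 := ok_ens rg ltr01 (lexx _); have v0 := v_gt0 ok1; rewrite /= in v0.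
rewrite -mulrBr Zsw (_ : 16 * K ^+ 10 / v ^+ 4 = (K ^+ 2 * ((2 * (K ^+ 2 / v)) * (2 * (K / v)))) ^+ 2); last by field; rewrite gt_eqF.
apply: sqr_le_norm; apply: normrM_le; first exact: cc_bnd.
apply: normrM_le; last by have := normrB_le (be_le ok1 b) (be_le ok1 e) => /=; lra.
by have := normrB_le (pcol_bnd b hI) (pcol_bnd e hI); lra.
Qed.

(** For w at most u this is the tangent bound e^w >= e^u (1 + w - u); the other case is
    symmetric. *)
Lemma exp_diff (u w : R) : (u - w) * (expR u - expR w) <= (u - w) ^+ 2 * (expR u + expR w).
Proof.
wlog h : u w / w <= u.
  move=> hw; have [/hw //|/ltW /hw] := leP w u.
  by move=> h; apply: le_trans (le_trans _ h) _; rewrite le_eqVlt; apply/orP; left; apply/eqP; ring.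
have e0 := expR_gt0 u; have e1 := expR_gt0 w.
rewrite expr2 -mulrA ler_wpM2l ?subr_ge0 //.
have := expR_ge1Dx (w - u); rewrite expRD expRN => h2.
have : expR u * (1 + (w - u)) <= expR w.
  by rewrite -ler_pdivlMl // mulrC.
by nra.
Qed.

(** Below, convexity of exp and the zero mean of Z suffice. Above, for Y = [cc] Z, the sum of Y e^Y
    is symmetrised over column transpositions into products (Y - Y')(e^Y - e^Y'), which [exp_diff]
    bounds by a small multiple of the sum of e^Y. The inequality e^Y - 1 <= Y e^Y closes the
    estimate. *)
Lemma avg_exp : #|I|%:R <= \sum_(H' in I) expR (cc * Z H') <= #|I|%:R * (1 + 16 * K ^+ 10 / v ^+ 2).
Proof.
have ok1 := ok_ens rg ltr01 (lexx _); have v0 := v_gt0 ok1; have K0 := K_ge0 ok1; rewrite /= in v0 K0.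
have [m0 n0] := mn_gt0 rg.
set S := \sum_(H' in I) _; have S0 : 0 <= S by apply: sumr_ge0 => H' _; exact: expR_ge0.
apply/andP; split.
  apply: le_trans (_ : \sum_(H' in I) (1 + cc * Z H') <= _).
    by rewrite big_split /= sumr_const -mulr_sumr sum_Z mulr0 addr0.
  by apply: ler_sum => H' _; exact: expR_ge1Dx.
(* The bound [16 * K ^+ 10 / v ^+ 4] on a squared increment, times 2 and the n^2 pairs of columns,
   is divided by 4 n; finally n is at most [v ^+ 2]. *)
pose ep := 8 * K ^+ 10 / v ^+ 2.
have h1 : \sum_(H' in I) cc * Z H' * expR (cc * Z H') <= ep * S.
  rewrite -(ler_pM2l (_ : 0 < 4 * n%:R)) ?mulr_gt0 //.
  have e1 : 2 * n%:R * (\sum_(H' in I) cc * Z H' * expR (cc * Z H')) =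
    \sum_b \sum_e \sum_(H' in I) (cc * Z H' - cc * Z (colsw b e H')) * expR (cc * Z H').
    rewrite mulr_sumr (eq_bigr (fun H' => \sum_b \sum_e (cc * Z H' - cc * Z (colsw b e H')) * expR (cc * Z H'))); last first.
      move=> H' _; rewrite (_ : 2 * n%:R * (cc * Z H' * expR (cc * Z H')) = cc * expR (cc * Z H') * (2 * n%:R * Z H')); last by ring.
      rewrite -sum_Zsw mulr_sumr; apply: eq_bigr => b _; rewrite mulr_sumr; apply: eq_bigr => e _; ring.
    by rewrite exchange_big /=; apply: eq_bigr => b _; rewrite exchange_big.
  have e2 b e : 2 * (\sum_(H' in I) (cc * Z H' - cc * Z (colsw b e H')) * expR (cc * Z H')) =
     \sum_(H' in I) (cc * Z H' - cc * Z (colsw b e H')) * (expR (cc * Z H') - expR (cc * Z (colsw b e H'))).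
    under [RHS]eq_bigr do rewrite mulrBr; rewrite sumrB.
    rewrite -[X in _ = _ - X](sum_iso_sw _ b e); under [X in _ = _ - X]eq_bigr do rewrite colswK.
    rewrite mulr_natl mulr2n; congr (_ + _); rewrite -sumrN; apply: eq_bigr => H' _; ring.
  have e3 b e : 2 * (\sum_(H' in I) (cc * Z H' - cc * Z (colsw b e H')) * expR (cc * Z H')) <= 16 * K ^+ 10 / v ^+ 4 * (2 * S).
    rewrite e2; apply: le_trans (_ : \sum_(H' in I) 16 * K ^+ 10 / v ^+ 4 * (expR (cc * Z H') + expR (cc * Z (colsw b e H'))) <= _).
      apply: ler_sum => H' hI; apply: le_trans (exp_diff _ _) _.
      by rewrite ler_wpM2r ?addr_ge0 ?expR_ge0 // Ysw_bnd.
    have e5 : \sum_(H' in I) expR (cc * Z (colsw b e H')) = S by exact: (sum_iso_sw (fun H' => expR (cc * Z H')) b e).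
    rewrite -mulr_sumr big_split /= e5 -/S; apply: ler_wpM2l; last by lra.
    by rewrite divr_ge0 ?mulr_ge0 ?exprn_ge0 // ltW.
  rewrite (_ : 4 * n%:R * (\sum_(H' in I) _) = 2 * (2 * n%:R * \sum_(H' in I) cc * Z H' * expR (cc * Z H'))); last by ring.
  rewrite e1 mulr_sumr.
  apply: le_trans (_ : \sum_(b < n) \sum_(e < n) 16 * K ^+ 10 / v ^+ 4 * (2 * S) <= _).
    by apply: ler_sum => b _; rewrite mulr_sumr; apply: ler_sum => e _; exact: e3.
  rewrite !sum_constM !card_ord.
  rewrite (_ : n%:R * (n%:R * _) = n%:R * (32 * K ^+ 10 * S / v ^+ 4) * n%:R); last by field; rewrite gt_eqF.
  rewrite (_ : 4 * n%:R * (ep * S) = n%:R * (32 * K ^+ 10 * S / v ^+ 4) * v ^+ 2); last by rewrite /ep; field; rewrite gt_eqF.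
  rewrite ler_wpM2l ?(rgn rg) // mulr_ge0 ?(ltW n0) // divr_ge0 ?exprn_ge0 ?(ltW v0) // !mulr_ge0 ?exprn_ge0 //.
have h2 : S - #|I|%:R <= ep * S.
  apply: le_trans h1; rewrite -sum1_card natr_sum -sumrB; apply: ler_sum => H' _.
  have := expR_ge1Dx (- (cc * Z H')); rewrite expRN => h; have e0 := expR_gt0 (cc * Z H').
  rewrite lerBlDr -lerBlDl; have : expR (cc * Z H') * (1 - cc * Z H') <= 1.
    by rewrite -ler_pdivlMl // mulr1.
  lra.
have ep1 : ep <= 2^-1.
  have k := rgK rg; have := Kv_small ok1 (isT : (11 < 100)%N) => /= h.
  have k1 : K^-1 <= 2^-1 by rewrite lef_pV2 ?posrE //; lra.
  have v1 : 1 <= v := v_ge1 ok1.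
  apply: le_trans (_ : K ^+ 11 / v <= _); last by lra.
  rewrite /ep ler_pM ?mulr_ge0 ?exprn_ge0 ?invr_ge0 //.
  - by rewrite sqr_ge0.
  - by rewrite (exprS K 10) ler_wpM2r ?exprn_ge0 //; lra.
  - by rewrite lef_pV2 ?posrE ?exprn_gt0 // expr2 ler_peMl // ltW.
have ep0 : 0 <= ep by rewrite divr_ge0 ?mulr_ge0 ?exprn_ge0 ?(ltW v0).
rewrite (_ : 16 * K ^+ 10 / v ^+ 2 = 2 * ep); last by rewrite /ep; ring.
have C0 : 0 <= #|I|%:R :> R by rewrite ler0n.
have e4 : S * (1 - ep) <= #|I|%:R by lra.
have p : 0 < 1 - ep by lra.
rewrite -(ler_pM2r p); apply: le_trans e4 _; rewrite -mulrA ler_peMr //; nra.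
Qed.
End Average.

(** * Expected number of contained copies *)

Section Expectation.
Variables (R : realType) (m n : nat) (s : 'I_m -> nat) (t : 'I_n -> nat) (H : bgraph m n).
Variables (K v : R) (x y : nat).
Hypothesis rg : regular s t H K v x y.
Hypothesis lnv : ln v <= K.
Local Notation l := (lm R n s).
Local Notation I := (isoClass H).

Lemma exp_containedE : exp_contained R s t H = \sum_(H' in I) NH R s t H' / #|Bst s t|%:R.
Proof.
rewrite /exp_contained -mulr_suml; congr (_ / _); rewrite /NH exchange_big /=; apply: eq_bigr => G _.
rewrite -sum1_card natr_sum big_mkcond [RHS]big_mkcond /=; apply: eq_bigr => H' _.
by rewrite inE; case: (H' \in I) => //=; case: (H' \subset G).
Qed.

Lemma card_iso H' : H' \in I -> #|H'| = #|H|.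
Proof. by move=> hI; apply/eqP; rewrite -(eqr_nat R) (X_xm (rg_iso rg hI)) (X_xm rg). Qed.

(** The rescalings of [alv] by n and of [bev] by m exchange the roles of x and y through m x = n
    y. *)
Lemma Sg_RC : Sg R s t x y = (y%:R * Rdev R s + x%:R * Cdev R t) / (m%:R * n%:R).
Proof.
have [m0 n0] := mn_gt0 rg.
have yE : y%:R = m%:R * x%:R / n%:R :> R.
  have := X_xm rg; have ok1 := ok_ens rg ltr01 (lexx _); have := XXn ok1; rewrite /XX /= => -> _.
  by rewrite /nr mulrAC divff ?gt_eqF // mul1r.
rewrite /Sg !nF_cv (_ : \sum_i _ = Rdev R s / n%:R ^+ 2); last first.
  by rewrite /Rdev mulr_suml; apply: eq_bigr => a _; rewrite mxE expr_div_n.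
rewrite (_ : \sum_i _ = Cdev R t / m%:R ^+ 2); last first.
  by rewrite /Cdev mulr_suml; apply: eq_bigr => a _; rewrite mxE expr_div_n.
by rewrite yE; field; rewrite !gt_eqF.
Qed.

Theorem exp_contained_main : exists2 e : R, `|e| <= K ^+ 74 / v &
  exp_contained R s t H = l ^+ #|H| * #|I|%:R *
    expR (- ((1 - l) * (x%:R * y%:R - x%:R - y%:R)) / (2 * l)
          - (y%:R * Rdev R s + x%:R * Cdev R t) / (2 * l ^+ 2 * m%:R * n%:R) + e).
Proof.
have /andP[l0 l1] := l01 rg; have [m0 n0] := mn_gt0 rg; have k := rgK rg.
have ok1 := ok_ens rg ltr01 (lexx _); have v0 := v_gt0 ok1; have v1 := v_ge1 ok1; rewrite /= in v0 v1.
set A := - _ / _ - _.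
pose C0 := #|H|%:R * ln l - Bg R s t x y / 2 / l ^+ 2.
have CA : expR C0 = l ^+ #|H| * expR A.
  rewrite /C0 expRD expRM_natl lnK ?posrE //; congr (_ * expR _).
  by rewrite /A /Bg Sg_RC; field; rewrite !gt_eqF.
pose eta := K ^+ 73 / v; have eta0 : 0 <= eta by rewrite divr_ge0 ?exprn_ge0 //; lra.
(* Only the factor with [Zg] varies over the class: relabelling preserves the degrees, hence the
   edge count and [Bg]. *)
have term H' : H' \in I -> expR (C0 - eta) * expR (cc R n s * Zg R s t H') <= NH R s t H' / #|Bst s t|%:R
     <= expR (C0 + eta) * expR (cc R n s * Zg R s t H').
  move=> hI; have [e he ->] := containment_prob (rg_iso rg hI) lnv.
  rewrite -!expRD !ler_expR /Psi0 card_iso // -/C0 /Zc /cc.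
  move: he; rewrite ler_norml -/eta => /andP[e0 e1].
  rewrite (_ : - (l * (1 - l))^-1 * Zg R s t H' = - (Zg R s t H' / (l * (1 - l)))); last by ring.
  by apply/andP; split; lra.
have /andP[a1 a2] := avg_exp rg.
set S := \sum_(H' in I) expR _ in a1 a2.
have I0 : 0 < #|I|%:R :> R by rewrite ltr0n card_gt0; apply/set0Pn; exists H; exact: iso_refl.
have S0 : 0 < S by apply: lt_le_trans a1.
have b1 : expR (C0 - eta) * S <= exp_contained R s t H.
  by rewrite exp_containedE mulr_sumr; apply: ler_sum => H' hI; case/andP: (term H' hI).
have b2 : exp_contained R s t H <= expR (C0 + eta) * S.
  by rewrite exp_containedE mulr_sumr; apply: ler_sum => H' hI; case/andP: (term H' hI).
have E0 : 0 < exp_contained R s t H by apply: lt_le_trans b1; rewrite mulr_gt0 ?expR_gt0.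
move: (exp_contained R s t H) b1 b2 E0 => EC b1 b2 E0.
exists (ln EC - ln #|I|%:R - C0); last first.
  have -> : A + (ln EC - ln #|I|%:R - C0) = A - C0 + (ln EC - ln #|I|%:R) by ring.
  rewrite expRD -ln_div ?posrE // lnK ?posrE ?divr_gt0 //.
  rewrite expRD expRN CA; field; by rewrite !gt_eqF ?expR_gt0 ?exprn_gt0.
have c1 : C0 - eta + ln S <= ln EC.
  by rewrite -(expRK (C0 - eta)) -lnM ?posrE ?expR_gt0 // ler_ln ?posrE ?(mulr_gt0 (expR_gt0 _) S0) //.
have c2 : ln EC <= C0 + eta + ln S.
  by rewrite -(expRK (C0 + eta)) -lnM ?posrE ?expR_gt0 // ler_ln ?posrE ?(mulr_gt0 (expR_gt0 _) S0) //.
have c3 : ln #|I|%:R <= ln S by rewrite ler_ln ?posrE.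
pose dl := 16 * K ^+ 10 / v ^+ 2; have dl0 : 0 <= dl by rewrite divr_ge0 ?mulr_ge0 ?exprn_ge0 //; move: k v0; clear -rg lnv; lra.
have c4 : ln S <= ln #|I|%:R + dl.
  apply: le_trans (_ : ln (#|I|%:R * (1 + dl)) <= _); first by rewrite ler_ln ?posrE ?mulr_gt0 // ltr_wpDr.
  by rewrite lnM ?posrE //; [rewrite lerD2l le_ln1Dx //; move: dl0; clear -rg lnv; lra | move: dl0; clear -rg lnv; lra].
have d1 : dl <= eta.
  rewrite /dl /eta; apply: le_trans (_ : K ^+ 11 / v <= _); last by rewrite ler_pM2r ?invr_gt0 // ler_weXn2l //; move: k; clear -rg lnv; lra.
  apply: ler_pM; rewrite ?mulr_ge0 ?exprn_ge0 ?invr_ge0 ?exprn_ge0 //; try (move: k v0; clear -rg lnv; lra).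
  - by rewrite (exprS K 10) ler_wpM2r ?exprn_ge0 //; move: k; clear -rg lnv; lra.
  - by rewrite lef_pV2 ?posrE ?exprn_gt0 // expr2 ler_peMl // ltW.
have d2 : 2 * eta <= K ^+ 74 / v.
  by rewrite /eta mulrA ler_pM2r ?invr_gt0 // (exprS K 73) ler_wpM2r ?exprn_ge0 //; move: k; clear -rg lnv; lra.
by rewrite ler_norml; move: c1 c2 c3 c4 d1 d2 eta0 dl0; clear -rg lnv; lra.
Qed.
End Expectation.

(** * Complementation *)
Section Complement.
Variables (R : realType) (m n : nat) (s : 'I_m -> nat) (t : 'I_n -> nat) (H : bgraph m n).
Variables (K v : R) (x y : nat).
Hypothesis rg : regular s t H K v x y.
Hypothesis lnv : ln v <= K.
Local Notation l := (lm R n s).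
Local Notation I := (isoClass H).
Definition cs (a : 'I_m) : nat := (n - s a)%N.
Definition ct (b : 'I_n) : nat := (m - t b)%N.

Lemma deg_u_le (G : bgraph m n) a : (deg_u G a <= n)%N.
Proof. by apply: leq_trans (max_card _) _; rewrite card_ord. Qed.
Lemma deg_v_le (G : bgraph m n) b : (deg_v G b <= m)%N.
Proof. by apply: leq_trans (max_card _) _; rewrite card_ord. Qed.

Lemma deg_uC (G : bgraph m n) a : deg_u (~: G) a = (n - deg_u G a)%N.
Proof.
have -> : deg_u (~: G) a = #|~: [set k | (a, k) \in G]| by apply: eq_card => k; rewrite !inE.
have h := cardsC [set k | (a, k) \in G]; rewrite card_ord in h.
by apply/eqP; rewrite -(eqn_add2l (deg_u G a)) subnKC ?deg_u_le //; apply/eqP; exact: h.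
Qed.
Lemma deg_vC (G : bgraph m n) b : deg_v (~: G) b = (m - deg_v G b)%N.
Proof.
have -> : deg_v (~: G) b = #|~: [set k | (k, b) \in G]| by apply: eq_card => k; rewrite !inE.
have h := cardsC [set k | (k, b) \in G]; rewrite card_ord in h.
by apply/eqP; rewrite -(eqn_add2l (deg_v G b)) subnKC ?deg_v_le //; apply/eqP; exact: h.
Qed.

Lemma s_le a : (s a <= n)%N.
Proof. by have /set0Pn[G] := rgB rg; rewrite inE => /andP[/forallP h _]; rewrite -(eqP (h a)) deg_u_le. Qed.
Lemma t_le b : (t b <= m)%N.
Proof. by have /set0Pn[G] := rgB rg; rewrite inE => /andP[_ /forallP h]; rewrite -(eqP (h b)) deg_v_le. Qed.

Lemma BstC G : (~: G \in Bst cs ct) = (G \in Bst s t).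
Proof.
rewrite !inE; congr (_ && _); apply: eq_forallb => i; rewrite ?deg_uC ?deg_vC /cs /ct.
  by have h1 := deg_u_le G i; have h2 := s_le i; apply/eqP/eqP; lia.
by have h1 := deg_v_le G i; have h2 := t_le i; apply/eqP/eqP; lia.
Qed.

Lemma exp_disjointE : exp_disjoint R s t H = exp_contained R cs ct H.
Proof.
rewrite /exp_disjoint /exp_contained; congr (_ / _%:R).
  rewrite [RHS](reindex_inj (inv_inj (@setCK _))) /=; apply: eq_big => G; first by rewrite BstC.
  move=> _; congr (_%:R); apply: eq_card => H'; rewrite !inE; congr (_ && _).
  by rewrite setI_eq0 disjoints_subset.
rewrite -(card_imset (Bst s t) (inv_inj (@setCK _))); apply: eq_card => G.
apply/imsetP/idP => [[G' hG ->]|hG]; first by rewrite BstC.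
by exists (~: G); rewrite ?setCK // -BstC setCK.
Qed.

Lemma csE a : (cs a)%:R = n%:R - (s a)%:R :> R. Proof. by rewrite natrB // s_le. Qed.
Lemma ctE b : (ct b)%:R = m%:R - (t b)%:R :> R. Proof. by rewrite natrB // t_le. Qed.

Lemma smeanC : smean R cs = n%:R - smean R s.
Proof.
have [m0 n0] := mn_gt0 rg; rewrite /smean; under eq_bigr do rewrite csE.
by rewrite sumrB sum_constM card_ord; field; rewrite gt_eqF.
Qed.
Lemma tmeanC : tmean R ct = m%:R - tmean R t.
Proof.
have [m0 n0] := mn_gt0 rg; rewrite /tmean; under eq_bigr do rewrite ctE.
by rewrite sumrB sum_constM card_ord; field; rewrite gt_eqF.
Qed.
Lemma lmC : lm R n cs = 1 - l.
Proof. by have [m0 n0] := mn_gt0 rg; rewrite /lm /Defs.lam smeanC; field; rewrite gt_eqF. Qed.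
Lemma RdevC : Rdev R cs = Rdev R s.
Proof. by apply: eq_bigr => a _; rewrite smeanC csE; ring. Qed.
Lemma CdevC : Cdev R ct = Cdev R t.
Proof. by apply: eq_bigr => a _; rewrite tmeanC ctE; ring. Qed.

Lemma regularC : regular cs ct H K v x y.
Proof.
case: (rg) => hB hK hnu hm hn hmn hl hl1 ha hb hx hy xK yK; split=> //.
- by have /set0Pn[G hG] := hB; apply/set0Pn; exists (~: G); rewrite BstC.
- by rewrite lmC.
- by rewrite lmC subKr.
- by move=> a; have := ha a; rewrite !mxE smeanC csE (_ : _ - (_ - _) = - ((s a)%:R - smean R s)); [rewrite mulNr normrN | ring].
- by move=> a; have := hb a; rewrite !mxE tmeanC ctE (_ : _ - (_ - _) = - ((t a)%:R - tmean R t)); [rewrite mulNr normrN | ring].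
Qed.

Theorem exp_disjoint_main : exists2 e : R, `|e| <= K ^+ 74 / v &
  exp_disjoint R s t H = (1 - l) ^+ #|H| * #|I|%:R *
    expR (- (l * (x%:R * y%:R - x%:R - y%:R)) / (2 * (1 - l))
          - (y%:R * Rdev R s + x%:R * Cdev R t) / (2 * (1 - l) ^+ 2 * m%:R * n%:R) + e).
Proof.
have := exp_contained_main regularC lnv; rewrite lmC subKr RdevC CdevC => -[e he h].
by exists e => //; rewrite exp_disjointE.
Qed.
End Complement.

(** * Asymptotic scales *)
Section Scale.
Variables (R : realType) (m n : nat) (s : 'I_m -> nat) (t : 'I_n -> nat) (H : bgraph m n) (x y : nat).
Variables (a b c eps : R).
Local Notation L := (n%:R : R).
Local Notation T := (L `^ eps).
Local Notation l := (lm R n s).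
Local Notation K := (T ^+ 10).
Definition nu0 : R := Num.sqrt (Num.max m%:R n%:R).
(** With [K] equal to n^(10 eps), the bound 1/2000 makes [K ^+ 100] at most the square root of n.
    The condition with 740 turns the error [K ^+ 74 / nu0] into n^(-b). *)
Hypotheses (e0 : 0 < eps) (e1 : eps <= 2000^-1) (eb : b + 740 * eps <= 2^-1) (a0 : 0 <= a) (n0 : (0 < n)%N) (m0 : (0 < m)%N).
Hypotheses (T1 : 100 <= T) (cT : c <= T) (aT : 4 * a / eps + 4 <= T) (eT : eps^-1 <= T).
Hypotheses (hB : Bst s t != set0) (hl : 0 < l < 1).
Hypotheses (hx : forall j, deg_u H j = x) (hy : forall k, deg_v H k = y).
Hypotheses (hs : forall j, `|(s j)%:R - smean R s| <= c * L `^ (2^-1 + eps))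
  (ht : forall k, `|(t k)%:R - tmean R t| <= c * L `^ (2^-1 + eps))
  (hX : #|H|%:R <= c * L `^ (1 + 2 * eps)).
Hypotheses (hnm : L <= m%:R `^ (1 + eps)) (hmn : m%:R <= L `^ (1 + eps)).
Hypothesis hlog : (1 - 2 * l) ^+ 2 / (8 * (l * (1 - l) / 2)) * (1 + 5 * m%:R / (6 * L) + 5 * L / (6 * m%:R)) <= a * ln L.

Lemma L_gt0 : 0 < L. Proof. by rewrite ltr0n. Qed.
Lemma L_ge1 : 1 <= L. Proof. by rewrite ler1n. Qed.
Lemma T_gt0 : 0 < T. Proof. have := T1; lra. Qed.
Lemma powLD (p q : R) : L `^ (p + q) = L `^ p * L `^ q.
Proof. by rewrite powRD // pnatr_eq0 -lt0n n0 implybT. Qed.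

Lemma m_le : m%:R <= L * T.
Proof. by apply: le_trans hmn _; rewrite powLD powRr1 ?ler0n. Qed.
Lemma n_le : L <= m%:R * T.
Proof.
have T1' := T1; have M0 : 0 <= m%:R :> R by rewrite ler0n.
have [mn|/ltW nm] := leP m%:R L; last by apply: le_trans nm _; rewrite ler_peMr //; lra.
apply: le_trans hnm _; rewrite powRD; last by rewrite pnatr_eq0 -lt0n m0 implybT.
by rewrite powRr1 // ler_wpM2l // ge0_ler_powR ?nnegrE // ltW.
Qed.

Lemma Tk_le i j : (i <= j)%N -> T ^+ i <= T ^+ j.
Proof. by move=> ij; rewrite ler_weXn2l //; have := T1; lra. Qed.

Lemma lnL_le : ln L <= T ^+ 2.
Proof.
have e : ln T = eps * ln L by rewrite ln_powR.
have h := ln_le_sub1 T_gt0; have T0 := T_gt0.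
have : ln L <= eps^-1 * T by rewrite ler_pdivlMl // -e; lra.
by move=> h2; apply: le_trans h2 _; rewrite expr2 ler_pM2r.
Qed.

Lemma nu_sqr : nu0 ^+ 2 = Num.max m%:R L.
Proof. by rewrite sqr_sqrtr // le_max ler0n. Qed.
Lemma nu_ge : Num.sqrt L <= nu0.
Proof. by rewrite ler_wsqrtr // le_max lexx orbT. Qed.
Lemma nu_le : nu0 <= Num.sqrt L * T.
Proof.
have T0 := T_gt0; have h := m_le; have LT : L * T <= L * T ^+ 2.
  by rewrite ler_pM2l ?L_gt0 // expr2 ler_peMl ?ltW //; have := T1; lra.
rewrite -[X in _ * X](ger0_norm (ltW T0)) -sqrtr_sqr -sqrtrM ?ler0n // ler_wsqrtr // ge_max.
rewrite (le_trans h LT) /= ler_peMr ?ler0n // expr2; have := T1; nra.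
Qed.

(** The fraction in [hlog] equals a quarter of 1/(l (1 - l)) - 4, and the factor beside it is at
    least 1. So the logarithmic condition keeps [l] away from 0 and 1 up to a factor of order log n,
    which a power of [T] absorbs. *)
Lemma lam_bnd : (l * (1 - l))^-1 <= T ^+ 4.
Proof.
have /andP[l0 l1] := hl; have p : 0 < l * (1 - l) by rewrite mulr_gt0 // subr_gt0.
have lnL := lnL_le; have L1 : 0 <= ln L by rewrite ln_ge0 ?L_ge1.
have T0 := T_gt0; have T2 := T1.
have h1 : (1 - 2 * l) ^+ 2 / (8 * (l * (1 - l) / 2)) <= a * ln L.
  apply: le_trans hlog; rewrite ler_peMr //; first by rewrite divr_ge0 ?sqr_ge0 // mulr_ge0 // divr_ge0 // ltW.
  by rewrite -addrA lerDl addr_ge0 // divr_ge0 ?mulr_ge0 ?ler0n.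
have h2 : (l * (1 - l))^-1 <= 4 * (a * ln L) + 4.
  have e : (1 - 2 * l) ^+ 2 / (8 * (l * (1 - l) / 2)) = ((l * (1 - l))^-1 - 4) / 4.
    by field; rewrite !gt_eqF // subr_gt0.
  by rewrite e in h1; lra.
apply: le_trans h2 _.
have h4 : 4 * a <= T.
  have i0 : 1 <= eps^-1 by rewrite invf_ge1 //; have := e1; lra.
  have : 4 * a <= 4 * a / eps by rewrite ler_peMr // mulr_ge0.
  have := aT; lra.
have h5 : 4 * a * ln L <= T * T ^+ 2 by apply: ler_pM => //; rewrite mulr_ge0.
have h6 : 100 * T ^+ 3 <= T ^+ 4 by rewrite (exprS T 3) ler_pM2r ?exprn_gt0.
have h7 : 1 <= T ^+ 3 by rewrite exprn_ege1 //; lra.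
rewrite mulrA; apply: le_trans (lerD h5 (lexx _)) _; rewrite -exprS; lra.
Qed.

Lemma K_pow_le_nu : K ^+ 100 <= nu0.
Proof.
apply: le_trans nu_ge; rewrite -exprM -powR_mulrn ?powR_ge0 // -powRrM -powR12_sqrt ?ler0n //.
by rewrite ler_powR ?L_ge1 // (_ : (10 * 100)%:R = 1000 :> R) ?natrM //; have := e1; lra.
Qed.

Lemma error_le : K ^+ 74 / nu0 <= L `^ (- b).
Proof.
have s0 : 0 < Num.sqrt L by rewrite sqrtr_gt0 L_gt0.
have v0 : 0 < nu0 by apply: lt_le_trans nu_ge.
apply: le_trans (_ : K ^+ 74 / Num.sqrt L <= _).
  by rewrite ler_wpM2l ?exprn_ge0 ?powR_ge0 // lef_pV2 ?posrE // nu_ge.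
rewrite ler_pdivrMr // -powR12_sqrt ?ler0n // -powLD.
rewrite -exprM -powR_mulrn ?powR_ge0 // -powRrM ler_powR ?L_ge1 //.
by rewrite (_ : (10 * 74)%:R = 740 :> R) ?natrM //; have := eb; lra.
Qed.

Lemma cardH : #|H|%:R = m%:R * x%:R :> R /\ #|H|%:R = L * y%:R.
Proof.
have e : #|H|%:R = \sum_a \sum_b edge R H (a, b) :> R.
  rewrite pair_bigA /= -sum1_card natr_sum big_mkcond /=; apply: eq_bigr => p _.
  by rewrite /edge -surjective_pairing; case: (_ \in H).
rewrite e; split.
  by rewrite (eq_bigr (fun=> x%:R)) ?sum_constM ?card_ord // => j _; rewrite -deg_uE hx.
by rewrite exchange_big /= (eq_bigr (fun=> y%:R)) ?sum_constM ?card_ord // => k _; rewrite -deg_vE hy.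
Qed.

Lemma regular_scale : regular s t H K nu0 x y.
Proof.
have T0 := T_gt0; have T2 := T1; have Tn0 := ltW T0; have L0 := L_gt0; have M0 : 0 < m%:R :> R by rewrite ltr0n.
have s0 : 0 < Num.sqrt L by rewrite sqrtr_gt0.
have ss : Num.sqrt L * Num.sqrt L = L by rewrite -expr2 sqr_sqrtr // ltW.
have v0 : 0 < nu0 by apply: lt_le_trans nu_ge.
have T10 : T <= K by rewrite -[leLHS]expr1 Tk_le.
have [hm hn] := (m_le, n_le); have [c1 c2] := cardH.
have /andP[l0 l1] := hl; have lb := lam_bnd.
have TK (z : R) i : (i <= 10)%N -> z <= T ^+ i -> z <= K by move=> hi hz; apply: le_trans hz (Tk_le hi).
have lK : 1 <= K * (l * (1 - l)).
  have p : 0 < l * (1 - l) by rewrite mulr_gt0 // subr_gt0.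
  by rewrite -(ler_pM2r (_ : 0 < (l * (1 - l))^-1)) ?invr_gt0 // mul1r mulfK ?gt_eqF //; apply: TK lb.
have K0 : 0 < K by rewrite exprn_gt0.
have dev (z : R) : `|z| <= c * L `^ (2^-1 + eps) -> `|z| <= T ^+ 2 * Num.sqrt L.
  move=> h; apply: le_trans h _; rewrite powLD powR12_sqrt ?ler0n // (_ : T ^+ 2 * _ = T * (Num.sqrt L * T)); last by ring.
  by rewrite ler_wpM2r // mulr_ge0 // ltW.
have X1 : #|H|%:R <= T ^+ 3 * L.
  apply: le_trans hX _; rewrite powLD powRr1 ?ler0n // (mulrC 2) powRrM powR_mulrn ?powR_ge0 //.
  by rewrite (_ : T ^+ 3 * L = T * (L * T ^+ 2)); [rewrite ler_wpM2r // mulr_ge0 ?exprn_ge0 // ltW | ring].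
split=> //.
- by lra.
- exact: K_pow_le_nu.
- by rewrite nu_sqr le_max lexx.
- by rewrite nu_sqr le_max lexx orbT.
- rewrite (exprM nu0 2 2) nu_sqr; have [mn|nm] := leP m%:R L.
    by rewrite expr2 mulrA ler_pM2r //; apply: le_trans hn _; rewrite mulrC ler_pM2r.
  by rewrite expr2 mulrCA ler_pM2l //; apply: le_trans hm _; rewrite mulrC ler_pM2r.
- apply: le_trans lK _; rewrite ler_pM2l //; nra.
- apply: le_trans lK _; rewrite ler_pM2l //; nra.
- move=> j; rewrite mxE normrM (ger0_norm (_ : 0 <= L^-1)) ?invr_ge0 ?ler0n //.
  apply: TK (isT : (3 <= 10)%N) _.
  rewrite mulrAC ler_pdivrMr //; apply: le_trans (ler_pM _ _ (dev _ (hs j)) nu_le) _ => //; first exact: ltW.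
  by rewrite [leLHS](_ : _ = T ^+ 3 * (Num.sqrt L * Num.sqrt L)); [rewrite ss | ring].
- move=> k; rewrite mxE normrM (ger0_norm (_ : 0 <= m%:R^-1)) ?invr_ge0 ?ler0n //.
  apply: TK (isT : (4 <= 10)%N) _.
  rewrite mulrAC ler_pdivrMr //; apply: le_trans (ler_pM _ _ (dev _ (ht k)) nu_le) _ => //; first exact: ltW.
  apply: le_trans (_ : T ^+ 3 * L <= _).
    by rewrite [leLHS](_ : _ = T ^+ 3 * (Num.sqrt L * Num.sqrt L)); [rewrite ss | ring].
  by rewrite [leRHS](_ : _ = T ^+ 3 * (m%:R * T)); [rewrite ler_pM2l ?exprn_gt0 | ring].
(* The degree x is the number of edges divided by m, so the bound on the edge count makes it at most
   a power of [T]; likewise for y with n. *)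
- apply: TK (isT : (4 <= 10)%N) _; rewrite -(ler_pM2l M0) -c1; apply: le_trans X1 _.
  by rewrite [leRHS](_ : _ = T ^+ 3 * (m%:R * T)); [rewrite ler_pM2l ?exprn_gt0 | ring].
- apply: TK (isT : (3 <= 10)%N) _; rewrite -(ler_pM2l L0) -c2; apply: le_trans X1 _.
  by rewrite mulrC.
Qed.

Lemma ln_nu : ln nu0 <= K.
Proof.
have s0 : 0 < Num.sqrt L by rewrite sqrtr_gt0 L_gt0.
have v0 : 0 < nu0 by apply: lt_le_trans nu_ge.
apply: le_trans (_ : ln (Num.sqrt L * T) <= _).
  by rewrite ler_ln ?posrE ?mulr_gt0 ?T_gt0 ?nu_le.
rewrite lnM ?posrE ?T_gt0 //.
have h1 : ln (Num.sqrt L) <= ln L.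
  rewrite ler_ln ?posrE ?L_gt0 // -{2}(sqr_sqrtr (ltW L_gt0)) expr2 ler_peMl ?(ltW s0) //.
  by rewrite -[leLHS]sqrtr1 ler_wsqrtr // L_ge1.
have h2 := lnL_le; have h3 := ln_le_sub1 T_gt0; have T2 := T1.
have h4 : T ^+ 3 <= K by rewrite Tk_le.
have h5 : T ^+ 2 * 100 <= T ^+ 3 by rewrite (exprSr T 2) ler_wpM2l // exprn_ge0 // ltW // T_gt0.
have h6 : T <= T ^+ 2 by rewrite -{1}[T]expr1 Tk_le.
lra.
Qed.
End Scale.

Theorem theorem2p7 (R : realType) (a b : R) :
  0 < a -> 0 < b -> a + b < 2^-1 ->
  exists eps0 : R, 0 < eps0 /\
  forall eps : R, 0 < eps -> eps < eps0 ->
  forall (m n : nat -> nat)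
         (s : forall i, 'I_(m i) -> nat) (t : forall i, 'I_(n i) -> nat)
         (H : forall i, {set 'I_(m i) * 'I_(n i)}) (x y : nat -> nat),
  (* m, n -> infinity *)
  (forall N : nat, exists i0, forall i, (i0 <= i)%N -> (N <= m i)%N /\ (N <= n i)%N) ->
  (* positive degrees with equal sums, B(s,t) nonempty, 0 < lambda < 1 *)
  (forall i j, (0 < s i j)%N) -> (forall i k, (0 < t i k)%N) ->
  (forall i, (\sum_(j < m i) s i j)%N = (\sum_(k < n i) t i k)%N) ->
  (forall i, Bst (s i) (t i) != set0) ->
  (forall i, 0 < lam (n i) R (s i) < 1) ->
  (* H has all u-degrees x and all v-degrees y *)
  (forall i j, deg_u (H i) j = x i) -> (forall i k, deg_v (H i) k = y i) ->
  (* uniform O-bounds *)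
  (exists c : R, forall i j,
      `|(s i j)%:R - smean R (s i)| <= c * (n i)%:R `^ (2^-1 + eps)) ->
  (exists c : R, forall i k,
      `|(t i k)%:R - tmean R (t i)| <= c * (n i)%:R `^ (2^-1 + eps)) ->
  (exists c : R, forall i, (x i)%:R <= c * (n i)%:R `^ (2^-1 + eps)) ->
  (exists c : R, forall i, (y i)%:R <= c * (n i)%:R `^ (2^-1 + eps)) ->
  (exists c : R, forall i, (#|H i|)%:R <= c * (n i)%:R `^ (1 + 2 * eps)) ->
  (* n = o(m^(1+eps)), m = o(n^(1+eps)) *)
  (forall e : R, 0 < e -> exists i0, forall i, (i0 <= i)%N ->
      (n i)%:R <= e * (m i)%:R `^ (1 + eps)) ->
  (forall e : R, 0 < e -> exists i0, forall i, (i0 <= i)%N ->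
      (m i)%:R <= e * (n i)%:R `^ (1 + eps)) ->
  (* the logarithmic condition *)
  (forall i,
      (1 - 2 * lam (n i) R (s i)) ^+ 2 / (8 * Acoef (n i) R (s i))
        * (1 + 5 * (m i)%:R / (6 * (n i)%:R) + 5 * (n i)%:R / (6 * (m i)%:R))
      <= a * ln ((n i)%:R)) ->
  exists c : R, exists i0 : nat, forall i, (i0 <= i)%N ->
    let l := lam (n i) R (s i) in
    let xr := (x i)%:R : R in
    let yr := (y i)%:R : R in
    let mr := (m i)%:R : R in
    let nr := (n i)%:R : R in
    let RC := yr * Rdev R (s i) + xr * Cdev R (t i) in
    (exists d : R, `|d| <= c * nr `^ (- b) /\
       exp_contained R (s i) (t i) (H i)
       = l ^+ #|H i| * (#|isoClass (H i)|)%:R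
         * expR (- ((1 - l) * (xr * yr - xr - yr)) / (2 * l)
                 - RC / (2 * l ^+ 2 * mr * nr) + d)) /\
    (exists d : R, `|d| <= c * nr `^ (- b) /\
       exp_disjoint R (s i) (t i) (H i)
       = (1 - l) ^+ #|H i| * (#|isoClass (H i)|)%:R
         * expR (- (l * (xr * yr - xr - yr)) / (2 * (1 - l))
                 - RC / (2 * (1 - l) ^+ 2 * mr * nr) + d)).
Proof.
(* The two bounds encode the requirements of [K_pow_le_nu] and [error_le]; the second is positive
   because b < 1/2. *)
move=> a0 b0 ab; pose eps0 := Num.min 2000^-1 ((2^-1 - b) / 740).
exists eps0; split; first by rewrite /eps0 lt_min divr_gt0 //=; lra.
move=> eps e0; rewrite /eps0 lt_min => /andP[e1 e2] m n s t H x y hinf sp tp hst hB hl hx hy.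
move=> [c1 hs] [c2 ht] _ _ [c3 hX] hnm hmn hlog.
have eb : b + 740 * eps <= 2^-1 by move: e2; rewrite ltr_pdivlMr //; lra.
pose c := `|c1| + `|c2| + `|c3|.
pose B := 100 + c + (4 * a / eps + 4) + eps^-1.
have c0 : 0 <= c by rewrite !addr_ge0.
have ae0 : 0 <= 4 * a / eps by rewrite divr_ge0 ?mulr_ge0 // ltW.
have i0 : 0 <= eps^-1 by rewrite invr_ge0 ltW.
(* Beyond this index n^eps exceeds [B], so all constants hidden in the hypotheses are at most a
   power of n^eps. *)
have [N hN] := hinf (Num.bound (B `^ eps^-1)).+1.
have [N1 h1] := hnm 1 ltr01; have [N2 h2] := hmn 1 ltr01.
exists 1; exists (maxn N (maxn N1 N2)) => i; rewrite !geq_max => /and3P[iN iN1 iN2].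
have [mN nN] := hN i iN.
have n0 : (0 < n i)%N by apply: leq_trans nN.
have m0 : (0 < m i)%N by apply: leq_trans mN.
have hT : B <= (n i)%:R `^ eps.
  have B0 : 0 <= B by rewrite !addr_ge0.
  have -> : B = (B `^ eps^-1) `^ eps by rewrite -powRrM mulVf ?gt_eqF // powRr1.
  apply: ge0_ler_powR; rewrite ?nnegrE ?powR_ge0 ?ler0n ?(ltW e0) //.
  apply/ltW; apply: lt_le_trans (archi_boundP (powR_ge0 _ _)) _.
  by rewrite ler_nat; apply: leq_trans nN.
have cc1 : c1 <= c by have := ler_norm c1; rewrite /c; have := normr_ge0 c2; have := normr_ge0 c3; clear; lra.
have cc2 : c2 <= c by have := ler_norm c2; rewrite /c; have := normr_ge0 c1; have := normr_ge0 c3; clear; lra.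
have cc3 : c3 <= c by have := ler_norm c3; rewrite /c; have := normr_ge0 c1; have := normr_ge0 c2; clear; lra.
have hs' j : `|(s i j)%:R - smean R (s i)| <= c * (n i)%:R `^ (2^-1 + eps).
  by apply: le_trans (hs i j) _; rewrite ler_wpM2r ?powR_ge0.
have ht' k : `|(t i k)%:R - tmean R (t i)| <= c * (n i)%:R `^ (2^-1 + eps).
  by apply: le_trans (ht i k) _; rewrite ler_wpM2r ?powR_ge0.
have hX' : #|H i|%:R <= c * (n i)%:R `^ (1 + 2 * eps).
  by apply: le_trans (hX i) _; rewrite ler_wpM2r ?powR_ge0.
have hnm' := h1 i iN1; have hmn' := h2 i iN2; rewrite !mul1r in hnm' hmn'.
have T1 : 100 <= (n i)%:R `^ eps by move: hT c0 ae0 i0; rewrite /B; clear; lra.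
have cT : c <= (n i)%:R `^ eps by move: hT c0 ae0 i0; rewrite /B; clear; lra.
have aT : 4 * a / eps + 4 <= (n i)%:R `^ eps by move: hT c0 ae0 i0; rewrite /B; clear; lra.
have eT : eps^-1 <= (n i)%:R `^ eps by move: hT c0 ae0 i0; rewrite /B; clear; lra.
have rg := regular_scale e0 (ltW e1) (ltW a0) n0 m0 T1 cT aT eT (hB i) (hl i) (hx i) (hy i) hs' ht' hX' hnm' hmn' (hlog i).
have lnv := ln_nu e0 n0 T1 eT hmn'.
cbv zeta; split.
- have [d hd E] := exp_contained_main rg lnv; exists d; split; last exact: E.
  by rewrite mul1r; apply: le_trans hd _; exact: error_le.
- have [d hd E] := exp_disjoint_main rg lnv; exists d; split; last exact: E.
  by rewrite mul1r; apply: le_trans hd _; exact: error_le.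
Qed.
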